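(* Let $D=((a_n),(b_n))$ be a divisor with $a_n\neq 0$ and $b_n\neq 0$ for all $n$. Then $D$ is the divisor of some $f\in{\cal N}_1$ if and only if all of the following hold: (a) $\inf_{n,k}|a_n-b_k|>0$; (b) there is $C<\infty$ such that ${\rm card}\{n:|a_n-c|\le 1\}+{\rm card}\{n:|b_n-c|\le1\}<C$ for all $c\in\mathbb{C}$; (c) there is $R<\infty$ such that for every $c\in\mathbb{C}$ the disc $B(c,R)$ contains some $a_n$ and some $b_k$; (d) there is $C<\infty$ such that for all $c\in\mathbb{C}$ and all $r>1$, $$\Big|\int_1^r\frac{{\rm card}\{n:|a_n-c|<t\}-{\rm card}\{n:|b_n-c|<t\}}{t}\,dt\Big|<C;$$ (e) there is $C<\infty$ such that for all $c\in\mathbb{C}$ and all $r>1$, $$\Big|\frac1r\int_1^r\Big(\sum_{n:|a_n-c|<t}(a_n-c)-\sum_{n:|b_n-c|<t}(b_n-c)\Big)\frac{dt}{t}\Big|<C;$$ (f) the limit $\lim_{r\to\infty}\Big(\sum_{1\le|a_n|<r}a_n^{-2}-\sum_{1\le|b_n|<r}b_n^{-2}\Big)$ exists and is finite. Moreover, in this case the limit $$\alpha=\lim_{r\to\infty}\Big(\sum_{n:|b_n|<r}\big(1/b_n-\overline{b_n}/r^2\big)-\sum_{n:|a_n|<r}\big(1/a_n-\overline{a_n}/r^2\big)\Big)$$ exists, the limit $$f(z)=e^{\alpha z}\lim_{r\to\infty}\frac{\prod_{n:|a_n|<r}(1-z/a_n)e^{z/a_n}}{\prod_{n:|b_n|<r}(1-z/b_n)e^{z/b_n}}$$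 exists uniformly on compact subsets of $\mathbb{C}$ (in the spherical metric), and every ${\cal N}_1$-function with divisor $D$ equals a constant multiple of this $f$.
   Context: $\rho_S$ denotes the spherical (chordal) metric on the Riemann sphere. A meromorphic function $f$ on $\mathbb{C}$ is called normal if for every sequence $(h_n)\subset\mathbb{C}$ there is a subsequence $(h_{n'})$ with $\rho_S(f(z+h_{n'}),f(z+h_{m'}))\to0$ as $n',m'\to\infty$ uniformly on compact subsets of $\mathbb{C}$. A normal function is of the first category, written $f\in{\cal N}_1$, if no limit (uniformly on compacta in $\rho_S$) of a sequence of translates $f(z+h_n)$ is a constant function (the constant $\infty$ included). A divisor is a map $D:\mathbb{C}\to\mathbb{Z}$ with discrete support; it is written $D=((a_n),(b_n))$, where $(a_n)$ lists the points with $D>0$, each point $a$ repeated $D(a)$ times, and $(b_n)$ lists the points with $D<0$, each point $b$ repeated $-D(b)$ times. $D$ is the divisor of a meromorphic $f$ if the $a_n$ are the zeros and the $b_n$ the poles of $f$ counted with multiplicity. $B(c,R)=\{z:|z-c|<R\}$. *)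

(* Defs.v *)
From Stdlib Require Import Reals Lra List ZArith ClassicalEpsilon.
Open Scope R_scope.

Definition Cc : Type := (R * R)%type.
Definition Cmk (x y : R) : Cc := (x, y).
Definition Czero : Cc := (0, 0).
Definition Cone : Cc := (1, 0).
Definition Cadd (z w : Cc) : Cc := (fst z + fst w, snd z + snd w).
Definition Copp (z : Cc) : Cc := (- fst z, - snd z).
Definition Csub (z w : Cc) : Cc := Cadd z (Copp w).
Definition Cmul (z w : Cc) : Cc :=
  (fst z * fst w - snd z * snd w, fst z * snd w + snd z * fst w).
Definition Cinv (z : Cc) : Cc :=
  (fst z / (fst z ^ 2 + snd z ^ 2), - snd z / (fst z ^ 2 + snd z ^ 2)).
Definition Cdiv (z w : Cc) : Cc := Cmul z (Cinv w).
Definition Cconj (z : Cc) : Cc := (fst z, - snd z).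
Definition Cnorm (z : Cc) : R := sqrt (fst z ^ 2 + snd z ^ 2).
Definition RtoC (x : R) : Cc := (x, 0).
Definition Cexp (z : Cc) : Cc := (exp (fst z) * cos (snd z), exp (fst z) * sin (snd z)).
Fixpoint Cpow (z : Cc) (n : nat) : Cc :=
  match n with O => Cone | S n => Cmul z (Cpow z n) end.
Definition Czpow (z : Cc) (m : Z) : Cc :=
  match m with
  | Z0 => Cone
  | Zpos p => Cpow z (Pos.to_nat p)
  | Zneg p => Cinv (Cpow z (Pos.to_nat p))
  end.

(* None stands for the point at infinity *)
Definition sphere : Type := option Cc.

Definition rhoS (u v : sphere) : R :=
  match u, v with
  | Some z, Some w =>
      2 * Cnorm (Csub z w) / sqrt ((1 + Cnorm z ^ 2) * (1 + Cnorm w ^ 2))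
  | Some z, None | None, Some z => 2 / sqrt (1 + Cnorm z ^ 2)
  | None, None => 0
  end.

(* multiplication of a point of the sphere by a finite complex number
   (used only with nonzero factors) *)
Definition smul (c : Cc) (u : sphere) : sphere :=
  match u with Some z => Some (Cmul c z) | None => None end.

Definition sdiv (x y : Cc) : sphere :=
  if Req_EM_T (Cnorm y) 0 then None else Some (Cdiv x y).

Definition inB (c : Cc) (r : R) (z : Cc) : Prop := Cnorm (Csub z c) < r.

Definition C_differentiable_at (g : Cc -> Cc) (z0 : Cc) : Prop :=
  exists l : Cc, forall eps, eps > 0 -> exists del, del > 0 /\
    forall h : Cc, Cnorm h < del ->
      Cnorm (Csub (Csub (g (Cadd z0 h)) (g z0)) (Cmul l h)) <= eps * Cnorm h.

Definition holomorphic_on_disc (g : Cc -> Cc) (c : Cc) (r : R) : Prop :=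
  forall z, inB c r z -> C_differentiable_at g z.

Definition srecip (w : Cc) : sphere := sdiv Cone w.

(* f : Cc -> sphere is meromorphic on Cc: a holomorphic map into the Riemann
   sphere (locally f or 1/f is holomorphic) which is not identically infinity *)
Definition meromorphic (f : Cc -> sphere) : Prop :=
  (exists z, f z <> None) /\
  forall z0, exists r, r > 0 /\
    ((exists g, holomorphic_on_disc g z0 r /\ forall z, inB z0 r z -> f z = Some (g z))
     \/
     (exists g, holomorphic_on_disc g z0 r /\ forall z, inB z0 r z -> f z = srecip (g z))).

Definition order_at (f : Cc -> sphere) (a : Cc) (m : Z) : Prop :=
  exists r g, r > 0 /\ holomorphic_on_disc g a r /\ g a <> Czero /\
    forall z, inB a r z -> z <> a -> f z = Some (Cmul (Czpow (Csub z a) m) (g z)).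

Definition divisor (D : Cc -> Z) : Prop :=
  forall c r, exists l : list Cc, forall z, D z <> 0%Z -> Cnorm (Csub z c) <= r -> In z l.

Definition divisor_of (D : Cc -> Z) (f : Cc -> sphere) : Prop :=
  forall a, order_at f a (D a).

(* the (finite, for a divisor and a bounded P) list of support points satisfying P *)
Definition supp_list (D : Cc -> Z) (P : Cc -> Prop) : list Cc :=
  epsilon (inhabits nil)
    (fun l => NoDup l /\ forall z, In z l <-> (D z <> 0%Z /\ P z)).

(* sum over the zeros a_n (each repeated D(a) times) with P(a_n) of F(a_n) *)
Definition sum_zeros (D : Cc -> Z) (P : Cc -> Prop) (F : Cc -> Cc) : Cc :=
  fold_right Cadd Czero
    (map (fun z => Cmul (RtoC (IZR (D z))) (F z))
         (supp_list D (fun z => (D z > 0)%Z /\ P z))).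
(* sum over the poles b_n (each repeated -D(b) times) with P(b_n) of F(b_n) *)
Definition sum_poles (D : Cc -> Z) (P : Cc -> Prop) (F : Cc -> Cc) : Cc :=
  fold_right Cadd Czero
    (map (fun z => Cmul (RtoC (IZR (- D z))) (F z))
         (supp_list D (fun z => (D z < 0)%Z /\ P z))).
Definition card_zeros (D : Cc -> Z) (P : Cc -> Prop) : R :=
  fold_right Rplus 0 (map (fun z => IZR (D z)) (supp_list D (fun z => (D z > 0)%Z /\ P z))).
Definition card_poles (D : Cc -> Z) (P : Cc -> Prop) : R :=
  fold_right Rplus 0 (map (fun z => IZR (- D z)) (supp_list D (fun z => (D z < 0)%Z /\ P z))).
Definition prod_zeros (D : Cc -> Z) (P : Cc -> Prop) (F : Cc -> Cc) : Cc :=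
  fold_right Cmul Cone
    (map (fun z => Cpow (F z) (Z.to_nat (D z)))
         (supp_list D (fun z => (D z > 0)%Z /\ P z))).
Definition prod_poles (D : Cc -> Z) (P : Cc -> Prop) (F : Cc -> Cc) : Cc :=
  fold_right Cmul Cone
    (map (fun z => Cpow (F z) (Z.to_nat (- D z)))
         (supp_list D (fun z => (D z < 0)%Z /\ P z))).

Definition Rint (g : R -> R) (a b v : R) : Prop :=
  exists pr : Riemann_integrable g a b, RiemannInt pr = v.
Definition Cint (g : R -> Cc) (a b : R) (v : Cc) : Prop :=
  Rint (fun t => fst (g t)) a b (fst v) /\ Rint (fun t => snd (g t)) a b (snd v).

Definition Clim_infty (g : R -> Cc) (L : Cc) : Prop :=
  forall eps, eps > 0 -> exists M, forall r, r > M -> Cnorm (Csub (g r) L) < eps.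

Definition seq_unif_compact (u : nat -> Cc -> sphere) (g : Cc -> sphere) : Prop :=
  forall Rad eps, eps > 0 -> exists N, forall n, (n >= N)%nat ->
    forall z, Cnorm z <= Rad -> rhoS (u n z) (g z) < eps.

Definition normal (f : Cc -> sphere) : Prop :=
  meromorphic f /\
  forall h : nat -> Cc, exists phi : nat -> nat,
    (forall n, (phi n < phi (S n))%nat) /\
    forall Rad eps, eps > 0 -> exists N, forall n m, (n >= N)%nat -> (m >= N)%nat ->
      forall z, Cnorm z <= Rad ->
        rhoS (f (Cadd z (h (phi n)))) (f (Cadd z (h (phi m)))) < eps.

Definition N1 (f : Cc -> sphere) : Prop :=
  normal f /\
  forall (h : nat -> Cc) (g : Cc -> sphere),
    seq_unif_compact (fun n z => f (Cadd z (h n))) g ->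
    ~ (exists w : sphere, forall z, g z = w).

(* Main.v *)
(** Necessity.  The translates of an N1-function f form a relatively compact family without constant
    limits, so f is uniformly continuous into the sphere and oscillates by a fixed amount on every disc of a
    fixed radius.  Many zeros in a small disc, or a tiny value far from the zeros (Harnack), would make f tiny
    on a disc, and smallness propagates; this gives (b) and bounds ln|f| away from the divisor.  Hence
    ln|f(z)| differs by O(1) from the sum of D(a) ln|z-a| over |a-z| < 1.  By this bound the zeroth and first
    Fourier coefficients of ln|f| on the circle |z-c| = r are bounded uniformly in c and r; Jensen's formula
    and its analogue for the first coefficient turn this into (d) and (e).  On a large disc without zeros or
    without poles, 1/f or f would be bounded, hence almost constant by Schwarz's lemma; this gives (c).

    Sufficiency.  Bound (e) controls the sums of D(a) conj(a-c) / max(r,|a-c|)^2, which are gradients in c of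
    the potential sum D(a) ln|z-a| averaged over B(c,r), and (d) bounds the difference between this average and
    the sum of D(a) ln max(1,|a-c|).  Comparing the gradients at c = 0 and c = 1 shows that (f) already follows from (b), (d), (e).  The
    product therefore converges, and, with the exponential factor e^{alpha z} compensating the limit gradient, its
    logarithm obeys the same O(1) estimate as above.  With (a) and (b) this makes it Lipschitz into the
    sphere, hence normal, and (c) excludes constant limits.  Two functions obeying the estimate have a
    bounded zero-free quotient, which is constant by Liouville's theorem. *)


From Pilot Require Import Defs.
From Stdlib Require Import Reals Lra Lia List ZArith Permutation.
From Stdlib Require Import ClassicalEpsilon Classical.
From Coquelicot Require Import Coquelicot.
Open Scope R_scope.

Bind Scope C_scope with C.

(** * Complex derivatives *)

(** The obstacle in the sufficiency part is to estimate the potential at a far point z without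
    losing a factor |z|. By (e), the mean over a disc of radius r has gradient O(1/r); with r = |z|
    + 1 the segment from 0, where the product is normalised, to z costs only O(1). Truncations |a| <
    rho are centred at 0 while the estimates are centred at c. Passing from one to the other
    involves the number of zeros minus poles in a disc, for which (b) gives only O(r^2); (d)
    improves this to O(r), which makes the error O(1/rho). In the necessity part, a logarithmic
    singularity near the circle |z-c| = r contributes O(1/r) to the mean over the angle, and (b)
    allows only O(r) of them within distance 1 of the circle; this is why the mean of the modulus of
    ln|f| stays bounded. Integrations over radii are replaced by derivative identities for kernels
    in max(r,|a-c|). Poles are reduced to zeros by f -> 1/f, an isometry of the sphere. The complex
    analysis rests on the mean value property, proved by Goursat's bisection in polar
    coordinates. *)

Definition Ccont (g : C -> C) (z : C) : Prop :=
  forall eps, 0 < eps -> exists del, 0 < del /\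
    forall w, Cmod (w - z) < del -> Cmod (g w - g z) < eps.

Definition Cder (g : C -> C) (z l : C) : Prop :=
  forall eps, 0 < eps -> exists del, 0 < del /\
    forall h, Cmod h < del -> Cmod (g (z + h)%C - g z - l * h) <= eps * Cmod h.

Lemma Cmod_sub_sym (z w : C) : Cmod (z - w) = Cmod (w - z).
Proof. rewrite <- Cmod_opp. f_equal. ring. Qed.

Lemma Cmod_tri (z w u : C) : Cmod (z - u) <= Cmod (z - w) + Cmod (w - u).
Proof. replace (z - u)%C with ((z - w) + (w - u))%C by ring. apply Cmod_triangle. Qed.

Lemma Cmod_tri_sub (z w : C) : Cmod (z - w) <= Cmod z + Cmod w.
Proof. unfold Cminus. rewrite <- (Cmod_opp w). apply Cmod_triangle. Qed.

Lemma Cmod_tri_inv (z w : C) : Cmod z - Cmod w <= Cmod (z - w).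
Proof.
  assert (H := Cmod_triangle (z - w) w).
  replace (z - w + w)%C with z in H by ring. lra.
Qed.

Lemma Csub_0_eq (z w : C) : (z - w = 0)%C -> z = w.
Proof. intros H. replace z with (z - w + w)%C by ring. rewrite H. ring. Qed.

Lemma Cmod_sub_pos (z w : C) : z <> w -> 0 < Cmod (z - w).
Proof. intros H. apply Cmod_gt_0. intros E. apply H, Csub_0_eq, E. Qed.

Lemma Ceq_dec (z w : C) : {z = w} + {z <> w}.
Proof. apply excluded_middle_informative. Qed.

Lemma Ccont_const (k z : C) : Ccont (fun _ => k) z.
Proof.
  intros eps He. exists 1. split; [lra|]. intros.
  replace (k - k)%C with (RtoC 0) by ring. rewrite Cmod_0. exact He.
Qed.

Lemma Ccont_id (z : C) : Ccont (fun w => w) z.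
Proof. intros eps He. exists eps. split; auto. Qed.

Lemma Ccont_plus (f g : C -> C) (z : C) :
  Ccont f z -> Ccont g z -> Ccont (fun w => f w + g w)%C z.
Proof.
  intros Hf Hg eps He.
  destruct (Hf (eps/2)) as [d1 [D1 H1]]; [lra|].
  destruct (Hg (eps/2)) as [d2 [D2 H2]]; [lra|].
  exists (Rmin d1 d2). split; [apply Rmin_pos; lra|]. intros w Hw.
  replace (f w + g w - (f z + g z))%C with ((f w - f z) + (g w - g z))%C by ring.
  eapply Rle_lt_trans; [apply Cmod_triangle|].
  specialize (H1 w (Rlt_le_trans _ _ _ Hw (Rmin_l _ _))).
  specialize (H2 w (Rlt_le_trans _ _ _ Hw (Rmin_r _ _))). lra.
Qed.

Lemma Ccont_mult (f g : C -> C) (z : C) :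
  Ccont f z -> Ccont g z -> Ccont (fun w => f w * g w)%C z.
Proof.
  intros Hf Hg eps He.
  set (A := Cmod (f z) + 1). set (B := Cmod (g z) + 1).
  assert (HA : 1 <= A) by (unfold A; pose proof (Cmod_ge_0 (f z)); lra).
  assert (HB : 1 <= B) by (unfold B; pose proof (Cmod_ge_0 (g z)); lra).
  destruct (Hf (Rmin 1 (eps/(2*B)))) as [d1 [D1 H1]].
  { apply Rmin_pos; [lra|]. apply Rdiv_lt_0_compat; lra. }
  destruct (Hg (eps/(2*A))) as [d2 [D2 H2]].
  { apply Rdiv_lt_0_compat; lra. }
  exists (Rmin d1 d2). split; [apply Rmin_pos; lra|]. intros w Hw.
  replace (f w * g w - f z * g z)%C with (f w * (g w - g z) + (f w - f z) * g z)%C by ring.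
  eapply Rle_lt_trans; [apply Cmod_triangle|]. rewrite !Cmod_mult.
  specialize (H1 w (Rlt_le_trans _ _ _ Hw (Rmin_l _ _))).
  specialize (H2 w (Rlt_le_trans _ _ _ Hw (Rmin_r _ _))).
  assert (H3 := Rlt_le_trans _ _ _ H1 (Rmin_l _ _)).
  assert (H4 := Rlt_le_trans _ _ _ H1 (Rmin_r _ _)).
  assert (Cmod (f w) <= A).
  { pose proof (Cmod_tri_inv (f w) (f z)). unfold A. lra. }
  assert (Cmod (g z) <= B) by (unfold B; lra).
  assert (Cmod (f w) * Cmod (g w - g z) <= A * Cmod (g w - g z))
    by (apply Rmult_le_compat_r; [apply Cmod_ge_0|lra]).
  assert (A * Cmod (g w - g z) < A * (eps/(2*A))) by (apply Rmult_lt_compat_l; lra).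
  assert (Cmod (f w - f z) * Cmod (g z) <= (eps/(2*B)) * B)
    by (apply Rmult_le_compat; try apply Cmod_ge_0; lra).
  replace (A * (eps/(2*A))) with (eps/2) in * by (field; lra).
  replace ((eps/(2*B)) * B) with (eps/2) in * by (field; lra). lra.
Qed.

Lemma Ccont_comp (f g : C -> C) (z : C) :
  Ccont g z -> Ccont f (g z) -> Ccont (fun w => f (g w)) z.
Proof.
  intros Hg Hf eps He. destruct (Hf eps He) as [d [D1 H1]].
  destruct (Hg d D1) as [d' [D2 H2]]. exists d'. split; auto.
Qed.

Lemma Ccont_inv (z : C) : z <> 0 -> Ccont (fun w => / w)%C z.
Proof.
  intros Hz eps He. assert (Hp := proj1 (Cmod_gt_0 z) Hz).
  set (m := Cmod z) in *.
  exists (Rmin (m/2) (eps * m * m / 2)). split.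
  { apply Rmin_pos; [lra|]. assert (0 < eps * m * m) by (repeat apply Rmult_lt_0_compat; lra). lra. }
  intros w Hw.
  assert (H1 := Rlt_le_trans _ _ _ Hw (Rmin_l _ _)).
  assert (H2 := Rlt_le_trans _ _ _ Hw (Rmin_r _ _)).
  assert (H3 : m / 2 < Cmod w).
  { pose proof (Cmod_tri_inv z w). rewrite Cmod_sub_sym in H. fold m in H. lra. }
  assert (Hw0 : w <> 0) by (apply Cmod_gt_0; lra).
  replace (/ w - / z)%C with ((z - w) / (w * z))%C by (field; auto).
  rewrite Cmod_div by (apply Cmult_neq_0; auto). rewrite Cmod_mult. fold m.
  rewrite Cmod_sub_sym.
  apply Rmult_lt_reg_r with (Cmod w * m); [apply Rmult_lt_0_compat; lra|].
  unfold Rdiv. rewrite Rmult_assoc, Rinv_l by (apply Rgt_not_eq, Rmult_lt_0_compat; lra).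
  assert (eps * (m/2 * m) <= eps * (Cmod w * m)).
  { apply Rmult_le_compat_l; [lra|]. apply Rmult_le_compat_r; lra. }
  nra.
Qed.

Lemma Ccont_ext_loc (f g : C -> C) (z : C) (r : R) : 0 < r ->
  (forall w, Cmod (w - z) < r -> f w = g w) -> Ccont f z -> Ccont g z.
Proof.
  intros Hr He Hf eps Heps. destruct (Hf eps Heps) as [d [D1 H1]].
  exists (Rmin d r). split; [apply Rmin_pos; lra|]. intros w Hw.
  rewrite <- !He; [apply H1| |].
  - eapply Rlt_le_trans; [exact Hw|apply Rmin_l].
  - replace (z - z)%C with (RtoC 0) by ring. rewrite Cmod_0. lra.
  - eapply Rlt_le_trans; [exact Hw|apply Rmin_r].
Qed.

(* Caratheodory's form of differentiability, from which the algebra of derivatives is immediate. *)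
Lemma Cder_carat (g : C -> C) (z l : C) :
  Cder g z l <-> exists q, Ccont q z /\ q z = l /\ forall w, g w = (g z + q w * (w - z))%C.
Proof.
  split.
  - intros H.
    exists (fun w => if Ceq_dec w z then l else (g w - g z) / (w - z))%C. split; [|split].
    + intros eps He. destruct (H (eps/2)) as [d [D1 H1]]; [lra|].
      exists d. split; auto. intros w Hw.
      destruct (Ceq_dec z z) as [_|]; [|congruence].
      destruct (Ceq_dec w z) as [E|E].
      * replace (l - l)%C with (RtoC 0) by ring. rewrite Cmod_0. lra.
      * specialize (H1 (w - z)%C Hw). replace (z + (w - z))%C with w in H1 by ring.
        assert (Hne : (w - z <> 0)%C) by (intros E'; apply E, Csub_0_eq, E').
        assert (Hp := Cmod_sub_pos _ _ E).
        replace ((g w - g z) / (w - z) - l)%C with ((g w - g z - l * (w - z)) / (w - z))%C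
          by (field; auto).
        rewrite Cmod_div by auto.
        apply Rle_lt_trans with (eps/2); [|lra].
        apply Rmult_le_reg_r with (Cmod (w - z)); [exact Hp|].
        unfold Rdiv. rewrite Rmult_assoc, Rinv_l by lra. lra.
    + destruct (Ceq_dec z z); congruence.
    + intros w. destruct (Ceq_dec w z) as [E|E].
      * subst. ring.
      * field. intros E'; apply E, Csub_0_eq, E'.
  - intros [q [Hq [E Hw]]] eps He. destruct (Hq eps He) as [d [D1 H1]].
    exists d. split; auto. intros h Hh. rewrite (Hw (z + h)%C), <- E.
    replace (g z + q (z + h)%C * (z + h - z) - g z - q z * h)%C
      with ((q (z + h)%C - q z) * h)%C by ring.
    rewrite Cmod_mult. apply Rmult_le_compat_r; [apply Cmod_ge_0|].
    left. apply H1. replace (z + h - z)%C with h by ring. exact Hh.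
Qed.

Lemma Cder_Ccont (g : C -> C) (z l : C) : Cder g z l -> Ccont g z.
Proof.
  intros H. apply Cder_carat in H. destruct H as [q [Hq [E Hw]]].
  assert (K : Ccont (fun w => g z + q w * (w + - z))%C z).
  { apply Ccont_plus; [apply Ccont_const|]. apply Ccont_mult; [exact Hq|].
    apply Ccont_plus; [apply Ccont_id|apply Ccont_const]. }
  apply (Ccont_ext_loc _ _ _ 1 Rlt_0_1 (fun w _ => eq_sym (Hw w)) K).
Qed.

Lemma Cder_const (k z : C) : Cder (fun _ => k) z 0.
Proof.
  apply Cder_carat. exists (fun _ => 0%C).
  split; [apply Ccont_const|split; auto]. intros. ring.
Qed.

Lemma Cder_id (z : C) : Cder (fun w => w) z 1.
Proof.
  apply Cder_carat. exists (fun _ => 1%C).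
  split; [apply Ccont_const|split; auto]. intros. ring.
Qed.

Lemma Cder_plus (f g : C -> C) (z a b : C) :
  Cder f z a -> Cder g z b -> Cder (fun w => f w + g w)%C z (a + b).
Proof.
  intros Hf Hg. apply Cder_carat in Hf; apply Cder_carat in Hg.
  destruct Hf as [p [P1 [P2 P3]]], Hg as [q [Q1 [Q2 Q3]]].
  apply Cder_carat. exists (fun w => p w + q w)%C.
  split; [apply Ccont_plus; auto|split; [congruence|]].
  intros w. rewrite (P3 w), (Q3 w). ring.
Qed.

Lemma Cder_mult (f g : C -> C) (z a b : C) :
  Cder f z a -> Cder g z b -> Cder (fun w => f w * g w)%C z (a * g z + f z * b).
Proof.
  intros Hf Hg. assert (Cf := Cder_Ccont _ _ _ Hf).
  apply Cder_carat in Hf; apply Cder_carat in Hg.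
  destruct Hf as [p [P1 [P2 P3]]], Hg as [q [Q1 [Q2 Q3]]].
  apply Cder_carat. exists (fun w => p w * g z + f w * q w)%C.
  split; [|split; [congruence|]].
  - apply Ccont_plus; apply Ccont_mult; auto. apply Ccont_const.
  - intros w. rewrite (Q3 w), (P3 w). ring.
Qed.

Lemma Cder_comp (f g : C -> C) (z a b : C) :
  Cder g z b -> Cder f (g z) a -> Cder (fun w => f (g w)) z (a * b).
Proof.
  intros Hg Hf. assert (Cg := Cder_Ccont _ _ _ Hg).
  apply Cder_carat in Hf; apply Cder_carat in Hg.
  destruct Hf as [p [P1 [P2 P3]]], Hg as [q [Q1 [Q2 Q3]]].
  apply Cder_carat. exists (fun w => p (g w) * q w)%C.
  split; [|split; [congruence|]].
  - apply Ccont_mult; auto. apply Ccont_comp; auto.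
  - intros w. rewrite (P3 (g w)). rewrite (Q3 w) at 2. ring.
Qed.

Lemma Cder_inv (z : C) : z <> 0 -> Cder (fun w => / w)%C z (- / (z * z)).
Proof.
  intros Hz. apply Cder_carat.
  (* For [w = 0] the slope stays unsimplified, so that Caratheodory's identity holds whatever value
     [/ 0] has. *)
  exists (fun w => if Ceq_dec w 0 then - / z * (/ (w - z)) + / w / (w - z) else - (/ z * / w))%C.
  split; [|split].
  - apply (Ccont_ext_loc (fun w => - / z * / w)%C _ _ (Cmod z)).
    + apply Cmod_gt_0, Hz.
    + intros w Hw. destruct (Ceq_dec w 0) as [E|E]; [|field; auto].
      subst. exfalso. replace (0 - z)%C with (- z)%C in Hw by ring.
      rewrite Cmod_opp in Hw. lra.
    + apply Ccont_mult; [apply Ccont_const|apply Ccont_inv, Hz].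
  - destruct (Ceq_dec z 0); [contradiction|]. field; auto.
  - intros w. destruct (Ceq_dec w 0) as [E|E].
    + subst. unfold Cdiv. rewrite Cmult_plus_distr_r, <- !Cmult_assoc.
      assert (0 - z <> 0)%C.
      { intros E. apply Hz. replace z with (- (0 - z))%C by ring. rewrite E. ring. }
      rewrite Cinv_l by auto. ring.
    + field; auto.
Qed.

Lemma Cder_ext_loc (f g : C -> C) (z l : C) (r : R) : 0 < r ->
  (forall w, Cmod (w - z) < r -> f w = g w) -> Cder f z l -> Cder g z l.
Proof.
  intros Hr He Hf eps Heps. destruct (Hf eps Heps) as [d [D1 H1]].
  exists (Rmin d r). split; [apply Rmin_pos; lra|]. intros h Hh.
  rewrite <- !He; [apply H1| |].
  - eapply Rlt_le_trans; [exact Hh|apply Rmin_l].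
  - replace (z - z)%C with (RtoC 0) by ring. rewrite Cmod_0. lra.
  - replace (z + h - z)%C with h by ring. eapply Rlt_le_trans; [exact Hh|apply Rmin_r].
Qed.

Lemma Cder_eq (f : C -> C) (z l l' : C) : Cder f z l -> l = l' -> Cder f z l'.
Proof. intros H E. subst. exact H. Qed.

Lemma Cder_scal (k : C) (f : C -> C) (z l : C) :
  Cder f z l -> Cder (fun w => k * f w)%C z (k * l).
Proof.
  intros H. eapply Cder_eq; [apply Cder_mult; [apply Cder_const|exact H]|]. cbv beta. ring.
Qed.

Lemma Cder_minus (f g : C -> C) (z a b : C) :
  Cder f z a -> Cder g z b -> Cder (fun w => f w - g w)%C z (a - b).
Proof.
  intros Hf Hg. apply (Cder_ext_loc (fun w => f w + (-1) * g w)%C _ _ _ 1 Rlt_0_1).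
  - intros. ring.
  - eapply Cder_eq; [apply Cder_plus; [exact Hf|apply (Cder_scal (-1)%C), Hg]|]. ring.
Qed.

Lemma Cder_finv (f : C -> C) (z l : C) : f z <> 0 ->
  Cder f z l -> Cder (fun w => / f w)%C z (- l / (f z * f z)).
Proof.
  intros Hz H. eapply Cder_eq; [apply (Cder_comp Cinv f z _ _ H (Cder_inv _ Hz))|].
  field. auto.
Qed.

Definition Cdiff (g : C -> C) (z : C) : Prop := exists l, Cder g z l.

Lemma Cdiff_iff (g : C -> C) (z : C) : C_differentiable_at g z <-> Cdiff g z.
Proof.
  split; intros [l H]; exists l; intros eps He; destruct (H eps He) as [d [D1 H1]];
    exists d; (split; [exact D1|exact H1]).
Qed.

Lemma Cdiff_Ccont g z : Cdiff g z -> Ccont g z.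
Proof. intros [l H]. eapply Cder_Ccont, H. Qed.
Lemma Cdiff_const k z : Cdiff (fun _ => k) z.
Proof. exists 0. apply Cder_const. Qed.
Lemma Cdiff_id z : Cdiff (fun w => w) z.
Proof. exists 1. apply Cder_id. Qed.
Lemma Cdiff_plus f g z : Cdiff f z -> Cdiff g z -> Cdiff (fun w => f w + g w)%C z.
Proof. intros [a Ha] [b Hb]. eexists. apply Cder_plus; eauto. Qed.
Lemma Cdiff_minus f g z : Cdiff f z -> Cdiff g z -> Cdiff (fun w => f w - g w)%C z.
Proof. intros [a Ha] [b Hb]. eexists. apply Cder_minus; eauto. Qed.
Lemma Cdiff_mult f g z : Cdiff f z -> Cdiff g z -> Cdiff (fun w => f w * g w)%C z.
Proof. intros [a Ha] [b Hb]. eexists. apply Cder_mult; eauto. Qed.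
Lemma Cdiff_inv (f : C -> C) (z : C) : f z <> 0 -> Cdiff f z -> Cdiff (fun w => / f w)%C z.
Proof. intros Hz [a Ha]. eexists. apply (Cder_finv f z a Hz Ha). Qed.
Lemma Cdiff_div (f g : C -> C) (z : C) : g z <> 0 -> Cdiff f z -> Cdiff g z -> Cdiff (fun w => f w / g w)%C z.
Proof. intros Hz Hf Hg. apply Cdiff_mult; auto. apply Cdiff_inv; auto. Qed.
Lemma Cdiff_comp (f g : C -> C) (z : C) : Cdiff g z -> Cdiff f (g z) -> Cdiff (fun w => f (g w)) z.
Proof. intros [a Ha] [b Hb]. eexists. apply Cder_comp; eauto. Qed.
Lemma Cdiff_ext_loc (f g : C -> C) (z : C) r : 0 < r ->
  (forall w, Cmod (w - z) < r -> f w = g w) -> Cdiff f z -> Cdiff g z.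
Proof. intros Hr He [a Ha]. eexists. eapply Cder_ext_loc; eauto. Qed.

Lemma Cmod_le_sum (z : C) : Cmod z <= Rabs (fst z) + Rabs (snd z).
Proof.
  unfold Cmod. apply Rsqr_incr_0_var; [|pose proof (Rabs_pos (fst z)); pose proof (Rabs_pos (snd z)); lra].
  rewrite Rsqr_sqrt by nra. unfold Rsqr.
  pose proof (Rabs_pos (fst z)); pose proof (Rabs_pos (snd z)).
  pose proof (pow2_abs (fst z)). pose proof (pow2_abs (snd z)). nra.
Qed.

Lemma fst_le_Cmod (z : C) : Rabs (fst z) <= Cmod z.
Proof. eapply Rle_trans; [apply Rmax_l|apply Rmax_Cmod]. Qed.
Lemma snd_le_Cmod (z : C) : Rabs (snd z) <= Cmod z.
Proof. eapply Rle_trans; [apply Rmax_r|apply Rmax_Cmod]. Qed.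

Lemma Cmod_sqr (z : C) : Cmod z * Cmod z = fst z * fst z + snd z * snd z.
Proof. unfold Cmod. rewrite sqrt_sqrt; nra. Qed.

(* The factor 2 comes from treating the two coordinates separately. *)
Lemma seg_mvt (g dg : C -> C) (z h k : C) (M : R) :
  (forall t, 0 <= t <= 1 -> is_derive (fun t => fst (g (z + RtoC t * h)%C)) t (fst (dg (z + RtoC t * h)%C * h)%C)
                         /\ is_derive (fun t => snd (g (z + RtoC t * h)%C)) t (snd (dg (z + RtoC t * h)%C * h)%C)) ->
  (forall t, 0 <= t <= 1 -> Cmod (dg (z + RtoC t * h)%C - k) <= M) ->
  Cmod (g (z + h)%C - g z - k * h) <= 2 * M * Cmod h.
Proof.
  intros Hd HM.
  assert (K : forall p : C -> R, (p = fst \/ p = snd) ->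
     Rabs (p (g (z + h)%C - g z - k * h)%C) <= M * Cmod h).
  { intros p Hp.
    assert (Hlin : forall u v : C, p (u - v)%C = p u - p v)
      by (intros; destruct Hp; subst; simpl; ring).
    assert (Hle : forall u : C, Rabs (p u) <= Cmod u)
      by (intros; destruct Hp; subst; [apply fst_le_Cmod|apply snd_le_Cmod]).
    destruct (MVT_gen (fun t => p (g (z + RtoC t * h)%C) - t * p (k * h)%C) 0 1
        (fun t => p ((dg (z + RtoC t * h)%C - k) * h)%C)) as [c [Hc1 Hc2]].
    - intros t Ht. rewrite Rmin_left, Rmax_right in Ht by lra.
      assert (Q : is_derive (fun t => p (g (z + RtoC t * h)%C)) t (p (dg (z + RtoC t * h)%C * h)%C)).
      { destruct Hp; subst; apply Hd; lra. }
      evar_last. { apply (is_derive_minus _ (fun t => t * p (k * h)%C) t _ (p (k * h)%C) Q).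
        auto_derive; auto. ring. }
      unfold minus, plus, opp; simpl. replace ((dg (z + RtoC t * h)%C - k) * h)%C
        with ((dg (z + RtoC t * h)%C) * h - k * h)%C by ring. rewrite Hlin. ring.
    - intros t Ht. rewrite Rmin_left, Rmax_right in Ht by lra.
      apply continuity_pt_filterlim. 
      apply (continuous_minus (fun t => p (g (z + RtoC t * h)%C)) (fun t => t * p (k * h)%C) t).
      + apply (@ex_derive_continuous R_AbsRing R_NormedModule).
        exists (p (dg (z + RtoC t * h)%C * h)%C). destruct Hp; subst; apply Hd; lra.
      + apply (@ex_derive_continuous R_AbsRing R_NormedModule). auto_derive. auto.
    - rewrite Rmin_left, Rmax_right in Hc1 by lra.
      replace (z + RtoC 1 * h)%C with (z + h)%C in Hc2 by ring.
      replace (z + RtoC 0 * h)%C with z in Hc2 by ring.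
      rewrite !Hlin. replace (p (g (z+h)%C) - p (g z) - p (k * h)%C) with
        (p ((dg (z + RtoC c * h)%C - k) * h)%C) by lra.
      eapply Rle_trans; [apply Hle|]. rewrite Cmod_mult.
      apply Rmult_le_compat_r; [apply Cmod_ge_0|]. apply HM, Hc1. }
  eapply Rle_trans; [apply Cmod_le_sum|].
  assert (A := K fst (or_introl eq_refl)). assert (B := K snd (or_intror eq_refl)). lra.
Qed.

(** This is [seg_mvt] with [k = dg z]: continuity of [dg] makes the bound [M] as small as desired.
    Differentiability of [cexp] and [Clog] thus reduces to real derivatives along segments, which
    [auto_derive] computes. *)
Lemma Cder_of_seg (g dg : C -> C) (z : C) (r : R) : 0 < r ->
  (forall h t, Cmod h < r -> 0 <= t <= 1 ->
     is_derive (fun t => fst (g (z + RtoC t * h)%C)) t (fst (dg (z + RtoC t * h)%C * h)%C)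
     /\ is_derive (fun t => snd (g (z + RtoC t * h)%C)) t (snd (dg (z + RtoC t * h)%C * h)%C)) ->
  Ccont dg z -> Cder g z (dg z).
Proof.
  intros Hr Hd Hc eps He. destruct (Hc (eps/2)) as [d [D1 H1]]; [lra|].
  exists (Rmin d r). split; [apply Rmin_pos; lra|]. intros h Hh.
  replace (eps * Cmod h) with (2 * (eps/2) * Cmod h) by field.
  apply (seg_mvt g dg).
  - intros t Ht. apply Hd; auto. eapply Rlt_le_trans; [exact Hh|apply Rmin_r].
  - intros t Ht. left. apply H1. replace (z + RtoC t * h - z)%C with (RtoC t * h)%C by ring.
    rewrite Cmod_mult, Cmod_R, Rabs_pos_eq by lra.
    apply Rle_lt_trans with (1 * Cmod h).
    + apply Rmult_le_compat_r; [apply Cmod_ge_0|lra].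
    + rewrite Rmult_1_l. eapply Rlt_le_trans; [exact Hh|apply Rmin_l].
Qed.

Lemma Cder_line (g : C -> C) (z h l : C) (t : R) : Cder g (z + RtoC t * h)%C l ->
  is_derive (fun t => fst (g (z + RtoC t * h)%C)) t (fst (l * h)%C)
  /\ is_derive (fun t => snd (g (z + RtoC t * h)%C)) t (snd (l * h)%C).
Proof.
  intros H.
  assert (K : forall p : C -> R, (p = fst \/ p = snd) ->
     is_derive (fun t => p (g (z + RtoC t * h)%C)) t (p (l * h)%C)).
  { intros p Hp.
    assert (Hlin : forall u v : C, p (u - v)%C = p u - p v)
      by (intros; destruct Hp; subst; simpl; ring).
    assert (Hle : forall u : C, Rabs (p u) <= Cmod u)
      by (intros; destruct Hp; subst; [apply fst_le_Cmod|apply snd_le_Cmod]).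
    assert (Hsc : forall (s : R) u, p (RtoC s * u)%C = s * p u)
      by (intros; destruct Hp; subst; simpl; ring).
    apply is_derive_Reals. intros eps He.
    set (m := Cmod h + 1). assert (Hm : 0 < m) by (unfold m; pose proof (Cmod_ge_0 h); lra).
    destruct (H (eps/(2*m))) as [d [D1 H1]]; [apply Rdiv_lt_0_compat; lra|].
    assert (D2 : 0 < d / m) by (apply Rdiv_lt_0_compat; lra).
    exists (mkposreal _ D2). intros s Hs0 Hs. simpl in Hs.
    assert (Hpos := Rabs_pos_lt s Hs0).
    specialize (H1 (RtoC s * h)%C). rewrite Cmod_mult, Cmod_R in H1.
    assert (Hlt : Rabs s * Cmod h < d).
    { apply Rle_lt_trans with (Rabs s * m); [apply Rmult_le_compat_l; unfold m; lra|].
      apply Rmult_lt_reg_r with (/ m); [apply Rinv_0_lt_compat; lra|].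
      rewrite Rmult_assoc, Rinv_r by lra. rewrite Rmult_1_r. exact Hs. }
    specialize (H1 Hlt).
    replace (z + RtoC t * h + RtoC s * h)%C with (z + RtoC (t + s) * h)%C in H1
      by (rewrite RtoC_plus; ring).
    replace ((p (g (z + RtoC (t + s) * h)%C) - p (g (z + RtoC t * h)%C)) / s - p (l * h)%C)
      with (p (g (z + RtoC (t + s) * h)%C - g (z + RtoC t * h)%C - l * (RtoC s * h))%C / s).
    2:{ rewrite !Hlin. replace (l * (RtoC s * h))%C with (RtoC s * (l * h))%C by ring.
        rewrite Hsc. field. auto. }
    unfold Rdiv. rewrite Rabs_mult, Rabs_inv.
    apply Rmult_lt_reg_r with (Rabs s); [exact Hpos|].
    rewrite Rmult_assoc, Rinv_l, Rmult_1_r by lra.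
    eapply Rle_lt_trans; [apply Hle|]. eapply Rle_lt_trans; [apply H1|].
    apply Rle_lt_trans with (eps / (2*m) * (Rabs s * m)).
    - apply Rmult_le_compat_l; [left; apply Rdiv_lt_0_compat; lra|].
      apply Rmult_le_compat_l; unfold m; lra.
    - replace (eps / (2*m) * (Rabs s * m)) with (eps * Rabs s / 2) by (field; lra).
      assert (0 < eps * Rabs s) by (apply Rmult_lt_0_compat; lra). lra. }
  split; apply K; auto.
Qed.

Lemma Cder_mvt (g dg : C -> C) (z h : C) (M : R) :
  (forall t, 0 <= t <= 1 -> Cder g (z + RtoC t * h)%C (dg (z + RtoC t * h)%C)) ->
  (forall t, 0 <= t <= 1 -> Cmod (dg (z + RtoC t * h)%C) <= M) ->
  Cmod (g (z + h)%C - g z) <= 2 * M * Cmod h.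
Proof.
  intros Hd HM. replace (g (z + h)%C - g z)%C with (g (z + h)%C - g z - 0 * h)%C by ring.
  apply (seg_mvt g dg).
  - intros t Ht. apply Cder_line, Hd, Ht.
  - intros t Ht. replace (dg (z + RtoC t * h)%C - 0)%C with (dg (z + RtoC t * h)%C) by ring.
    apply HM, Ht.
Qed.

(** * Exponential and logarithm *)

Lemma Ccont_of_2d (g : C -> C) (z : C) :
  continuity_2d_pt (fun x y => fst (g (x, y))) (fst z) (snd z) ->
  continuity_2d_pt (fun x y => snd (g (x, y))) (fst z) (snd z) -> Ccont g z.
Proof.
  intros H1 H2 eps He.
  assert (He2 : 0 < eps / 2) by lra.
  destruct (H1 (mkposreal _ He2)) as [d1 D1], (H2 (mkposreal _ He2)) as [d2 D2]. simpl in *.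
  exists (Rmin d1 d2). split; [apply Rmin_pos; apply cond_pos|].
  intros w Hw.
  assert (A := fst_le_Cmod (w - z)%C). assert (B := snd_le_Cmod (w - z)%C). simpl in A, B.
  assert (A1 := Rmin_l d1 d2). assert (A2 := Rmin_r d1 d2).
  assert (F : Rabs (fst (g w) - fst (g z)) < eps / 2).
  { destruct w as [x y], z as [u v]. apply D1; simpl in *; unfold Rminus; lra. }
  assert (S : Rabs (snd (g w) - snd (g z)) < eps / 2).
  { destruct w as [x y], z as [u v]. apply D2; simpl in *; unfold Rminus; lra. }
  eapply Rle_lt_trans; [apply Cmod_le_sum|]. simpl. unfold Rminus in *. lra.
Qed.

Definition cexp : C -> C := Cexp.

Lemma cexp_plus (z w : C) : cexp (z + w)%C = (cexp z * cexp w)%C.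
Proof.
  unfold cexp, Cexp. simpl. rewrite exp_plus, cos_plus, sin_plus.
  unfold Cmult; simpl. f_equal; ring.
Qed.

Lemma cexp_0 : cexp 0 = 1.
Proof. unfold cexp, Cexp. simpl. rewrite exp_0, cos_0, sin_0. unfold RtoC. f_equal; ring. Qed.

Lemma Cmod_cexp (z : C) : Cmod (cexp z) = exp (fst z).
Proof.
  assert (H := Cmod_sqr (cexp z)). change (fst (cexp z)) with (exp (fst z) * cos (snd z)) in H.
  change (snd (cexp z)) with (exp (fst z) * sin (snd z)) in H.
  assert (T := sin2_cos2 (snd z)). unfold Rsqr in T.
  assert (P := exp_pos (fst z)). assert (Q := Cmod_ge_0 (cexp z)).
  apply Rsqr_inj; [exact Q|lra|]. unfold Rsqr. rewrite H.
  replace (exp (fst z) * cos (snd z) * (exp (fst z) * cos (snd z)) +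
    exp (fst z) * sin (snd z) * (exp (fst z) * sin (snd z))) with
    (exp (fst z) * exp (fst z) * (sin (snd z) * sin (snd z) + cos (snd z) * cos (snd z))) by ring.
  rewrite T. ring.
Qed.

Lemma cexp_neq_0 (z : C) : cexp z <> 0.
Proof. apply Cmod_gt_0. rewrite Cmod_cexp. apply exp_pos. Qed.

Lemma cexp_opp (z : C) : cexp (- z)%C = (/ cexp z)%C.
Proof.
  assert (H := cexp_plus z (- z)%C). replace (z + - z)%C with (RtoC 0) in H by ring.
  rewrite cexp_0 in H.
  replace (cexp (- z)%C) with (/ cexp z * (cexp z * cexp (- z)%C))%C
    by (field; apply cexp_neq_0).
  rewrite <- H. field. apply cexp_neq_0.
Qed.

Lemma Ccont_cexp (z : C) : Ccont cexp z.
Proof.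
  apply Ccont_of_2d; simpl.
  - apply (continuity_2d_pt_mult (fun x _ => exp x) (fun _ y => cos y)).
    + apply (continuity_1d_2d_pt_comp exp (fun x _ => x)).
      apply derivable_continuous_pt, derivable_pt_exp. apply continuity_2d_pt_id1.
    + apply (continuity_1d_2d_pt_comp cos (fun _ y => y)).
      apply continuity_cos. apply continuity_2d_pt_id2.
  - apply (continuity_2d_pt_mult (fun x _ => exp x) (fun _ y => sin y)).
    + apply (continuity_1d_2d_pt_comp exp (fun x _ => x)).
      apply derivable_continuous_pt, derivable_pt_exp. apply continuity_2d_pt_id1.
    + apply (continuity_1d_2d_pt_comp sin (fun _ y => y)).
      apply continuity_sin. apply continuity_2d_pt_id2.
Qed.

Lemma Cder_cexp (z : C) : Cder cexp z (cexp z).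
Proof.
  apply (Cder_of_seg cexp cexp z 1 Rlt_0_1); [|apply Ccont_cexp].
  intros h t _ _. unfold cexp, Cexp. simpl. split; auto_derive; auto; unfold Rminus; ring.
Qed.

Definition cis (y : R) : C := (cos y, sin y).

Lemma Cmod_cis y : Cmod (cis y) = 1.
Proof.
  unfold Cmod, cis. simpl. replace (cos y * (cos y * 1) + sin y * (sin y * 1)) with 1.
  apply sqrt_1. pose proof (sin2_cos2 y). unfold Rsqr in H. lra.
Qed.

Lemma cis_neq_0 y : cis y <> 0.
Proof. apply Cmod_gt_0. rewrite Cmod_cis. lra. Qed.

Lemma cis_2PI : cis (2 * PI) = cis 0.
Proof. unfold cis. rewrite cos_2PI, sin_2PI, cos_0, sin_0. reflexivity. Qed.

Lemma cis_conj y : Cconj (cis y) = (/ cis y)%C.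
Proof.
  assert (H := Cmod2_conj (cis y)). rewrite Cmod_cis in H.
  replace (Cconj (cis y)) with (/ cis y * (cis y * Cconj (cis y)))%C
    by (field; apply cis_neq_0).
  rewrite <- H. rewrite pow1. field. apply cis_neq_0.
Qed.

Lemma Cmod_Rcis (r y : R) : 0 <= r -> Cmod (RtoC r * cis y) = r.
Proof. intros. rewrite Cmod_mult, Cmod_cis, Cmod_R, Rabs_pos_eq; lra. Qed.

Lemma polar (z : C) : exists y, 0 <= y <= 2 * PI /\ z = (RtoC (Cmod z) * cis y)%C.
Proof.
  destruct (Ceq_dec z 0) as [E|E].
  - exists 0. split; [pose proof PI_RGT_0; lra|]. subst. rewrite Cmod_0. ring.
  - assert (Hp := proj1 (Cmod_gt_0 z) E). assert (Hs := Cmod_sqr z).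
    set (m := Cmod z) in *. destruct z as [x v]. simpl in Hs.
    assert (Hb : -1 <= x / m <= 1).
    { assert (- m <= x <= m) by nra.
      split; apply Rmult_le_reg_r with m; auto; unfold Rdiv; rewrite Rmult_assoc, Rinv_l; lra. }
    assert (Hsq : 1 - (x / m)² = (v/m)²).
    { unfold Rsqr. field_simplify; [|lra|lra]. f_equal. nra. }
    destruct (Rle_dec 0 v).
    + exists (acos (x/m)). pose proof (acos_bound (x/m)). split; [pose proof PI_RGT_0; lra|].
      unfold cis. rewrite cos_acos, sin_acos by auto. rewrite Hsq.
      rewrite sqrt_Rsqr by (apply Rdiv_le_0_compat; lra).
      unfold Cmult, RtoC; simpl. f_equal; field; lra.
    + exists (2*PI - acos (x/m)). pose proof (acos_bound (x/m)). split; [pose proof PI_RGT_0; lra|].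
      unfold cis. replace (2 * PI - acos (x/m)) with (- acos (x/m) + 2 * INR 1 * PI) by (simpl; ring).
      rewrite cos_period, sin_period, cos_neg, sin_neg.
      rewrite cos_acos, sin_acos by auto. rewrite Hsq.
      replace ((v/m)²) with ((-v/m)²) by (unfold Rsqr; field; lra).
      rewrite sqrt_Rsqr by (apply Rdiv_le_0_compat; lra).
      unfold Cmult, RtoC; simpl. f_equal; field; lra.
Qed.

Lemma cexp_surj (z : C) : z <> 0 -> exists w, cexp w = z.
Proof.
  intros Hz. destruct (polar z) as [y [_ Hy]]. exists (ln (Cmod z), y).
  unfold cexp, Cexp. simpl. rewrite exp_ln by (apply Cmod_gt_0, Hz).
  rewrite Hy at 3. unfold cis, Cmult, RtoC; simpl. f_equal; ring.
Qed.

(** The principal logarithm on the right half-plane, the only region where [atan (y / x)] is the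
    argument. *)
Definition Clog (z : C) : C := (ln (Cmod z), atan (snd z / fst z)).

Lemma cexp_Clog (z : C) : 0 < fst z -> cexp (Clog z) = z.
Proof.
  intros Hx. assert (Hp : 0 < Cmod z) by (pose proof (fst_le_Cmod z); rewrite Rabs_pos_eq in H; lra).
  unfold cexp, Cexp, Clog. simpl. rewrite exp_ln by auto.
  rewrite cos_atan, sin_atan.
  assert (E : sqrt (1 + (snd z / fst z)²) = Cmod z / fst z).
  { replace (1 + (snd z / fst z)²) with ((Cmod z / fst z)²).
    - apply sqrt_Rsqr. apply Rdiv_le_0_compat; lra.
    - unfold Rsqr. pose proof (Cmod_sqr z). field_simplify; try lra. f_equal. nra. }
  rewrite E. destruct z as [x y]. simpl in *. f_equal; field; lra.
Qed.

Lemma Cder_Clog (z : C) : 0 < fst z -> Cder Clog z (/ z).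
Proof.
  intros Hx. apply (Cder_of_seg Clog Cinv z (fst z) Hx).
  - intros h t Hh Ht.
    assert (Hp : 0 < fst z + t * fst h).
    { assert (A := fst_le_Cmod h).
      assert (Rabs (fst h) < fst z) by lra. apply Rabs_def2 in H. nra. }
    unfold Clog, Cmod, Cinv. simpl.
    set (x := fst z) in *. set (y := snd z). set (a := fst h) in *. set (b := snd h).
    assert (HN : 0 < (x + t*a) * (x + t*a) + (y + t*b) * (y + t*b)).
    { apply Rplus_lt_le_0_compat; [apply Rmult_lt_0_compat; exact Hp|apply Rle_0_sqr]. }
    assert (E1 : forall u, x + (u*a - 0*b) = x + u*a) by (intros; ring).
    assert (E2 : forall u, y + (u*b + 0*a) = y + u*b) by (intros; ring).
    assert (HS := sqrt_lt_R0 _ HN). assert (HS2 := sqrt_sqrt _ (Rlt_le _ _ HN)).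
    split.
    + apply (is_derive_ext (fun t => ln (sqrt ((x + t*a) * (x + t*a) + (y + t*b) * (y + t*b))))).
      { intros u. rewrite E1, E2. f_equal. f_equal. ring. }
      auto_derive; [auto|]. rewrite E1, E2.
      replace ((x + t * a) * ((x + t * a) * 1) + (y + t * b) * ((y + t * b) * 1))
        with ((x + t*a) * (x + t*a) + (y + t*b) * (y + t*b)) by ring.
      set (s := sqrt _) in *. rewrite <- HS2. field. lra.
    + apply (is_derive_ext (fun t => atan ((y + t*b) / (x + t*a)))).
      { intros u. rewrite E1, E2. reflexivity. }
      auto_derive; [lra|]. rewrite E1, E2. field_simplify_eq; [ring|]. repeat split; nra.
  - apply Ccont_inv. intros E. rewrite E in Hx. simpl in Hx. lra.
Qed.

(** * Integrals over circles *)

Definition Rcont (f : R -> C) (t : R) : Prop :=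
  continuous (fun t => fst (f t)) t /\ continuous (fun t => snd (f t)) t.

Lemma continuous_R_iff (f : R -> R) (t : R) : continuous f t <->
  (forall eps, 0 < eps -> exists del, 0 < del /\ forall u, Rabs (u - t) < del -> Rabs (f u - f t) < eps).
Proof.
  split.
  - intros H eps He.
    destruct (proj1 (filterlim_locally f (f t)) H (mkposreal _ He)) as [d Hd].
    exists d. split; [apply cond_pos|]. intros u Hu. apply Hd. exact Hu.
  - intros H. apply filterlim_locally. intros [eps He]. destruct (H eps He) as [d [D1 H1]].
    exists (mkposreal d D1). intros u Hu. apply H1. exact Hu.
Qed.

Lemma Rcont_curve (g : C -> C) (gam : R -> C) (t : R) :
  Rcont gam t -> Ccont g (gam t) -> Rcont (fun t => g (gam t)) t.
Proof.
  intros [H1 H2] Hg.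
  assert (K : forall eps, 0 < eps -> exists del, 0 < del /\
     forall u, Rabs (u - t) < del -> Cmod (g (gam u) - g (gam t)) < eps).
  { intros eps He. destruct (Hg eps He) as [d [D1 D2]].
    destruct (proj1 (continuous_R_iff _ _) H1 (d/2)) as [d1 [E1 E2]]; [lra|].
    destruct (proj1 (continuous_R_iff _ _) H2 (d/2)) as [d2 [F1 F2]]; [lra|].
    exists (Rmin d1 d2). split; [apply Rmin_pos; lra|]. intros u Hu. apply D2.
    eapply Rle_lt_trans; [apply Cmod_le_sum|]. simpl.
    specialize (E2 u (Rlt_le_trans _ _ _ Hu (Rmin_l _ _))).
    specialize (F2 u (Rlt_le_trans _ _ _ Hu (Rmin_r _ _))). unfold Rminus in *. lra. }
  split; apply continuous_R_iff; intros eps He; destruct (K eps He) as [d [D1 D2]];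
    exists d; (split; [exact D1|]); intros u Hu; specialize (D2 u Hu);
    eapply Rle_lt_trans; try exact D2.
  - apply (fst_le_Cmod (g (gam u) - g (gam t))%C).
  - apply (snd_le_Cmod (g (gam u) - g (gam t))%C).
Qed.

Lemma Rcont_const (k : C) t : Rcont (fun _ => k) t.
Proof. split; apply continuous_const. Qed.

Lemma Rcont_plus (f g : R -> C) t : Rcont f t -> Rcont g t -> Rcont (fun t => f t + g t)%C t.
Proof. intros [A B] [A' B']. split; simpl; apply (continuous_plus (V := R_NormedModule)); auto. Qed.

Lemma Rcont_mult (f g : R -> C) t : Rcont f t -> Rcont g t -> Rcont (fun t => f t * g t)%C t.
Proof.
  intros [A B] [A' B']. split; simpl.
  - apply (continuous_minus (V := R_NormedModule)); apply (continuous_mult (K := R_AbsRing)); auto.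
  - apply (continuous_plus (V := R_NormedModule)); apply (continuous_mult (K := R_AbsRing)); auto.
Qed.

Lemma Rcont_minus (f g : R -> C) t : Rcont f t -> Rcont g t -> Rcont (fun t => f t - g t)%C t.
Proof. intros [A B] [A' B']. split; simpl; apply (continuous_minus (V := R_NormedModule)); auto. Qed.

Lemma Rcont_RtoC (f : R -> R) t : continuous f t -> Rcont (fun t => RtoC (f t)) t.
Proof. intros H. split; simpl; [exact H|apply continuous_const]. Qed.

Lemma Rcont_cis t : Rcont cis t.
Proof.
  split; simpl; apply continuity_pt_filterlim; [apply continuity_cos|apply continuity_sin].
Qed.

Lemma Rcont_id t : Rcont (fun t => RtoC t) t.
Proof. apply Rcont_RtoC, continuous_id. Qed.

Lemma Rcont_circle (c : C) (r : R) t : Rcont (fun y => c + RtoC r * cis y)%C t.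
Proof. apply Rcont_plus; [apply Rcont_const|]. apply Rcont_mult; [apply Rcont_const|apply Rcont_cis]. Qed.

Lemma Rcont_ray (c : C) (y : R) t : Rcont (fun r => c + RtoC r * cis y)%C t.
Proof. apply Rcont_plus; [apply Rcont_const|]. apply Rcont_mult; [apply Rcont_id|apply Rcont_const]. Qed.

Definition CI (f : R -> C) (a b : R) : C :=
  (RInt (fun t => fst (f t)) a b, RInt (fun t => snd (f t)) a b).

Definition cont_on (f : R -> C) (a b : R) : Prop := forall t, a <= t <= b -> Rcont f t.

Lemma cont_on_ex (f : R -> C) (a b : R) : a <= b -> cont_on f a b ->
  ex_RInt (fun t => fst (f t)) a b /\ ex_RInt (fun t => snd (f t)) a b.
Proof.
  intros Hab H. split; apply (ex_RInt_continuous (V := R_CompleteNormedModule)); intros t Ht;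
    rewrite Rmin_left, Rmax_right in Ht by lra; apply H; lra.
Qed.

Lemma CI_plus (f g : R -> C) (a b : R) : a <= b -> cont_on f a b -> cont_on g a b ->
  CI (fun t => f t + g t)%C a b = (CI f a b + CI g a b)%C.
Proof.
  intros Hab Hf Hg. destruct (cont_on_ex f a b Hab Hf), (cont_on_ex g a b Hab Hg).
  unfold CI, Cplus. simpl. f_equal.
  - apply (RInt_plus (V := R_CompleteNormedModule)); auto.
  - apply (RInt_plus (V := R_CompleteNormedModule)); auto.
Qed.

Lemma RInt_Rscal (k : R) (f : R -> R) (a b : R) : ex_RInt f a b ->
  RInt (fun t => k * f t) a b = k * RInt f a b.
Proof. exact (RInt_scal (V := R_CompleteNormedModule) f a b k). Qed.

Lemma ex_RInt_Rscal (k : R) (f : R -> R) (a b : R) : ex_RInt f a b -> ex_RInt (fun t => k * f t) a b.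
Proof. exact (ex_RInt_scal (V := R_NormedModule) f a b k). Qed.

Lemma RInt_Rplus (f g : R -> R) (a b : R) : ex_RInt f a b -> ex_RInt g a b ->
  RInt (fun t => f t + g t) a b = RInt f a b + RInt g a b.
Proof. exact (RInt_plus (V := R_CompleteNormedModule) f g a b). Qed.

Lemma RInt_Rminus (f g : R -> R) (a b : R) : ex_RInt f a b -> ex_RInt g a b ->
  RInt (fun t => f t - g t) a b = RInt f a b - RInt g a b.
Proof. exact (RInt_minus (V := R_CompleteNormedModule) f g a b). Qed.

Lemma ex_RInt_Rplus (f g : R -> R) (a b : R) : ex_RInt f a b -> ex_RInt g a b ->
  ex_RInt (fun t => f t + g t) a b.
Proof. exact (ex_RInt_plus (V := R_NormedModule) f g a b). Qed.

Lemma CI_scal (k : C) (f : R -> C) (a b : R) : a <= b -> cont_on f a b ->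
  CI (fun t => k * f t)%C a b = (k * CI f a b)%C.
Proof.
  intros Hab Hf. destruct (cont_on_ex f a b Hab Hf) as [E1 E2].
  unfold CI, Cmult. simpl.
  rewrite RInt_Rminus, RInt_Rplus by (apply ex_RInt_Rscal; auto).
  rewrite !RInt_Rscal by auto. reflexivity.
Qed.

Lemma CI_ext (f g : R -> C) (a b : R) : a <= b -> (forall t, a <= t <= b -> f t = g t) ->
  CI f a b = CI g a b.
Proof.
  intros Hab H. unfold CI. f_equal; apply RInt_ext; intros t Ht;
    rewrite Rmin_left, Rmax_right in Ht by lra; rewrite H; auto; lra.
Qed.

Lemma CI_const (k : C) (a b : R) : CI (fun _ => k) a b = (RtoC (b - a) * k)%C.
Proof.
  unfold CI. rewrite !RInt_const. unfold scal; simpl; unfold mult; simpl.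
  unfold Cmult, RtoC; simpl. f_equal; ring.
Qed.

Lemma CI_minus (f g : R -> C) (a b : R) : a <= b -> cont_on f a b -> cont_on g a b ->
  CI (fun t => f t - g t)%C a b = (CI f a b - CI g a b)%C.
Proof.
  intros Hab Hf Hg. rewrite (CI_ext _ (fun t => f t + (-1) * g t)%C) by (auto; intros; ring).
  rewrite CI_plus; auto.
  - rewrite CI_scal; auto. ring.
  - intros t Ht. apply Rcont_mult; [apply Rcont_const|auto].
Qed.

Lemma CI_Chasles (f : R -> C) (a m b : R) : a <= m <= b -> cont_on f a b ->
  CI f a b = (CI f a m + CI f m b)%C.
Proof.
  intros Hm Hf.
  destruct (cont_on_ex f a m (proj1 Hm)) as [A1 A2]. { intros t Ht; apply Hf; lra. }
  destruct (cont_on_ex f m b (proj2 Hm)) as [B1 B2]. { intros t Ht; apply Hf; lra. }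
  unfold CI, Cplus. simpl. f_equal; symmetry.
  - apply (RInt_Chasles (V := R_CompleteNormedModule)); auto.
  - apply (RInt_Chasles (V := R_CompleteNormedModule)); auto.
Qed.

Lemma CI_bound (f : R -> C) (a b M : R) : a <= b -> cont_on f a b ->
  (forall t, a <= t <= b -> Cmod (f t) <= M) -> Cmod (CI f a b) <= 2 * M * (b - a).
Proof.
  intros Hab Hf HM. destruct (cont_on_ex f a b Hab Hf) as [E1 E2].
  eapply Rle_trans; [apply Cmod_le_sum|]. unfold CI; simpl.
  assert (A := abs_RInt_le_const _ a b M Hab E1). assert (B := abs_RInt_le_const _ a b M Hab E2).
  assert (A1 := A (fun t Ht => Rle_trans _ _ _ (fst_le_Cmod (f t)) (HM t Ht))).
  assert (B1 := B (fun t Ht => Rle_trans _ _ _ (snd_le_Cmod (f t)) (HM t Ht))). lra.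
Qed.

Lemma CI_conj (f : R -> C) (a b : R) : a <= b -> cont_on f a b ->
  CI (fun t => Cconj (f t)) a b = Cconj (CI f a b).
Proof.
  intros Hab Hf. destruct (cont_on_ex f a b Hab Hf) as [E1 E2].
  unfold CI, Cconj. simpl. f_equal. apply (RInt_opp (V := R_CompleteNormedModule)); auto.
Qed.

(* Goursat's bisection, isolated from complex analysis. *)
Lemma rect_null (mu : R -> R -> R -> R -> C) (a0 b0 p0 q0 : R) :
  a0 < b0 -> p0 < q0 ->
  (forall a m b p q, a0 <= a -> a <= m -> m <= b -> b <= b0 -> p0 <= p -> p <= q -> q <= q0 ->
     mu a b p q = (mu a m p q + mu m b p q)%C) ->
  (forall a b p m q, a0 <= a -> a <= b -> b <= b0 -> p0 <= p -> p <= m -> m <= q -> q <= q0 ->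
     mu a b p q = (mu a b p m + mu a b m q)%C) ->
  (forall x y eps, a0 <= x <= b0 -> p0 <= y <= q0 -> 0 < eps -> exists del, 0 < del /\
     forall a b p q, a0 <= a <= x -> x <= b <= b0 -> p0 <= p <= y -> y <= q <= q0 ->
       b - a < del -> q - p < del -> Cmod (mu a b p q) <= eps * ((b - a) + (q - p)) ^ 2) ->
  mu a0 b0 p0 q0 = 0.
Proof.
  intros Hab Hpq addx addy loc.
  destruct (Ceq_dec (mu a0 b0 p0 q0) 0) as [E|E]; [exact E|exfalso].
  assert (HK := proj1 (Cmod_gt_0 _) E). set (K := Cmod (mu a0 b0 p0 q0)) in *.
  set (W := b0 - a0). set (H := q0 - p0).
  set (w := fun n => W * (/2) ^ n). set (h := fun n => H * (/2) ^ n).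
  assert (Hw : forall n, 0 < w n) by (intros; unfold w, W; apply Rmult_lt_0_compat; [lra|apply pow_lt; lra]).
  assert (Hh : forall n, 0 < h n) by (intros; unfold h, H; apply Rmult_lt_0_compat; [lra|apply pow_lt; lra]).
  assert (Hw2 : forall n, w n = w (S n) + w (S n)) by (intros; unfold w; simpl; lra).
  assert (Hh2 : forall n, h n = h (S n) + h (S n)) by (intros; unfold h; simpl; lra).
  (* [s] is the lower left corner of a rectangle of stage [n], with sides [w n] and [h n]; at least
     a fourth of the modulus survives each quartering. *)
  set (Good := fun n (s : R * R) => a0 <= fst s /\ fst s + w n <= b0 /\ p0 <= snd s /\ snd s + h n <= q0 /\
      K * (/4)^n <= Cmod (mu (fst s) (fst s + w n) (snd s) (snd s + h n))).
  set (Next := fun n (s s' : R * R) => Good (S n) s' /\ fst s <= fst s' <= fst s + w (S n) /\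
      snd s <= snd s' <= snd s + h (S n)).
  assert (step : forall n s, Good n s -> exists s', Next n s s').
  { intros n [a p] [G1 [G2 [G3 [G4 G5]]]]. simpl in *.
    assert (W1 := Hw (S n)). assert (H1 := Hh (S n)).
    rewrite (Hw2 n), (Hh2 n) in *.
    rewrite (addx a (a + w (S n))) in G5 by lra.
    rewrite (addy a _ p (p + h (S n))), (addy (a + w (S n)) _ p (p + h (S n))) in G5 by lra.
    replace (a + (w (S n) + w (S n))) with (a + w (S n) + w (S n)) in G5 by ring.
    replace (p + (h (S n) + h (S n))) with (p + h (S n) + h (S n)) in G5 by ring.
    set (k := K * (/4)^(S n)). assert (Hk : K * (/4)^n = 4 * k) by (unfold k; simpl; field).
    rewrite Hk in G5.
    destruct (Rle_dec k (Cmod (mu a (a + w (S n)) p (p + h (S n))))) as [L|L1].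
    { exists (a, p). unfold Next, Good; simpl. fold (pow (/4) (S n)). repeat split; try exact L; lra. }
    destruct (Rle_dec k (Cmod (mu a (a + w (S n)) (p + h (S n)) (p + h (S n) + h (S n))))) as [L|L2].
    { exists (a, p + h (S n)). unfold Next, Good; simpl. repeat split; try exact L; lra. }
    destruct (Rle_dec k (Cmod (mu (a + w (S n)) (a + w (S n) + w (S n)) p (p + h (S n))))) as [L|L3].
    { exists (a + w (S n), p). unfold Next, Good; simpl. repeat split; try exact L; lra. }
    destruct (Rle_dec k (Cmod (mu (a + w (S n)) (a + w (S n) + w (S n)) (p + h (S n)) (p + h (S n) + h (S n))))) as [L|L4].
    { exists (a + w (S n), p + h (S n)). unfold Next, Good; simpl. repeat split; try exact L; lra. }
    exfalso.
    match type of G5 with _ <= Cmod (?u + ?v + (?x + ?y)) =>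
      pose proof (Cmod_triangle (u + v) (x + y)); pose proof (Cmod_triangle u v);
      pose proof (Cmod_triangle x y) end. lra. }
  set (sq := fix sq n := match n with O => (a0, p0) | S n => epsilon (inhabits (0,0)) (Next n (sq n)) end).
  assert (HG : forall n, Good n (sq n)).
  { induction n.
    - unfold Good, w, h, W, H; simpl. rewrite !Rmult_1_r.
      replace (a0 + (b0 - a0)) with b0 by ring. replace (p0 + (q0 - p0)) with q0 by ring.
      repeat split; try lra. fold K. lra.
    - simpl. apply (epsilon_spec (inhabits (0,0)) (Next n (sq n))). apply step, IHn. }
  assert (HN : forall n, Next n (sq n) (sq (S n))).
  { intros n. simpl. apply (epsilon_spec (inhabits (0,0)) (Next n (sq n))). apply step, HG. }
  assert (nest : forall (u v : nat -> R), (forall n, 0 < v n) -> (forall n, u n <= u (S n)) ->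
     (forall n, u (S n) + v (S n) <= u n + v n) -> exists x, forall n, u n <= x <= u n + v n).
  { intros u v Hv Hu Huv.
    assert (M1 : forall n k, u n <= u (n + k)%nat).
    { intros n k. induction k; [rewrite Nat.add_0_r; lra|].
      rewrite Nat.add_succ_r. specialize (Hu (n + k)%nat). lra. }
    assert (M2 : forall n k, u (n + k)%nat + v (n + k)%nat <= u n + v n).
    { intros n k. induction k; [rewrite Nat.add_0_r; lra|].
      rewrite Nat.add_succ_r. specialize (Huv (n + k)%nat). lra. }
    assert (M3 : forall n m, u n <= u m + v m).
    { intros n m. destruct (Nat.le_ge_cases n m).
      - replace m with (n + (m - n))%nat by lia. pose proof (M1 n (m-n)%nat). pose proof (Hv (n + (m-n))%nat). lra.
      - replace n with (m + (n - m))%nat by lia. pose proof (M2 m (n-m)%nat). pose proof (Hv (m + (n-m))%nat). lra. }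
    destruct (completeness (fun x => exists n, x = u n)) as [x [X1 X2]].
    - exists (u O + v O). intros y [n Hn]. subst. apply M3.
    - exists (u O). exists O. reflexivity.
    - exists x. intros n. split; [apply X1; exists n; reflexivity|].
      apply X2. intros y [m Hm]. subst. apply M3. }
  destruct (nest (fun n => fst (sq n)) w Hw) as [x Hx].
  { intros n. apply (HN n). }
  { intros n. destruct (HN n) as [_ [N1 _]]. rewrite (Hw2 n). lra. }
  destruct (nest (fun n => snd (sq n)) h Hh) as [y Hy].
  { intros n. apply (HN n). }
  { intros n. destruct (HN n) as [_ [_ N1]]. rewrite (Hh2 n). lra. }
  assert (HWH : 0 < (W + H) ^ 2) by (apply pow_lt; unfold W, H; lra).
  (* With this tolerance the local bound at stage [N] is [K * (/4)^N / 2], half of what [Good]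
     guarantees. *)
  destruct (loc x y (K / (2 * (W + H)^2))) as [del [D1 D2]].
  { specialize (Hx O). unfold w in Hx. simpl in Hx. unfold W in Hx. lra. }
  { specialize (Hy O). unfold h in Hy. simpl in Hy. unfold H in Hy. lra. }
  { apply Rdiv_lt_0_compat; lra. }
  destruct (pow_lt_1_zero (/2)) with (y := del / (W + H)) as [N HNN].
  { rewrite Rabs_pos_eq; lra. }
  { apply Rdiv_lt_0_compat; unfold W, H; lra. }
  specialize (HNN N (le_n _)). rewrite Rabs_pos_eq in HNN by (apply pow_le; lra).
  assert (P2 : 0 < (/2)^N) by (apply pow_lt; lra).
  assert (HNN2 : (W + H) * (/2)^N < del).
  { apply Rmult_lt_reg_r with (/ (W + H)); [apply Rinv_0_lt_compat; unfold W, H; lra|].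
    replace ((W + H) * (/2)^N * / (W + H)) with ((/2)^N) by (field; unfold W, H; lra). exact HNN. }
  assert (WN := Hw N). assert (HhN := Hh N).
  assert (EWH : w N + h N = (W + H) * (/2)^N) by (unfold w, h; ring).
  destruct (HG N) as [G1 [G2 [G3 [G4 G5]]]].
  specialize (D2 (fst (sq N)) (fst (sq N) + w N) (snd (sq N)) (snd (sq N) + h N)).
  specialize (Hx N). specialize (Hy N).
  assert (D3 := D2 ltac:(lra) ltac:(lra) ltac:(lra) ltac:(lra) ltac:(lra) ltac:(lra)).
  replace (fst (sq N) + w N - fst (sq N) + (snd (sq N) + h N - snd (sq N))) with (w N + h N) in D3 by ring.
  rewrite EWH, Rpow_mult_distr in D3.
  assert (E4 : ((/2)^N)^2 = (/4)^N).
  { rewrite <- pow_mult, Nat.mul_comm, pow_mult. f_equal. simpl. field. }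
  rewrite E4 in D3.
  replace (K / (2 * (W + H)^2) * ((W + H)^2 * (/4)^N)) with (K * (/4)^N / 2) in D3 by (field; unfold W, H; lra).
  assert (0 < K * (/4)^N) by (apply Rmult_lt_0_compat; [lra|apply pow_lt; lra]). lra.
Qed.

(** * Goursat's theorem for polar rectangles *)

Lemma cis_lip (y p : R) : Cmod (cis p - cis y) <= 2 * Rabs (p - y).
Proof.
  assert (E : forall u, cis u = cexp (0, u)).
  { intros. unfold cis, cexp, Cexp. simpl. rewrite exp_0. f_equal; ring. }
  rewrite !E. set (h := (0, p - y) : C).
  replace ((0, p) : C) with (((0, y) : C) + h)%C by (unfold h, Cplus; simpl; f_equal; ring).
  replace (Rabs (p - y)) with (Cmod h).
  - rewrite <- (Rmult_1_r 2) at 1. apply (Cder_mvt cexp cexp).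
    + intros. apply Cder_cexp.
    + intros. rewrite Cmod_cexp. simpl. right. rewrite <- exp_0. f_equal. unfold h; simpl. ring.
  - unfold h, Cmod; simpl. rewrite <- (sqrt_Rsqr_abs (p - y)). f_equal. unfold Rsqr. ring.
Qed.

(** The integral of [g z dz / (z - c)] along the boundary of the polar rectangle with radii in
    [[a,b]] and angles in [[p,q]]: there [dz / (z - c)] is [dt / t] on the rays and [i dy] on the
    arcs. *)
Definition polar_form (g : C -> C) (c : C) (a b p q : R) : C :=
  (CI (fun t => RtoC (/ t) * (g (c + RtoC t * cis p)%C - g (c + RtoC t * cis q)%C))%C a b
   + Ci * CI (fun y => g (c + RtoC b * cis y)%C - g (c + RtoC a * cis y)%C)%C p q)%C.

Lemma Cmod_sub_c (c u : C) : Cmod (c + u - c) = Cmod u.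
Proof. f_equal. ring. Qed.

Section Annulus.
Variables (c : C) (s r : R).
Hypotheses (Hs : 0 < s) (Hsr : s <= r).

Definition ann_cont (g : C -> C) : Prop := forall z, s <= Cmod (z - c) <= r -> Ccont g z.

Lemma ann_rad g p q a b : ann_cont g -> s <= a -> b <= r ->
  cont_on (fun t => RtoC (/ t) * (g (c + RtoC t * cis p)%C - g (c + RtoC t * cis q)%C))%C a b.
Proof.
  intros Hg Ha Hb t Ht. apply Rcont_mult.
  - apply Rcont_RtoC. apply (continuous_Rinv t). lra.
  - apply Rcont_minus.
    + apply (Rcont_curve g (fun t => c + RtoC t * cis p)%C); [apply Rcont_ray|].
      apply Hg. rewrite Cmod_sub_c, Cmod_Rcis; lra.
    + apply (Rcont_curve g (fun t => c + RtoC t * cis q)%C); [apply Rcont_ray|].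
      apply Hg. rewrite Cmod_sub_c, Cmod_Rcis; lra.
Qed.

Lemma ann_circ1 g a p q : ann_cont g -> s <= a <= r ->
  cont_on (fun y => g (c + RtoC a * cis y)%C) p q.
Proof.
  intros Hg Ha t Ht. apply (Rcont_curve g (fun y => c + RtoC a * cis y)%C); [apply Rcont_circle|].
  apply Hg. rewrite Cmod_sub_c, Cmod_Rcis; lra.
Qed.

Lemma ann_circ g a b p q : ann_cont g -> s <= a <= r -> s <= b <= r ->
  cont_on (fun y => g (c + RtoC b * cis y)%C - g (c + RtoC a * cis y)%C)%C p q.
Proof.
  intros Hg Ha Hb t Ht. apply Rcont_minus; apply (ann_circ1 g) with (p := p) (q := q); auto.
Qed.

Lemma polar_form_addx g : ann_cont g -> forall a m b p q, s <= a -> a <= m -> m <= b -> b <= r ->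
  p <= q -> polar_form g c a b p q = (polar_form g c a m p q + polar_form g c m b p q)%C.
Proof.
  intros Hg a m b p q H1 H2 H3 H4 H5. unfold polar_form.
  rewrite (CI_Chasles _ a m b) by (try lra; apply ann_rad; auto; lra).
  rewrite !CI_minus; try apply ann_circ1; auto; try lra. ring.
Qed.

Lemma polar_form_addy g : ann_cont g -> forall a b p m q, s <= a -> a <= b -> b <= r ->
  p <= m -> m <= q -> polar_form g c a b p q = (polar_form g c a b p m + polar_form g c a b m q)%C.
Proof.
  intros Hg a b p m q H1 H2 H3 H4 H5. unfold polar_form.
  rewrite (CI_Chasles _ p m q) by (try lra; apply ann_circ; auto; lra).
  rewrite (CI_ext (fun t => RtoC (/ t) * (g (c + RtoC t * cis p)%C - g (c + RtoC t * cis q)%C))%C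
     (fun t => RtoC (/ t) * (g (c + RtoC t * cis p)%C - g (c + RtoC t * cis m)%C)
       + RtoC (/ t) * (g (c + RtoC t * cis m)%C - g (c + RtoC t * cis q)%C))%C)
     by (auto; intros; ring).
  rewrite CI_plus by (try lra; apply ann_rad; auto; lra). ring.
Qed.

(** For constants the opposite sides cancel; for [l * (z - c)] the integrand is the exact form
    [l dz]. *)
Lemma polar_form_linear (k l : C) a b p q : s <= a -> a <= b -> p <= q ->
  polar_form (fun z => k + l * (z - c))%C c a b p q = 0.
Proof.
  intros H1 H2 H3. unfold polar_form.
  rewrite (CI_ext _ (fun _ => l * (cis p - cis q))%C).
  2: lra.
  2:{ intros t Ht. rewrite RtoC_inv by lra. field. intros E. apply RtoC_inj in E. lra. }
  rewrite (CI_ext (fun y => (k + l * (c + RtoC b * cis y - c)) - (k + l * (c + RtoC a * cis y - c)))%C (fun y => l * RtoC (b - a) * cis y)%C).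
  2: lra.
  2:{ intros t Ht. rewrite RtoC_minus. ring. }
  rewrite CI_const, CI_scal by (try lra; intros t _; apply Rcont_cis).
  assert (E : CI cis p q = (sin q - sin p, cos p - cos q)).
  { unfold CI, cis; simpl. f_equal; apply is_RInt_unique.
    - apply (is_RInt_derive (V := R_CompleteNormedModule) sin cos).
      + intros x _. auto_derive; auto. ring.
      + intros x _. apply continuity_pt_filterlim, continuity_cos.
    - evar_last. { apply (is_RInt_derive (V := R_CompleteNormedModule) (fun x => - cos x) sin).
      + intros x _. auto_derive; auto. ring.
      + intros x _. apply continuity_pt_filterlim, continuity_sin. }
      unfold minus, plus, opp; simpl. ring. }
  rewrite E. unfold cis, Ci, Cmult, Cplus, Cminus, Copp, RtoC. simpl. f_equal; ring.
Qed.

Lemma polar_form_plus f g a b p q : ann_cont f -> ann_cont g -> s <= a -> a <= b -> b <= r -> p <= q ->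
  polar_form (fun z => f z + g z)%C c a b p q = (polar_form f c a b p q + polar_form g c a b p q)%C.
Proof.
  intros Hf Hg H1 H2 H3 H4. unfold polar_form.
  rewrite (CI_ext _ (fun t => RtoC (/ t) * (f (c + RtoC t * cis p)%C - f (c + RtoC t * cis q)%C)
     + RtoC (/ t) * (g (c + RtoC t * cis p)%C - g (c + RtoC t * cis q)%C))%C) by (auto; intros; ring).
  rewrite (CI_ext (fun y => f _ + g _ - _)%C (fun y => (f (c + RtoC b * cis y)%C - f (c + RtoC a * cis y)%C)
     + (g (c + RtoC b * cis y)%C - g (c + RtoC a * cis y)%C))%C) by (auto; intros; ring).
  rewrite !CI_plus; [ring|..];
    lazymatch goal with
    | |- _ <= _ => lra
    | |- cont_on (fun t => RtoC (/ t) * _)%C _ _ => apply ann_rad; auto; lra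
    | |- _ => apply ann_circ; auto; lra
    end.
Qed.

Lemma polar_form_bound g a b p q M : ann_cont g -> s <= a -> a <= b -> b <= r -> p <= q ->
  (forall t y, a <= t <= b -> p <= y <= q -> Cmod (g (c + RtoC t * cis y)%C) <= M) ->
  Cmod (polar_form g c a b p q) <= 4 * M * (/ s * (b - a) + (q - p)).
Proof.
  intros Hg H1 H2 H3 H4 HM. unfold polar_form.
  assert (HM0 : 0 <= M) by (eapply Rle_trans; [apply Cmod_ge_0|apply (HM a p); lra]).
  assert (HM2 : forall t y t' y', a <= t <= b -> p <= y <= q -> a <= t' <= b -> p <= y' <= q ->
     Cmod (g (c + RtoC t * cis y)%C - g (c + RtoC t' * cis y')%C) <= 2 * M).
  { intros. eapply Rle_trans; [apply Cmod_tri_sub|].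
    assert (A := HM t y). assert (B := HM t' y'). lra. }
  eapply Rle_trans; [apply Cmod_triangle|]. rewrite Cmod_mult, Cmod_Ci.
  assert (A : Cmod (CI (fun t => RtoC (/ t) * (g (c + RtoC t * cis p)%C - g (c + RtoC t * cis q)%C))%C a b)
     <= 2 * (/ s * (2 * M)) * (b - a)).
  { apply CI_bound; auto. apply ann_rad; auto; lra.
    intros t Ht. rewrite Cmod_mult, Cmod_R, Rabs_pos_eq by (left; apply Rinv_0_lt_compat; lra).
    apply Rmult_le_compat; [left; apply Rinv_0_lt_compat; lra|apply Cmod_ge_0| |apply HM2; lra].
    apply Rinv_le_contravar; lra. }
  assert (B : Cmod (CI (fun y => g (c + RtoC b * cis y)%C - g (c + RtoC a * cis y)%C)%C p q)
     <= 2 * (2 * M) * (q - p)).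
  { apply CI_bound; auto. apply ann_circ; auto; lra. intros t Ht. apply HM2; lra. }
  lra.
Qed.

Lemma polar_goursat g : s < r -> (forall z, s <= Cmod (z - c) <= r -> Cdiff g z) ->
  polar_form g c s r 0 (2 * PI) = 0.
Proof.
  intros Hlt Hd. assert (Hg : ann_cont g) by (intros z Hz; apply Cdiff_Ccont, Hd, Hz).
  assert (HPI := PI_RGT_0).
  apply (rect_null (polar_form g c)); try lra.
  - intros. apply polar_form_addx; auto.
  - intros. apply polar_form_addy; auto.
  - intros x y eps Hx Hy He. set (z0 := (c + RtoC x * cis y)%C).
    assert (Hz0 : s <= Cmod (z0 - c) <= r) by (unfold z0; rewrite Cmod_sub_c, Cmod_Rcis; lra).
    destruct (Hd z0 Hz0) as [l Hl].
    (* [N] absorbs the factor [4 (/ s + 1)] of [polar_form_bound] and the factor [2 r + 1] relating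
       polar to Euclidean distance. *)
    set (N := 4 * (2 * r + 1) * (/ s + 1)).
    assert (Hs1 : 0 < / s) by (apply Rinv_0_lt_compat; lra).
    assert (HN : 0 < N) by (unfold N; repeat apply Rmult_lt_0_compat; lra).
    destruct (Hl (eps / N)) as [d [D1 D2]]; [apply Rdiv_lt_0_compat; lra|].
    exists (d / (2 * (2 * r + 1))). split; [apply Rdiv_lt_0_compat; lra|].
    intros a b p q Ha Hb Hp Hq Hab Hpq.
    (* [g] minus its tangent at [z0], written as a constant plus a multiple of [z - c] so that
       [polar_form_linear] disposes of the tangent. *)
    set (g2 := fun z => (g z + (- (g z0) + - l * (z0 - c) * (-1) + - l * (z - c)))%C).
    assert (Hg2 : ann_cont g2).
    { intros z Hz. unfold g2. apply Ccont_plus; [apply Hg, Hz|].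
      apply Ccont_plus; [apply Ccont_const|]. apply Ccont_mult; [apply Ccont_const|].
      apply (Ccont_plus (fun w => w) (fun _ => (- c)%C)); [apply Ccont_id|apply Ccont_const]. }
    assert (E : polar_form g c a b p q = polar_form g2 c a b p q).
    { unfold g2. rewrite (polar_form_plus g (fun z => (- g z0 + - l * (z0 - c) * (-1) + - l * (z - c)))%C); auto; try lra.
      - rewrite polar_form_linear by lra. ring.
      - intros z _. apply Ccont_plus; [apply Ccont_const|]. apply Ccont_mult; [apply Ccont_const|].
        apply (Ccont_plus (fun w => w) (fun _ => (- c)%C)); [apply Ccont_id|apply Ccont_const]. }
    rewrite E. set (dm := (2 * r + 1) * ((b - a) + (q - p))).
    assert (Hdm : forall t u, a <= t <= b -> p <= u <= q -> Cmod (c + RtoC t * cis u - z0) <= dm).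
    { intros t u Ht Hu. unfold z0.
      replace (c + RtoC t * cis u - (c + RtoC x * cis y))%C
        with (RtoC (t - x) * cis u + RtoC x * (cis u - cis y))%C by (rewrite RtoC_minus; ring).
      eapply Rle_trans; [apply Cmod_triangle|]. rewrite !Cmod_mult, Cmod_cis, !Cmod_R.
      rewrite (Rabs_pos_eq x) by lra.
      assert (L1 : Rabs (t - x) <= b - a) by (apply Rabs_le; lra).
      assert (L2 : Rabs (u - y) <= q - p) by (apply Rabs_le; lra).
      assert (L3 := cis_lip y u).
      assert (x * Cmod (cis u - cis y) <= r * (2 * (q - p)))
        by (apply Rmult_le_compat; try apply Cmod_ge_0; lra).
      unfold dm. assert (0 <= r * (b - a)) by (apply Rmult_le_pos; lra).
      assert (0 <= r * (q - p)) by (apply Rmult_le_pos; lra). lra. }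
    assert (Hdmd : dm < d).
    { unfold dm. assert (b - a + (q - p) < d / (2 * r + 1)).
      { replace (d / (2*r+1)) with (d / (2 * (2 * r + 1)) + d / (2 * (2 * r + 1))) by (field; lra). lra. }
      apply Rmult_lt_reg_r with (/ (2 * r + 1)); [apply Rinv_0_lt_compat; lra|].
      replace ((2 * r + 1) * (b - a + (q - p)) * / (2 * r + 1)) with (b - a + (q - p)) by (field; lra).
      exact H. }
    eapply Rle_trans.
    { apply (polar_form_bound g2 a b p q (eps / N * dm)); auto; try lra.
      intros t u Ht Hu. specialize (Hdm t u Ht Hu).
      set (z := (c + RtoC t * cis u)%C) in *.
      specialize (D2 (z - z0)%C ltac:(lra)). replace (z0 + (z - z0))%C with z in D2 by ring.
      unfold g2. replace (g z + (- g z0 + - l * (z0 - c) * -1 + - l * (z - c)))%C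
        with (g z - g z0 - l * (z - z0))%C by ring.
      eapply Rle_trans; [exact D2|]. apply Rmult_le_compat_l; [left; apply Rdiv_lt_0_compat; lra|exact Hdm]. }
    assert (X : / s * (b - a) + (q - p) <= (/ s + 1) * ((b - a) + (q - p))).
    { assert (0 <= / s * (q - p)) by (apply Rmult_le_pos; lra). lra. }
    assert (0 <= eps / N * dm).
    { apply Rmult_le_pos; [left; apply Rdiv_lt_0_compat; lra|]. unfold dm. apply Rmult_le_pos; lra. }
    eapply Rle_trans; [apply Rmult_le_compat_l; [lra|exact X]|].
    right. unfold dm, N. field. lra.
Qed.
End Annulus.

(* The radial sides of the polar rectangle cancel by periodicity. *)
Lemma circle_indep (g : C -> C) (c : C) (s r : R) : 0 < s -> s <= r ->
  (forall z, s <= Cmod (z - c) <= r -> Cdiff g z) ->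
  CI (fun y => g (c + RtoC s * cis y)%C) 0 (2 * PI) = CI (fun y => g (c + RtoC r * cis y)%C) 0 (2 * PI).
Proof.
  intros Hs Hsr Hd. destruct (Req_dec s r) as [E|E]; [subst; auto|].
  assert (HPI := PI_RGT_0).
  assert (Hg : ann_cont c s r g) by (intros z Hz; apply Cdiff_Ccont, Hd, Hz).
  assert (H := polar_goursat c s r Hs Hsr g ltac:(lra) Hd). unfold polar_form in H.
  rewrite CI_minus in H; try lra; try (apply (ann_circ1 c s r Hs g); auto; lra).
  rewrite (CI_ext _ (fun _ => 0%C)) in H; try lra.
  2:{ intros t _. rewrite cis_2PI. ring. }
  rewrite CI_const in H.
  set (A := CI (fun y => g (c + RtoC s * cis y)%C) 0 (2 * PI)) in *.
  set (B := CI (fun y => g (c + RtoC r * cis y)%C) 0 (2 * PI)) in *.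
  apply Csub_0_eq. replace (A - B)%C with (Ci * (RtoC (r - s) * 0 + Ci * (B - A)))%C.
  - rewrite H. ring.
  - transitivity ((Ci * Ci) * (B - A))%C; [ring|].
    replace (Ci * Ci)%C with (RtoC (-1)) by (unfold Ci, Cmult, RtoC; simpl; f_equal; ring). ring.
Qed.

(** By [circle_indep] the radius may shrink to 0, where continuity at [c] gives the value. The
    differentiability hypothesis leaves out the centre so that the lemma applies to difference
    quotients extended continuously to [c]. *)
Lemma circle_mean (g : C -> C) (c : C) (r : R) : 0 < r ->
  (forall z, 0 < Cmod (z - c) <= r -> Cdiff g z) -> Ccont g c ->
  CI (fun y => g (c + RtoC r * cis y)%C) 0 (2 * PI) = (RtoC (2 * PI) * g c)%C.
Proof.
  intros Hr Hd Hc. assert (HPI := PI_RGT_0).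
  assert (Hcr : forall s, 0 < s <= r -> cont_on (fun y => g (c + RtoC s * cis y)%C) 0 (2 * PI)).
  { intros s Hs. apply (ann_circ1 c s r (proj1 Hs) g); [|lra].
    intros z Hz. apply Cdiff_Ccont, Hd. lra. }
  apply Csub_0_eq. apply Cmod_eq_0. apply Rle_antisym; [|apply Cmod_ge_0].
  apply le_epsilon. intros eps He.
  destruct (Hc (eps / (4 * PI))) as [d [D1 D2]]; [apply Rdiv_lt_0_compat; lra|].
  set (s := Rmin (d/2) r). assert (Hs : 0 < s <= r).
  { unfold s. split; [apply Rmin_pos; lra|apply Rmin_r]. }
  rewrite <- (circle_indep g c s r); try lra; [|intros; apply Hd; lra].
  rewrite <- (Rminus_0_r (2 * PI)) at 2. rewrite <- CI_const.
  rewrite <- CI_minus by (auto; try lra; intros t _; apply Rcont_const).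
  replace (0 + eps) with (2 * (eps / (4 * PI)) * (2 * PI - 0)) by (field; lra).
  apply CI_bound; try lra.
  - intros t Ht. apply Rcont_minus; [apply Hcr; auto|apply Rcont_const].
  - intros t _. left. apply D2. rewrite Cmod_sub_c, Cmod_Rcis by lra.
    unfold s. eapply Rle_lt_trans; [apply Rmin_l|]. lra.
Qed.

(** * Maximum principle and Schwarz's lemma *)

Definition Rcont_at (phi : C -> R) (z : C) : Prop :=
  forall eps, 0 < eps -> exists del, 0 < del /\
    forall w, Cmod (w - z) < del -> Rabs (phi w - phi z) < eps.

(** Clamping the radius extends a function given on a closed annulus to all polar coordinates
    without losing continuity; the compactness lemmas on rectangles ask for two-sided continuity at
    the boundary radii too. *)
Definition clamp (s r t : R) : R := Rmax s (Rmin t r).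

Lemma clamp_in s r t : s <= r -> s <= clamp s r t <= r.
Proof.
  intros H. unfold clamp, Rmax, Rmin. destruct (Rle_dec t r); destruct (Rle_dec s _); lra.
Qed.

Lemma clamp_id s r t : s <= t <= r -> clamp s r t = t.
Proof. intros H. unfold clamp. rewrite Rmin_left, Rmax_right; lra. Qed.

Lemma clamp_lip s r t u : Rabs (clamp s r t - clamp s r u) <= Rabs (t - u).
Proof.
  unfold clamp, Rmax, Rmin.
  destruct (Rle_dec t r); destruct (Rle_dec u r); repeat destruct (Rle_dec s _);
    unfold Rabs; repeat destruct (Rcase_abs _); lra.
Qed.

Lemma polar_cont (phi : C -> R) (c : C) (s r : R) : 0 <= s -> s <= r ->
  (forall z, s <= Cmod (z - c) <= r -> Rcont_at phi z) ->
  forall t y, continuity_2d_pt (fun t y => phi (c + RtoC (clamp s r t) * cis y)%C) t y.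
Proof.
  intros Hs Hsr Hc t y eps.
  assert (Hz := clamp_in s r t Hsr).
  destruct (Hc (c + RtoC (clamp s r t) * cis y)%C) with (eps := pos eps) as [d [D1 D2]].
  { rewrite Cmod_sub_c, Cmod_Rcis; lra. } { apply cond_pos. }
  assert (Hd : 0 < d / (1 + 2 * r + 1)) by (apply Rdiv_lt_0_compat; lra).
  exists (mkposreal _ Hd). simpl. intros u v Hu Hv. apply D2.
  replace (c + RtoC (clamp s r u) * cis v - (c + RtoC (clamp s r t) * cis y))%C
    with (RtoC (clamp s r u - clamp s r t) * cis v + RtoC (clamp s r t) * (cis v - cis y))%C
    by (rewrite RtoC_minus; ring).
  eapply Rle_lt_trans; [apply Cmod_triangle|]. rewrite !Cmod_mult, Cmod_cis, !Cmod_R.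
  rewrite (Rabs_pos_eq (clamp s r t)) by lra.
  assert (A := clamp_lip s r u t). assert (B := cis_lip y v).
  assert (clamp s r t * Cmod (cis v - cis y) <= r * (2 * Rabs (v - y)))
    by (apply Rmult_le_compat; try apply Cmod_ge_0; lra).
  assert (r * Rabs (v - y) <= r * (d / (1 + 2*r + 1))) by (apply Rmult_le_compat_l; lra).
  replace d with (d / (1 + 2*r + 1) * (1 + 2 * r + 1)) by (field; lra). lra.
Qed.

(** The maximum is taken in two stages, first over the angle and then over the radius; continuity in
    the radius, uniform in the angle, makes the first maximum continuous. *)
Lemma polar_max (phi : C -> R) (c : C) (s r : R) : 0 <= s -> s <= r ->
  (forall z, s <= Cmod (z - c) <= r -> Rcont_at phi z) ->
  exists p, s <= Cmod (p - c) <= r /\ forall z, s <= Cmod (z - c) <= r -> phi z <= phi p.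
Proof.
  intros Hs Hsr Hc. assert (HPI := PI_RGT_0).
  set (F := fun t y => phi (c + RtoC (clamp s r t) * cis y)%C).
  assert (HF := polar_cont phi c s r Hs Hsr Hc). fold F in HF.
  assert (H1 : forall t, exists y, (forall y', 0 <= y' <= 2 * PI -> F t y' <= F t y) /\ 0 <= y <= 2 * PI).
  { intros t. apply continuity_ab_maj; [lra|]. intros y _. apply continuity_pt_filterlim, filterlim_locally.
    intros eps. destruct (HF t y eps) as [d Hd]. exists d. intros v Hv.
    apply (Hd t v); [rewrite Rminus_eq_0, Rabs_R0; apply cond_pos|exact Hv]. }
  set (ys := fun t => epsilon (inhabits 0) (fun y => (forall y', 0 <= y' <= 2 * PI -> F t y' <= F t y) /\ 0 <= y <= 2 * PI)).
  assert (Hys : forall t, (forall y', 0 <= y' <= 2 * PI -> F t y' <= F t (ys t)) /\ 0 <= ys t <= 2 * PI)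
    by (intros t; apply (epsilon_spec (inhabits 0) _ (H1 t))).
  destruct (continuity_ab_maj (fun t => F t (ys t)) s r Hsr) as [tm [M1 M2]].
  { intros t0 _. apply continuity_pt_filterlim, filterlim_locally. intros eps.
    destruct (uniform_continuity_2d_1d' F 0 (2 * PI) t0 (fun x _ => HF t0 x) eps) as [d Hd].
    exists d. intros t Ht. assert (Ht' : Rabs (t - t0) < d) by exact Ht.
    apply Rabs_def2 in Ht'. destruct (Hys t) as [A1 A2], (Hys t0) as [B1 B2].
    assert (K : forall y, 0 <= y <= 2 * PI -> Rabs (F t y - F t0 y) < eps).
    { intros y Hy. pose proof (cond_pos d). apply Hd; try lra. rewrite Rminus_eq_0, Rabs_R0; lra. }
    specialize (A1 _ B2). specialize (B1 _ A2).
    assert (K1 := Rabs_def2 _ _ (K _ A2)). assert (K2 := Rabs_def2 _ _ (K _ B2)).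
    change (Rabs (F t (ys t) - F t0 (ys t0)) < eps). apply Rabs_def1; lra. }
  exists (c + RtoC (clamp s r tm) * cis (ys tm))%C. split.
  - assert (A := clamp_in s r tm Hsr). rewrite Cmod_sub_c, Cmod_Rcis; lra.
  - intros z Hz. destruct (polar (z - c)) as [y [Hy1 Hy2]].
    assert (E : phi z = F (Cmod (z - c)) y).
    { unfold F. rewrite clamp_id by exact Hz. f_equal. rewrite <- Hy2. ring. }
    rewrite E. eapply Rle_trans; [apply (Hys (Cmod (z - c))), Hy1|]. apply M1, Hz.
Qed.

Lemma Rcont_at_Cmod (g : C -> C) (z : C) : Ccont g z -> Rcont_at (fun w => Cmod (g w)) z.
Proof.
  intros H eps He. destruct (H eps He) as [d [D1 D2]]. exists d. split; auto. intros w Hw.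
  eapply Rle_lt_trans; [|apply D2, Hw].
  assert (A := Cmod_tri_inv (g w) (g z)). assert (B := Cmod_tri_inv (g z) (g w)).
  rewrite (Cmod_sub_sym (g z)) in B. apply Rabs_le. lra.
Qed.

Lemma Rcont_at_fst (g : C -> C) (z : C) : Ccont g z -> Rcont_at (fun w => fst (g w)) z.
Proof.
  intros H eps He. destruct (H eps He) as [d [D1 D2]]. exists d. split; auto. intros w Hw.
  eapply Rle_lt_trans; [|apply D2, Hw]. apply (fst_le_Cmod (g w - g z)%C).
Qed.
Lemma Rcont_at_snd (g : C -> C) (z : C) : Ccont g z -> Rcont_at (fun w => snd (g w)) z.
Proof.
  intros H eps He. destruct (H eps He) as [d [D1 D2]]. exists d. split; auto. intros w Hw.
  eapply Rle_lt_trans; [|apply D2, Hw]. apply (snd_le_Cmod (g w - g z)%C).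
Qed.

Lemma Rcont_at_plus (f g : C -> R) (z : C) : Rcont_at f z -> Rcont_at g z -> Rcont_at (fun w => f w + g w) z.
Proof.
  intros Hf Hg eps He.
  destruct (Hf (eps/2)) as [d1 [D1 H1]]; [lra|].
  destruct (Hg (eps/2)) as [d2 [D2 H2]]; [lra|].
  exists (Rmin d1 d2). split; [apply Rmin_pos; lra|]. intros w Hw.
  specialize (H1 w (Rlt_le_trans _ _ _ Hw (Rmin_l _ _))).
  specialize (H2 w (Rlt_le_trans _ _ _ Hw (Rmin_r _ _))).
  replace (f w + g w - (f z + g z)) with ((f w - f z) + (g w - g z)) by ring.
  eapply Rle_lt_trans; [apply Rabs_triang|lra].
Qed.

(* The term [eps |z|^2] makes [|psi|^2] strictly subharmonic, so that it has no interior maximum. *)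
Lemma max_principle (psi : C -> C) (c : C) (s r M : R) : 0 < r -> s <= r -> 0 <= M ->
  (forall z, s <= Cmod (z - c) <= r -> Ccont psi z) ->
  (forall z, s < Cmod (z - c) < r -> exists rho, 0 < rho /\
     forall w, 0 < Cmod (w - z) < rho -> Cdiff psi w) ->
  (forall z, Cmod (z - c) = s \/ Cmod (z - c) = r -> Cmod (psi z) <= M) ->
  forall z, s <= Cmod (z - c) <= r -> Cmod (psi z) <= M.
Proof.
  intros Hr Hsr HM Hc Hd Hb z1 Hz1. apply Rnot_lt_le. intros Hlt.
  set (B := (Cmod c + r) ^ 2 + 1).
  assert (HB : 1 <= B) by (unfold B; pose proof (pow2_ge_0 (Cmod c + r)); lra).
  assert (HBz : forall z, s <= Cmod (z - c) <= r -> Cmod z * Cmod z <= B - 1).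
  { intros z Hz. unfold B. assert (Cmod z <= Cmod c + r).
    { pose proof (Cmod_tri_inv z c). lra. }
    pose proof (Cmod_ge_0 z). nra. }
  set (K := Cmod (psi z1) * Cmod (psi z1) - M * M).
  assert (HK : 0 < K) by (unfold K; nra).
  set (eps := K / (2 * B)). assert (He : 0 < eps) by (apply Rdiv_lt_0_compat; lra).
  assert (HeB : eps * B = K / 2) by (unfold eps; field; lra).
  set (phi := fun z => Cmod (psi z * psi z) + Cmod (RtoC eps * (z * z))).
  assert (Ephi : forall z, phi z = Cmod (psi z) * Cmod (psi z) + eps * (Cmod z * Cmod z)).
  { intros z. unfold phi. rewrite !Cmod_mult, Cmod_R, Rabs_pos_eq by lra. ring. }
  assert (HL : forall z, Rmax 0 s <= Cmod (z - c) <= r -> s <= Cmod (z - c) <= r).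
  { intros z [A1 A2]. split; auto. eapply Rle_trans; [apply Rmax_r|exact A1]. }
  (* A negative [s] turns the annulus into the full disc; the later applications with [s = -1] rely
     on this. *)
  destruct (polar_max phi c (Rmax 0 s) r) as [p [P1 P2]].
  { apply Rmax_l. } { apply Rmax_lub; lra. }
  { intros z Hz. apply Rcont_at_plus.
    - apply (Rcont_at_Cmod (fun z => psi z * psi z)%C). apply Ccont_mult; apply Hc; auto.
    - apply (Rcont_at_Cmod (fun z => RtoC eps * (z * z))%C).
      apply Ccont_mult; [apply Ccont_const|]. apply (Ccont_mult (fun z => z) (fun z => z)); apply Ccont_id. }
  assert (P3 : phi z1 <= phi p).
  { apply P2. split; [|lra]. apply Rmax_lub; [apply Cmod_ge_0|lra]. }
  apply HL in P1. rewrite !Ephi in P3.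
  assert (Hnn : 0 <= eps * (Cmod z1 * Cmod z1)).
  { apply Rmult_le_pos; [lra|]. apply Rmult_le_pos; apply Cmod_ge_0. }
  assert (Hbp : eps * (Cmod p * Cmod p) <= eps * B).
  { apply Rmult_le_compat_l; [lra|]. specialize (HBz p P1). lra. }
  destruct (Rle_lt_dec (Cmod (psi p)) M) as [L|L].
  { assert (Cmod (psi p) * Cmod (psi p) <= M * M) by (pose proof (Cmod_ge_0 (psi p)); nra).
    unfold K in *. lra. }
  assert (HI : s < Cmod (p - c) < r).
  { split.
    - destruct (Rle_lt_or_eq_dec _ _ (proj1 P1)) as [|E]; auto. exfalso.
      specialize (Hb p (or_introl (eq_sym E))). lra.
    - destruct (Rle_lt_or_eq_dec _ _ (proj2 P1)) as [|E]; auto. exfalso.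
      specialize (Hb p (or_intror E)). lra. }
  destruct (Hd p HI) as [rho [R1 R2]].
  set (d := Rmin (rho/2) (Rmin ((Cmod (p-c) - s)/2) ((r - Cmod (p - c))/2))).
  assert (Hdd : 0 < d) by (unfold d; repeat apply Rmin_pos; lra).
  assert (Hd1 : d <= rho / 2) by apply Rmin_l.
  assert (Hd2 : d <= (Cmod (p-c) - s)/2) by (eapply Rle_trans; [apply Rmin_r|apply Rmin_l]).
  assert (Hd3 : d <= (r - Cmod (p-c))/2) by (eapply Rle_trans; [apply Rmin_r|apply Rmin_r]).
  (* [phi z - phi p] equals twice the real part of [G z] plus [|psi z - psi p|^2 + eps |z - p|^2].
     At a maximum [p] the real part of [G] is therefore negative on the whole circle, against its
     mean value [G p = 0]. *)
  set (G := fun z => (Cconj (psi p) * (psi z - psi p) + RtoC eps * Cconj p * (z - p))%C).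
  assert (HGc : forall z, Cmod (z - p) <= d -> Ccont G z).
  { intros z Hz. unfold G. apply (Ccont_plus (fun z => Cconj (psi p) * (psi z - psi p))%C (fun z => RtoC eps * Cconj p * (z - p))%C).
    - apply Ccont_mult; [apply Ccont_const|].
      apply (Ccont_plus psi (fun _ => (- psi p)%C)); [|apply Ccont_const].
      apply Hc. pose proof (Cmod_tri z p c). pose proof (Cmod_tri p z c). rewrite (Cmod_sub_sym p z) in *. lra.
    - apply Ccont_mult; [apply Ccont_const|].
      apply (Ccont_plus (fun z => z) (fun _ => (- p)%C)); [apply Ccont_id|apply Ccont_const]. }
  assert (HGm : CI (fun y => G (p + RtoC d * cis y)%C) 0 (2 * PI) = (RtoC (2 * PI) * G p)%C).
  { apply circle_mean; auto.
    - intros z Hz. unfold G. apply (Cdiff_plus (fun z => Cconj (psi p) * (psi z - psi p))%C (fun z => RtoC eps * Cconj p * (z - p))%C).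
      + apply Cdiff_mult; [apply Cdiff_const|]. apply Cdiff_minus; [|apply Cdiff_const]. apply R2. lra.
      + apply Cdiff_mult; [apply Cdiff_const|]. apply (Cdiff_minus (fun z => z)); [apply Cdiff_id|apply Cdiff_const].
    - apply HGc. replace (p - p)%C with (RtoC 0) by ring. rewrite Cmod_0. lra. }
  assert (HG0 : G p = 0) by (unfold G; ring).
  rewrite HG0, Cmult_0_r in HGm.
  assert (HG1 : RInt (fun y => fst (G (p + RtoC d * cis y)%C)) 0 (2 * PI) = 0)
    by exact (f_equal fst HGm).
  assert (HPI := PI_RGT_0).
  assert (Hcon : cont_on (fun y => G (p + RtoC d * cis y)%C) 0 (2 * PI)).
  { intros t _. apply (Rcont_curve G (fun y => p + RtoC d * cis y)%C); [apply Rcont_circle|].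
    apply HGc. rewrite Cmod_sub_c, Cmod_Rcis; lra. }
  destruct (cont_on_ex _ 0 (2 * PI) ltac:(lra) Hcon) as [E1 _].
  assert (Hle : RInt (fun y => fst (G (p + RtoC d * cis y)%C)) 0 (2 * PI) <= RInt (fun _ => - (eps * (d * d) / 2)) 0 (2 * PI)).
  { apply RInt_le; auto; [lra|apply ex_RInt_const|]. intros y _.
    set (z := (p + RtoC d * cis y)%C).
    assert (Hzp : Cmod (z - p) = d) by (unfold z; rewrite Cmod_sub_c, Cmod_Rcis; lra).
    assert (HzK : Rmax 0 s <= Cmod (z - c) <= r).
    { pose proof (Cmod_tri z p c). pose proof (Cmod_tri p z c). rewrite (Cmod_sub_sym p z) in *.
      split; [|lra]. apply Rmax_lub; [apply Cmod_ge_0|lra]. }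
    assert (A := P2 z HzK). rewrite !Ephi, !Cmod_sqr in A.
    assert (A2 : d * d = Cmod (z - p) * Cmod (z - p)) by (rewrite Hzp; ring).
    rewrite Cmod_sqr in A2. rewrite A2. unfold G. simpl.
    unfold Cconj, RtoC, Cminus, Cplus, Copp, Cmult in *. simpl in *.
    generalize dependent (fst (psi z)). generalize dependent (snd (psi z)). clearbody eps d. clear - He.
    intros u v A. pose proof (Rle_0_sqr (v - fst (psi p))). pose proof (Rle_0_sqr (u - snd (psi p))).
    unfold Rsqr in *. lra. }
  rewrite HG1, RInt_const in Hle.
  assert (Hle' : 0 <= (2 * PI - 0) * (- (eps * (d * d) / 2))) by exact Hle.
  clearbody eps d.
  assert (0 < eps * (d * d)) by (repeat apply Rmult_lt_0_compat; lra).
  assert (0 < 2 * PI * (eps * (d*d))) by (apply Rmult_lt_0_compat; lra). lra.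
Qed.

(** The difference quotient [q] at [c] is continuous there and holomorphic elsewhere, so the maximum
    principle gives [|q| <= M / r] on every disc of radius [r < R0]; then [r] tends to [R0]. *)
Lemma schwarz (phi : C -> C) (c : C) (R0 M : R) : 0 < R0 -> 0 <= M ->
  (forall z, Cmod (z - c) < R0 -> Cdiff phi z) ->
  (forall z, Cmod (z - c) < R0 -> Cmod (phi z) <= M) -> phi c = 0 ->
  forall z, Cmod (z - c) < R0 -> Cmod (phi z) <= M / R0 * Cmod (z - c).
Proof.
  intros HR HM Hd Hb H0 z Hz.
  assert (Hcc : Cmod (c - c) < R0) by (replace (c - c)%C with (RtoC 0) by ring; rewrite Cmod_0; lra).
  destruct (Hd c Hcc) as [l Hl]. apply Cder_carat in Hl. destruct Hl as [q [Q1 [Q2 Q3]]].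
  assert (Q4 : forall w, w <> c -> q w = (phi w / (w - c))%C).
  { intros w Hw. rewrite (Q3 w), H0. field. intros E. apply Hw, Csub_0_eq, E. }
  assert (Q5 : forall w, w <> c -> Cmod (w - c) < R0 -> Cdiff q w).
  { intros w Hw Hw2. apply (Cdiff_ext_loc (fun w => phi w / (w - c))%C q w (Cmod (w - c))).
    - apply Cmod_sub_pos, Hw.
    - intros u Hu. symmetry. apply Q4. intros E. subst. rewrite Cmod_sub_sym in Hu. lra.
    - apply Cdiff_div; [|apply Hd, Hw2|apply (Cdiff_minus (fun z => z)); [apply Cdiff_id|apply Cdiff_const]].
      intros E. apply Hw, Csub_0_eq, E. }
  assert (K : forall r, Cmod (z - c) < r < R0 -> Cmod (phi z) <= M / r * Cmod (z - c)).
  { intros r Hr. assert (Hr0 : 0 < r) by (pose proof (Cmod_ge_0 (z - c)); lra).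
    assert (Hq : Cmod (q z) <= M / r).
    { apply (max_principle q c (-1) r); try lra.
      - apply Rdiv_le_0_compat; lra.
      - intros w Hw. destruct (Ceq_dec w c) as [E|E]; [subst; exact Q1|].
        apply Cdiff_Ccont, Q5; auto. lra.
      - intros w Hw. destruct (Ceq_dec w c) as [E|E].
        + exists R0. split; auto. intros u Hu. subst. apply Q5; [|lra].
          intros E. subst. replace (c - c)%C with (RtoC 0) in Hu by ring. rewrite Cmod_0 in Hu. lra.
        + exists (Rmin (Cmod (w - c)) (R0 - Cmod (w - c))). split.
          * apply Rmin_pos; [apply Cmod_sub_pos, E|lra].
          * intros u Hu. assert (A1 := Rmin_l (Cmod (w - c)) (R0 - Cmod (w - c))).
            assert (A2 := Rmin_r (Cmod (w - c)) (R0 - Cmod (w - c))). apply Q5.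
            -- intros E'. subst. rewrite Cmod_sub_sym in Hu. lra.
            -- pose proof (Cmod_tri u w c). lra.
      - intros w [Hw|Hw]; [pose proof (Cmod_ge_0 (w - c)); lra|].
        assert (w <> c).
        { intros E. rewrite E in Hw. replace (c - c)%C with (RtoC 0) in Hw by ring.
          rewrite Cmod_0 in Hw. lra. }
        rewrite Q4 by auto. rewrite Cmod_div.
        + rewrite Hw. apply Rmult_le_compat_r; [left; apply Rinv_0_lt_compat; lra|]. apply Hb. lra.
        + intros E. apply H, Csub_0_eq, E.
      - pose proof (Cmod_ge_0 (z - c)). lra. }
    rewrite (Q3 z), H0. replace (0 + q z * (z - c))%C with (q z * (z - c))%C by ring.
    rewrite Cmod_mult. apply Rmult_le_compat_r; [apply Cmod_ge_0|exact Hq]. }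
  set (x := Cmod (z - c)) in *. assert (Hx : 0 <= x) by apply Cmod_ge_0.
  apply Rnot_lt_le. intros Hlt.
  assert (HA : 0 < Cmod (phi z)).
  { eapply Rle_lt_trans; [|exact Hlt]. apply Rmult_le_pos; [apply Rdiv_le_0_compat; lra|lra]. }
  set (A := Cmod (phi z)) in *.
  assert (K2 : forall r, x < r < R0 -> A * r <= M * x).
  { intros r Hr. specialize (K r Hr). apply Rmult_le_compat_r with (r := r) in K; [|lra].
    replace (M / r * x * r) with (M * x) in K by (field; lra). exact K. }
  assert (Hlt2 : M * x < A * R0).
  { apply Rmult_lt_compat_r with (r := R0) in Hlt; auto.
    replace (M / R0 * x * R0) with (M * x) in Hlt by (field; lra). exact Hlt. }
  assert (Hmx : M * x / A < R0).
  { apply Rmult_lt_reg_r with A; auto. unfold Rdiv. rewrite Rmult_assoc, Rinv_l; lra. }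
  (* A radius below [R0] but beyond [M * x / A] contradicts [K2]; this replaces the passage to the
     limit [r -> R0]. *)
  set (r := (Rmax x (M * x / A) + R0) / 2).
  assert (Hr1 : Rmax x (M * x / A) < R0) by (apply Rmax_lub_lt; auto).
  assert (Hr2 := Rmax_l x (M * x / A)). assert (Hr3 := Rmax_r x (M * x / A)).
  specialize (K2 r ltac:(unfold r; lra)).
  assert (M * x / A < r) by (unfold r; lra).
  apply Rmult_lt_compat_r with (r := A) in H; auto. unfold Rdiv in H. rewrite Rmult_assoc, Rinv_l in H; lra.
Qed.

Lemma schwarz_lip (g : C -> C) (c : C) (R0 M : R) : 0 < R0 ->
  (forall z, Cmod (z - c) < R0 -> Cdiff g z) ->
  (forall z, Cmod (z - c) < R0 -> Cmod (g z) <= M) ->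
  forall z, Cmod (z - c) < R0 -> Cmod (g z - g c) <= 2 * M / R0 * Cmod (z - c).
Proof.
  intros HR Hd Hb z Hz.
  assert (Hcc : Cmod (c - c) < R0) by (replace (c - c)%C with (RtoC 0) by ring; rewrite Cmod_0; lra).
  assert (HM : 0 <= M) by (eapply Rle_trans; [apply Cmod_ge_0|apply (Hb c Hcc)]).
  apply (schwarz (fun w => g w - g c)%C c R0 (2 * M)); auto; try lra.
  - intros w Hw. apply Cdiff_minus; [apply Hd, Hw|apply Cdiff_const].
  - intros w Hw. eapply Rle_trans; [apply Cmod_tri_sub|].
    pose proof (Hb w Hw). pose proof (Hb c Hcc). lra.
  - ring.
Qed.

(** * Jensen's formula and its first moment *)

Lemma Cmod_sub_self (c : C) : Cmod (c - c) = 0.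
Proof. replace (c - c)%C with (RtoC 0) by ring. apply Cmod_0. Qed.

Lemma ray_unif (h : C -> C) (c : C) (r m : R) : 0 <= r -> 0 < m ->
  (forall z, Cmod (z - c) <= r -> Ccont h z) ->
  exists del, 0 < del /\ forall t u y, 0 <= t <= r -> 0 <= u <= r -> 0 <= y <= 2 * PI -> Rabs (u - t) < del ->
    Cmod (h (c + RtoC u * cis y)%C - h (c + RtoC t * cis y)%C) < m.
Proof.
  intros Hr Hm Hc. assert (Hm2 : 0 < m / 2) by lra.
  assert (Hc' : forall z, 0 <= Cmod (z - c) <= r -> Ccont h z) by (intros; apply Hc; lra).
  destruct (uniform_continuity_2d (fun t y => fst (h (c + RtoC (clamp 0 r t) * cis y)%C)) 0 r 0 (2 * PI)) with (eps := mkposreal _ Hm2) as [d1 H1].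
  { intros. apply (polar_cont (fun z => fst (h z)) c 0 r); try lra. intros z Hz. apply Rcont_at_fst, Hc', Hz. }
  destruct (uniform_continuity_2d (fun t y => snd (h (c + RtoC (clamp 0 r t) * cis y)%C)) 0 r 0 (2 * PI)) with (eps := mkposreal _ Hm2) as [d2 H2].
  { intros. apply (polar_cont (fun z => snd (h z)) c 0 r); try lra. intros z Hz. apply Rcont_at_snd, Hc', Hz. }
  exists (Rmin d1 d2). split; [apply Rmin_pos; apply cond_pos|].
  intros t u y Ht Hu Hy Htu.
  assert (A1 := Rlt_le_trans _ _ _ Htu (Rmin_l _ _)). assert (A2 := Rlt_le_trans _ _ _ Htu (Rmin_r _ _)).
  specialize (H1 t y u y Ht Hy Hu Hy A1). specialize (H2 t y u y Ht Hy Hu Hy A2).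
  rewrite Rminus_eq_0, Rabs_R0 in H1, H2. rewrite !clamp_id in H1, H2 by auto.
  specialize (H1 (cond_pos d1)). specialize (H2 (cond_pos d2)). simpl in H1, H2.
  eapply Rle_lt_trans; [apply Cmod_le_sum|]. simpl. unfold Rminus in *. lra.
Qed.

(* The logarithm at z is the telescoping sum of the principal logarithms of the quotients of h at
   consecutive points of a fine subdivision of the segment [c, z]. *)
Lemma holo_log (h : C -> C) (c : C) (r : R) : 0 < r ->
  (forall z, Cmod (z - c) <= r -> Cdiff h z /\ h z <> 0) ->
  exists L : C -> C, forall z, Cmod (z - c) < r -> Cdiff L z /\ cexp (L z) = h z.
Proof.
  intros Hr Hh.
  assert (Hc : forall z, Cmod (z - c) <= r -> Ccont h z) by (intros; apply Cdiff_Ccont, Hh; auto).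
  destruct (polar_max (fun z => - Cmod (h z)) c 0 r) as [p [P1 P2]]; try lra.
  { intros z Hz eps He. destruct (Rcont_at_Cmod h z (Hc z (proj2 Hz)) eps He) as [d [D1 D2]].
    exists d. split; auto. intros w Hw. specialize (D2 w Hw).
    replace (- Cmod (h w) - - Cmod (h z)) with (- (Cmod (h w) - Cmod (h z))) by ring. rewrite Rabs_Ropp. exact D2. }
  set (m := Cmod (h p)). assert (Hm : 0 < m) by (apply Cmod_gt_0, Hh; lra).
  destruct (ray_unif h c r m) as [d [D1 D2]]; try lra. { exact Hc. }
  (* More than [r / d] steps make each step shorter than [d], so [h] changes by less than its least
     modulus [m], and consecutive quotients stay in the disc of radius 1 about 1, where [Clog] is
     valid. *)
  destruct (INR_unbounded (r / d)) as [N HN].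
  assert (HN0 : 0 < INR N) by (eapply Rle_lt_trans; [|exact HN]; apply Rdiv_le_0_compat; lra).
  assert (K : forall k, (k <= N)%nat -> exists L : C -> C, forall z, Cmod (z - c) < r ->
     Cdiff L z /\ cexp (L z) = h (c + RtoC (INR k / INR N) * (z - c))%C).
  { induction k; intros Hk.
    - destruct (cexp_surj (h c)) as [w Hw].
      { apply Hh. rewrite Cmod_sub_self. lra. }
      exists (fun _ => w). intros z Hz. split; [apply Cdiff_const|]. rewrite Hw. f_equal.
      simpl. unfold Rdiv. rewrite Rmult_0_l. ring.
    - destruct IHk as [L HL]; [lia|].
      set (Pk := fun j z => (c + RtoC (INR j / INR N) * (z - c))%C).
      assert (HP : forall j z, (j <= N)%nat -> Cmod (z - c) < r -> Cmod (Pk j z - c) <= r).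
      { intros j z Hj Hz. unfold Pk. rewrite Cmod_sub_c, Cmod_mult, Cmod_R.
        assert (0 <= INR j / INR N <= 1).
        { split; [apply Rdiv_le_0_compat; auto; apply pos_INR|].
          apply Rmult_le_reg_r with (INR N); auto. unfold Rdiv. rewrite Rmult_assoc, Rinv_l by lra.
          apply le_INR in Hj. lra. }
        rewrite Rabs_pos_eq by lra. pose proof (Cmod_ge_0 (z - c)). nra. }
      assert (HPd : forall j z, (j <= N)%nat -> Cmod (z - c) < r -> Cdiff (fun z => h (Pk j z)) z).
      { intros j z Hj Hz. apply (Cdiff_comp h (Pk j)); [|apply Hh, HP; auto].
        unfold Pk. apply Cdiff_plus; [apply Cdiff_const|].
        apply Cdiff_mult; [apply Cdiff_const|]. apply (Cdiff_minus (fun z => z)); [apply Cdiff_id|apply Cdiff_const]. }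
      assert (Hpos : forall z, Cmod (z - c) < r -> 0 < fst (h (Pk (S k) z) / h (Pk k z))%C).
      { intros z Hz. destruct (polar (z - c)) as [y [Y1 Y2]]. set (t := Cmod (z - c)) in *.
        assert (Ht : 0 <= t) by apply Cmod_ge_0.
        assert (EP : forall j, Pk j z = (c + RtoC (INR j / INR N * t) * cis y)%C).
        { intros j. unfold Pk. rewrite Y2 at 1. rewrite RtoC_mult. ring. }
        assert (Hj : forall j, (j <= N)%nat -> 0 <= INR j / INR N * t <= r).
        { intros j Hj. specialize (HP j z Hj Hz). rewrite EP, Cmod_sub_c, Cmod_mult, Cmod_cis, Cmod_R, Rmult_1_r in HP.
          pose proof (Rle_abs (INR j / INR N * t)). split; [|lra].
          apply Rmult_le_pos; auto. apply Rdiv_le_0_compat; auto. apply pos_INR. }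
        assert (A : Cmod (h (Pk (S k) z) - h (Pk k z)) < m).
        { rewrite !EP. apply D2; auto; try (apply Hj; lia).
          rewrite S_INR. replace ((INR k + 1) / INR N * t - INR k / INR N * t) with (t / INR N) by (field; lra).
          rewrite Rabs_pos_eq by (apply Rdiv_le_0_compat; auto).
          apply Rmult_lt_reg_r with (INR N); auto. unfold Rdiv at 1. rewrite Rmult_assoc, Rinv_l by lra.
          assert (r < d * INR N). { apply Rmult_lt_compat_r with (r := d) in HN; auto.
            unfold Rdiv in HN. rewrite Rmult_assoc, Rinv_l in HN; lra. } lra. }
        assert (Hne : h (Pk k z) <> 0) by (apply Hh, HP; auto; lia).
        assert (B : m <= Cmod (h (Pk k z))).
        { assert (Q := P2 (Pk k z)). unfold m. assert (Q2 := HP k z ltac:(lia) Hz).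
          pose proof (Cmod_ge_0 (Pk k z - c)). specialize (Q ltac:(lra)). lra. }
        assert (E : Cmod (h (Pk (S k) z) / h (Pk k z) - 1) < 1).
        { replace (h (Pk (S k) z) / h (Pk k z) - 1)%C with ((h (Pk (S k) z) - h (Pk k z)) / h (Pk k z))%C by (field; auto).
          rewrite Cmod_div by auto. apply Rmult_lt_reg_r with (Cmod (h (Pk k z))); [lra|].
          unfold Rdiv. rewrite Rmult_assoc, Rinv_l; lra. }
        assert (F := fst_le_Cmod (h (Pk (S k) z) / h (Pk k z) - 1)%C).
        assert (F2 : Rabs (fst (h (Pk (S k) z) / h (Pk k z) - 1)%C) < 1) by lra.
        apply Rabs_def2 in F2. destruct F2 as [_ F2].
        change (fst (h (Pk (S k) z) / h (Pk k z) - 1)%C) with (fst (h (Pk (S k) z) / h (Pk k z))%C + - 1) in F2. lra. }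
      exists (fun z => L z + Clog (h (Pk (S k) z) / h (Pk k z)))%C.
      intros z Hz. destruct (HL z Hz) as [L1 L2].
      assert (Hne : h (Pk k z) <> 0) by (apply Hh, HP; auto; lia).
      split.
      + apply Cdiff_plus; auto.
        apply (Cdiff_comp Clog (fun z => h (Pk (S k) z) / h (Pk k z))%C).
        * apply (Cdiff_div (fun z => h (Pk (S k) z)) (fun z => h (Pk k z))); auto; apply HPd; auto; lia.
        * eexists. apply Cder_Clog, Hpos, Hz.
      + rewrite cexp_plus, L2, cexp_Clog by (apply Hpos, Hz). fold (Pk k z). fold (Pk (S k) z). field. auto. }
  destruct (K N (le_n _)) as [L HL]. exists L. intros z Hz. destruct (HL z Hz) as [A B]. split; auto.
  rewrite B. f_equal. unfold Rdiv. rewrite Rinv_r by lra. ring.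
Qed.

Lemma Cder_unique (f : C -> C) (z a b : C) : Cder f z a -> Cder f z b -> a = b.
Proof.
  intros Ha Hb. destruct (Ceq_dec a b) as [E|E]; auto. exfalso.
  assert (Hp := Cmod_sub_pos _ _ E). set (k := Cmod (a - b)) in *.
  destruct (Ha (k/3)) as [d1 [A1 A2]]; [lra|]. destruct (Hb (k/3)) as [d2 [B1 B2]]; [lra|].
  set (d := Rmin d1 d2 / 2). assert (Hd : 0 < d) by (unfold d; assert (0 < Rmin d1 d2) by (apply Rmin_pos; auto); lra).
  assert (Hm : Cmod (RtoC d) = d) by (rewrite Cmod_R, Rabs_pos_eq; lra).
  assert (L1 := Rmin_l d1 d2). assert (L2 := Rmin_r d1 d2).
  specialize (A2 (RtoC d) ltac:(rewrite Hm; unfold d in *; lra)).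
  specialize (B2 (RtoC d) ltac:(rewrite Hm; unfold d in *; lra)). rewrite Hm in A2, B2.
  assert (Q := Cmod_tri_sub (f (z + RtoC d)%C - f z - b * RtoC d) (f (z + RtoC d)%C - f z - a * RtoC d)).
  replace (f (z + RtoC d)%C - f z - b * RtoC d - (f (z + RtoC d)%C - f z - a * RtoC d))%C
    with ((a - b) * RtoC d)%C in Q by ring.
  rewrite Cmod_mult, Hm in Q. fold k in Q. nra.
Qed.

Lemma CI_cis : CI cis 0 (2 * PI) = 0.
Proof.
  assert (HPI := PI_RGT_0).
  rewrite (CI_ext _ (fun y => (fun z => z) (0 + RtoC 1 * cis y)%C)) by (try lra; intros; ring).
  rewrite (circle_mean (fun z => z) 0 1); [ring|lra| |apply Ccont_id].
  intros; apply Cdiff_id.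
Qed.

(** With [h = exp L] on a larger disc, [ln|h|] is half the sum of [L] and its conjugate. Against the
    conjugate of [cis y], the part with [L] yields the first Taylor coefficient [h'/h] of [L]; the
    other part is, up to a factor, the conjugate of a mean of [L z * (z - c)], which vanishes at the
    centre. *)
Lemma log_moment (h : C -> C) (c : C) (R0 r : R) (l : C) : 0 < r < R0 ->
  (forall z, Cmod (z - c) < R0 -> Cdiff h z /\ h z <> 0) -> Cder h c l ->
  RInt (fun y => ln (Cmod (h (c + RtoC r * cis y)%C))) 0 (2 * PI) = 2 * PI * ln (Cmod (h c)) /\
  CI (fun y => RtoC (ln (Cmod (h (c + RtoC r * cis y)%C))) * Cconj (cis y))%C 0 (2 * PI)
    = (RtoC (PI * r) * (l / h c))%C.
Proof.
  intros Hr Hh Hl. assert (HPI := PI_RGT_0).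
  destruct (holo_log h c ((r + R0) / 2)) as [L HL]; [lra|intros; apply Hh; lra|].
  set (r1 := (r + R0) / 2) in *. assert (Hr1 : r < r1) by (unfold r1; lra).
  assert (Hcc : Cmod (c - c) < r1) by (rewrite Cmod_sub_self; lra).
  assert (Hcir : forall y, Cmod (c + RtoC r * cis y - c) = r)
    by (intros; rewrite Cmod_sub_c, Cmod_Rcis; lra).
  assert (Eln : forall z, Cmod (z - c) < r1 -> ln (Cmod (h z)) = fst (L z)).
  { intros z Hz. rewrite <- (proj2 (HL z Hz)), Cmod_cexp, ln_exp. reflexivity. }
  assert (HLc : cont_on (fun y => L (c + RtoC r * cis y)%C) 0 (2 * PI)).
  { intros t _. apply (Rcont_curve L (fun y => c + RtoC r * cis y)%C); [apply Rcont_circle|].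
    apply Cdiff_Ccont, HL. rewrite Hcir. lra. }
  assert (Hcc2 : cont_on (fun y => Cconj (cis y)) 0 (2 * PI)).
  { intros t _. split; simpl; apply continuity_pt_filterlim; [apply continuity_cos|].
    apply continuity_pt_opp, continuity_sin. }
  assert (Hci : cont_on cis 0 (2 * PI)) by (intros t _; apply Rcont_cis).
  assert (M0 : CI (fun y => L (c + RtoC r * cis y)%C) 0 (2 * PI) = (RtoC (2 * PI) * L c)%C).
  { apply circle_mean; [lra| |apply Cdiff_Ccont, HL, Hcc]. intros z Hz. apply HL. lra. }
  split.
  - rewrite (RInt_ext _ (fun y => fst (L (c + RtoC r * cis y)%C))).
    2:{ intros y _. apply Eln. rewrite Hcir. lra. }
    rewrite (Eln c Hcc). transitivity (fst (RtoC (2 * PI) * L c)%C); [exact (f_equal fst M0)|].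
    change (fst (RtoC (2 * PI) * L c)%C) with (2 * PI * fst (L c) - 0 * snd (L c)).
    match goal with |- @eq _ ?a ?b => change (@eq R a b) end. ring.
  - destruct (proj1 (HL c Hcc)) as [lam Hlam].
    assert (El : l = (h c * lam)%C).
    { apply (Cder_unique h c); auto.
      apply (Cder_ext_loc (fun z => cexp (L z)) h c _ r1); [lra|intros; apply HL; auto|].
      rewrite <- (proj2 (HL c Hcc)). apply (Cder_comp cexp L); auto. apply Cder_cexp. }
    assert (Hne : h c <> 0) by (apply Hh; rewrite Cmod_sub_self; lra).
    replace (l / h c)%C with lam by (rewrite El; field; auto).
    apply Cder_carat in Hlam. destruct Hlam as [q [Q1 [Q2 Q3]]].
    assert (Hqd : forall z, 0 < Cmod (z - c) < r1 -> Cdiff q z).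
    { intros z Hz. assert (Hzc : forall w, Cmod (w - z) < Cmod (z - c) -> (w - c <> 0)%C).
      { intros w Hw E. apply Csub_0_eq in E. subst w. rewrite Cmod_sub_sym in Hw. lra. }
      apply (Cdiff_ext_loc (fun w => (L w - L c) / (w - c))%C q z (Cmod (z - c))); [lra| |].
      - intros w Hw. rewrite (Q3 w). field. apply Hzc, Hw.
      - apply (Cdiff_div (fun w => L w - L c)%C (fun w => w - c)%C).
        + apply Hzc. rewrite Cmod_sub_self. lra.
        + apply Cdiff_minus; [apply HL; lra|apply Cdiff_const].
        + apply (Cdiff_minus (fun z => z)); [apply Cdiff_id|apply Cdiff_const]. }
    assert (Mq : CI (fun y => q (c + RtoC r * cis y)%C) 0 (2 * PI) = (RtoC (2 * PI) * q c)%C).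
    { apply circle_mean; [lra| |exact Q1]. intros z Hz. apply Hqd. lra. }
    assert (M1 : CI (fun y => L (c + RtoC r * cis y)%C * Cconj (cis y))%C 0 (2 * PI) = (RtoC (2 * PI * r) * lam)%C).
    { rewrite (CI_ext _ (fun y => L c * Cconj (cis y) + RtoC r * q (c + RtoC r * cis y)%C)%C); [|lra|].
      - rewrite CI_plus; try lra.
        + rewrite !CI_scal; try lra; auto.
          * rewrite CI_conj, CI_cis, Mq, Q2 by (auto; lra).
            replace (Cconj 0) with (RtoC 0) by (apply injective_projections; simpl; ring).
            rewrite !RtoC_mult. ring.
          * intros t _. apply (Rcont_curve q (fun y => c + RtoC r * cis y)%C); [apply Rcont_circle|].
            apply Cdiff_Ccont, Hqd. rewrite Hcir. lra.
        + intros t Ht. apply Rcont_mult; [apply Rcont_const|apply Hcc2, Ht].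
        + intros t Ht. apply Rcont_mult; [apply Rcont_const|].
          apply (Rcont_curve q (fun y => c + RtoC r * cis y)%C); [apply Rcont_circle|].
          apply Cdiff_Ccont, Hqd. rewrite Hcir. lra.
      - intros y _. rewrite (Q3 (c + RtoC r * cis y)%C) at 1. rewrite cis_conj. field. apply cis_neq_0. }
    assert (M2 : CI (fun y => Cconj (L (c + RtoC r * cis y)%C) * Cconj (cis y))%C 0 (2 * PI) = 0).
    { rewrite (CI_ext _ (fun y => Cconj (RtoC (/ r) * ((fun z => L z * (z - c)) (c + RtoC r * cis y)))%C)); [|lra|].
      - assert (Hgc : cont_on (fun y => (fun z => L z * (z - c))%C (c + RtoC r * cis y)%C) 0 (2 * PI)).
        { intros t Ht. apply Rcont_mult; [apply HLc, Ht|]. apply Rcont_minus; [apply Rcont_circle|apply Rcont_const]. }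
        rewrite CI_conj, CI_scal; try lra; auto.
        + rewrite (circle_mean (fun z => L z * (z - c))%C c r); [|lra| |].
          * replace (RtoC (/ r) * (RtoC (2 * PI) * (L c * (c - c))))%C with (RtoC 0) by ring.
            apply injective_projections; simpl; ring.
          * intros z Hz. apply Cdiff_mult; [apply HL; lra|]. apply (Cdiff_minus (fun z => z)); [apply Cdiff_id|apply Cdiff_const].
          * apply Cdiff_Ccont. apply Cdiff_mult; [apply HL; lra|]. apply (Cdiff_minus (fun z => z)); [apply Cdiff_id|apply Cdiff_const].
        + intros t Ht. apply Rcont_mult; [apply Rcont_const|apply Hgc, Ht].
      - intros y _. rewrite <- Cmult_conj. f_equal. rewrite RtoC_inv by lra. field.
        intros E. apply RtoC_inj in E. lra. }
    rewrite (CI_ext _ (fun y => RtoC (/2) * (L (c + RtoC r * cis y)%C * Cconj (cis y) + Cconj (L (c + RtoC r * cis y)%C) * Cconj (cis y)))%C); [|lra|].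
    + assert (Hc1 : cont_on (fun y => L (c + RtoC r * cis y)%C * Cconj (cis y))%C 0 (2 * PI)).
      { intros t Ht. apply Rcont_mult; [apply HLc, Ht|apply Hcc2, Ht]. }
      assert (Hc2 : cont_on (fun y => Cconj (L (c + RtoC r * cis y)%C) * Cconj (cis y))%C 0 (2 * PI)).
      { intros t Ht. apply Rcont_mult; [|apply Hcc2, Ht]. destruct (HLc t Ht) as [B1 B2]. split; simpl; auto.
        apply (continuous_opp (V := R_NormedModule)). exact B2. }
      rewrite CI_scal, CI_plus, M1, M2; try lra; auto.
      * apply injective_projections; simpl; field.
      * intros t Ht. apply Rcont_plus; auto.
    + intros y _. rewrite Eln by (rewrite Hcir; lra). apply injective_projections; simpl; field.
Qed.

Lemma ln_circle (c a : C) (r : R) : 0 < r -> r <> Cmod (a - c) ->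
  RInt (fun y => ln (Cmod (c + RtoC r * cis y - a))) 0 (2 * PI) = 2 * PI * ln (Rmax r (Cmod (a - c))) /\
  CI (fun y => RtoC (ln (Cmod (c + RtoC r * cis y - a))) * Cconj (cis y))%C 0 (2 * PI)
    = (RtoC (- PI * r / (Rmax r (Cmod (a - c)))^2) * Cconj (a - c))%C.
Proof.
  intros Hr Hne. set (x := (a - c)%C) in *. assert (Hx0 := Cmod_ge_0 x).
  destruct (Rlt_le_dec r (Cmod x)) as [H|H].
  - rewrite Rmax_right by lra.
    destruct (log_moment (fun z => z - a)%C c (Cmod x) r (1 - 0)%C) as [A B].
    + lra.
    + intros z Hz. split; [apply (Cdiff_minus (fun z => z)); [apply Cdiff_id|apply Cdiff_const]|].
      intros E. apply Csub_0_eq in E. subst z. fold x in Hz. lra.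
    + apply (Cder_minus (fun z => z) (fun _ => a)); [apply Cder_id|apply Cder_const].
    + rewrite A, B. split.
      * do 2 f_equal. unfold x. apply Cmod_sub_sym.
      * assert (x <> 0) by (apply Cmod_gt_0; lra).
        replace (c - a)%C with (- x)%C by (unfold x; ring).
        replace (Cconj x) with (RtoC (Cmod x ^ 2) * / x)%C.
        2:{ rewrite Cmod2_conj. field. auto. }
        unfold Rdiv. rewrite !RtoC_mult, RtoC_inv by (apply pow_nonzero; lra). rewrite RtoC_opp. field.
        split; auto. intros E. apply RtoC_inj in E. apply pow_nonzero in E; auto. lra.
  - assert (Hlt : Cmod x < r) by lra. rewrite Rmax_left by lra.
    (* For [a] inside the circle, [|z - a|] coincides on the circle with the modulus of a function
       whose zero is the reflection of [a], outside the circle; [log_moment] applies to that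
       function. *)
    assert (Er : forall y, Cmod (c + RtoC r * cis y - a) = Cmod (RtoC r - Cconj x / RtoC r * (c + RtoC r * cis y - c))).
    { intros y. replace (c + RtoC r * cis y - a)%C with (cis y * (RtoC r - x * / cis y))%C
        by (unfold x; field; apply cis_neq_0).
      rewrite <- cis_conj, Cmod_mult, Cmod_cis, Rmult_1_l. rewrite <- (Cmod_conj (RtoC r - _)).
      f_equal. unfold Cconj, Cdiv, Cmult, Cminus, Cplus, Copp, Cinv, RtoC; simpl. f_equal; field; lra. }
    (* A radius between [r] and the distance [r^2 / |x|] of the reflected zero, in a form that
       remains meaningful for [x = 0]. *)
    set (R0 := r * (2 * r / (r + Cmod x))).
    assert (Q1 : 1 < 2 * r / (r + Cmod x)).
    { apply Rmult_lt_reg_r with (r + Cmod x); [lra|]. unfold Rdiv. rewrite Rmult_assoc, Rinv_l; lra. }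
    assert (Hr0 : RtoC r <> 0) by (intros E; apply RtoC_inj in E; lra).
    destruct (log_moment (fun z => RtoC r - Cconj x / RtoC r * (z - c))%C c R0 r (0 - Cconj x / RtoC r * (1 - 0))%C) as [A B].
    + split; auto. unfold R0. rewrite <- (Rmult_1_r r) at 1. apply Rmult_lt_compat_l; auto.
    + intros z Hz. split.
      * apply (Cdiff_minus (fun _ => RtoC r) (fun z => Cconj x / RtoC r * (z - c))%C); [apply Cdiff_const|].
        apply Cdiff_mult; [apply Cdiff_const|]. apply (Cdiff_minus (fun z => z)); [apply Cdiff_id|apply Cdiff_const].
      * intros E. apply Csub_0_eq in E. apply (f_equal Cmod) in E.
        rewrite Cmod_mult, Cmod_div, Cmod_conj, !Cmod_R, Rabs_pos_eq in E by (auto; lra).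
        assert (Cmod x / r * Cmod (z - c) <= Cmod x / r * R0).
        { apply Rmult_le_compat_l; [apply Rdiv_le_0_compat; lra|lra]. }
        unfold R0 in H0. replace (Cmod x / r * (r * (2 * r / (r + Cmod x)))) with (r * (2 * Cmod x / (r + Cmod x))) in H0 by (field; lra).
        assert (2 * Cmod x / (r + Cmod x) < 1).
        { apply Rmult_lt_reg_r with (r + Cmod x); [lra|]. unfold Rdiv. rewrite Rmult_assoc, Rinv_l; lra. }
        assert (r * (2 * Cmod x / (r + Cmod x)) < r * 1) by (apply Rmult_lt_compat_l; lra). lra.
    + apply (Cder_minus (fun _ => RtoC r) (fun z => Cconj x / RtoC r * (z - c))%C); [apply Cder_const|].
      apply Cder_scal. apply (Cder_minus (fun z => z) (fun _ => c)); [apply Cder_id|apply Cder_const].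
    + cbv beta in A, B.
      replace (RtoC r - Cconj x / RtoC r * (c - c))%C with (RtoC r) in A, B by (field; auto).
      rewrite (RInt_ext _ (fun y => ln (Cmod (RtoC r - Cconj x / RtoC r * (c + RtoC r * cis y - c)))))
        by (intros; rewrite <- Er; reflexivity).
      rewrite (CI_ext _ (fun y => RtoC (ln (Cmod (RtoC r - Cconj x / RtoC r * (c + RtoC r * cis y - c)))) * Cconj (cis y))%C)
        by (try (pose proof PI_RGT_0; lra); intros; rewrite <- Er; reflexivity).
      rewrite A, B. split.
      * rewrite Cmod_R, Rabs_pos_eq; lra.
      * unfold Rdiv. rewrite !RtoC_mult, RtoC_inv by (apply pow_nonzero; lra). rewrite RtoC_opp, RtoC_pow. field. auto.
Qed.

Lemma ex_RInt_circle (u : C -> R) (c : C) (r : R) : 0 <= r ->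
  (forall z, Cmod (z - c) = r -> Rcont_at u z) ->
  (forall y, continuous (fun y => u (c + RtoC r * cis y)%C) y) /\
  ex_RInt (fun y => u (c + RtoC r * cis y)%C) 0 (2 * PI).
Proof.
  intros Hr Hu.
  assert (K : forall y, continuous (fun y => u (c + RtoC r * cis y)%C) y).
  { intros y. assert (H := Rcont_curve (fun z => RtoC (u z)) (fun y => c + RtoC r * cis y)%C y (Rcont_circle c r y)).
    destruct H as [H _]; auto. intros eps He.
    destruct (Hu (c + RtoC r * cis y)%C) with (eps := eps) as [d [D1 D2]]; auto.
    { rewrite Cmod_sub_c, Cmod_Rcis; lra. }
    exists d. split; auto. intros w Hw. rewrite <- RtoC_minus, Cmod_R. apply D2, Hw. }
  split; auto. apply (ex_RInt_continuous (V := R_CompleteNormedModule)). auto.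
Qed.

Lemma Rcont_at_ln (g : C -> C) (z : C) : Ccont g z -> g z <> 0 -> Rcont_at (fun w => ln (Cmod (g w))) z.
Proof.
  intros Hg Hz eps He. assert (Hp := proj1 (Cmod_gt_0 _) Hz).
  assert (Hl : continuous ln (Cmod (g z))).
  { apply continuity_pt_filterlim, derivable_continuous_pt. exists (/ Cmod (g z)). apply derivable_pt_lim_ln, Hp. }
  destruct (proj1 (continuous_R_iff _ _) Hl eps He) as [d [D1 D2]].
  destruct (Rcont_at_Cmod g z Hg d D1) as [d' [D3 D4]]. exists d'. split; auto.
Qed.

Lemma ln_max1_continuous (t : R) : 0 <= t -> continuous (fun t => ln (Rmax 1 t)) t.
Proof.
  intros Ht. apply (continuous_comp (fun t => Rmax 1 t) ln).
  - apply (continuous_R_iff (fun t => Rmax 1 t)). intros eps He. exists eps. split; auto. intros u Hu.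
    unfold Rmax. destruct (Rle_dec 1 u), (Rle_dec 1 t); revert Hu; unfold Rabs; repeat destruct (Rcase_abs _); lra.
  - apply continuity_pt_filterlim, derivable_continuous_pt. exists (/ Rmax 1 t). apply derivable_pt_lim_ln.
    eapply Rlt_le_trans; [|apply Rmax_l]. lra.
Qed.

(* [1 + |r e^{iy} - x|^2 = |p e^{iy} - x'|^2] with [p^2 + |x'|^2 = 1 + r^2 + |x|^2] and [p |x'| = r |x|]. *)
Lemma ln_max1_circle (c a : C) (r : R) : 0 < r -> 0 < Cmod (a - c) ->
  ex_RInt (fun y => ln (Rmax 1 (Cmod (c + RtoC r * cis y - a)))) 0 (2 * PI) /\
  RInt (fun y => ln (Rmax 1 (Cmod (c + RtoC r * cis y - a)))) 0 (2 * PI)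
    <= 2 * PI * ln (Rmax r (Cmod (a - c)) + 1).
Proof.
  intros Hr Hx. assert (HPI := PI_RGT_0). set (x := (a - c)%C) in *. set (s := Cmod x) in *.
  assert (E1 : ex_RInt (fun y => ln (Rmax 1 (Cmod (c + RtoC r * cis y - a)))) 0 (2 * PI)).
  { apply (ex_RInt_circle (fun z => ln (Rmax 1 (Cmod (z - a)))) c r); [lra|].
    intros z _ eps He.
    destruct (proj1 (continuous_R_iff _ _) (ln_max1_continuous (Cmod (z - a)) (Cmod_ge_0 _)) eps He) as [d [D1 D2]].
    destruct (Rcont_at_Cmod (fun w => w - a)%C z) with (eps := d) as [d' [D3 D4]]; auto.
    - apply (Ccont_plus (fun z => z) (fun _ => (- a)%C)); [apply Ccont_id|apply Ccont_const].
    - exists d'. split; auto. }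
  split; auto.
  (* [A] and [B] are the extreme values of [sqrt (1 + |z - a|^2)] on the circle; they must equal
     [p + q] and [p - q], which determines the new radius [p] and [q = |x'|]. *)
  set (A := sqrt (1 + (r + s)^2)). set (B := sqrt (1 + (r - s)^2)).
  assert (HA2 : A * A = 1 + (r + s)^2) by (apply sqrt_sqrt; pose proof (pow2_ge_0 (r + s)); lra).
  assert (HB2 : B * B = 1 + (r - s)^2) by (apply sqrt_sqrt; pose proof (pow2_ge_0 (r - s)); lra).
  assert (HA : 0 <= A) by apply sqrt_pos. assert (HB : 0 <= B) by apply sqrt_pos.
  assert (HB1 : 1 <= B) by (pose proof (pow2_ge_0 (r - s)); nra).
  assert (HAB : B < A) by nra.
  set (p := (A + B)/2). set (q := (A - B)/2). set (x' := (RtoC (q / s) * x)%C).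
  assert (Hp : 0 < p) by (unfold p; lra). assert (Hq : 0 < q) by (unfold q; lra).
  assert (Hqp : q < p) by (unfold p, q; lra).
  assert (Epq : p * q = r * s) by (unfold p, q; nra).
  assert (Epq2 : p * p + q * q = 1 + r * r + s * s) by (unfold p, q; nra).
  assert (Hpm : p <= Rmax r s + 1).
  { assert (A <= r + s + 1) by nra. assert (B <= Rabs (r - s) + 1).
    { assert (HR := Rabs_pos (r - s)). assert (HR2 := pow2_abs (r - s)). nra. }
    unfold p. unfold Rmax, Rabs in *. destruct (Rle_dec r s), (Rcase_abs (r - s)); lra. }
  assert (Hx' : Cmod x' = q).
  { unfold x'. rewrite Cmod_mult, Cmod_R, Rabs_pos_eq by (apply Rdiv_le_0_compat; lra). fold s. field. lra. }
  assert (Hneq : p <> Cmod (c + x' - c)) by (rewrite Cmod_sub_c, Hx'; lra).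
  destruct (ln_circle c (c + x')%C p Hp Hneq) as [I _]. rewrite Cmod_sub_c, Hx', Rmax_left in I by lra.
  apply Rle_trans with (RInt (fun y => ln (Cmod (c + RtoC p * cis y - (c + x')))) 0 (2 * PI)).
  - assert (Hne : forall z, Cmod (z - c) = p -> (z - (c + x') <> 0)%C).
    { intros z Hz E. apply Csub_0_eq in E. subst z. congruence. }
    apply RInt_le; auto; [lra| |].
    + apply (ex_RInt_circle (fun z => ln (Cmod (z - (c + x')))) c p); [lra|].
      intros z Hz. apply (Rcont_at_ln (fun w => w - (c + x'))%C z); auto.
      apply (Ccont_plus (fun z => z) (fun _ => (- (c + x'))%C)); [apply Ccont_id|apply Ccont_const].
    + intros y _.
      assert (Hpos : 0 < Cmod (c + RtoC p * cis y - (c + x'))).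
      { apply Cmod_gt_0, Hne. rewrite Cmod_sub_c, Cmod_Rcis; lra. }
      assert (Hsq : Cmod (c + RtoC p * cis y - (c + x')) * Cmod (c + RtoC p * cis y - (c + x'))
        = 1 + Cmod (c + RtoC r * cis y - a) * Cmod (c + RtoC r * cis y - a)).
      { replace (c + RtoC p * cis y - (c + x'))%C with (RtoC p * cis y - x')%C by ring.
        replace (c + RtoC r * cis y - a)%C with (RtoC r * cis y - x)%C by (unfold x; ring).
        assert (Ex : Cmod x' * Cmod x' = q * q) by (rewrite Hx'; ring).
        assert (Ex2 : Cmod x * Cmod x = s * s) by reflexivity.
        rewrite Cmod_sqr in Ex, Ex2. rewrite !Cmod_sqr.
        assert (T := sin2_cos2 y). unfold Rsqr in T.
        assert (F1 : fst x' = q / s * fst x) by (unfold x'; simpl; ring).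
        assert (F2 : snd x' = q / s * snd x) by (unfold x'; simpl; ring).
        clearbody s. clear I Hne Hneq Hpos. clearbody x'. clear E1. clearbody x. rewrite F1, F2 in Ex. simpl. rewrite F1, F2.
        set (X := fst x) in *. set (Y := snd x) in *. set (cc := cos y) in *. set (ss := sin y) in *.
        assert (P1 : p * (q / s) = r) by (replace (p * (q / s)) with (p * q / s) by (field; lra); rewrite Epq; field; lra).
        replace ((p * cc - 0 * ss + - (q / s * X)) * (p * cc - 0 * ss + - (q / s * X)) +
          (p * ss + 0 * cc + - (q / s * Y)) * (p * ss + 0 * cc + - (q / s * Y)))
          with (p * p * (ss * ss + cc * cc) + (q / s * X * (q / s * X) + q / s * Y * (q / s * Y)) - 2 * (p * (q / s)) * (cc * X + ss * Y)) by ring.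
        rewrite T, P1, Ex.
        assert (T2 : r * r * (ss * ss + cc * cc) = r * r) by (rewrite T; ring).
        lra. }
      apply Rcomplements.ln_le; [eapply Rlt_le_trans; [|apply Rmax_l]; lra|].
      assert (Q := Cmod_ge_0 (c + RtoC r * cis y - a)).
      apply Rmax_lub; nra.
  - rewrite I. apply Rmult_le_compat_l; [lra|]. apply Rcomplements.ln_le; auto.
Qed.

(** * Finite sums over the divisor *)

Definition rsum (l : list C) (F : C -> R) : R := fold_right Rplus 0 (map F l).
Definition csum (l : list C) (F : C -> C) : C := fold_right Cplus 0 (map F l).

Lemma rsum_ext (l : list C) F G : (forall a, In a l -> F a = G a) -> rsum l F = rsum l G.
Proof.
  intros H. induction l; [reflexivity|]. unfold rsum in *; simpl in *.
  rewrite H, IHl by auto. reflexivity.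
Qed.

Lemma csum_ext (l : list C) F G : (forall a, In a l -> F a = G a) -> csum l F = csum l G.
Proof.
  intros H. induction l; [reflexivity|]. unfold csum in *; simpl in *.
  rewrite H, IHl by auto. reflexivity.
Qed.

Lemma rsum_cons a l F : rsum (a :: l) F = F a + rsum l F.
Proof. reflexivity. Qed.
Lemma csum_cons a l F : csum (a :: l) F = (F a + csum l F)%C.
Proof. reflexivity. Qed.

Lemma rsum_app l l' F : rsum (l ++ l') F = rsum l F + rsum l' F.
Proof. induction l; [unfold rsum; simpl; ring|]. simpl. rewrite !rsum_cons, IHl. ring. Qed.
Lemma csum_app l l' F : csum (l ++ l') F = (csum l F + csum l' F)%C.
Proof. induction l; [unfold csum; simpl; ring|]. simpl. rewrite !csum_cons, IHl. ring. Qed.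

Lemma rsum_plus l F G : rsum l (fun a => F a + G a) = rsum l F + rsum l G.
Proof. induction l; [unfold rsum; simpl; ring|]. rewrite !rsum_cons, IHl. ring. Qed.
Lemma rsum_minus l F G : rsum l (fun a => F a - G a) = rsum l F - rsum l G.
Proof. induction l; [unfold rsum; simpl; ring|]. rewrite !rsum_cons, IHl. ring. Qed.
Lemma rsum_scal l k F : rsum l (fun a => k * F a) = k * rsum l F.
Proof. induction l; [unfold rsum; simpl; ring|]. rewrite !rsum_cons, IHl. ring. Qed.
Lemma csum_plus l F G : csum l (fun a => F a + G a)%C = (csum l F + csum l G)%C.
Proof. induction l; [unfold csum; simpl; ring|]. rewrite !csum_cons, IHl. ring. Qed.
Lemma csum_minus l F G : csum l (fun a => F a - G a)%C = (csum l F - csum l G)%C.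
Proof. induction l; [unfold csum; simpl; ring|]. rewrite !csum_cons, IHl. ring. Qed.
Lemma csum_scal l k F : csum l (fun a => k * F a)%C = (k * csum l F)%C.
Proof. induction l; [unfold csum; simpl; ring|]. rewrite !csum_cons, IHl. ring. Qed.

Lemma rsum_le l F G : (forall a, In a l -> F a <= G a) -> rsum l F <= rsum l G.
Proof.
  intros H. induction l; [apply Rle_refl|]. rewrite !rsum_cons.
  apply Rplus_le_compat; [apply H; left; auto|apply IHl; intros; apply H; right; auto].
Qed.

Lemma rsum_0 l F : (forall a, In a l -> F a = 0) -> rsum l F = 0.
Proof. intros H. induction l; [reflexivity|]. rewrite rsum_cons, H, IHl by (simpl; auto; intros; apply H; simpl; auto). ring. Qed.

Lemma rsum_nonneg l F : (forall a, In a l -> 0 <= F a) -> 0 <= rsum l F.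
Proof. intros H. rewrite <- (rsum_0 l (fun _ => 0)) by auto. apply rsum_le, H. Qed.

Lemma rsum_Rabs l F : Rabs (rsum l F) <= rsum l (fun a => Rabs (F a)).
Proof.
  induction l; [unfold rsum; simpl; rewrite Rabs_R0; lra|]. rewrite !rsum_cons.
  eapply Rle_trans; [apply Rabs_triang|]. lra.
Qed.

Lemma csum_Cmod l F : Cmod (csum l F) <= rsum l (fun a => Cmod (F a)).
Proof.
  induction l; [unfold csum, rsum; simpl; rewrite Cmod_0; lra|]. rewrite rsum_cons, csum_cons.
  eapply Rle_trans; [apply Cmod_triangle|]. lra.
Qed.

Lemma csum_fst l F : fst (csum l F) = rsum l (fun a => fst (F a)).
Proof. induction l; [reflexivity|]. rewrite rsum_cons, csum_cons. simpl. rewrite IHl. reflexivity. Qed.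
Lemma csum_snd l F : snd (csum l F) = rsum l (fun a => snd (F a)).
Proof. induction l; [reflexivity|]. rewrite rsum_cons, csum_cons. simpl. rewrite IHl. reflexivity. Qed.

Lemma rsum_perm l l' F : Permutation l l' -> rsum l F = rsum l' F.
Proof.
  intros H. induction H; auto; rewrite ?rsum_cons; lra.
Qed.
Lemma csum_perm l l' F : Permutation l l' -> csum l F = csum l' F.
Proof.
  intros H. induction H; auto; rewrite ?csum_cons; [rewrite IHPermutation; auto|ring|congruence].
Qed.

Definition indic (P : Prop) : R := if excluded_middle_informative P then 1 else 0.
Lemma indic_true (P : Prop) : P -> indic P = 1.
Proof. intros. unfold indic. destruct (excluded_middle_informative P); tauto. Qed.
Lemma indic_false (P : Prop) : ~ P -> indic P = 0.
Proof. intros. unfold indic. destruct (excluded_middle_informative P); tauto. Qed.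

Definition fil (P : C -> Prop) (l : list C) : list C :=
  filter (fun a => if excluded_middle_informative (P a) then true else false) l.

Lemma fil_In P l a : In a (fil P l) <-> In a l /\ P a.
Proof.
  unfold fil. rewrite filter_In. destruct (excluded_middle_informative (P a)); intuition discriminate.
Qed.
Lemma fil_NoDup P l : NoDup l -> NoDup (fil P l).
Proof. apply NoDup_filter. Qed.
Lemma fil_perm P l : Permutation l (fil P l ++ fil (fun a => ~ P a) l).
Proof.
  unfold fil. induction l as [|a l IH]; [constructor|]. simpl.
  destruct (excluded_middle_informative (P a)); destruct (excluded_middle_informative (~ P a)); try tauto.
  - simpl. constructor. exact IH.
  - apply Permutation_cons_app. exact IH.
Qed.
Lemma rsum_fil P l F : rsum (fil P l) F = rsum l (fun a => indic (P a) * F a).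
Proof.
  unfold fil, indic. induction l as [|a l IH]; [reflexivity|]. simpl.
  destruct (excluded_middle_informative (P a)) eqn:E; rewrite !rsum_cons, ?E, IH; ring.
Qed.
Lemma csum_fil P l F : csum (fil P l) F = csum l (fun a => RtoC (indic (P a)) * F a)%C.
Proof.
  unfold fil, indic. induction l as [|a l IH]; [reflexivity|]. simpl.
  destruct (excluded_middle_informative (P a)) eqn:E; rewrite !csum_cons, ?E, IH; ring.
Qed.
Lemma rsum_split P l F : rsum l F = rsum (fil P l) F + rsum (fil (fun a => ~ P a) l) F.
Proof. rewrite <- rsum_app. apply rsum_perm, fil_perm. Qed.

Lemma NoDup_same_perm (l l' : list C) : NoDup l -> NoDup l' -> (forall a, In a l <-> In a l') -> Permutation l l'.
Proof. intros. apply NoDup_Permutation; auto. Qed.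

(** * Support lists, signed sums and counting bounds for a divisor *)

Definition supp (D : C -> Z) (P : C -> Prop) (l : list C) : Prop :=
  NoDup l /\ forall z, In z l <-> (D z <> 0%Z /\ P z).

Definition bounded_pred (P : C -> Prop) : Prop := exists c r, forall z, P z -> Cmod (z - c) <= r.

Lemma bounded_disc (c : C) (r : R) : bounded_pred (fun z => Cmod (z - c) < r).
Proof. exists c, r. intros. lra. Qed.
Lemma bounded_disc_le (c : C) (r : R) : bounded_pred (fun z => Cmod (z - c) <= r).
Proof. exists c, r. auto. Qed.
Lemma bounded_sub (P Q : C -> Prop) : (forall z, Q z -> P z) -> bounded_pred P -> bounded_pred Q.
Proof. intros H [c [r Hr]]. exists c, r. auto. Qed.

Lemma supp_exists (D : C -> Z) (P : C -> Prop) : divisor D -> bounded_pred P -> exists l, supp D P l.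
Proof.
  intros HD [c [r Hr]]. destruct (HD c r) as [l Hl].
  exists (fil (fun z => D z <> 0%Z /\ P z) (nodup Ceq_dec l)). split.
  - apply fil_NoDup, NoDup_nodup.
  - intros z. rewrite fil_In, nodup_In. split; [tauto|]. intros [A B].
    split; [apply Hl; auto; apply Hr, B|auto].
Qed.

Lemma supp_perm D P l l' : supp D P l -> supp D P l' -> Permutation l l'.
Proof. intros [A B] [A' B']. apply NoDup_same_perm; auto. intros. rewrite B, B'. tauto. Qed.

Lemma supp_list_spec (D : C -> Z) (P : C -> Prop) : divisor D -> bounded_pred P -> supp D P (supp_list D P).
Proof. intros HD HP. apply (epsilon_spec (inhabits nil) (fun l => NoDup l /\ forall z, In z l <-> D z <> 0%Z /\ P z)). apply supp_exists; auto. Qed.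

Lemma supp_fil D P Q l : supp D P l -> (forall z, Q z -> P z) -> supp D Q (fil Q l).
Proof.
  intros [A B] H. split; [apply fil_NoDup, A|]. intros z. rewrite fil_In, B. intuition.
Qed.

(** The bridge from the statement, which lists zeros and poles separately, to sums over a single
    list with the signed weight [D a], the form used in the estimates. *)
Lemma supp_zp_perm D P l : divisor D -> bounded_pred P -> supp D P l ->
  Permutation l (supp_list D (fun z => (D z > 0)%Z /\ P z) ++ supp_list D (fun z => (D z < 0)%Z /\ P z)).
Proof.
  intros HD HP [A B].
  destruct (supp_list_spec D (fun z => (D z > 0)%Z /\ P z) HD) as [A1 B1].
  { apply (bounded_sub P); auto; tauto. }
  destruct (supp_list_spec D (fun z => (D z < 0)%Z /\ P z) HD) as [A2 B2].
  { apply (bounded_sub P); auto; tauto. }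
  apply NoDup_same_perm; auto.
  - apply NoDup_app; auto. intros a H1 H2. apply B1 in H1. apply B2 in H2. lia.
  - intros z. rewrite in_app_iff, B, B1, B2. split.
    + intros [H1 H2]. destruct (Z_lt_le_dec (D z) 0); [right|left]; repeat split; auto; lia.
    + intros [[K1 K2]|[K1 K2]]; split; tauto.
Qed.

Lemma sum_zp D P l (F : C -> C) : divisor D -> bounded_pred P -> supp D P l ->
  (sum_zeros D P F - sum_poles D P F)%C = csum l (fun a => RtoC (IZR (D a)) * F a)%C.
Proof.
  intros HD HP Hl. rewrite (csum_perm _ _ _ (supp_zp_perm D P l HD HP Hl)), csum_app.
  unfold Cminus. f_equal.
  change (- csum (supp_list D (fun z => (D z < 0)%Z /\ P z)) (fun z => RtoC (IZR (- D z)) * F z) =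
    csum (supp_list D (fun z => (D z < 0)%Z /\ P z)) (fun a => RtoC (IZR (D a)) * F a))%C.
  rewrite (csum_ext _ (fun z => RtoC (IZR (- D z)) * F z)%C (fun z => (-1) * (RtoC (IZR (D z)) * F z))%C).
  - rewrite csum_scal. ring.
  - intros a _. rewrite opp_IZR, RtoC_opp. ring.
Qed.

Lemma card_zp_minus D P l : divisor D -> bounded_pred P -> supp D P l ->
  card_zeros D P - card_poles D P = rsum l (fun a => IZR (D a)).
Proof.
  intros HD HP Hl. rewrite (rsum_perm _ _ _ (supp_zp_perm D P l HD HP Hl)), rsum_app.
  unfold Rminus. f_equal.
  change (- rsum (supp_list D (fun z => (D z < 0)%Z /\ P z)) (fun z => IZR (- D z)) =
    rsum (supp_list D (fun z => (D z < 0)%Z /\ P z)) (fun z => IZR (D z))).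
  rewrite (rsum_ext _ (fun z => IZR (- D z)) (fun z => (-1) * IZR (D z))).
  - rewrite rsum_scal. ring.
  - intros a _. rewrite opp_IZR. ring.
Qed.

Definition absD (D : C -> Z) (a : C) : R := Rabs (IZR (D a)).

Lemma card_zp_plus D P l : divisor D -> bounded_pred P -> supp D P l ->
  card_zeros D P + card_poles D P = rsum l (absD D).
Proof.
  intros HD HP Hl. rewrite (rsum_perm _ _ _ (supp_zp_perm D P l HD HP Hl)), rsum_app.
  destruct (supp_list_spec D (fun z => (D z > 0)%Z /\ P z) HD) as [_ B1].
  { apply (bounded_sub P); auto; tauto. }
  destruct (supp_list_spec D (fun z => (D z < 0)%Z /\ P z) HD) as [_ B2].
  { apply (bounded_sub P); auto; tauto. }
  f_equal.
  - apply rsum_ext. intros a Ha. apply B1 in Ha. unfold absD. rewrite Rabs_pos_eq; auto. apply IZR_le. lia.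
  - apply rsum_ext. intros a Ha. apply B2 in Ha. unfold absD. rewrite opp_IZR, Rabs_left1; auto. apply IZR_le. lia.
Qed.

Lemma absD_pos D a : 0 <= absD D a.
Proof. apply Rabs_pos. Qed.

Lemma absD_ge1 D a : D a <> 0%Z -> 1 <= absD D a.
Proof. intros H. unfold absD. rewrite <- abs_IZR. apply IZR_le. lia. Qed.

(* [l] may contain points outside the support: they have weight 0. *)
Definition count_bound (D : C -> Z) (s K : R) : Prop :=
  0 <= K /\ forall c l, NoDup l -> (forall a, In a l -> Cmod (a - c) <= s) -> rsum l (absD D) <= K.

Lemma count_bound_cover (D : C -> Z) (s K : R) (ps l : list C) : count_bound D s K -> NoDup l ->
  (forall a, In a l -> exists p, In p ps /\ Cmod (a - p) <= s) -> rsum l (absD D) <= INR (length ps) * K.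
Proof.
  intros [HK HC] Hl Hcov. revert l Hl Hcov. induction ps as [|p ps IH]; intros l Hl Hcov.
  - simpl. rewrite Rmult_0_l. right. apply rsum_0. intros a Ha. destruct (Hcov a Ha) as [p [[] _]].
  - rewrite (rsum_split (fun a => Cmod (a - p) <= s)). change (length (p :: ps)) with (S (length ps)).
    rewrite S_INR.
    assert (A : rsum (fil (fun a => Cmod (a - p) <= s) l) (absD D) <= K).
    { apply (HC p); [apply fil_NoDup, Hl|]. intros a Ha. apply fil_In in Ha. tauto. }
    assert (B : rsum (fil (fun a => ~ Cmod (a - p) <= s) l) (absD D) <= INR (length ps) * K).
    { apply IH; [apply fil_NoDup, Hl|]. intros a Ha. apply fil_In in Ha. destruct Ha as [Ha Hn].
      destruct (Hcov a Ha) as [q [[Hq|Hq] Hq2]]; [subst; contradiction|]. exists q. auto. }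
    lra.
Qed.

Lemma floor_exists (x : R) : 0 <= x -> exists n : nat, INR n <= x < INR n + 1.
Proof.
  intros Hx. destruct (nfloor_ex x Hx) as [n Hn]. exists n. exact Hn.
Qed.

Lemma grid_cover (R0 s : R) : 0 < s -> 0 <= R0 ->
  exists ps : list C, forall z, Cmod z <= R0 -> exists p, In p ps /\ Cmod (z - p) <= s.
Proof.
  intros Hs HR. destruct (INR_unbounded (4 * R0 / s + 1)) as [N HN].
  set (f := fun n : nat => - R0 + INR n * (s / 2)).
  exists (map (fun q => (f (fst q), f (snd q))) (list_prod (seq 0 N) (seq 0 N))).
  assert (K : forall x, Rabs x <= R0 -> exists n, In n (seq 0 N) /\ Rabs (x - f n) <= s / 2).
  { intros x Hx. apply Rcomplements.Rabs_le_between in Hx.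
    destruct (floor_exists ((x + R0) / (s/2))) as [n [N1 N2]].
    { apply Rdiv_le_0_compat; lra. }
    exists n. assert (E : (x + R0) / (s/2) * (s/2) = x + R0) by (field; lra).
    split.
    - apply in_seq. split; [lia|]. simpl. apply INR_lt.
      eapply Rle_lt_trans; [exact N1|]. eapply Rle_lt_trans; [|exact HN].
      assert ((x + R0) / (s/2) <= (2 * R0) / (s/2)).
      { apply Rmult_le_compat_r; [left; apply Rinv_0_lt_compat; lra|lra]. }
      replace (2 * R0 / (s/2)) with (4 * R0 / s) in H by (field; lra). lra.
    - unfold f. apply Rabs_le. 
      assert (INR n * (s/2) <= x + R0) by (rewrite <- E; apply Rmult_le_compat_r; lra).
      assert (x + R0 <= (INR n + 1) * (s/2)) by (rewrite <- E; apply Rmult_le_compat_r; lra). lra. }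
  intros z Hz. destruct (K (fst z)) as [n [N1 N2]].
  { eapply Rle_trans; [apply fst_le_Cmod|auto]. }
  destruct (K (snd z)) as [m [M1 M2]].
  { eapply Rle_trans; [apply snd_le_Cmod|auto]. }
  exists (f n, f m). split.
  - apply in_map_iff. exists (n, m). split; auto. apply in_prod; auto.
  - eapply Rle_trans; [apply Cmod_le_sum|]. simpl. unfold Rminus in *. lra.
Qed.

Lemma count_bound_scale (D : C -> Z) (s K R0 : R) : 0 < s -> 0 <= R0 -> count_bound D s K ->
  exists K', count_bound D R0 K'.
Proof.
  intros Hs HR HC. destruct (grid_cover R0 s Hs HR) as [ps Hps].
  exists (INR (length ps) * K). split.
  - apply Rmult_le_pos; [apply pos_INR|apply HC].
  - intros c l Hl Ha. rewrite <- (length_map (fun p => c + p)%C).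
    apply (count_bound_cover D s K _ l HC Hl). intros a Hin.
    destruct (Hps (a - c)%C (Ha a Hin)) as [p [P1 P2]]. exists (c + p)%C. split.
    + apply in_map_iff. exists p. auto.
    + replace (a - (c + p))%C with (a - c - p)%C by ring. exact P2.
Qed.

Lemma count_annulus_half (D : C -> Z) (K : R) (c : C) (r : R) (l : list C) : count_bound D 1 K -> 0 <= r -> NoDup l ->
  (forall a, In a l -> r <= Cmod (a - c) <= r + 1/2) -> rsum l (absD D) <= 28 * K * (r + 1).
Proof.
  intros HC Hr Hl Ha. assert (HPI := PI_RGT_0). assert (HP4 := PI_4).
  (* Consecutive points on the circle of radius [r] differ by the angle [2 PI / N]. As [cis_lip]
     loses a factor 2 and [PI <= 3.5], [N >= 28 r] brings every point of the circle within 1/2 of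
     one of them, and the width of the annulus adds another 1/2. *)
  destruct (floor_exists (28 * r)) as [n [N1 N2]]; [lra|]. set (N := S n).
  assert (HN : 28 * r < INR N <= 28 * r + 1) by (unfold N; rewrite S_INR; lra).
  assert (HN0 : 0 < INR N) by (apply lt_0_INR; unfold N; lia).
  set (ps := map (fun j => c + RtoC r * cis (2 * PI * INR j / INR N))%C (seq 0 (S N))).
  apply Rle_trans with (INR (length ps) * K).
  - apply (count_bound_cover D 1 K ps l HC Hl). intros a Hin.
    destruct (polar (a - c)) as [y [Y1 Y2]]. specialize (Ha a Hin). set (t := Cmod (a - c)) in *.
    destruct (floor_exists (y * INR N / (2 * PI))) as [j [J1 J2]].
    { apply Rdiv_le_0_compat; [apply Rmult_le_pos|]; lra. }
    assert (E : y * INR N / (2 * PI) * (2 * PI / INR N) = y) by (field; lra).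
    assert (Hd : 0 < 2 * PI / INR N) by (apply Rdiv_lt_0_compat; lra).
    assert (A1 : INR j * (2 * PI / INR N) <= y) by (rewrite <- E; apply Rmult_le_compat_r; lra).
    assert (A2 : y <= (INR j + 1) * (2 * PI / INR N)) by (rewrite <- E; apply Rmult_le_compat_r; lra).
    exists (c + RtoC r * cis (2 * PI * INR j / INR N))%C. split.
    + apply in_map_iff. exists j. split; auto. apply in_seq. split; [lia|]. simpl.
      apply Nat.lt_succ_r. apply INR_le. eapply Rle_trans; [exact J1|].
      apply Rmult_le_reg_r with (2 * PI); [lra|]. unfold Rdiv. rewrite Rmult_assoc, Rinv_l by lra. nra.
    + replace (a - (c + RtoC r * cis (2 * PI * INR j / INR N)))%C
        with (RtoC (t - r) * cis y + RtoC r * (cis y - cis (2 * PI * INR j / INR N)))%C.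
      2:{ rewrite RtoC_minus. replace a with (c + RtoC t * cis y)%C by (rewrite <- Y2; ring). ring. }
      eapply Rle_trans; [apply Cmod_triangle|]. rewrite !Cmod_mult, Cmod_cis, !Cmod_R, !Rabs_pos_eq by lra.
      assert (B := cis_lip (2 * PI * INR j / INR N) y).
      replace (2 * PI * INR j / INR N) with (INR j * (2 * PI / INR N)) in * by (field; lra).
      rewrite Rabs_pos_eq in B by lra.
      assert (r * Cmod (cis y - cis (INR j * (2 * PI / INR N))) <= r * (2 * (2 * PI / INR N)))
        by (apply Rmult_le_compat_l; lra).
      assert (r * (2 * (2 * PI / INR N)) <= 1/2).
      { replace (r * (2 * (2 * PI / INR N))) with (4 * PI * r / INR N) by (field; lra).
        apply Rmult_le_reg_r with (INR N); auto. unfold Rdiv at 1. rewrite Rmult_assoc, Rinv_l by lra.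
        assert (HP3 := PI2_3_2). assert (4 * PI * r <= 14 * r).
        { apply Rmult_le_compat_r; auto. assert (PI <= 3.5); [|lra].
          assert (HH := PI_ineq 1). unfold sum_f_R0, tg_alt, PI_tg in HH. simpl in HH. lra. }
        lra. }
      lra.
  - unfold ps. rewrite length_map, length_seq, S_INR. destruct HC as [HK _]. nra.
Qed.

Lemma count_annulus (D : C -> Z) (K : R) (c : C) (r : R) (m : nat) (l : list C) : count_bound D 1 K -> 0 <= r -> NoDup l ->
  (forall a, In a l -> r <= Cmod (a - c) <= r + INR m / 2) ->
  rsum l (absD D) <= (INR m + 1) * (28 * K * (r + INR m / 2 + 1)).
Proof.
  intros HC Hr. assert (HK := proj1 HC). revert l. induction m; intros l Hl Ha.
  - simpl. rewrite Rplus_0_l, Rmult_1_l. 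
    eapply Rle_trans; [apply (count_annulus_half D K c r l HC Hr Hl)|].
    + intros a Hin. specialize (Ha a Hin). simpl in Ha. lra.
    + right. field.
  - rewrite (rsum_split (fun a => Cmod (a - c) <= r + INR m / 2)). rewrite S_INR in *.
    assert (HM := pos_INR m).
    assert (A : rsum (fil (fun a => Cmod (a - c) <= r + INR m / 2) l) (absD D) <= (INR m + 1) * (28 * K * (r + INR m / 2 + 1))).
    { apply IHm; [apply fil_NoDup, Hl|]. intros a Hin. apply fil_In in Hin. destruct Hin as [Hin H].
      specialize (Ha a Hin). lra. }
    assert (B : rsum (fil (fun a => ~ Cmod (a - c) <= r + INR m / 2) l) (absD D) <= 28 * K * (r + INR m / 2 + 1)).
    { apply (count_annulus_half D K c (r + INR m / 2)); auto; [lra|apply fil_NoDup, Hl|].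
      intros a Hin. apply fil_In in Hin. destruct Hin as [Hin H]. specialize (Ha a Hin). lra. }
    assert (28 * K * (r + INR m / 2 + 1) <= 28 * K * (r + (INR m + 1) / 2 + 1)) by (apply Rmult_le_compat_l; lra).
    assert ((INR m + 1) * (28 * K * (r + INR m / 2 + 1)) <= (INR m + 1) * (28 * K * (r + (INR m + 1) / 2 + 1)))
      by (apply Rmult_le_compat_l; lra). lra.
Qed.

Lemma list_bounded (l : list C) : exists B, 0 <= B /\ forall a, In a l -> Cmod a <= B.
Proof.
  induction l as [|b l [B [HB1 HB2]]]; [exists 0; split; [lra|intros a []]|].
  exists (Rmax B (Cmod b)). split; [eapply Rle_trans; [exact HB1|apply Rmax_l]|].
  intros a [E|E]; [subst; apply Rmax_r|eapply Rle_trans; [apply HB2, E|apply Rmax_l]].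
Qed.

(** A unit annulus at distance [x] carries at most [252 K x] by [count_annulus], and
    [252 / x^2 <= 600 (1/x - 1/(x+1))] telescopes. The cube is the least integer exponent for which
    the counting bound alone gives convergence. *)
Lemma tail_cube (D : C -> Z) (K : R) (r : R) (l : list C) : count_bound D 1 K -> 1 <= r -> NoDup l ->
  (forall a, In a l -> r <= Cmod a) ->
  rsum l (fun a => absD D a * / (Cmod a)^3) <= 600 * K / r.
Proof.
  intros HC Hr Hl Ha. assert (HK := proj1 HC).
  assert (Main : forall n l, NoDup l -> (forall a, In a l -> r <= Cmod a < r + INR n) ->
     rsum l (fun a => absD D a * / (Cmod a)^3) <= 600 * K * (/ r - / (r + INR n))).
  { clear l Hl Ha. induction n; intros l Hl Ha.
    - simpl in *. rewrite Rplus_0_r, Rminus_eq_0, Rmult_0_r. right. apply rsum_0.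
      intros a Hin. specialize (Ha a Hin). lra.
    - rewrite (rsum_split (fun a => Cmod a < r + INR n)). rewrite S_INR in *.
      assert (HM := pos_INR n). set (x := r + INR n) in *. assert (Hx : 1 <= x) by (unfold x; lra).
      assert (A : rsum (fil (fun a => Cmod a < x) l) (fun a => absD D a * / (Cmod a)^3) <= 600 * K * (/ r - / x)).
      { apply IHn; [apply fil_NoDup, Hl|]. intros a Hin. apply fil_In in Hin. destruct Hin as [Hin H].
        specialize (Ha a Hin). unfold x in *. lra. }
      assert (B : rsum (fil (fun a => ~ Cmod a < x) l) (fun a => absD D a * / (Cmod a)^3) <= 600 * K * (/ x - / (x + 1))).
      { set (l2 := fil (fun a => ~ Cmod a < x) l).
        assert (Hl2 : forall a, In a l2 -> x <= Cmod a <= x + 1).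
        { intros a Hin. apply fil_In in Hin. destruct Hin as [Hin H]. specialize (Ha a Hin). unfold x in *. lra. }
        apply Rle_trans with (rsum l2 (fun a => / x^3 * absD D a)).
        - apply rsum_le. intros a Hin. rewrite Rmult_comm. apply Rmult_le_compat_r; [apply absD_pos|].
          apply Rinv_le_contravar; [apply pow_lt; lra|]. apply pow_incr. specialize (Hl2 a Hin). lra.
        - rewrite rsum_scal.
          assert (E : rsum l2 (absD D) <= (2 + 1) * (28 * K * (x + 2/2 + 1))).
          { apply (count_annulus D K 0 x 2 l2); auto; [lra|apply fil_NoDup, Hl|]. intros a Hin.
            replace (a - 0)%C with a by ring. specialize (Hl2 a Hin). simpl. lra. }
          assert (Hx3 : 0 < / x^3) by (apply Rinv_0_lt_compat, pow_lt; lra).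
          apply Rle_trans with (/ x^3 * (252 * K * x)).
          + apply Rmult_le_compat_l; [lra|]. eapply Rle_trans; [exact E|]. nra.
          + replace (/ x - / (x + 1)) with (/ (x * (x + 1))) by (field; lra).
            replace (/ x^3 * (252 * K * x)) with (K * (252 * / (x * x))) by (field; lra).
            rewrite (Rmult_comm 600), Rmult_assoc. apply Rmult_le_compat_l; auto.
            apply Rmult_le_reg_r with (x * x * (x + 1)); [nra|].
            replace (252 * / (x * x) * (x * x * (x + 1))) with (252 * (x + 1)) by (field; lra).
            replace (600 * / (x * (x + 1)) * (x * x * (x + 1))) with (600 * x) by (field; lra). lra. }
      replace (r + (INR n + 1)) with (x + 1) by (unfold x; ring). lra. }
  destruct (list_bounded l) as [B [HB HB2]]. destruct (INR_unbounded B) as [n Hn].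
  eapply Rle_trans; [apply (Main n l Hl)|].
  - intros a Hin. specialize (HB2 a Hin). split; [apply Ha, Hin|lra].
  - assert (0 < / (r + INR n)) by (apply Rinv_0_lt_compat; pose proof (pos_INR n); lra).
    unfold Rdiv. apply Rmult_le_compat_l; lra.
Qed.

(** * Consequences of the bounds (b), (d) and (e) *)

(** The kernels below contain [Rmax t m], which has a corner at [t = m]; they are differentiable
    there all the same, because the formulas on both sides have a common derivative. *)
Lemma glue_derive (F : R -> R -> R) (t m d : R) :
  (t <= m -> is_derive (fun t => F t m) t d) -> (m <= t -> is_derive (fun t => F t t) t d) ->
  is_derive (fun t => F t (Rmax t m)) t d.
Proof.
  intros H1 H2. destruct (Rtotal_order t m) as [H|[H|H]].
  - apply (is_derive_ext_loc (fun t => F t m)); [|apply H1; lra].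
    assert (Hp : 0 < m - t) by lra. exists (mkposreal _ Hp). intros u Hu.
    apply Rabs_def2 in Hu. unfold minus, plus, opp in Hu; simpl in Hu. rewrite Rmax_right; auto; lra.
  - subst. specialize (H1 (Rle_refl _)). specialize (H2 (Rle_refl _)).
    apply is_derive_Reals in H1, H2. apply is_derive_Reals. intros eps He.
    destruct (H1 eps He) as [d1 D1], (H2 eps He) as [d2 D2].
    exists (mkposreal _ (Rmin_pos _ _ (cond_pos d1) (cond_pos d2))). intros h Hh Hlt. simpl in Hlt.
    rewrite (Rmax_left m m) by lra. destruct (Rle_dec 0 h).
    + rewrite Rmax_left by lra. apply D2; auto. eapply Rlt_le_trans; [exact Hlt|apply Rmin_r].
    + rewrite Rmax_right by lra. apply D1; auto. eapply Rlt_le_trans; [exact Hlt|apply Rmin_l].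
  - apply (is_derive_ext_loc (fun t => F t t)); [|apply H2; lra].
    assert (Hp : 0 < t - m) by lra. exists (mkposreal _ Hp). intros u Hu.
    apply Rabs_def2 in Hu. unfold minus, plus, opp in Hu; simpl in Hu. rewrite Rmax_left; auto; lra.
Qed.

Lemma is_derive_rsum (l : list C) (k : C -> R -> R) (dk : C -> R) (t : R) :
  (forall a, In a l -> is_derive (k a) t (dk a)) ->
  is_derive (fun t => rsum l (fun a => k a t)) t (rsum l dk).
Proof.
  intros H. induction l as [|b l IH].
  - change (is_derive (fun _ : R => 0) t 0). auto_derive; auto.
  - apply (is_derive_plus (K := R_AbsRing) (V := R_NormedModule) (fun t => k b t) (fun t => rsum l (fun a => k a t))).
    + apply H. left; auto.
    + apply IH. intros. apply H. right; auto.
Qed.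

Lemma incr_le (f df : R -> R) (a b : R) : a <= b ->
  (forall t, a <= t <= b -> is_derive f t (df t)) -> (forall t, a <= t <= b -> 0 <= df t) -> f a <= f b.
Proof.
  intros Hab Hd Hp. destruct (MVT_gen f a b df) as [c [C1 C2]].
  - intros t Ht. rewrite Rmin_left, Rmax_right in Ht by lra. apply Hd. lra.
  - intros t Ht. rewrite Rmin_left, Rmax_right in Ht by lra.
    apply continuity_pt_filterlim, (@ex_derive_continuous R_AbsRing R_NormedModule). exists (df t). apply Hd. lra.
  - rewrite Rmin_left, Rmax_right in C1 by lra. specialize (Hp c C1).
    assert (0 <= df c * (b - a)) by (apply Rmult_le_pos; lra). lra.
Qed.

(** Serves as integration of the inequality [|f'| <= h'], without any integral of the sums below
    over the radius. *)
Lemma mvt_dom (f df h dh : R -> R) (a b : R) : a <= b ->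
  (forall t, a <= t <= b -> is_derive f t (df t)) -> (forall t, a <= t <= b -> is_derive h t (dh t)) ->
  (forall t, a <= t <= b -> Rabs (df t) <= dh t) -> Rabs (f b - f a) <= h b - h a.
Proof.
  intros Hab Hf Hh Hle.
  assert (A := incr_le (fun t => h t - f t) (fun t => dh t - df t) a b Hab).
  assert (B := incr_le (fun t => h t + f t) (fun t => dh t + df t) a b Hab).
  assert (A' : h a - f a <= h b - f b).
  { apply A; intros t Ht.
    - apply (is_derive_minus (K := R_AbsRing) (V := R_NormedModule)); auto.
    - specialize (Hle t Ht). apply Rcomplements.Rabs_le_between in Hle. lra. }
  assert (B' : h a + f a <= h b + f b).
  { apply B; intros t Ht.
    - apply (is_derive_plus (K := R_AbsRing) (V := R_NormedModule)); auto.
    - specialize (Hle t Ht). apply Rcomplements.Rabs_le_between in Hle. lra. }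
  apply Rabs_le. lra.
Qed.

(** The list may exceed the support points in [P]: sums whose terms vanish outside [P] do not see
    the surplus ([covers_rsum]), so that discs with different centres and radii can share one
    list. *)
Definition covers (D : C -> Z) (P : C -> Prop) (l : list C) : Prop :=
  NoDup l /\ forall z, D z <> 0%Z -> P z -> In z l.

Lemma supp_covers D P l : supp D P l -> covers D P l.
Proof. intros [A B]. split; auto. intros. apply B; auto. Qed.
Lemma covers_sub D (P Q : C -> Prop) l : (forall z, Q z -> P z) -> covers D P l -> covers D Q l.
Proof. intros H [A B]. split; auto. Qed.

Lemma covers_rsum D P l l' (F : C -> R) : covers D P l -> covers D P l' ->
  (forall a, D a = 0%Z \/ ~ P a -> F a = 0) -> rsum l F = rsum l' F.
Proof.
  intros [N1 C1] [N2 C2] HF.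
  set (Q := fun a => D a <> 0%Z /\ P a).
  assert (K : forall l, rsum l F = rsum (fil Q l) F).
  { intros l0. rewrite (rsum_split Q), (rsum_0 (fil (fun a => ~ Q a) l0)); [ring|].
    intros a Ha. apply fil_In in Ha. apply HF. unfold Q in Ha. destruct (Z.eq_dec (D a) 0); tauto. }
  rewrite (K l), (K l'). apply rsum_perm, NoDup_same_perm; try apply fil_NoDup; auto.
  intros a. rewrite !fil_In. unfold Q. split; intros [A [B B']]; auto.
Qed.

Lemma covers_csum D P l l' (F : C -> C) : covers D P l -> covers D P l' ->
  (forall a, D a = 0%Z \/ ~ P a -> F a = 0) -> csum l F = csum l' F.
Proof.
  intros H1 H2 HF. apply injective_projections.
  - rewrite !csum_fst. apply (covers_rsum D P); auto. intros a Ha. rewrite (HF a Ha). reflexivity.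
  - rewrite !csum_snd. apply (covers_rsum D P); auto. intros a Ha. rewrite (HF a Ha). reflexivity.
Qed.

Definition lst (D : C -> Z) (rho : R) : list C := supp_list D (fun z => Cmod z < rho).

Lemma bounded_lst rho : bounded_pred (fun z => Cmod z < rho).
Proof. exists 0, rho. intros z Hz. replace (z - 0)%C with z by ring. lra. Qed.

Lemma lst_supp (D : C -> Z) rho : divisor D -> supp D (fun z => Cmod z < rho) (lst D rho).
Proof. intros HD. apply supp_list_spec; auto. apply bounded_lst. Qed.

Lemma lst_covers_disc (D : C -> Z) rho c r : divisor D -> Cmod c + r <= rho ->
  covers D (fun z => Cmod (z - c) < r) (lst D rho).
Proof.
  intros HD H. apply (covers_sub D (fun z => Cmod z < rho)); [|apply supp_covers, lst_supp, HD].
  intros z Hz. pose proof (Cmod_tri_inv z c). lra.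
Qed.

(* Lr r s is the integral of 1_{s<t}/t over [1,r]. *)
Definition m1 (s : R) : R := Rmax 1 s.
Definition Lr (r s : R) : R := ln (Rmax r (m1 s)) - ln (m1 s).

Lemma m1_ge1 s : 1 <= m1 s.
Proof. apply Rmax_l. Qed.
Lemma m1_ge s : s <= m1 s.
Proof. apply Rmax_r. Qed.

Lemma Lr_0 r s : 1 <= r -> r <= s -> Lr r s = 0.
Proof. intros H1 H2. unfold Lr. rewrite Rmax_right; [ring|]. pose proof (m1_ge s). lra. Qed.

Lemma Rmax_m1 r s : 1 <= r -> Rmax r (m1 s) = Rmax r s.
Proof. intros. unfold m1, Rmax. repeat destruct (Rle_dec _ _); lra. Qed.

(* Conditions (d) and (e) with the integrals evaluated; points of [l] outside the disc do not contribute. *)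
Definition dsum_bound (D : C -> Z) (K : R) : Prop := 0 <= K /\
  forall c r l, 1 <= r -> covers D (fun z => Cmod (z - c) < r) l ->
    Rabs (rsum l (fun a => IZR (D a) * Lr r (Cmod (a - c)))) <= K.

Definition esum_bound (D : C -> Z) (K : R) : Prop := 0 <= K /\
  forall c r l, 1 <= r -> covers D (fun z => Cmod (z - c) < r) l ->
    Cmod (csum l (fun a => RtoC (IZR (D a) * Lr r (Cmod (a - c))) * (a - c))%C) <= K * r.

(** Between the radii [r] and [r + 1] the sum in (d) changes by the net count times [ln ((r+1)/r)],
    up to the points with [r <= |a-c| <= r + 1]; these are O(r) many and contribute at most [1/r]
    each. As the logarithm is at least [1/(r+1)], zeros and poles balance up to O(r) in a disc of
    radius [r]. *)
Lemma card_linear (D : C -> Z) (K K1 : R) : count_bound D 1 K -> dsum_bound D K1 ->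
  exists M, 0 <= M /\ forall c r l, 1 <= r -> NoDup l -> covers D (fun z => Cmod (z - c) < r + 1) l ->
    Rabs (rsum l (fun a => IZR (D a) * indic (Cmod (a - c) < r))) <= M * r.
Proof.
  intros HC [HK1 HD]. assert (HK := proj1 HC).
  exists (2 * (2 * K1 + 3 * (28 * K * 3))). split; [nra|]. intros c r l Hr Hl Hcov.
  assert (A := HD c (r + 1) l ltac:(lra) Hcov).
  assert (B := HD c r l Hr (covers_sub D _ _ l (fun z (Hz : Cmod (z - c) < r) => Rlt_trans _ _ (r+1) Hz ltac:(lra)) Hcov)).
  set (n := rsum l (fun a => IZR (D a) * indic (Cmod (a - c) < r))).
  set (dl := ln (r + 1) - ln r).
  assert (Hln : forall x, r <= x <= r + 1 -> 0 <= ln (r + 1) - ln x <= / r).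
  { intros x Hx. split; [assert (ln x <= ln (r + 1)) by (apply Rcomplements.ln_le; lra); lra|].
    rewrite <- ln_div by lra. assert (L : ln ((r + 1) / x) <= (r + 1) / x - 1).
    { assert (H0 : 0 < (r + 1) / x) by (apply Rdiv_lt_0_compat; lra).
      assert (X := exp_ineq1_le (ln ((r + 1) / x))). rewrite exp_ln in X by auto. lra. }
    eapply Rle_trans; [exact L|]. apply Rmult_le_reg_r with (x * r); [nra|].
    replace (((r + 1) / x - 1) * (x * r)) with ((r + 1 - x) * r) by (field; lra).
    replace (/ r * (x * r)) with x by (field; lra). nra. }
  assert (Hdl : / (r + 1) <= dl).
  { unfold dl. assert (X : ln (r / (r + 1)) <= r / (r + 1) - 1).
    { assert (H0 : 0 < r / (r + 1)) by (apply Rdiv_lt_0_compat; lra).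
      assert (X := exp_ineq1_le (ln (r / (r + 1)))). rewrite exp_ln in X by auto. lra. }
    rewrite ln_div in X by lra. replace (r / (r + 1) - 1) with (- / (r + 1)) in X by (field; lra). lra. }
  set (An := fun a => r <= Cmod (a - c) <= r + 1).
  assert (E : Rabs (dl * n - rsum l (fun a => IZR (D a) * Lr (r + 1) (Cmod (a - c))) + rsum l (fun a => IZR (D a) * Lr r (Cmod (a - c)))) <= / r * rsum (fil An l) (absD D)).
  { unfold n. rewrite <- rsum_scal, <- rsum_minus, <- rsum_plus, <- rsum_scal, rsum_fil.
    eapply Rle_trans; [apply rsum_Rabs|]. apply rsum_le. intros a _. set (s := Cmod (a - c)).
    assert (Hs : 0 <= s) by apply Cmod_ge_0.
    assert (Hm := m1_ge1 s). assert (Hm2 := m1_ge s).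
    replace (dl * (IZR (D a) * indic (s < r)) - IZR (D a) * Lr (r + 1) s + IZR (D a) * Lr r s)
      with (IZR (D a) * (dl * indic (s < r) - (Lr (r + 1) s - Lr r s))) by ring.
    rewrite Rabs_mult. fold (absD D a).
    destruct (Rlt_le_dec s r) as [H|H].
    - rewrite indic_true by auto. unfold Lr.
      assert (m1 s <= r) by (apply Rmax_lub; lra). rewrite !Rmax_left by lra.
      replace (dl * 1 - (ln (r + 1) - ln (m1 s) - (ln r - ln (m1 s)))) with 0 by (unfold dl; ring).
      rewrite Rabs_R0, Rmult_0_r. apply Rmult_le_pos; [unfold indic; destruct (excluded_middle_informative _); lra|].
      apply Rmult_le_pos; [left; apply Rinv_0_lt_compat; lra|apply absD_pos].
    - rewrite (indic_false (s < r)) by lra. rewrite (Lr_0 r s) by lra.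
      destruct (Rle_lt_dec s (r + 1)) as [H'|H'].
      + rewrite (indic_true (An a)) by (unfold An; fold s; lra).
        assert (Hm3 : m1 s = s) by (unfold m1; apply Rmax_right; lra).
        unfold Lr. rewrite Hm3, Rmax_left by lra. specialize (Hln s ltac:(lra)).
        replace (dl * 0 - (ln (r + 1) - ln s - 0)) with (- (ln (r + 1) - ln s)) by ring.
        rewrite Rabs_Ropp, Rabs_pos_eq by lra. pose proof (absD_pos D a). nra.
      + rewrite (indic_false (An a)) by (unfold An; fold s; lra). rewrite (Lr_0 (r + 1) s) by lra.
        replace (dl * 0 - (0 - 0)) with 0 by ring. rewrite Rabs_R0. lra. }
  assert (F : rsum (fil An l) (absD D) <= (INR 2 + 1) * (28 * K * (r + INR 2 / 2 + 1))).
  { apply (count_annulus D K c r 2); auto; [lra|apply fil_NoDup, Hl|]. intros a Ha. apply fil_In in Ha.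
    unfold An in Ha. simpl. lra. }
  simpl in F.
  assert (F2 : / r * rsum (fil An l) (absD D) <= 3 * (28 * K * 3)).
  { apply Rmult_le_reg_l with r; [lra|]. rewrite <- Rmult_assoc, Rinv_r by lra. nra. }
  apply Rcomplements.Rabs_le_between in A. apply Rcomplements.Rabs_le_between in B.
  assert (G : Rabs (dl * n) <= 2 * K1 + 3 * (28 * K * 3)).
  { apply Rcomplements.Rabs_le_between in E. apply Rabs_le. lra. }
  assert (Hdl0 : 0 < / (r + 1)) by (apply Rinv_0_lt_compat; lra).
  rewrite Rabs_mult, Rabs_pos_eq in G by lra.
  assert (G2 : / (r + 1) * Rabs n <= 2 * K1 + 3 * (28 * K * 3)).
  { eapply Rle_trans; [|exact G]. apply Rmult_le_compat_r; [apply Rabs_pos|exact Hdl]. }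
  apply Rmult_le_compat_l with (r := r + 1) in G2; [|lra].
  rewrite <- Rmult_assoc, Rinv_r, Rmult_1_l in G2 by lra. nra.
Qed.

(** [r^2 kap r s] is the integral of [2 t Lr t s] for [t] from 1 to [r], so bounds on sums of [Lr]
    pass to [kap]. For [s >= 1] it equals [kk r s - ln s], which makes it the link between (d) and
    disc averages. *)
Definition kap (r s : R) : R :=
  ln (Rmax r (m1 s)) - ln (m1 s) - 1/2 + (m1 s)^2 / (2 * (Rmax r (m1 s))^2).

(* d/dr (r^2 kap) = 2 r Lr *)
Lemma kap_bound (D : C -> Z) (K1 : R) : dsum_bound D K1 ->
  forall c r l, 1 <= r -> covers D (fun z => Cmod (z - c) < r) l ->
    Rabs (rsum l (fun a => IZR (D a) * kap r (Cmod (a - c)))) <= K1.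
Proof.
  intros [HK1 HD] c r l Hr Hcov.
  set (F := fun m t M : R => t^2 * (ln M - ln m) - t^2/2 + t^2 * m^2 / (2 * M^2)).
  set (Y := fun t => rsum l (fun a => IZR (D a) * F (m1 (Cmod (a - c))) t (Rmax t (m1 (Cmod (a - c)))))).
  assert (HY : Rabs (Y r - Y 1) <= K1 * r^2 - K1 * 1^2).
  { apply (mvt_dom Y (fun t => rsum l (fun a => IZR (D a) * (2 * t * Lr t (Cmod (a - c))))) (fun t => K1 * t^2) (fun t => K1 * (2 * t))); auto.
    - intros t Ht. apply is_derive_rsum. intros a _. apply is_derive_scal.
      set (m := m1 (Cmod (a - c))). assert (Hm := m1_ge1 (Cmod (a - c))). fold m in Hm.
      unfold Lr. fold m. apply glue_derive.
      + intros Htm. rewrite Rmax_right by auto. unfold F. auto_derive; [auto|]. field. lra.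
      + intros Htm. rewrite Rmax_left by auto. unfold F. auto_derive.
        * repeat split; auto; try lra. apply Rgt_not_eq, Rmult_lt_0_compat; [lra|]. nra.
        * field. lra.
    - intros t Ht. auto_derive; auto. ring.
    - intros t Ht. rewrite (rsum_ext l _ (fun a => 2 * t * (IZR (D a) * Lr t (Cmod (a - c))))) by (intros; ring).
      rewrite rsum_scal, Rabs_mult, Rabs_pos_eq by lra.
      assert (A := HD c t l (proj1 Ht)). rewrite (Rmult_comm K1). apply Rmult_le_compat_l; [lra|]. apply A.
      apply (covers_sub D (fun z => Cmod (z - c) < r)); auto. intros; lra. }
  assert (HY1 : Y 1 = 0).
  { unfold Y. apply rsum_0. intros a _. unfold F. set (m := m1 (Cmod (a - c))).
    assert (Hm : 1 <= m) by apply m1_ge1. rewrite Rmax_right by auto. field. lra. }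
  assert (HYr : Y r = r^2 * rsum l (fun a => IZR (D a) * kap r (Cmod (a - c)))).
  { unfold Y. rewrite <- rsum_scal. apply rsum_ext. intros a _. unfold F, kap.
    set (m := m1 (Cmod (a - c))). assert (Hm : 1 <= m) by apply m1_ge1.
    assert (r <= Rmax r m) by apply Rmax_l. field. lra. }
  rewrite HY1, HYr, Rminus_0_r, Rabs_mult, Rabs_pos_eq in HY by nra.
  assert (0 < r^2) by nra. set (q := Rabs _) in *.
  apply Rmult_le_reg_l with (r^2); auto. nra.
Qed.

Definition qk (r1 r2 s : R) : R := / (Rmax r1 s)^2 - / (Rmax r2 s)^2.

(** Integration by parts in [t]: the function [/ m^2 - / max(t,m)^2 - 2 Lr t / t^2] has derivative
    [4 Lr t / t^3]. The bound [K2 t] on the sums with [Lr] makes the sums of the latter at most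
    [4 K2 / t^2], integrable up to infinity, and the boundary terms at most [2 K2 / t]. In the
    application [p] is a coordinate of [a - c]. *)
Lemma q_comp_bound (D : C -> Z) (K2 : R) (c : C) (p : C -> R) (l : list C) (r1 r2 : R) : 0 <= K2 -> 1 <= r1 -> r1 <= r2 ->
  (forall t, r1 <= t <= r2 -> Rabs (rsum l (fun a => IZR (D a) * Lr t (Cmod (a - c)) * p a)) <= K2 * t) ->
  Rabs (rsum l (fun a => IZR (D a) * qk r1 r2 (Cmod (a - c)) * p a)) <= 8 * K2 / r1.
Proof.
  intros HK H1 H12 HE.
  set (F := fun m t M : R => / m^2 - / M^2 - 2 * (ln M - ln m) / t^2).
  set (Y := fun t => rsum l (fun a => IZR (D a) * p a * F (m1 (Cmod (a - c))) t (Rmax t (m1 (Cmod (a - c)))))).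
  assert (HY : Rabs (Y r2 - Y r1) <= - (4 * K2) / r2 - (- (4 * K2) / r1)).
  { apply (mvt_dom Y (fun t => rsum l (fun a => IZR (D a) * p a * (4 * Lr t (Cmod (a - c)) / t^3))) (fun t => - (4 * K2) / t) (fun t => 4 * K2 / t^2)); auto.
    - intros t Ht. apply is_derive_rsum. intros a _. apply is_derive_scal.
      set (m := m1 (Cmod (a - c))). assert (Hm := m1_ge1 (Cmod (a - c))). fold m in Hm.
      unfold Lr. fold m. apply glue_derive.
      + intros Htm. rewrite Rmax_right by auto. unfold F. auto_derive; [nra|]. field. lra.
      + intros Htm. rewrite Rmax_left by auto. unfold F. auto_derive.
        * repeat split; nra.
        * field. lra.
    - intros t Ht. auto_derive; [lra|]. field. lra.
    - intros t Ht. rewrite (rsum_ext l _ (fun a => 4 / t^3 * (IZR (D a) * Lr t (Cmod (a - c)) * p a))) by (intros; field; lra).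
      assert (Ht3 : 0 < t^3) by (apply pow_lt; lra).
      rewrite rsum_scal, Rabs_mult, Rabs_pos_eq by (apply Rdiv_le_0_compat; lra).
      replace (4 * K2 / t^2) with (4 / t^3 * (K2 * t)) by (field; lra).
      apply Rmult_le_compat_l; [apply Rdiv_le_0_compat; lra|]. apply HE, Ht. }
  assert (HYe : forall t, r1 <= t -> Y t = rsum l (fun a => IZR (D a) * p a * (/ (m1 (Cmod (a - c)))^2 - / (Rmax t (Cmod (a - c)))^2))
     - 2 / t^2 * rsum l (fun a => IZR (D a) * Lr t (Cmod (a - c)) * p a)).
  { intros t Ht. rewrite <- rsum_scal, <- rsum_minus. apply rsum_ext. intros a _. unfold F, Lr.
    rewrite Rmax_m1 by lra. set (m := m1 (Cmod (a - c))). assert (Hm : 1 <= m) by apply m1_ge1.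
    assert (t <= Rmax t (Cmod (a - c))) by apply Rmax_l. field. lra. }
  rewrite (HYe r1), (HYe r2) in HY by lra.
  assert (E : rsum l (fun a => IZR (D a) * qk r1 r2 (Cmod (a - c)) * p a) =
    rsum l (fun a => IZR (D a) * p a * (/ (m1 (Cmod (a - c)))^2 - / (Rmax r2 (Cmod (a - c)))^2))
    - rsum l (fun a => IZR (D a) * p a * (/ (m1 (Cmod (a - c)))^2 - / (Rmax r1 (Cmod (a - c)))^2))).
  { rewrite <- rsum_minus. apply rsum_ext. intros. unfold qk. ring. }
  rewrite E. set (A := rsum l _) in *. set (B := rsum l _) in *.
  assert (G1 := HE r1 ltac:(lra)). assert (G2 := HE r2 ltac:(lra)).
  set (e1 := rsum l (fun a => IZR (D a) * Lr r1 (Cmod (a - c)) * p a)) in *.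
  set (e2 := rsum l (fun a => IZR (D a) * Lr r2 (Cmod (a - c)) * p a)) in *.
  assert (T : forall t e, r1 <= t -> Rabs e <= K2 * t -> Rabs (2 / t^2 * e) <= 2 * K2 / t).
  { intros t e Ht He. assert (Ht2 : 0 < t^2) by (apply pow_lt; lra).
    rewrite Rabs_mult, Rabs_pos_eq by (apply Rdiv_le_0_compat; lra).
    replace (2 * K2 / t) with (2 / t^2 * (K2 * t)) by (field; lra).
    apply Rmult_le_compat_l; [apply Rdiv_le_0_compat; lra|auto]. }
  assert (T1 := T r1 e1 ltac:(lra) G1). assert (T2 := T r2 e2 ltac:(lra) G2).
  apply Rcomplements.Rabs_le_between in T1, T2, HY.
  assert (I0 : 0 <= / r2) by (left; apply Rinv_0_lt_compat; lra).
  assert (I1 : / r2 <= / r1) by (apply Rinv_le_contravar; lra).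
  assert (I3 : 0 <= K2 * / r2) by (apply Rmult_le_pos; auto).
  assert (I4 : K2 * / r2 <= K2 * / r1) by (apply Rmult_le_compat_l; auto).
  unfold Rdiv in *. apply Rabs_le. lra.
Qed.

(** The term [D(a) conj(a-c) / max(r,|a-c|)^2] at [r = r1] minus the same at [r = r2]; the
    difference vanishes for [|a-c| >= r2], which makes the sum over the divisor finite. *)
Definition qterm (D : C -> Z) (c : C) (r1 r2 : R) (a : C) : C :=
  (RtoC (IZR (D a) * qk r1 r2 (Cmod (a - c))) * Cconj (a - c))%C.

Lemma q_bound (D : C -> Z) (K2 : R) : esum_bound D K2 ->
  forall c r1 r2 l, 1 <= r1 -> r1 <= r2 -> covers D (fun z => Cmod (z - c) < r2) l ->
    Cmod (csum l (qterm D c r1 r2)) <= 16 * K2 / r1.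
Proof.
  intros [HK HE] c r1 r2 l H1 H12 Hcov.
  assert (HE' : forall t, r1 <= t <= r2 -> Cmod (csum l (fun a => RtoC (IZR (D a) * Lr t (Cmod (a - c))) * (a - c))%C) <= K2 * t).
  { intros t Ht. apply HE; [lra|]. apply (covers_sub D (fun z => Cmod (z - c) < r2)); auto. intros; lra. }
  assert (A := q_comp_bound D K2 c (fun a => fst (a - c)%C) l r1 r2 HK H1 H12).
  assert (B := q_comp_bound D K2 c (fun a => snd (a - c)%C) l r1 r2 HK H1 H12).
  replace (16 * K2 / r1) with (8 * K2 / r1 + 8 * K2 / r1) by (field; lra).
  eapply Rle_trans; [apply Cmod_le_sum|]. rewrite csum_fst, csum_snd. apply Rplus_le_compat.
  - erewrite rsum_ext; [apply A|].
    + intros t Ht. eapply Rle_trans; [|apply (HE' t Ht)]. eapply Rle_trans; [|apply fst_le_Cmod].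
      rewrite csum_fst. right. f_equal. apply rsum_ext. intros. simpl. ring.
    + intros. unfold qterm. simpl. ring.
  - rewrite <- Rabs_Ropp. replace (- rsum l (fun a => snd (qterm D c r1 r2 a)))
      with (rsum l (fun a => IZR (D a) * qk r1 r2 (Cmod (a - c)) * snd (a - c)%C)).
    2:{ rewrite <- (Rmult_1_l (rsum l (fun a => snd _))), Ropp_mult_distr_l, <- rsum_scal. apply rsum_ext.
        intros. unfold qterm. simpl. ring. }
    apply B. intros t Ht. eapply Rle_trans; [|apply (HE' t Ht)]. eapply Rle_trans; [|apply snd_le_Cmod].
    rewrite csum_snd. right. f_equal. apply rsum_ext. intros. simpl. ring.
Qed.

Lemma lst_fil_perm (D : C -> Z) r1 r2 : divisor D -> r1 <= r2 ->
  Permutation (lst D r1) (fil (fun a => Cmod a < r1) (lst D r2)).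
Proof.
  intros HD H. apply (supp_perm D (fun a => Cmod a < r1)); [apply lst_supp, HD|].
  apply (supp_fil D (fun a => Cmod a < r2)); [apply lst_supp, HD|]. intros; lra.
Qed.

Lemma lst_diff (D : C -> Z) r1 r2 F : divisor D -> r1 <= r2 ->
  (csum (lst D r2) F - csum (lst D r1) F)%C = csum (fil (fun a => ~ Cmod a < r1) (lst D r2)) F.
Proof.
  intros HD H. rewrite (csum_perm _ _ _ (lst_fil_perm D r1 r2 HD H)).
  rewrite (csum_perm _ _ _ (fil_perm (fun a => Cmod a < r1) (lst D r2))) at 1. rewrite csum_app. ring.
Qed.

Lemma lst_In (D : C -> Z) r a : divisor D -> (In a (lst D r) <-> D a <> 0%Z /\ Cmod a < r).
Proof. intros HD. apply (lst_supp D r HD). Qed.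

(** The conjugated gradient field of the disc averages, to be cut off at [|a| < rho] about the
    origin whatever [c] is. The correction [conj a / rho^2] is the one in the definition of [alpha];
    it makes the sum agree, up to O(1/rho), with one cut off continuously about [c]. *)
Definition gterm (D : C -> Z) (c : C) (r rho : R) (a : C) : C :=
  (RtoC (IZR (D a)) * (RtoC (/ (Rmax r (Cmod (a - c)))^2) * Cconj (a - c) - RtoC (/ rho^2) * Cconj a))%C.

Definition gam (D : C -> Z) (c : C) (r rho : R) : C := csum (lst D rho) (gterm D c r rho).

Section Estimates.
Variables (D : C -> Z) (K K1 K2 : R).
Hypotheses (HD : divisor D) (HC : count_bound D 1 K) (Hd : dsum_bound D K1) (He : esum_bound D K2).

Lemma inv_sq_diff (x y : R) : 0 < x -> x <= y -> y * (/ x^2 - / y^2) <= 2 * (y - x) / x^2.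
Proof.
  intros Hx Hxy. replace (y * (/ x^2 - / y^2)) with ((y - x) * ((y + x) / y) / x^2) by (field; lra).
  apply Rmult_le_compat_r; [left; apply Rinv_0_lt_compat, pow_lt, Hx|].
  rewrite Rmult_comm. apply Rmult_le_compat_r; [lra|].
  apply Rmult_le_reg_r with y; [lra|]. unfold Rdiv. rewrite Rmult_assoc, Rinv_l; lra.
Qed.

Lemma gamma_q (B : R) : 0 <= B -> exists G, 0 <= G /\ forall c r rho, Cmod c <= B -> 1 <= r -> r + 2 * B + 1 <= rho ->
  Cmod (gam D c r rho - csum (lst D (rho + B + 1)) (qterm D c r rho)) <= G / rho.
Proof.
  intros HB. destruct (card_linear D K K1 HC Hd) as [M [HM0 HM]]. assert (HK := proj1 HC).
  (* [m] annuli of width 1/2 cover the width [2 B]. *)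
  destruct (INR_unbounded (4 * B)) as [m Hm]. assert (Hm0 := pos_INR m).
  set (N := (INR m + 1) * (28 * K * (INR m + 2))).
  assert (HN : 0 <= N) by (unfold N; repeat apply Rmult_le_pos; lra).
  exists (B * M + 4 * B * N). split; [assert (0 <= B * M) by (apply Rmult_le_pos; auto); assert (0 <= B * N) by (apply Rmult_le_pos; auto); lra|].
  intros c r rho Hc Hr Hrho. set (l := lst D (rho + B + 1)).
  unfold gam. rewrite (csum_perm _ _ _ (lst_fil_perm D rho (rho + B + 1) HD ltac:(lra))), csum_fil. fold l.
  rewrite <- csum_minus.
  set (n := rsum l (fun a => IZR (D a) * indic (Cmod (a - 0) < rho))).
  (* The added term compensates the shift by [c], so that [U a = 0] unless [a] lies between the two
     cut-off circles. *)
  set (U := fun a => (RtoC (indic (Cmod a < rho)) * gterm D c r rho a - qterm D c r rho a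
      + RtoC (IZR (D a) * indic (Cmod (a - 0) < rho)) * (RtoC (/ rho^2) * Cconj c))%C).
  assert (E : csum l (fun a => RtoC (indic (Cmod a < rho)) * gterm D c r rho a - qterm D c r rho a)%C
     = (csum l U - RtoC n * (RtoC (/ rho^2) * Cconj c))%C).
  { unfold U. rewrite csum_plus.
    rewrite (csum_ext l (fun a => RtoC (IZR (D a) * indic (Cmod (a - 0) < rho)) * (RtoC (/ rho^2) * Cconj c))%C
      (fun a => (RtoC (/ rho^2) * Cconj c) * RtoC (IZR (D a) * indic (Cmod (a - 0) < rho)))%C) by (intros; ring).
    rewrite csum_scal.
    replace (csum l (fun a => RtoC (IZR (D a) * indic (Cmod (a - 0) < rho)))) with (RtoC n); [ring|].
    apply injective_projections; [rewrite csum_fst; reflexivity|rewrite csum_snd; simpl; symmetry; apply rsum_0; auto]. }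
  rewrite E.
  set (An := fun a : C => rho - B <= Cmod (a - 0) <= rho + B).
  assert (HU : forall a, Cmod (U a) <= 4 * B / rho^2 * (indic (An a) * absD D a)).
  { intros a. unfold U, gterm, qterm, qk. set (s := Cmod (a - c)).
    assert (Hs : 0 <= s) by apply Cmod_ge_0.
    assert (Ea : (a - 0 = a)%C) by ring. rewrite Ea.
    assert (T1 := Cmod_tri_inv a c). fold s in T1.
    assert (T2 : s <= Cmod a + Cmod c) by apply Cmod_tri_sub.
    assert (Hr2 : 0 < rho^2) by (apply pow_lt; lra).
    assert (Hc0 := Cmod_ge_0 c).
    assert (HD0 := absD_pos D a).
    assert (Hind : forall P, 0 <= indic P) by (intros; unfold indic; destruct (excluded_middle_informative P); lra).
    assert (Ecc : Cconj (a - c) = (Cconj a - Cconj c)%C) by (apply injective_projections; simpl; ring).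
    assert (Hcj : Cmod (Cconj (a - c)) = s) by apply Cmod_conj.
    assert (Hpos : 0 <= 4 * B / rho^2) by (apply Rdiv_le_0_compat; lra).
    destruct (Rlt_le_dec (Cmod a) rho) as [Ha|Ha].
    - rewrite (indic_true (Cmod a < rho)) by auto.
      replace (1 * (RtoC (IZR (D a)) * (RtoC (/ (Rmax r s)^2) * Cconj (a - c) - RtoC (/ rho^2) * Cconj a))
        - RtoC (IZR (D a) * (/ (Rmax r s)^2 - / (Rmax rho s)^2)) * Cconj (a - c)
        + RtoC (IZR (D a) * 1) * (RtoC (/ rho^2) * Cconj c))%C
      with (RtoC (IZR (D a)) * (RtoC (/ (Rmax rho s)^2 - / rho^2) * Cconj (a - c)))%C.
      2:{ rewrite Ecc, !RtoC_mult, !RtoC_minus. ring. }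
      rewrite !Cmod_mult, !Cmod_R, Hcj. fold (absD D a).
      destruct (Rle_lt_dec s rho) as [H|H].
      + rewrite Rmax_left by auto. rewrite Rminus_eq_0, Rabs_R0, Rmult_0_l, Rmult_0_r.
        apply Rmult_le_pos; auto. apply Rmult_le_pos; auto.
      + rewrite (indic_true (An a)) by (unfold An; rewrite Ea; lra).
        rewrite Rmax_right by lra. rewrite Rabs_left1.
        2:{ assert (/ s^2 <= / rho^2) by (apply Rinv_le_contravar; auto; apply pow_incr; lra). lra. }
        rewrite Rmult_1_l. rewrite Rmult_comm. apply Rmult_le_compat_r; auto.
        assert (Q := inv_sq_diff rho s ltac:(lra) ltac:(lra)).
        replace (- (/ s^2 - / rho^2) * s) with (s * (/ rho^2 - / s^2)) by ring.
        eapply Rle_trans; [exact Q|]. apply Rmult_le_compat_r; [left; apply Rinv_0_lt_compat; lra|lra].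
    - rewrite (indic_false (Cmod a < rho)) by lra.
      replace (0 * (RtoC (IZR (D a)) * (RtoC (/ (Rmax r s)^2) * Cconj (a - c) - RtoC (/ rho^2) * Cconj a))
        - RtoC (IZR (D a) * (/ (Rmax r s)^2 - / (Rmax rho s)^2)) * Cconj (a - c)
        + RtoC (IZR (D a) * 0) * (RtoC (/ rho^2) * Cconj c))%C
      with (RtoC (IZR (D a)) * (RtoC (/ (Rmax rho s)^2 - / (Rmax r s)^2) * Cconj (a - c)))%C.
      2:{ rewrite Ecc, !RtoC_mult, !RtoC_minus. ring. }
      rewrite !Cmod_mult, !Cmod_R, Hcj. fold (absD D a).
      assert (Hsr : r <= s) by lra. rewrite (Rmax_right r s) by auto.
      destruct (Rle_lt_dec rho s) as [H|H].
      + rewrite Rmax_right by auto. rewrite Rminus_eq_0, Rabs_R0, Rmult_0_l, Rmult_0_r.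
        apply Rmult_le_pos; auto. apply Rmult_le_pos; auto.
      + rewrite (indic_true (An a)) by (unfold An; rewrite Ea; lra).
        rewrite Rmax_left by lra. rewrite Rabs_left1.
        2:{ assert (/ rho^2 <= / s^2) by (apply Rinv_le_contravar; [apply pow_lt; lra|apply pow_incr; lra]). lra. }
        rewrite Rmult_1_l. rewrite Rmult_comm. apply Rmult_le_compat_r; auto.
        assert (Hs1 : 0 < s) by lra.
        replace (- (/ rho^2 - / s^2) * s) with ((rho - s) * ((rho + s) / s) / rho^2) by (field; lra).
        apply Rmult_le_compat_r; [left; apply Rinv_0_lt_compat; lra|].
        assert ((rho + s) / s <= 4).
        { apply Rmult_le_reg_r with s; auto. unfold Rdiv. rewrite Rmult_assoc, Rinv_l; lra. }
        assert (0 <= (rho + s) / s) by (apply Rdiv_le_0_compat; lra).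
        rewrite (Rmult_comm 4). apply Rmult_le_compat; lra. }
  assert (HcU : Cmod (csum l U) <= 4 * B / rho^2 * (N * rho)).
  { eapply Rle_trans; [apply csum_Cmod|]. eapply Rle_trans; [apply rsum_le; intros a _; apply HU|].
    rewrite rsum_scal. apply Rmult_le_compat_l; [apply Rdiv_le_0_compat; [lra|apply pow_lt; lra]|].
    rewrite <- rsum_fil.
    eapply Rle_trans; [apply (count_annulus D K 0 (rho - B) m); auto; [lra|apply fil_NoDup, lst_supp, HD|]|].
    - intros a Ha. apply fil_In in Ha. unfold An in Ha. lra.
    - unfold N. rewrite !Rmult_assoc. repeat (apply Rmult_le_compat_l; [lra|]). nra. }
  assert (Hn : Rabs n <= M * rho).
  { apply HM; [lra|apply lst_supp, HD|]. apply lst_covers_disc; auto. rewrite Cmod_0. lra. }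
  eapply Rle_trans; [apply Cmod_tri_sub|]. rewrite !Cmod_mult, !Cmod_R, Cmod_conj.
  assert (Hr2 : 0 < / rho^2) by (apply Rinv_0_lt_compat, pow_lt; lra).
  rewrite (Rabs_pos_eq (/ rho^2)) by lra.
  assert (Z : Rabs n * (/ rho^2 * Cmod c) <= (M * rho) * (/ rho^2 * B)).
  { apply Rmult_le_compat; auto; [apply Rabs_pos|apply Rmult_le_pos; [lra|apply Cmod_ge_0]|apply Rmult_le_compat_l; lra]. }
  replace ((B * M + 4 * B * N) / rho) with (4 * B / rho^2 * (N * rho) + (M * rho) * (/ rho^2 * B)) by (field; lra).
  lra.
Qed.

Lemma gamma_bound (B : R) : 0 <= B -> exists G, 0 <= G /\ forall c r rho, Cmod c <= B -> 1 <= r -> r + 2 * B + 1 <= rho ->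
  Cmod (gam D c r rho) <= 16 * K2 / r + G / rho.
Proof.
  intros HB. destruct (gamma_q B HB) as [G [HG1 HG]]. exists G. split; auto. intros c r rho H1 H2 H3.
  assert (A := HG c r rho H1 H2 H3).
  assert (Q := q_bound D K2 He c r rho (lst D (rho + B + 1)) H2 ltac:(lra)).
  specialize (Q (lst_covers_disc D (rho + B + 1) c rho HD ltac:(lra))).
  pose proof (Cmod_tri_inv (gam D c r rho) (csum (lst D (rho + B + 1)) (qterm D c r rho))). lra.
Qed.

(* kk r |a-c| is the mean of ln|z-a| over the disc B(c,r). Its gradient in c is, up to sign and conjugation, the first summand of [gterm]. *)
Definition kk (r s : R) : R := / 2 * ln (Rmax (s^2) (r^2)) - / 2 + s^2 / (2 * Rmax (s^2) (r^2)).

Lemma Rmax_sq (r s : R) : 0 <= r -> 0 <= s -> Rmax (s^2) (r^2) = (Rmax r s)^2.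
Proof. intros. unfold Rmax. destruct (Rle_dec (s^2) (r^2)), (Rle_dec r s); auto; nra. Qed.

(** [gamma_bound] is integrated along the segment from 0 to [c]: at [t c] the sum has derivative
    minus the real part of [c * gam D (t c) r rho]. The term with [rho^2] is the contribution of the
    cut-off correction. *)
Lemma area_bound (B : R) : 0 <= B -> exists G, 0 <= G /\ forall c r rho, Cmod c <= B -> 1 <= r -> r + 2 * B + 1 <= rho ->
  Rabs (rsum (lst D rho) (fun a => IZR (D a) * (kk r (Cmod (a - c)) - kk r (Cmod a) + fst (c * Cconj a)%C / rho^2)))
    <= Cmod c * (16 * K2 / r + G / rho).
Proof.
  intros HB. destruct (gamma_bound B HB) as [G [HG1 HG]]. exists G. split; auto. intros c r rho H1 H2 H3.
  set (l := lst D rho). set (Bd := 16 * K2 / r + G / rho).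
  (* The squared distance is the variable: [|a - t c|] is not differentiable where it vanishes,
     while [kk] is differentiable in the square. *)
  set (S := fun (a : C) t => (fst a - t * fst c)^2 + (snd a - t * snd c)^2).
  assert (HS : forall a t, S a t = (Cmod (a - RtoC t * c))^2).
  { intros. unfold S. transitivity (Cmod (a - RtoC t * c) * Cmod (a - RtoC t * c)); [rewrite Cmod_sqr; simpl|]; ring. }
  set (F := fun s M : R => / 2 * ln M - / 2 + s / (2 * M)).
  set (f := fun t => rsum l (fun a => IZR (D a) * (F (S a t) (Rmax (S a t) (r^2)) - kk r (Cmod a) + t * (fst (c * Cconj a)%C / rho^2)))).
  assert (Hkk : forall a t, F (S a t) (Rmax (S a t) (r^2)) = kk r (Cmod (a - RtoC t * c))).
  { intros. rewrite HS. reflexivity. }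
  assert (A : Rabs (f 1 - f 0) <= Cmod c * Bd * 1 - Cmod c * Bd * 0).
  { apply (mvt_dom f (fun t => - fst (c * gam D (RtoC t * c) r rho)%C) (fun t => Cmod c * Bd * t) (fun _ => Cmod c * Bd)); [lra| | |].
    - intros t Ht. evar_last.
      { apply is_derive_rsum. intros a _. apply is_derive_scal.
        apply (is_derive_plus (K := R_AbsRing) (V := R_NormedModule)
          (fun t => F (S a t) (Rmax (S a t) (r^2)) - kk r (Cmod a)) (fun t => t * (fst (c * Cconj a)%C / rho^2)) t
          (/ (2 * Rmax (S a t) (r^2)) * (- 2 * fst (c * Cconj (a - RtoC t * c))%C)) (fst (c * Cconj a)%C / rho^2)).
        - evar_last.
          { apply (is_derive_minus (K := R_AbsRing) (V := R_NormedModule)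
              (fun t => F (S a t) (Rmax (S a t) (r^2))) (fun _ => kk r (Cmod a)) t
              (/ (2 * Rmax (S a t) (r^2)) * (- 2 * fst (c * Cconj (a - RtoC t * c))%C)) 0).
            - evar_last.
              { apply (is_derive_comp (K := R_AbsRing) (V := R_NormedModule) (fun s => F s (Rmax s (r^2))) (S a) t (/ (2 * Rmax (S a t) (r^2)))
                 (- 2 * fst (c * Cconj (a - RtoC t * c))%C)).
                - assert (Hr2 : 0 < r^2) by (apply pow_lt; lra). apply glue_derive.
                  + intros Hle. rewrite Rmax_right by auto. unfold F. auto_derive; [lra|]. field. lra.
                  + intros Hle. rewrite Rmax_left by auto. unfold F. auto_derive; [repeat split; lra|]. field. lra.
                - unfold S. auto_derive; auto. simpl. ring. }
              unfold scal; simpl; unfold mult; simpl. ring.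
            - auto_derive; auto. }
          unfold minus, plus, opp; simpl. ring.
        - auto_derive; auto. simpl. ring. }
      cbv beta. unfold gam. rewrite <- csum_scal, csum_fst.
      rewrite <- (Rmult_1_l (rsum _ (fun a => fst _))), Ropp_mult_distr_l, <- rsum_scal. apply rsum_ext. intros a _.
      unfold gterm. rewrite HS, Rmax_sq by (try apply Cmod_ge_0; lra).
      set (X := (Rmax r (Cmod (a - RtoC t * c)))^2).
      assert (HX : 0 < X) by (apply pow_lt; eapply Rlt_le_trans; [|apply Rmax_l]; lra).
      unfold plus; simpl. field. split; lra.
    - intros t Ht. auto_derive; auto. ring.
    - intros t Ht. rewrite Rabs_Ropp. eapply Rle_trans; [apply fst_le_Cmod|]. rewrite Cmod_mult.
      apply Rmult_le_compat_l; [apply Cmod_ge_0|]. apply HG; auto.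
      rewrite Cmod_mult, Cmod_R, Rabs_pos_eq by lra. pose proof (Cmod_ge_0 c). nra. }
  assert (F0 : f 0 = 0).
  { unfold f. apply rsum_0. intros a _. rewrite Hkk. replace (a - RtoC 0 * c)%C with a by ring. ring. }
  rewrite F0, Rminus_0_r in A. unfold f in A.
  rewrite (rsum_ext l _ (fun a => IZR (D a) * (kk r (Cmod (a - c)) - kk r (Cmod a) + fst (c * Cconj a)%C / rho^2))) in A.
  - lra.
  - intros a _. rewrite Hkk. replace (a - RtoC 1 * c)%C with (a - c)%C by ring. ring.
Qed.

End Estimates.

(** * Convergence of the compensated sums *)

Lemma Clim_ext (g h : R -> C) (L : C) (M0 : R) : (forall r, r > M0 -> g r = h r) -> Clim_infty g L -> Clim_infty h L.
Proof.
  intros H Hg eps He. destruct (Hg eps He) as [M HM]. exists (Rmax M M0). intros r Hr.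
  rewrite <- H; [apply HM|]; (eapply Rle_lt_trans; [|apply Hr]); [apply Rmax_l|apply Rmax_r].
Qed.

Lemma Clim_plus (g h : R -> C) (L L' : C) : Clim_infty g L -> Clim_infty h L' -> Clim_infty (fun r => g r + h r)%C (L + L')%C.
Proof.
  intros Hg Hh eps He. destruct (Hg (eps/2)) as [M1 HM1]; [lra|]. destruct (Hh (eps/2)) as [M2 HM2]; [lra|].
  exists (Rmax M1 M2). intros r Hr.
  assert (A : r > M1) by (eapply Rle_lt_trans; [apply Rmax_l|exact Hr]).
  assert (B : r > M2) by (eapply Rle_lt_trans; [apply Rmax_r|exact Hr]).
  specialize (HM1 r A). specialize (HM2 r B).
  change (Cmod (g r + h r - (L + L')) < eps). change (Cmod (g r - L) < eps / 2) in HM1. change (Cmod (h r - L') < eps / 2) in HM2.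
  replace (g r + h r - (L + L'))%C with ((g r - L) + (h r - L'))%C by ring.
  eapply Rle_lt_trans; [apply Cmod_triangle|]. lra.
Qed.

Lemma Clim_scal (k : C) (g : R -> C) (L : C) : Clim_infty g L -> Clim_infty (fun r => k * g r)%C (k * L)%C.
Proof.
  intros Hg eps He. assert (Hk := Cmod_ge_0 k). destruct (Hg (eps/(Cmod k + 1))) as [M HM]; [apply Rdiv_lt_0_compat; lra|].
  exists M. intros r Hr. specialize (HM r Hr). change (Cmod (g r - L) < eps / (Cmod k + 1)) in HM.
  change (Cmod (k * g r - k * L) < eps). replace (k * g r - k * L)%C with (k * (g r - L))%C by ring. rewrite Cmod_mult.
  apply Rle_lt_trans with (Cmod k * (eps / (Cmod k + 1))).
  - apply Rmult_le_compat_l; lra.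
  - apply Rlt_le_trans with ((Cmod k + 1) * (eps / (Cmod k + 1))).
    + apply Rmult_lt_compat_r; [apply Rdiv_lt_0_compat; lra|lra].
    + right. field. lra.
Qed.

Lemma Clim_const (k : C) : Clim_infty (fun _ => k) k.
Proof. intros eps He. exists 0. intros. change (Cmod (k - k) < eps). rewrite Cmod_sub_self. exact He. Qed.

Lemma Clim_small (g : R -> C) (G M0 : R) : 0 <= G -> (forall r, r > M0 -> Cmod (g r) <= G / r) -> Clim_infty g (RtoC 0).
Proof.
  intros HG Hg eps He. exists (Rmax (Rmax 1 M0) ((G + 1) / eps)). intros r Hr.
  assert (A1 : Rmax 1 M0 < r) by (eapply Rle_lt_trans; [apply Rmax_l|exact Hr]).
  assert (A2 : (G + 1) / eps < r) by (eapply Rle_lt_trans; [apply Rmax_r|exact Hr]).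
  assert (B1 : 1 < r) by (eapply Rle_lt_trans; [apply Rmax_l|exact A1]).
  assert (B2 : M0 < r) by (eapply Rle_lt_trans; [apply Rmax_r|exact A1]).
  change (Cmod (g r - 0) < eps). replace (g r - 0)%C with (g r) by ring.
  eapply Rle_lt_trans; [apply Hg, B2|].
  apply Rmult_lt_compat_r with (r := eps) in A2; auto. unfold Rdiv in A2. rewrite Rmult_assoc, Rinv_l in A2 by lra.
  apply Rmult_lt_reg_r with r; [lra|]. unfold Rdiv. rewrite Rmult_assoc, Rinv_l by lra. lra.
Qed.

Lemma R_Cauchy_lim (g : R -> R) : (forall eps, 0 < eps -> exists M, forall r1 r2, M < r1 -> r1 <= r2 -> Rabs (g r2 - g r1) < eps) ->
  exists L, forall eps, 0 < eps -> exists M, forall r, r > M -> Rabs (g r - L) < eps.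
Proof.
  intros H. destruct (proj1 (filterlim_locally_cauchy (U := R_CompleteSpace) (F := Rbar_locally p_infty) g)) as [L HL].
  - intros eps. destruct (H eps (cond_pos eps)) as [M HM].
    exists (fun r => M < r). split; [exists M; auto|]. intros u v Hu Hv.
    change (Rabs (g v - g u) < eps). destruct (Rle_lt_dec u v).
    + apply HM; auto.
    + rewrite Rabs_minus_sym. apply HM; auto. lra.
  - exists L. intros eps He. destruct (proj1 (filterlim_locally g L) HL (mkposreal _ He)) as [M HM].
    exists M. intros r Hr. apply HM. exact Hr.
Qed.

Lemma Clim_cauchy (g : R -> C) : (forall eps, 0 < eps -> exists M, forall r1 r2, M < r1 -> r1 <= r2 -> Cmod (g r2 - g r1) < eps) ->
  exists L, Clim_infty g L.
Proof.
  intros H. destruct (R_Cauchy_lim (fun r => fst (g r))) as [L1 HL1].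
  { intros eps He. destruct (H eps He) as [M HM]. exists M. intros r1 r2 H1 H2.
    eapply Rle_lt_trans; [apply (fst_le_Cmod (g r2 - g r1)%C)|]. auto. }
  destruct (R_Cauchy_lim (fun r => snd (g r))) as [L2 HL2].
  { intros eps He. destruct (H eps He) as [M HM]. exists M. intros r1 r2 H1 H2.
    eapply Rle_lt_trans; [apply (snd_le_Cmod (g r2 - g r1)%C)|]. auto. }
  exists (L1, L2). intros eps He.
  destruct (HL1 (eps/2)) as [M1 HM1]; [lra|]. destruct (HL2 (eps/2)) as [M2 HM2]; [lra|].
  exists (Rmax M1 M2). intros r Hr.
  assert (A : r > M1) by (eapply Rle_lt_trans; [apply Rmax_l|exact Hr]).
  assert (B : r > M2) by (eapply Rle_lt_trans; [apply Rmax_r|exact Hr]).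
  specialize (HM1 r A). specialize (HM2 r B).
  change (Cmod (g r - (L1, L2)) < eps). eapply Rle_lt_trans; [apply Cmod_le_sum|]. simpl. unfold Rminus in *. lra.
Qed.

Lemma Clim_cauchy_inv (g : R -> C) (G M0 : R) : 0 <= G ->
  (forall r1 r2, M0 < r1 -> r1 <= r2 -> Cmod (g r2 - g r1) <= G / r1) -> exists L, Clim_infty g L.
Proof.
  intros HG H. apply Clim_cauchy. intros eps He.
  exists (Rmax (Rmax 1 M0) ((G + 1) / eps)). intros r1 r2 H1 H2.
  assert (A1 : Rmax 1 M0 < r1) by (eapply Rle_lt_trans; [apply Rmax_l|exact H1]).
  assert (A2 : (G + 1) / eps < r1) by (eapply Rle_lt_trans; [apply Rmax_r|exact H1]).
  assert (B1 : 1 < r1) by (eapply Rle_lt_trans; [apply Rmax_l|exact A1]).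
  assert (B2 : M0 < r1) by (eapply Rle_lt_trans; [apply Rmax_r|exact A1]).
  eapply Rle_lt_trans; [apply H; auto|].
  apply Rmult_lt_compat_r with (r := eps) in A2; auto. unfold Rdiv in A2. rewrite Rmult_assoc, Rinv_l in A2 by lra.
  apply Rmult_lt_reg_r with r1; [lra|]. unfold Rdiv. rewrite Rmult_assoc, Rinv_l by lra. lra.
Qed.

Section Limits.
Variables (D : C -> Z) (K K1 K2 : R).
Hypotheses (HD : divisor D) (HC : count_bound D 1 K) (Hd : dsum_bound D K1) (He : esum_bound D K2).

(** By [gamma_q] it suffices to treat the sums cut off about [c]; the difference of two of these is
    a sum of [qterm D c r1 r2], at most [16 K2 / r1]. *)
Lemma gam_lim (c : C) : exists L, Clim_infty (fun rho => gam D c 1 rho) L.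
Proof.
  set (B := Cmod c). assert (HB : 0 <= B) by apply Cmod_ge_0. assert (HK2 := proj1 He).
  destruct (gamma_q D K K1 HD HC Hd B HB) as [G [HG1 HG]].
  set (q := fun rho => csum (lst D (rho + B + 1)) (qterm D c 1 rho)).
  destruct (Clim_cauchy_inv q (16 * K2) 1) as [L HL]; [lra| |].
  - intros r1 r2 H1 H2. unfold q.
    assert (Hz : forall r a, 1 <= r -> (D a = 0%Z \/ ~ Cmod (a - c) < r) -> qterm D c 1 r a = 0).
    { intros r a Hr [Ha|Ha]; unfold qterm, qk.
      - rewrite Ha. rewrite Rmult_0_l. ring.
      - rewrite !Rmax_right by lra. replace (IZR (D a) * (/ Cmod (a - c) ^ 2 - / Cmod (a - c) ^ 2)) with 0 by ring. ring. }
    rewrite (covers_csum D (fun z => Cmod (z - c) < r1) (lst D (r1 + B + 1)) (lst D (r2 + B + 1)) (qterm D c 1 r1)).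
    + rewrite <- csum_minus.
      rewrite (csum_ext _ _ (qterm D c r1 r2)).
      * apply q_bound; auto; try lra. apply lst_covers_disc; auto. unfold B. lra.
      * intros a _. unfold qterm, qk. rewrite !RtoC_mult, !RtoC_minus. ring.
    + apply lst_covers_disc; auto. unfold B. lra.
    + apply lst_covers_disc; auto. unfold B. lra.
    + intros a Ha. apply Hz; auto. lra.
  - exists (L + 0)%C. apply (Clim_ext (fun r => q r + (gam D c 1 r - q r))%C _ _ 0).
    + intros. ring.
    + apply Clim_plus; auto. apply (Clim_small _ G (2 * B + 2)); auto.
      intros r Hr. apply HG; unfold B in *; lra.
Qed.

(** Zeros count positively here, so the sums tend to [- alpha]. *)
Definition aterm (rho : R) (a : C) : C := (RtoC (IZR (D a)) * (/ a - RtoC (/ rho^2) * Cconj a))%C.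

Lemma Cinv_conj (a : C) : a <> 0 -> (/ a)%C = (RtoC (/ (Cmod a)^2) * Cconj a)%C.
Proof.
  intros Ha. assert (Hp := proj1 (Cmod_gt_0 a) Ha). rewrite RtoC_inv by (apply pow_nonzero; lra). rewrite Cmod2_conj.
  field. split; auto. intros E. apply Ha. apply Cmod_eq_0. rewrite <- Cmod_conj, E. apply Cmod_0.
Qed.

Hypothesis (H0 : D 0 = 0%Z).

(** For [|a| >= 1] the kernel [conj a / max(1,|a|)^2] of [gam D 0 1 rho] is [1/a]; the finitely many
    points in the unit disc add a constant. *)
Lemma alpha_lim : exists L, Clim_infty (fun rho => csum (lst D rho) (aterm rho)) L.
Proof.
  destruct (gam_lim 0) as [L HL].
  exists (L + csum (lst D 1) (fun a => RtoC (IZR (D a)) * (/ a - Cconj a)))%C.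
  apply (Clim_ext (fun rho => gam D 0 1 rho + csum (lst D 1) (fun a => RtoC (IZR (D a)) * (/ a - Cconj a)))%C _ _ 1).
  - intros rho Hr. unfold gam.
    rewrite (csum_perm (lst D 1) _ _ (lst_fil_perm D 1 rho HD ltac:(lra))), csum_fil, <- csum_plus.
    apply csum_ext. intros a Ha. apply lst_In in Ha; auto.
    assert (Ha0 : a <> 0) by (intros E; rewrite E, H0 in Ha; lia).
    unfold gterm, aterm. replace (a - 0)%C with a by ring.
    destruct (Rlt_le_dec (Cmod a) 1).
    + rewrite indic_true, Rmax_left by lra. rewrite pow1, Rinv_1. ring.
    + rewrite indic_false, Rmax_right by lra. rewrite (Cinv_conj a Ha0). ring.
  - apply Clim_plus; auto. apply Clim_const.
Qed.

Definition fterm (a : C) : C := (RtoC (IZR (D a)) * / (a * a))%C.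

(** In [gam] at [c = 1] minus [gam] at [c = 0] the cut-off corrections cancel, and far out the terms
    are [1/(a-1) - 1/a = 1/a^2 + 1/(a^2 (a-1))]. Both limits exist by [gam_lim], and the cubic
    remainder converges by [tail_cube]. *)
Lemma square_lim : exists L, Clim_infty (fun rho => csum (fil (fun a => 1 <= Cmod a) (lst D rho)) fterm) L.
Proof.
  destruct (gam_lim 0) as [La HLa]. destruct (gam_lim 1) as [Lb HLb].
  set (u := fun a : C => (RtoC (/ (Rmax 1 (Cmod (a - 1)))^2) * Cconj (a - 1) - RtoC (/ (Rmax 1 (Cmod a))^2) * Cconj a)%C).
  set (w := fun a : C => (RtoC (IZR (D a)) * u a - RtoC (indic (1 <= Cmod a)) * fterm a)%C).
  assert (HK := proj1 HC).
  destruct (Clim_cauchy_inv (fun rho => csum (lst D rho) w) (1200 * K) 2) as [Lc HLc]; [lra| |].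
  { intros r1 r2 H1 H2. rewrite lst_diff by auto.
    set (l := fil (fun a => ~ Cmod a < r1) (lst D r2)).
    assert (Hl : forall a, In a l -> r1 <= Cmod a).
    { intros a Ha. apply fil_In in Ha. lra. }
    eapply Rle_trans; [apply csum_Cmod|].
    apply Rle_trans with (rsum l (fun a => 2 * (absD D a * / (Cmod a)^3))).
    - apply rsum_le. intros a Ha. specialize (Hl a Ha). unfold w, fterm.
      rewrite indic_true by lra.
      assert (T := Cmod_tri_inv a 1). rewrite Cmod_1 in T.
      assert (Ha0 : a <> 0) by (apply Cmod_gt_0; lra). assert (Ha1 : (a - 1 <> 0)%C) by (apply Cmod_gt_0; lra).
      unfold u. rewrite !Rmax_right by lra. rewrite <- !Cinv_conj by auto.
      replace (RtoC (IZR (D a)) * (/ (a - 1) - / a) - 1 * (RtoC (IZR (D a)) * / (a * a)))%C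
        with (RtoC (IZR (D a)) * / (a * a * (a - 1)))%C by (field; auto).
      rewrite Cmod_mult, Cmod_R, Cmod_inv by (repeat apply Cmult_neq_0; auto). rewrite !Cmod_mult. fold (absD D a).
      replace (2 * (absD D a * / Cmod a ^ 3)) with (absD D a * (2 * / Cmod a ^ 3)) by ring.
      apply Rmult_le_compat_l; [apply absD_pos|].
      replace (2 * / Cmod a ^ 3) with (/ (Cmod a * Cmod a * (Cmod a / 2))) by (field; lra).
      apply Rinv_le_contravar; [repeat apply Rmult_lt_0_compat; lra|].
      apply Rmult_le_compat_l; [apply Rmult_le_pos; lra|lra].
    - rewrite rsum_scal. replace (1200 * K / r1) with (2 * (600 * K / r1)) by (field; lra).
      apply Rmult_le_compat_l; [lra|]. apply tail_cube; auto; [lra|apply fil_NoDup, lst_supp, HD]. }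
  exists (Lb + (-1) * La + (-1) * Lc)%C.
  apply (Clim_ext (fun rho => gam D 1 1 rho + (-1) * gam D 0 1 rho + (-1) * csum (lst D rho) w)%C _ _ 1).
  - intros rho Hr. rewrite csum_fil. unfold gam. rewrite <- !csum_scal, <- !csum_plus. apply csum_ext. intros a _.
    unfold w, gterm, u. replace (a - 0)%C with a by ring. ring.
  - apply Clim_plus; [apply Clim_plus|]; auto; apply Clim_scal; auto.
Qed.
End Limits.

(** * The chordal metric *)

Definition sN (z : C) : R := sqrt (1 + Cmod z ^ 2).

Lemma sN_sq z : sN z * sN z = 1 + Cmod z ^ 2.
Proof. apply sqrt_sqrt. pose proof (pow2_ge_0 (Cmod z)). lra. Qed.
Lemma sN_ge1 z : 1 <= sN z.
Proof. assert (H := sN_sq z). pose proof (pow2_ge_0 (Cmod z)). pose proof (sqrt_pos (1 + Cmod z ^ 2)). fold (sN z) in *. nra. Qed.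
Lemma sN_ge z : Cmod z <= sN z.
Proof. assert (H := sN_sq z). pose proof (sN_ge1 z). pose proof (Cmod_ge_0 z). nra. Qed.

Lemma rho_SS z w : rhoS (Some z) (Some w) = 2 * Cmod (z - w) / (sN z * sN w).
Proof.
  unfold rhoS, sN. change (Cnorm (Csub z w)) with (Cmod (z - w)). change (Cnorm z) with (Cmod z).
  change (Cnorm w) with (Cmod w). rewrite sqrt_mult_alt; auto. pose proof (pow2_ge_0 (Cmod z)). lra.
Qed.

Lemma rho_SN z : rhoS (Some z) None = 2 / sN z.
Proof. reflexivity. Qed.
Lemma rho_NS z : rhoS None (Some z) = 2 / sN z.
Proof. reflexivity. Qed.

Lemma rho_pos u v : 0 <= rhoS u v.
Proof.
  destruct u as [z|], v as [w|]; rewrite ?rho_SS, ?rho_SN, ?rho_NS; try (simpl; lra);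
    apply Rdiv_le_0_compat; try lra; try (pose proof (sN_ge1 z)); try (pose proof (sN_ge1 w)); try lra.
  - pose proof (Cmod_ge_0 (z - w)). lra.
  - nra.
Qed.

Lemma rho_sym u v : rhoS u v = rhoS v u.
Proof.
  destruct u as [z|], v as [w|]; auto. rewrite !rho_SS, Cmod_sub_sym, (Rmult_comm (sN z)). reflexivity.
Qed.

Lemma rho_refl u : rhoS u u = 0.
Proof.
  destruct u as [z|]; auto. rewrite rho_SS, Cmod_sub_self. unfold Rdiv. ring.
Qed.

Lemma rho_eq0 u v : rhoS u v = 0 -> u = v.
Proof.
  destruct u as [z|], v as [w|]; auto; rewrite ?rho_SS, ?rho_SN, ?rho_NS; intros H.
  - assert (A := sN_ge1 z). assert (B := sN_ge1 w). f_equal. apply Csub_0_eq, Cmod_eq_0.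
    apply (f_equal (fun x => x * (sN z * sN w) / 2)) in H.
    replace (2 * Cmod (z - w) / (sN z * sN w) * (sN z * sN w) / 2) with (Cmod (z - w)) in H by (field; lra).
    rewrite H. field.
  - exfalso. assert (A := sN_ge1 z). assert (0 < 2 / sN z) by (apply Rdiv_lt_0_compat; lra). lra.
  - exfalso. assert (A := sN_ge1 w). assert (0 < 2 / sN w) by (apply Rdiv_lt_0_compat; lra). lra.
Qed.

Lemma rho_le_dist z w : rhoS (Some z) (Some w) <= 2 * Cmod (z - w).
Proof.
  rewrite rho_SS. assert (A := sN_ge1 z). assert (B := sN_ge1 w). assert (D := Cmod_ge_0 (z - w)).
  apply Rmult_le_reg_r with (sN z * sN w); [nra|]. unfold Rdiv. rewrite Rmult_assoc, Rinv_l by nra.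
  assert (1 <= sN z * sN w) by nra. set (p := sN z * sN w) in *. nra.
Qed.

(* Homogeneous coordinates of norm one: the chordal distance is 2|p q' - q p'|. *)
Definition hv (u : sphere) : C * C :=
  match u with
  | Some z => (RtoC (/ sN z) * z, RtoC (/ sN z))%C
  | None => (RtoC 1, RtoC 0)
  end.

Lemma hv_unit u : Cmod (fst (hv u)) ^ 2 + Cmod (snd (hv u)) ^ 2 = 1.
Proof.
  destruct u as [z|]; simpl.
  - assert (A := sN_ge1 z). assert (B := sN_sq z). rewrite Cmod_mult, Cmod_R, Rabs_pos_eq by (left; apply Rinv_0_lt_compat; lra).
    field_simplify; [|lra]. replace (Cmod z ^ 2 + 1) with (sN z * sN z) by lra. field. lra.
  - rewrite Cmod_1, Cmod_0. ring.
Qed.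

Lemma rho_hv u v : rhoS u v = 2 * Cmod (fst (hv u) * snd (hv v) - snd (hv u) * fst (hv v)).
Proof.
  destruct u as [z|], v as [w|]; rewrite ?rho_SS, ?rho_SN, ?rho_NS; simpl.
  - assert (A := sN_ge1 z). assert (B := sN_ge1 w).
    replace (RtoC (/ sN z) * z * RtoC (/ sN w) - RtoC (/ sN z) * (RtoC (/ sN w) * w))%C
      with (RtoC (/ sN z * / sN w) * (z - w))%C by (rewrite RtoC_mult; ring).
    rewrite Cmod_mult, Cmod_R, Rabs_pos_eq.
    + field. lra.
    + apply Rmult_le_pos; left; apply Rinv_0_lt_compat; lra.
  - assert (A := sN_ge1 z).
    replace (RtoC (/ sN z) * z * 0 - RtoC (/ sN z) * 1)%C with (- RtoC (/ sN z))%C by ring.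
    rewrite Cmod_opp, Cmod_R, Rabs_pos_eq; [field; lra|left; apply Rinv_0_lt_compat; lra].
  - assert (A := sN_ge1 w).
    replace (1 * RtoC (/ sN w) - 0 * (RtoC (/ sN w) * w))%C with (RtoC (/ sN w))%C by ring.
    rewrite Cmod_R, Rabs_pos_eq; [field; lra|left; apply Rinv_0_lt_compat; lra].
  - replace (1 * 0 - 0 * 1)%C with (RtoC 0) by ring. rewrite Cmod_0. ring.
Qed.

Lemma hv_inner u v : Cmod (fst (hv u) * Cconj (fst (hv v)) + snd (hv u) * Cconj (snd (hv v))) <= 1.
Proof.
  assert (A := hv_unit u). assert (B := hv_unit v).
  set (a := fst (hv u)) in *. set (b := snd (hv u)) in *. set (c := fst (hv v)) in *. set (d := snd (hv v)) in *.
  eapply Rle_trans; [apply Cmod_triangle|]. rewrite !Cmod_mult, !Cmod_conj.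
  pose proof (Rle_0_sqr (Cmod a - Cmod c)). pose proof (Rle_0_sqr (Cmod b - Cmod d)). unfold Rsqr in *. nra.
Qed.

Lemma rho_tri u p v : rhoS u v <= rhoS u p + rhoS p v.
Proof.
  rewrite !rho_hv. assert (A := hv_unit p). assert (B := hv_inner v p). assert (B' := hv_inner u p).
  set (a1 := fst (hv u)) in *. set (a2 := snd (hv u)) in *. set (b1 := fst (hv v)) in *. set (b2 := snd (hv v)) in *.
  set (p1 := fst (hv p)) in *. set (p2 := snd (hv p)) in *.
  (* The determinant times [|p1|^2 + |p2|^2 = 1] splits into two determinants with [p], weighted by
     inner products of modulus at most 1. *)
  assert (E : (a1 * b2 - a2 * b1)%C = ((a1 * p2 - a2 * p1) * (b1 * Cconj p1 + b2 * Cconj p2)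
     + (p1 * b2 - p2 * b1) * (a1 * Cconj p1 + a2 * Cconj p2))%C).
  { transitivity ((a1 * b2 - a2 * b1) * (p1 * Cconj p1 + p2 * Cconj p2))%C; [|ring].
    rewrite <- !Cmod2_conj, <- RtoC_plus, A. ring. }
  rewrite E. assert (T := Cmod_triangle ((a1 * p2 - a2 * p1) * (b1 * Cconj p1 + b2 * Cconj p2)) ((p1 * b2 - p2 * b1) * (a1 * Cconj p1 + a2 * Cconj p2))).
  rewrite !Cmod_mult in T.
  assert (G1 := Cmod_ge_0 (a1 * p2 - a2 * p1)). assert (G2 := Cmod_ge_0 (p1 * b2 - p2 * b1)). nra.
Qed.

(** Inversion is an isometry of the chordal metric ([rho_sinv]) and exchanges zeros with poles;
    estimates near poles are those near zeros applied to [sinv (f z)]. *)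
Definition sinv (u : sphere) : sphere :=
  match u with
  | Some z => if Ceq_dec z 0 then None else Some (/ z)%C
  | None => Some (RtoC 0)
  end.

Lemma sN_inv (z : C) : z <> 0 -> sN (/ z)%C = sN z / Cmod z.
Proof.
  intros Hz. assert (Hp := proj1 (Cmod_gt_0 z) Hz). assert (A := sN_ge1 z).
  unfold sN at 1. rewrite Cmod_inv by auto.
  replace (1 + (/ Cmod z) ^ 2) with ((sN z / Cmod z) * (sN z / Cmod z)).
  - apply sqrt_square. apply Rdiv_le_0_compat; lra.
  - assert (B := sN_sq z). replace (sN z / Cmod z * (sN z / Cmod z)) with (sN z * sN z / (Cmod z * Cmod z)) by (field; lra).
    rewrite B. field. lra.
Qed.

Lemma rho_sinv u v : rhoS (sinv u) (sinv v) = rhoS u v.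
Proof.
  assert (K0 : sN 0 = 1). { unfold sN. rewrite Cmod_0. replace (1 + 0 ^ 2) with 1 by ring. apply sqrt_1. }
  assert (KN : forall z : C, z <> 0 -> rhoS (Some (/ z)%C) (Some (RtoC 0)) = 2 / sN z).
  { intros z Hz. assert (Hp := proj1 (Cmod_gt_0 z) Hz). assert (A := sN_ge1 z).
    rewrite rho_SS, K0, sN_inv by auto. replace (/ z - 0)%C with (/ z)%C by ring. rewrite Cmod_inv by auto. field. lra. }
  assert (KZ : forall z : C, z <> 0 -> rhoS (Some (/ z)%C) None = rhoS (Some z) (Some (RtoC 0))).
  { intros z Hz. assert (Hp := proj1 (Cmod_gt_0 z) Hz). assert (A := sN_ge1 z).
    rewrite rho_SS, K0, rho_SN, sN_inv by auto. replace (z - 0)%C with z by ring. field. lra. }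
  assert (K00 : rhoS None (Some (RtoC 0)) = rhoS (Some (RtoC 0)) None) by reflexivity.
  destruct u as [z|], v as [w|]; unfold sinv; try destruct (Ceq_dec z 0) as [Ez|Ez]; try destruct (Ceq_dec w 0) as [Ew|Ew]; subst; auto.
  - symmetry. apply rho_refl.
  - rewrite rho_sym, KZ, rho_sym; auto.
  - assert (Hp := proj1 (Cmod_gt_0 z) Ez). assert (Hq := proj1 (Cmod_gt_0 w) Ew). assert (A := sN_ge1 z). assert (B := sN_ge1 w).
    rewrite !rho_SS, !sN_inv by auto. replace (/ z - / w)%C with ((w - z) / (z * w))%C by (field; auto).
    rewrite Cmod_div by (apply Cmult_neq_0; auto). rewrite Cmod_mult, (Cmod_sub_sym w). field. lra.
  - rewrite rho_sym, KN; auto.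
  - rewrite !rho_refl. reflexivity.
Qed.

Lemma sinv_invol u : sinv (sinv u) = u.
Proof.
  destruct u as [z|]; unfold sinv.
  - destruct (Ceq_dec z 0) as [E|E]; [subst; auto|].
    destruct (Ceq_dec (/ z) 0) as [E'|E'].
    + exfalso. apply (f_equal (fun u => u * z)%C) in E'. rewrite Cinv_l in E' by auto.
      replace (0 * z)%C with (RtoC 0) in E' by ring. apply RtoC_inj in E'. lra.
    + assert (E2 : (/ / z)%C = z) by (field; auto). rewrite E2. reflexivity.
  - destruct (Ceq_dec 0 0); [auto|congruence].
Qed.

Lemma rho_0N : rhoS (Some (RtoC 0)) None = 2.
Proof. rewrite rho_SN. unfold sN. rewrite Cmod_0. replace (1 + 0 ^ 2) with 1 by ring. rewrite sqrt_1. field. Qed.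

(** The bound does not depend on [y]: where [|y|] is large the chordal metric contracts by a
    compensating factor. This makes the convergence of the canonical product uniform near its
    poles. *)
Lemma rho_scaled (y t t' : C) : t' <> 0 -> rhoS (Some (y * t)%C) (Some (y * t')%C) <= 2 * Cmod (t - t') / Cmod t'.
Proof.
  intros Ht. assert (Hp := proj1 (Cmod_gt_0 t') Ht). rewrite rho_SS.
  replace (y * t - y * t')%C with (y * (t - t'))%C by ring. rewrite Cmod_mult.
  assert (A := sN_ge1 (y * t)). assert (B := sN_ge (y * t')). rewrite Cmod_mult in B.
  assert (B1 := sN_ge1 (y * t')). assert (Y := Cmod_ge_0 y). assert (D := Cmod_ge_0 (t - t')).
  apply Rmult_le_reg_r with (sN (y * t) * sN (y * t') * Cmod t'); [repeat apply Rmult_lt_0_compat; lra|].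
  replace (2 * (Cmod y * Cmod (t - t')) / (sN (y * t) * sN (y * t')) * (sN (y * t) * sN (y * t') * Cmod t'))
    with (2 * Cmod (t - t') * (Cmod y * Cmod t')) by (field; lra).
  replace (2 * Cmod (t - t') / Cmod t' * (sN (y * t) * sN (y * t') * Cmod t')) with (2 * Cmod (t - t') * (sN (y * t) * sN (y * t'))) by (field; lra).
  apply Rmult_le_compat_l; [lra|]. nra.
Qed.

Lemma Csub_0_r (y : C) : (y - 0)%C = y.
Proof. ring. Qed.

Definition small (e : R) (u : sphere) : Prop := match u with Some y => Cmod y <= e | None => False end.

Lemma rho_small e u : 0 <= e -> small e u -> rhoS u (Some (RtoC 0)) <= 2 * e.
Proof.
  intros He. destruct u as [y|]; [|intros []]. simpl. intros Hy.
  eapply Rle_trans; [apply rho_le_dist|]. rewrite Csub_0_r. lra.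
Qed.

Lemma small_rho u : rhoS u (Some (RtoC 0)) <= 1 -> small 1 u.
Proof.
  destruct u as [y|].
  - rewrite rho_SS, Csub_0_r. assert (K0 : sN 0 = 1).
    { unfold sN. rewrite Cmod_0. replace (1 + 0 ^ 2) with 1 by ring. apply sqrt_1. }
    rewrite K0. intros H. simpl. assert (A := sN_ge1 y). assert (B := sN_sq y).
    assert (2 * Cmod y <= sN y).
    { apply Rmult_le_compat_r with (r := sN y) in H; [|lra]. replace (2 * Cmod y / (sN y * 1) * sN y) with (2 * Cmod y) in H by (field; lra). lra. }
    pose proof (Cmod_ge_0 y). nra.
  - rewrite rho_sym, rho_0N. lra.
Qed.

Definition rcont (f : C -> sphere) (z : C) : Prop :=
  forall eps, 0 < eps -> exists del, 0 < del /\ forall w, Cmod (w - z) < del -> rhoS (f w) (f z) < eps.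

Lemma rho_limit_unique (f : C -> sphere) (z : C) (u v : sphere) :
  (forall eps, 0 < eps -> exists del, 0 < del /\ forall w, 0 < Cmod (w - z) < del -> rhoS (f w) u < eps) ->
  (forall eps, 0 < eps -> exists del, 0 < del /\ forall w, 0 < Cmod (w - z) < del -> rhoS (f w) v < eps) -> u = v.
Proof.
  intros Hu Hv. apply rho_eq0. apply Rle_antisym; [|apply rho_pos]. apply le_epsilon. intros eps He.
  destruct (Hu (eps/2)) as [d1 [A1 A2]]; [lra|]. destruct (Hv (eps/2)) as [d2 [B1 B2]]; [lra|].
  assert (Hm0 : 0 < Rmin d1 d2) by (apply Rmin_pos; auto).
  set (d := Rmin d1 d2 / 2). assert (Hd : 0 < d < Rmin d1 d2) by (unfold d; lra). clearbody d.
  assert (L1 := Rmin_l d1 d2). assert (L2 := Rmin_r d1 d2).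
  assert (Hw : Cmod (z + RtoC d - z) = d) by (rewrite Cmod_sub_c, Cmod_R, Rabs_pos_eq; lra).
  specialize (A2 (z + RtoC d)%C). specialize (B2 (z + RtoC d)%C). rewrite Hw in A2, B2.
  specialize (A2 ltac:(lra)). specialize (B2 ltac:(lra)).
  pose proof (rho_tri u (f (z + RtoC d)%C) v). rewrite (rho_sym u (f (z + RtoC d)%C)) in H. lra.
Qed.

Lemma Ccont_rcont (g : C -> C) (z : C) : Ccont g z -> rcont (fun w => Some (g w)) z.
Proof.
  intros H eps He. destruct (H (eps/2)) as [d [D1 D2]]; [lra|]. exists d. split; auto. intros w Hw.
  eapply Rle_lt_trans; [apply rho_le_dist|]. specialize (D2 w Hw). lra.
Qed.

Lemma srecip_sinv w : srecip w = sinv (Some w).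
Proof.
  unfold srecip, sdiv, sinv. destruct (Req_EM_T (Cnorm w) 0) as [E|E], (Ceq_dec w 0) as [E'|E']; auto.
  - exfalso. apply E'. apply Cmod_eq_0, E.
  - exfalso. apply E. subst. apply Cmod_0.
  - f_equal. change (1 * / w = / w)%C. ring.
Qed.

Lemma sdiv_eq x y : sdiv x y = if Ceq_dec y 0 then None else Some (x / y)%C.
Proof.
  unfold sdiv. destruct (Req_EM_T (Cnorm y) 0) as [E|E], (Ceq_dec y 0) as [E'|E']; auto.
  - exfalso. apply E'. apply Cmod_eq_0, E.
  - exfalso. apply E. subst. apply Cmod_0.
Qed.

Lemma rcont_sinv (f : C -> sphere) (z : C) : rcont f z -> rcont (fun w => sinv (f w)) z.
Proof.
  intros H eps He. destruct (H eps He) as [d [D1 D2]]. exists d. split; auto. intros w Hw. rewrite rho_sinv. auto.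
Qed.

Lemma rcont_ext_loc (f g : C -> sphere) (z : C) (r : R) : 0 < r ->
  (forall w, Cmod (w - z) < r -> f w = g w) -> rcont f z -> rcont g z.
Proof.
  intros Hr He Hf eps Heps. destruct (Hf eps Heps) as [d [D1 H1]].
  exists (Rmin d r). split; [apply Rmin_pos; lra|]. intros w Hw.
  rewrite <- !He; [apply H1| |].
  - eapply Rlt_le_trans; [exact Hw|apply Rmin_l].
  - rewrite Cmod_sub_self. exact Hr.
  - eapply Rlt_le_trans; [exact Hw|apply Rmin_r].
Qed.

Lemma mero_loc (f : C -> sphere) (z0 : C) : meromorphic f -> exists r g, 0 < r /\
  (forall z, Cmod (z - z0) < r -> Cdiff g z) /\
  ((forall z, Cmod (z - z0) < r -> f z = Some (g z)) \/ (forall z, Cmod (z - z0) < r -> f z = sinv (Some (g z)))).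
Proof.
  intros [_ H]. destruct (H z0) as [r [Hr [[g [Hg Hf]]|[g [Hg Hf]]]]]; exists r, g; (split; [exact Hr|split]).
  - intros z Hz. apply Cdiff_iff, Hg, Hz.
  - left. intros z Hz. apply Hf, Hz.
  - intros z Hz. apply Cdiff_iff, Hg, Hz.
  - right. intros z Hz. rewrite <- srecip_sinv. apply Hf, Hz.
Qed.

Lemma mero_rcont (f : C -> sphere) (z0 : C) : meromorphic f -> rcont f z0.
Proof.
  intros H. destruct (mero_loc f z0 H) as [r [g [Hr [Hg [Hf|Hf]]]]].
  - apply (rcont_ext_loc (fun w => Some (g w)) f z0 r Hr); [intros; symmetry; auto|].
    apply Ccont_rcont, Cdiff_Ccont, Hg. rewrite Cmod_sub_self. exact Hr.
  - apply (rcont_ext_loc (fun w => sinv (Some (g w))) f z0 r Hr); [intros; symmetry; auto|].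
    apply rcont_sinv, Ccont_rcont, Cdiff_Ccont, Hg. rewrite Cmod_sub_self. exact Hr.
Qed.

Definition fin (u : sphere) : C := match u with Some y => y | None => RtoC 0 end.

Lemma mero_fin_diff (f : C -> sphere) (z0 : C) : meromorphic f -> f z0 <> None -> Cdiff (fun z => fin (f z)) z0.
Proof.
  intros H Hn. destruct (mero_loc f z0 H) as [r [g [Hr [Hg [Hf|Hf]]]]].
  - apply (Cdiff_ext_loc g _ z0 r Hr); [intros w Hw; rewrite Hf by auto; reflexivity|].
    apply Hg. rewrite Cmod_sub_self. exact Hr.
  - assert (Hz : Cmod (z0 - z0) < r) by (rewrite Cmod_sub_self; exact Hr).
    assert (Hg0 : g z0 <> 0).
    { intros E. apply Hn. rewrite Hf by auto. unfold sinv. rewrite E. destruct (Ceq_dec 0 0); congruence. }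
    destruct (Cdiff_Ccont g z0 (Hg z0 Hz) (Cmod (g z0))) as [d [D1 D2]]; [apply Cmod_gt_0, Hg0|].
    apply (Cdiff_ext_loc (fun w => / g w)%C _ z0 (Rmin r d)); [apply Rmin_pos; auto| |].
    + intros w Hw. rewrite Hf by (eapply Rlt_le_trans; [exact Hw|apply Rmin_l]).
      unfold sinv. destruct (Ceq_dec (g w) 0) as [E|E]; auto.
      exfalso. specialize (D2 w (Rlt_le_trans _ _ _ Hw (Rmin_r _ _))). rewrite E in D2.
      replace (0 - g z0)%C with (- g z0)%C in D2 by ring. rewrite Cmod_opp in D2. lra.
    + apply Cdiff_inv; auto.
Qed.

Lemma mero_sinv (f : C -> sphere) : meromorphic f -> (exists z, f z <> Some (RtoC 0)) -> meromorphic (fun z => sinv (f z)).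
Proof.
  intros H [z Hz]. split.
  - exists z. intros E. apply Hz. rewrite <- (sinv_invol (f z)), E. reflexivity.
  - intros z0. destruct (proj2 H z0) as [r [Hr [[g [Hg Hf]]|[g [Hg Hf]]]]]; exists r; split; auto.
    + right. exists g. split; auto. intros w Hw. rewrite (Hf w Hw), srecip_sinv. reflexivity.
    + left. exists g. split; auto. intros w Hw. rewrite (Hf w Hw), srecip_sinv. apply sinv_invol.
Qed.

(** * Local form of a meromorphic function *)

Definition cpw : C -> nat -> C := Defs.Cpow.
Definition czp : C -> Z -> C := Czpow.

Lemma cpw_0 z : cpw z 0 = RtoC 1.
Proof. reflexivity. Qed.
Lemma cpw_S z n : cpw z (S n) = (z * cpw z n)%C.
Proof. reflexivity. Qed.
Lemma Cmod_cpw z n : Cmod (cpw z n) = Cmod z ^ n.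
Proof. induction n; [rewrite cpw_0, Cmod_1; reflexivity|]. rewrite cpw_S, Cmod_mult, IHn. reflexivity. Qed.
Lemma cpw_neq0 (z : C) n : z <> 0 -> cpw z n <> 0.
Proof. intros H. apply Cmod_gt_0. rewrite Cmod_cpw. apply pow_lt, Cmod_gt_0, H. Qed.
Lemma cpw_mult (z w : C) n : cpw (z * w)%C n = (cpw z n * cpw w n)%C.
Proof. induction n; [rewrite !cpw_0; ring|]. rewrite !cpw_S, IHn. ring. Qed.
Lemma cpw_cexp (z : C) n : cpw (cexp z) n = cexp (RtoC (INR n) * z)%C.
Proof.
  induction n; [rewrite cpw_0; simpl; replace (0 * z)%C with (RtoC 0) by ring; rewrite cexp_0; reflexivity|].
  rewrite cpw_S, IHn, S_INR, RtoC_plus. rewrite <- cexp_plus. f_equal. ring.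
Qed.
Lemma Cdiff_cpw (g : C -> C) (z : C) n : Cdiff g z -> Cdiff (fun w => cpw (g w) n) z.
Proof.
  intros H. induction n; [apply (Cdiff_const (RtoC 1))|]. apply (Cdiff_mult g (fun w => cpw (g w) n)); auto.
Qed.

Lemma czp_0 z : czp z 0 = RtoC 1.
Proof. reflexivity. Qed.
Lemma czp_pos z m : (0 <= m)%Z -> czp z m = cpw z (Z.to_nat m).
Proof. intros H. destruct m; try lia; reflexivity. Qed.
Lemma czp_neg z m : (m < 0)%Z -> czp z m = (/ cpw z (Z.to_nat (- m)))%C.
Proof. intros H. destruct m; try lia; reflexivity. Qed.
Lemma czp_neq0 (z : C) m : z <> 0 -> czp z m <> 0.
Proof.
  intros H. destruct (Z_lt_le_dec m 0).
  - rewrite czp_neg by auto. intros E. assert (A := cpw_neq0 z (Z.to_nat (- m)) H).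
    apply (f_equal (fun u => u * cpw z (Z.to_nat (- m)))%C) in E. rewrite Cinv_l in E by auto.
    replace (0 * cpw z (Z.to_nat (- m)))%C with (RtoC 0) in E by ring. apply RtoC_inj in E. lra.
  - rewrite czp_pos by auto. apply cpw_neq0, H.
Qed.
Lemma czp_zero m : (0 < m)%Z -> czp 0 m = RtoC 0.
Proof. intros H. rewrite czp_pos by lia. destruct (Z.to_nat m) eqn:E; [lia|]. rewrite cpw_S. ring. Qed.
Lemma czp_opp (z : C) m : z <> 0 -> czp z (- m) = (/ czp z m)%C.
Proof.
  intros H. destruct (Z.lt_trichotomy m 0) as [A|[A|A]].
  - rewrite (czp_neg z m), czp_pos by lia. assert (B := cpw_neq0 z (Z.to_nat (- m)) H). field. auto.
  - subst. change (czp z 0 = / czp z 0)%C. rewrite czp_0. field.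
  - rewrite (czp_pos z m), czp_neg by lia. rewrite Z.opp_involutive. reflexivity.
Qed.
Lemma ln_czp (z : C) m : z <> 0 -> ln (Cmod (czp z m)) = IZR m * ln (Cmod z).
Proof.
  intros H. assert (Hp := proj1 (Cmod_gt_0 z) H). destruct (Z_lt_le_dec m 0).
  - rewrite czp_neg by auto. rewrite Cmod_inv by (apply cpw_neq0, H). rewrite Cmod_cpw, ln_Rinv by (apply pow_lt, Hp).
    rewrite ln_pow by auto. rewrite INR_IZR_INZ, Z2Nat.id, opp_IZR by lia. ring.
  - rewrite czp_pos by auto. rewrite Cmod_cpw, ln_pow, INR_IZR_INZ, Z2Nat.id by auto. reflexivity.
Qed.
Lemma Cdiff_czp (g : C -> C) (z : C) m : Cdiff g z -> (0 <= m)%Z \/ g z <> 0 -> Cdiff (fun w => czp (g w) m) z.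
Proof.
  intros Hg H. destruct (Z_lt_le_dec m 0) as [L|L].
  - apply (Cdiff_ext_loc (fun w => / cpw (g w) (Z.to_nat (- m)))%C _ z 1 Rlt_0_1).
    + intros w _. symmetry. apply czp_neg, L.
    + destruct H; [lia|]. apply Cdiff_inv; [apply cpw_neq0; auto|]. apply Cdiff_cpw, Hg.
  - apply (Cdiff_ext_loc (fun w => cpw (g w) (Z.to_nat m))%C _ z 1 Rlt_0_1).
    + intros w _. symmetry. apply czp_pos, L.
    + apply Cdiff_cpw, Hg.
Qed.

Definition cprod (l : list C) (F : C -> C) : C := fold_right Cmult (RtoC 1) (map F l).

Lemma cprod_cons a l F : cprod (a :: l) F = (F a * cprod l F)%C.
Proof. reflexivity. Qed.
Lemma cprod_app l l' F : cprod (l ++ l') F = (cprod l F * cprod l' F)%C.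
Proof. induction l; [unfold cprod; simpl; ring|]. simpl. rewrite !cprod_cons, IHl. ring. Qed.
Lemma cprod_perm l l' F : Permutation l l' -> cprod l F = cprod l' F.
Proof.
  intros H. induction H; auto; rewrite ?cprod_cons; [rewrite IHPermutation; auto|ring|congruence].
Qed.
Lemma cprod_ext l F G : (forall a, In a l -> F a = G a) -> cprod l F = cprod l G.
Proof.
  intros H. induction l; [reflexivity|]. rewrite !cprod_cons.
  rewrite H, IHl by (simpl; auto; intros; apply H; simpl; auto). reflexivity.
Qed.
Lemma cprod_neq0 l F : (forall a, In a l -> F a <> RtoC 0) -> cprod l F <> RtoC 0.
Proof.
  intros H. induction l; [intros E; apply RtoC_inj in E; lra|]. rewrite cprod_cons.
  apply Cmult_neq_0; [apply H; simpl; auto|apply IHl; intros; apply H; simpl; auto].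
Qed.
Lemma cprod_zero l F a : In a l -> F a = RtoC 0 -> cprod l F = RtoC 0.
Proof.
  intros Ha HF. induction l as [|b l IH]; [destruct Ha|]. rewrite cprod_cons. destruct Ha as [E|Ha].
  - subst. rewrite HF. ring.
  - rewrite IH by auto. ring.
Qed.
Lemma cprod_mult l F G : cprod l (fun a => F a * G a)%C = (cprod l F * cprod l G)%C.
Proof. induction l; [unfold cprod; simpl; ring|]. rewrite !cprod_cons, IHl. ring. Qed.
Lemma Cdiff_cprod (l : list C) (F : C -> C -> C) (z : C) : (forall a, In a l -> Cdiff (F a) z) -> Cdiff (fun w => cprod l (fun a => F a w)) z.
Proof.
  intros H. induction l as [|b l IH]; [apply (Cdiff_const (RtoC 1))|].
  apply (Cdiff_mult (F b) (fun w => cprod l (fun a => F a w))); [apply H; left; auto|apply IH; intros; apply H; right; auto].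
Qed.
Lemma ln_cprod l F : (forall a, In a l -> F a <> RtoC 0) -> ln (Cmod (cprod l F)) = rsum l (fun a => ln (Cmod (F a))).
Proof.
  intros H. induction l; [unfold cprod, rsum; simpl; rewrite Cmod_1; apply ln_1|].
  rewrite cprod_cons, rsum_cons, Cmod_mult, ln_mult.
  - rewrite IHl; auto. intros; apply H; right; auto.
  - apply Cmod_gt_0, H. left; auto.
  - apply Cmod_gt_0, cprod_neq0. intros; apply H; right; auto.
Qed.

Definition rprod (D : C -> Z) (l : list C) (z : C) : C := cprod l (fun a => czp (z - a) (D a)).

Lemma Cdiff_sub_const (a z : C) : Cdiff (fun w => w - a)%C z.
Proof. apply (Cdiff_minus (fun w => w)); [apply Cdiff_id|apply Cdiff_const]. Qed.

Lemma rprod_neq0 (D : C -> Z) l (z : C) : ~ In z l -> rprod D l z <> 0.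
Proof.
  intros H. apply cprod_neq0. intros a Ha. apply czp_neq0. intros E. apply Csub_0_eq in E. subst. auto.
Qed.
Lemma rprod_diff (D : C -> Z) l (z : C) : ~ In z l -> Cdiff (rprod D l) z.
Proof.
  intros H. apply (Cdiff_cprod l (fun a w => czp (w - a) (D a))). intros a Ha.
  apply Cdiff_czp; [apply Cdiff_sub_const|]. right. intros E. apply Csub_0_eq in E. subst. auto.
Qed.
Lemma ln_rprod (D : C -> Z) l (z : C) : ~ In z l -> ln (Cmod (rprod D l z)) = rsum l (fun a => IZR (D a) * ln (Cmod (z - a))).
Proof.
  intros H. unfold rprod. rewrite ln_cprod.
  - apply rsum_ext. intros a Ha. apply ln_czp. intros E. apply Csub_0_eq in E. subst. auto.
  - intros a Ha. apply czp_neq0. intros E. apply Csub_0_eq in E. subst. auto.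
Qed.

Lemma rprod_factor (D : C -> Z) l (z0 z : C) : NoDup l -> (In z0 l \/ D z0 = 0%Z) ->
  rprod D l z = (czp (z - z0) (D z0) * rprod D (fil (fun a => a <> z0) l) z)%C.
Proof.
  intros Hl H. unfold rprod.
  destruct (classic (In z0 l)) as [Hin|Hout].
  - rewrite <- cprod_cons with (F := fun a => czp (z - a) (D a)). apply cprod_perm, NoDup_same_perm; auto.
    + constructor; [|apply fil_NoDup, Hl]. rewrite fil_In. tauto.
    + intros a. simpl. rewrite fil_In. destruct (Ceq_dec z0 a); [subst; tauto|]. split; [|intros [E|[E _]]; [contradiction|auto]].
      intros Ha. right. split; auto.
  - destruct H as [H|H]; [contradiction|]. rewrite H, czp_0, Cmult_1_l. apply cprod_perm, NoDup_same_perm; auto; [apply fil_NoDup, Hl|].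
    intros a. rewrite fil_In. split; [|tauto]. intros Ha. split; auto. intros E; subst; auto.
Qed.

Lemma list_sep (l : list C) (z : C) : exists r, 0 < r /\ forall a, In a l -> a <> z -> r <= Cmod (a - z).
Proof.
  induction l as [|b l [r [Hr H]]]; [exists 1; split; [lra|intros a []]|].
  destruct (Ceq_dec b z) as [E|E].
  - exists r. split; auto. intros a [Ha|Ha] Hne; [congruence|auto].
  - exists (Rmin r (Cmod (b - z))). split; [apply Rmin_pos; auto; apply Cmod_sub_pos, E|].
    intros a [Ha|Ha] Hne; [subst; apply Rmin_r|]. eapply Rle_trans; [apply Rmin_l|auto].
Qed.

(** On the disc [f] is a zero-free holomorphic [h] times the rational function with divisor [D].
    Values at zeros and poles are listed apart, since [rprod] takes a meaningless finite value at a
    pole. *)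
Definition LF (D : C -> Z) (f : C -> sphere) (c : C) (R0 : R) (l : list C) (h : C -> C) : Prop :=
  supp D (fun z => Cmod (z - c) < R0) l /\
  (forall z, Cmod (z - c) < R0 -> Cdiff h z /\ h z <> 0) /\
  (forall z, Cmod (z - c) < R0 -> (D z = 0%Z -> f z = Some (h z * rprod D l z)%C) /\
      ((D z > 0)%Z -> f z = Some (RtoC 0)) /\ ((D z < 0)%Z -> f z = None)).

Lemma LF_near (D : C -> Z) (f : C -> sphere) (c : C) (R0 : R) (l : list C) (h : C -> C) (z0 : C) :
  LF D f c R0 l h -> Cmod (z0 - c) < R0 -> exists r G, 0 < r /\
    (forall z, Cmod (z - z0) < r -> Cdiff G z /\ G z <> 0) /\
    (forall z, 0 < Cmod (z - z0) < r -> D z = 0%Z /\ f z = Some (czp (z - z0) (D z0) * G z)%C) /\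
    (D z0 = 0%Z -> f z0 = Some (G z0)).
Proof.
  intros [Hl [Hh Hf]] Hz0. destruct (list_sep l z0) as [r [Hr Hsep]].
  set (d := Rmin r (R0 - Cmod (z0 - c))). assert (Hd : 0 < d) by (apply Rmin_pos; lra).
  assert (Hd1 : d <= r) by apply Rmin_l. assert (Hd2 : d <= R0 - Cmod (z0 - c)) by apply Rmin_r.
  assert (Hin : forall z, Cmod (z - z0) < d -> Cmod (z - c) < R0).
  { intros z Hz. pose proof (Cmod_tri z z0 c). lra. }
  set (l' := fil (fun a => a <> z0) l).
  assert (Hl' : forall z, Cmod (z - z0) < d -> ~ In z l').
  { intros z Hz Hin'. apply fil_In in Hin'. destruct Hin' as [A B]. specialize (Hsep z A B). lra. }
  assert (Hfac : forall z, rprod D l z = (czp (z - z0) (D z0) * rprod D l' z)%C).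
  { intros z. apply rprod_factor; [apply Hl|]. destruct (Z.eq_dec (D z0) 0); auto. left. apply Hl. auto. }
  exists d, (fun z => h z * rprod D l' z)%C. split; auto. split; [|split].
  - intros z Hz. destruct (Hh z (Hin z Hz)) as [A B]. split.
    + apply Cdiff_mult; auto. apply rprod_diff, Hl', Hz.
    + apply Cmult_neq_0; auto. apply rprod_neq0, Hl', Hz.
  - intros z Hz. assert (Hz0' : D z = 0%Z).
    { destruct (Z.eq_dec (D z) 0) as [E|E]; auto. exfalso.
      assert (In z l) by (apply Hl; split; auto; apply Hin; lra).
      assert (z <> z0) by (intros E'; subst; rewrite Cmod_sub_self in Hz; lra).
      specialize (Hsep z H H0). lra. }
    split; auto. destruct (Hf z (Hin z (proj2 Hz))) as [A _]. rewrite A by auto. rewrite Hfac.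
    apply f_equal with (f := @Some C). ring.
  - intros E. destruct (Hf z0 Hz0) as [A _]. rewrite A by auto. rewrite Hfac, E, czp_0.
    apply f_equal with (f := @Some C). ring.
Qed.

(** Near a pole the holomorphic chart is [1/f], equal to [(z - z0)^(-m) / G] with [m = D z0 < 0];
    elsewhere it is [f] itself. *)
Lemma LF_mero (D : C -> Z) (f : C -> sphere) :
  (forall z0, exists c R0 l h, LF D f c R0 l h /\ Cmod (z0 - c) < R0) -> meromorphic f /\ divisor_of D f.
Proof.
  intros H.
  assert (K : forall z0, exists r G, 0 < r /\ (forall z, Cmod (z - z0) < r -> Cdiff G z /\ G z <> 0) /\
    (forall z, 0 < Cmod (z - z0) < r -> D z = 0%Z /\ f z = Some (czp (z - z0) (D z0) * G z)%C) /\
    (D z0 = 0%Z -> f z0 = Some (G z0)) /\ ((D z0 > 0)%Z -> f z0 = Some (RtoC 0)) /\ ((D z0 < 0)%Z -> f z0 = None)).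
  { intros z0. destruct (H z0) as [c [R0 [l [h [HLF Hz]]]]].
    destruct (LF_near D f c R0 l h z0 HLF Hz) as [r [G [A [B [E F]]]]]. exists r, G.
    destruct HLF as [_ [_ HLF]]. destruct (HLF z0 Hz) as [_ [P Q]]. repeat split; auto; try apply B; auto; apply E; auto. }
  split; [split|].
  - destruct (K 0) as [r [G [A [B [E _]]]]]. exists (0 + RtoC (r/2))%C.
    assert (Hm : Cmod (0 + RtoC (r / 2) - 0) = r / 2) by (rewrite Cmod_sub_c, Cmod_R, Rabs_pos_eq; lra).
    destruct (E (0 + RtoC (r/2))%C) as [_ E2]; [lra|]. rewrite E2. discriminate.
  - intros z0. destruct (K z0) as [r [G [A [B [E [F [P Q]]]]]]]. exists r. split; auto.
    assert (Hz0 : Cmod (z0 - z0) < r) by (rewrite Cmod_sub_self; auto).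
    assert (Hne : forall z, z <> z0 -> Cmod (z - z0) < r -> 0 < Cmod (z - z0) < r) by (intros; split; auto; apply Cmod_sub_pos; auto).
    destruct (Z_lt_le_dec (D z0) 0) as [L|L].
    + right. exists (fun z => czp (z - z0) (- D z0) / G z)%C. split.
      * intros z Hz. apply Cdiff_iff. apply (Cdiff_div (fun z => czp (z - z0) (- D z0)) G).
        -- apply B, Hz.
        -- apply Cdiff_czp; [apply Cdiff_sub_const|left; lia].
        -- apply B, Hz.
      * intros z Hz. change (Cmod (z - z0) < r) in Hz. rewrite srecip_sinv.
        destruct (Ceq_dec z z0) as [Ez|Ez].
        -- subst. rewrite Q by lia. replace (z0 - z0)%C with (RtoC 0) by ring. rewrite czp_zero by lia.
           unfold sinv. replace (0 / G z0)%C with (RtoC 0) by (unfold Cdiv; ring). destruct (Ceq_dec 0 0); congruence.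
        -- assert (Hd : (z - z0)%C <> RtoC 0) by (intros E'; apply Ez, Csub_0_eq, E'). destruct (B z Hz) as [_ HG].
           assert (Hp := czp_neq0 (z - z0) (D z0) Hd).
           rewrite czp_opp by auto. destruct (E z (Hne z Ez Hz)) as [_ E2]. rewrite E2. unfold sinv.
           destruct (Ceq_dec (/ czp (z - z0) (D z0) / G z) 0) as [E3|E3].
           ++ exfalso. apply (f_equal (fun u => u * (czp (z - z0) (D z0) * G z))%C) in E3.
              replace (/ czp (z - z0) (D z0) / G z * (czp (z - z0) (D z0) * G z))%C with (RtoC 1) in E3 by (field; auto).
              replace (0 * (czp (z - z0) (D z0) * G z))%C with (RtoC 0) in E3 by ring. apply RtoC_inj in E3. lra.
           ++ apply f_equal with (f := @Some C). field. auto.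
    + left. exists (fun z => czp (z - z0) (D z0) * G z)%C. split.
      * intros z Hz. apply Cdiff_iff. apply (Cdiff_mult (fun z => czp (z - z0) (D z0)) G); [|apply B, Hz].
        apply Cdiff_czp; [apply Cdiff_sub_const|left; lia].
      * intros z Hz. change (Cmod (z - z0) < r) in Hz. destruct (Ceq_dec z z0) as [Ez|Ez].
        -- subst. replace (z0 - z0)%C with (RtoC 0) by ring. destruct (Z.eq_dec (D z0) 0) as [E0|E0].
           ++ rewrite F by auto. rewrite E0, czp_0. apply f_equal with (f := @Some C). ring.
           ++ rewrite P by lia. rewrite czp_zero by lia. apply f_equal with (f := @Some C). ring.
        -- apply E, Hne; auto.
  - intros a. destruct (K a) as [r [G [A [B [E [F _]]]]]]. exists r, G. split; auto. split.
    + intros z Hz. apply Cdiff_iff, B, Hz.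
    + split; [apply B; rewrite Cmod_sub_self; auto|].
      intros z Hz Hne. change (Cmod (z - a) < r) in Hz. apply E. split; auto. apply Cmod_sub_pos, Hne.
Qed.

(** [order_at] ignores the value at [a] itself; it is recovered as a limit, since a meromorphic map
    is continuous into the sphere. *)
Lemma order_limit (f : C -> sphere) (a : C) (m : Z) : order_at f a m -> meromorphic f ->
  ((m > 0)%Z -> f a = Some (RtoC 0)) /\ ((m < 0)%Z -> f a = None) /\ (m = 0%Z -> exists y, y <> RtoC 0 /\ f a = Some y).
Proof.
  intros [r [g [Hr [Hg [Hga Hf]]]]] Hm.
  assert (Hcont := mero_rcont f a Hm).
  assert (Haa : Cmod (a - a) < r) by (rewrite Cmod_sub_self; auto).
  assert (Hgd : Cdiff g a) by (apply Cdiff_iff, Hg, Haa).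
  assert (U : forall u : C -> sphere, rcont u a -> (forall z, 0 < Cmod (z - a) < r -> f z = u z) -> f a = u a).
  { intros u Hu Heq. apply (rho_limit_unique f a).
    - intros eps He. destruct (Hcont eps He) as [d [D1 D2]]. exists d. split; auto. intros w Hw. apply D2. lra.
    - intros eps He. destruct (Hu eps He) as [d [D1 D2]]. exists (Rmin d r). split; [apply Rmin_pos; auto|].
      intros w Hw. rewrite Heq.
      + apply D2. eapply Rlt_le_trans; [apply Hw|apply Rmin_l].
      + split; [lra|]. eapply Rlt_le_trans; [apply Hw|apply Rmin_r]. }
  assert (Hf' : forall z, 0 < Cmod (z - a) < r -> f z = Some (czp (z - a) m * g z)%C).
  { intros z [Hz1 Hz2]. apply Hf; [exact Hz2|]. intros E. subst. rewrite Cmod_sub_self in Hz1. lra. }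
  assert (P1 : (0 <= m)%Z -> f a = Some (czp (a - a) m * g a)%C).
  { intros L. apply (U (fun z => Some (czp (z - a) m * g z)%C)); auto.
    apply Ccont_rcont, Cdiff_Ccont. apply (Cdiff_mult (fun z => czp (z - a) m) g); auto.
    apply Cdiff_czp; [apply Cdiff_sub_const|auto]. }
  replace (a - a)%C with (RtoC 0) in P1 by ring.
  split; [|split].
  - intros L. rewrite P1 by lia. rewrite czp_zero by lia. apply f_equal with (f := @Some C). ring.
  - intros L. destruct (Cdiff_Ccont g a Hgd (Cmod (g a))) as [d [D1 D2]]; [apply Cmod_gt_0, Hga|].
    assert (Hnz : forall w, Cmod (w - a) < d -> g w <> RtoC 0).
    { intros w Hw E. specialize (D2 w Hw). rewrite E in D2. replace (0 - g a)%C with (- g a)%C in D2 by ring.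
      rewrite Cmod_opp in D2. lra. }
    set (u := fun z => if Ceq_dec z a then None else f z).
    assert (Q : f a = sinv (Some (czp (a - a) (- m) / g a)%C)).
    { apply (rho_limit_unique f a).
      - intros eps He. destruct (Hcont eps He) as [d' [D1' D2']]. exists d'. split; auto. intros w Hw. apply D2'. lra.
      - assert (Hc2 : rcont (fun z => sinv (Some (czp (z - a) (- m) / g z)%C)) a).
        { apply rcont_sinv, Ccont_rcont, Cdiff_Ccont. apply (Cdiff_div (fun z => czp (z - a) (- m)) g); auto.
          apply Cdiff_czp; [apply Cdiff_sub_const|left; lia]. }
        intros eps He. destruct (Hc2 eps He) as [d' [D1' D2']]. exists (Rmin (Rmin d' d) r).
        split; [repeat apply Rmin_pos; auto|]. intros w [Hw1 Hw2].
        assert (A1 := Rlt_le_trans _ _ _ Hw2 (Rmin_l _ _)). assert (A2 := Rlt_le_trans _ _ _ Hw2 (Rmin_r _ _)).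
        assert (A3 := Rlt_le_trans _ _ _ A1 (Rmin_l _ _)). assert (A4 := Rlt_le_trans _ _ _ A1 (Rmin_r _ _)).
        specialize (D2' w A3). rewrite Hf' by lra.
        replace (Some (czp (w - a) m * g w)%C : sphere) with (sinv (Some (czp (w - a) (- m) / g w)%C)); auto.
        assert (Hd : (w - a)%C <> RtoC 0) by (apply Cmod_gt_0; auto). assert (Hgw := Hnz w A4).
        assert (Hp := czp_neq0 (w - a) m Hd). rewrite czp_opp by auto. unfold sinv.
        destruct (Ceq_dec (/ czp (w - a) m / g w) 0) as [E3|E3].
        + exfalso. apply (f_equal (fun u => u * (czp (w - a) m * g w))%C) in E3.
          replace (/ czp (w - a) m / g w * (czp (w - a) m * g w))%C with (RtoC 1) in E3 by (field; auto).
          replace (0 * (czp (w - a) m * g w))%C with (RtoC 0) in E3 by ring. apply RtoC_inj in E3. lra.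
        + apply f_equal with (f := @Some C). field. auto. }
    rewrite Q. replace (a - a)%C with (RtoC 0) by ring. rewrite czp_zero by lia. unfold sinv.
    replace (0 / g a)%C with (RtoC 0) by (unfold Cdiv; ring). destruct (Ceq_dec 0 0); congruence.
  - intros E. exists (g a). split; [exact Hga|]. rewrite P1 by lia. rewrite E, czp_0.
    apply f_equal with (f := @Some C). ring.
Qed.

Lemma LF_exists (D : C -> Z) (f : C -> sphere) (c : C) (R0 : R) : divisor D -> meromorphic f -> divisor_of D f ->
  exists l h, LF D f c R0 l h.
Proof.
  intros HD Hm Hdiv. set (l := supp_list D (fun z => Cmod (z - c) < R0)).
  assert (Hl : supp D (fun z => Cmod (z - c) < R0) l) by (apply supp_list_spec; auto; apply bounded_disc).
  (* [W z0 y] says that [y] is the value at [z0] of the holomorphic extension of [f / rprod D l]. It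
     exists by [order_at] and is unique as a limit, so [h] can be chosen pointwise and still
     coincides locally with one holomorphic [G]. *)
  set (W := fun (z0 y : C) => y <> RtoC 0 /\ exists r G, 0 < r /\ (forall z, Cmod (z - z0) < r -> Cdiff G z) /\ G z0 = y /\
     forall z, 0 < Cmod (z - z0) < r -> f z = Some (G z * rprod D l z)%C).
  assert (HW1 : forall z0, Cmod (z0 - c) < R0 -> exists y, W z0 y).
  { intros z0 Hz0. destruct (Hdiv z0) as [r [g [Hr [Hg [Hg0 Hf]]]]].
    destruct (list_sep l z0) as [r2 [Hr2 Hsep]]. set (l' := fil (fun a => a <> z0) l).
    assert (Hl' : forall z, Cmod (z - z0) < r2 -> ~ In z l').
    { intros z Hz Hin'. apply fil_In in Hin'. destruct Hin' as [A B]. specialize (Hsep z A B). lra. }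
    assert (Hfac : forall z, rprod D l z = (czp (z - z0) (D z0) * rprod D l' z)%C).
    { intros z. apply rprod_factor; [apply Hl|]. destruct (Z.eq_dec (D z0) 0); auto. left. apply Hl. auto. }
    assert (Hz00 : Cmod (z0 - z0) < r2) by (rewrite Cmod_sub_self; auto).
    exists (g z0 / rprod D l' z0)%C. split.
    - intros E. apply Hg0. assert (A := rprod_neq0 D l' z0 (Hl' z0 Hz00)).
      change (@eq C (g z0) (RtoC 0)). replace (g z0) with (g z0 / rprod D l' z0 * rprod D l' z0)%C by (field; auto). rewrite E. ring.
    - exists (Rmin r r2), (fun z => g z / rprod D l' z)%C. split; [apply Rmin_pos; auto|]. split; [|split; auto].
      + intros z Hz. assert (A1 := Rlt_le_trans _ _ _ Hz (Rmin_l _ _)). assert (A2 := Rlt_le_trans _ _ _ Hz (Rmin_r _ _)).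
        apply (Cdiff_div g (rprod D l')); [apply rprod_neq0, Hl', A2|apply Cdiff_iff, Hg, A1|apply rprod_diff, Hl', A2].
      + intros z [Hz1 Hz2]. assert (A1 := Rlt_le_trans _ _ _ Hz2 (Rmin_l _ _)). assert (A2 := Rlt_le_trans _ _ _ Hz2 (Rmin_r _ _)).
        rewrite Hf; [|exact A1|intros E; subst; rewrite Cmod_sub_self in Hz1; lra].
        assert (A := rprod_neq0 D l' z (Hl' z A2)). rewrite Hfac.
        apply f_equal with (f := @Some C). change (czp (z - z0) (D z0) * g z = g z / rprod D l' z * (czp (z - z0) (D z0) * rprod D l' z))%C.
        field. auto. }
  assert (HW2 : forall z0 y y', W z0 y -> W z0 y' -> y = y').
  { intros z0 y y' [Hy [r [G [Hr [HG [HGz Hf]]]]]] [Hy' [r' [G' [Hr' [HG' [HGz' Hf']]]]]].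
    destruct (list_sep l z0) as [r2 [Hr2 Hsep]].
    assert (Q : (Some y : sphere) = Some y').
    { rewrite <- HGz, <- HGz'. apply (rho_limit_unique (fun z => Some (G z)) z0).
      - assert (Hc := Ccont_rcont G z0 (Cdiff_Ccont _ _ (HG z0 ltac:(rewrite Cmod_sub_self; auto)))).
        intros eps He. destruct (Hc eps He) as [d [D1 D2]]. exists d. split; auto. intros w Hw. apply D2. lra.
      - assert (Hc := Ccont_rcont G' z0 (Cdiff_Ccont _ _ (HG' z0 ltac:(rewrite Cmod_sub_self; auto)))).
        intros eps He. destruct (Hc eps He) as [d [D1 D2]]. exists (Rmin (Rmin d r2) (Rmin r r')). split; [repeat apply Rmin_pos; auto|].
        intros w [Hw1 Hw2].
        assert (A1 := Rlt_le_trans _ _ _ Hw2 (Rmin_l _ _)). assert (A2 := Rlt_le_trans _ _ _ Hw2 (Rmin_r _ _)).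
        assert (B1 := Rlt_le_trans _ _ _ A1 (Rmin_l _ _)). assert (B2 := Rlt_le_trans _ _ _ A1 (Rmin_r _ _)).
        assert (B3 := Rlt_le_trans _ _ _ A2 (Rmin_l _ _)). assert (B4 := Rlt_le_trans _ _ _ A2 (Rmin_r _ _)).
        assert (Hnl : ~ In w l).
        { intros Hin. assert (w <> z0) by (intros E; subst; rewrite Cmod_sub_self in Hw1; lra). specialize (Hsep w Hin H). lra. }
        assert (Hp := rprod_neq0 D l w Hnl).
        assert (E : Some (G w * rprod D l w)%C = Some (G' w * rprod D l w)%C).
        { transitivity (f w); [symmetry; apply Hf; lra|apply Hf'; lra]. }
        injection E as E. replace (G w) with (G' w); [apply D2, B1|].
        replace (G' w) with (G' w * rprod D l w / rprod D l w)%C by (field; auto).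
        replace (G' w * rprod D l w)%C with (G w * rprod D l w)%C.
        + field. auto.
        + apply injective_projections; simpl; auto. }
    injection Q. auto. }
  set (h := fun z => epsilon (inhabits (RtoC 0)) (W z)).
  assert (Hh : forall z, Cmod (z - c) < R0 -> W z (h z)) by (intros z Hz; apply epsilon_spec, HW1, Hz).
  exists l, h. split; [exact Hl|split].
  - intros z0 Hz0. split; [|apply (Hh z0 Hz0)].
    destruct (Hh z0 Hz0) as [Hy [r [G [Hr [HG [HGz Hf]]]]]].
    destruct (Cdiff_Ccont G z0 (HG z0 ltac:(rewrite Cmod_sub_self; auto)) (Cmod (G z0))) as [d [D1 D2]].
    { rewrite HGz. apply Cmod_gt_0, Hy. }
    set (r' := Rmin (Rmin d r) (R0 - Cmod (z0 - c))).
    assert (Hr' : 0 < r') by (repeat apply Rmin_pos; auto; lra).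
    apply (Cdiff_ext_loc G h z0 r' Hr'); [|apply HG; rewrite Cmod_sub_self; auto].
    intros z Hz. assert (A1 := Rlt_le_trans _ _ _ Hz (Rmin_l _ _)). assert (A2 := Rlt_le_trans _ _ _ Hz (Rmin_r _ _)).
    assert (B1 := Rlt_le_trans _ _ _ A1 (Rmin_l _ _)). assert (B2 := Rlt_le_trans _ _ _ A1 (Rmin_r _ _)).
    assert (Hzc : Cmod (z - c) < R0) by (pose proof (Cmod_tri z z0 c); lra).
    destruct (Ceq_dec z z0) as [E|E]; [subst; auto|].
    apply (HW2 z); [|apply Hh, Hzc]. split.
    + intros E0. specialize (D2 z B1). rewrite E0 in D2. replace (0 - G z0)%C with (- G z0)%C in D2 by ring. rewrite Cmod_opp in D2. lra.
    + assert (Hp := Cmod_sub_pos _ _ E). exists (Rmin (Cmod (z - z0)) (r - Cmod (z - z0))), G.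
      split; [apply Rmin_pos; lra|]. split; [|split; auto].
      * intros w Hw. apply HG. pose proof (Cmod_tri w z z0). pose proof (Rlt_le_trans _ _ _ Hw (Rmin_r _ _)). lra.
      * intros w [Hw1 Hw2]. apply Hf. assert (C1 := Rlt_le_trans _ _ _ Hw2 (Rmin_l _ _)). assert (C2 := Rlt_le_trans _ _ _ Hw2 (Rmin_r _ _)).
        split.
        -- apply Cmod_sub_pos. intros E'. subst. rewrite Cmod_sub_sym in C1. lra.
        -- pose proof (Cmod_tri w z z0). lra.
  - intros z Hz. destruct (order_limit f z (D z) (Hdiv z) Hm) as [P1 [P2 P3]]. split; [|split; auto].
    intros E. destruct (Hh z Hz) as [Hy [r [G [Hr [HG [HGz Hf]]]]]].
    assert (Hnl : ~ In z l) by (intros Hin; apply Hl in Hin; tauto).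
    assert (Hc1 := mero_rcont f z Hm).
    assert (Hc2 : rcont (fun z => Some (G z * rprod D l z)%C) z).
    { apply Ccont_rcont, Cdiff_Ccont. apply Cdiff_mult; [apply HG; rewrite Cmod_sub_self; auto|apply rprod_diff, Hnl]. }
    rewrite <- HGz. apply (rho_limit_unique f z).
    + intros eps He. destruct (Hc1 eps He) as [d [D1 D2]]. exists d. split; auto. intros w Hw. apply D2. lra.
    + intros eps He. destruct (Hc2 eps He) as [d [D1 D2]]. exists (Rmin d r). split; [apply Rmin_pos; auto|].
      intros w [Hw1 Hw2]. assert (C1 := Rlt_le_trans _ _ _ Hw2 (Rmin_l _ _)). assert (C2 := Rlt_le_trans _ _ _ Hw2 (Rmin_r _ _)).
      rewrite Hf by lra. apply D2, C1.
Qed.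

(** * The canonical product *)

Lemma Cmod_lim_le (g : R -> C) (L k : C) (B M0 : R) : Clim_infty g L -> (forall r, r > M0 -> Cmod (g r - k) <= B) -> Cmod (L - k) <= B.
Proof.
  intros Hg H. apply le_epsilon. intros eps He. destruct (Hg eps He) as [M HM].
  set (r := Rmax M M0 + 1). assert (A := Rmax_l M M0). assert (A' := Rmax_r M M0).
  specialize (HM r ltac:(unfold r; lra)). specialize (H r ltac:(unfold r; lra)).
  change (Cmod (g r - L) < eps) in HM. rewrite Cmod_sub_sym in HM.
  pose proof (Cmod_tri L (g r) k). lra.
Qed.

(** The mean value inequality bounds differences of [Lam r] by differences of [lam r]. Uniform
    Cauchy convergence of the derivatives thus passes to the functions and, uniformly in the
    increment, to their difference quotients, whose limit gives the derivative. *)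
Lemma limit_of_derivatives (R0 M0 : R) (Lam lam : R -> C -> C) : 0 < R0 ->
  (forall r w, M0 < r -> Cmod w < R0 -> Cder (Lam r) w (lam r w)) -> (forall r, M0 < r -> Lam r 0 = RtoC 0) ->
  (forall eps, 0 < eps -> exists M, forall r1 r2 w, M < r1 -> r1 <= r2 -> Cmod w < R0 -> Cmod (lam r2 w - lam r1 w) <= eps) ->
  exists L : C -> C, (forall w, Cmod w < R0 -> Cdiff L w) /\
    (forall eps, 0 < eps -> exists M, forall r w, M < r -> Cmod w < R0 -> Cmod (Lam r w - L w) <= eps).
Proof.
  intros HR Hder Hz HC.
  assert (Hseg : forall w t, Cmod w < R0 -> 0 <= t <= 1 -> Cmod (0 + RtoC t * w) < R0).
  { intros w t Hw Ht. replace (0 + RtoC t * w)%C with (RtoC t * w)%C by ring.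
    rewrite Cmod_mult, Cmod_R, Rabs_pos_eq by lra. pose proof (Cmod_ge_0 w). nra. }
  assert (HCL : forall eps, 0 < eps -> exists M, forall r1 r2 w, M < r1 -> r1 <= r2 -> Cmod w < R0 -> Cmod (Lam r2 w - Lam r1 w) <= eps).
  { intros eps He. destruct (HC (eps / (2 * R0))) as [M HM]; [apply Rdiv_lt_0_compat; lra|].
    exists (Rmax M M0). intros r1 r2 w H1 H2 Hw.
    assert (A1 : M < r1) by (eapply Rle_lt_trans; [apply Rmax_l|exact H1]).
    assert (A2 : M0 < r1) by (eapply Rle_lt_trans; [apply Rmax_r|exact H1]).
    assert (Q := Cder_mvt (fun w => Lam r2 w - Lam r1 w)%C (fun w => lam r2 w - lam r1 w)%C 0 w (eps / (2 * R0))).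
    cbv beta in Q. replace (0 + w)%C with w in Q by ring. rewrite !Hz in Q by lra.
    replace (Lam r2 w - Lam r1 w - (0 - 0))%C with (Lam r2 w - Lam r1 w)%C in Q by ring.
    eapply Rle_trans; [apply Q|].
    - intros t Ht. apply Cder_minus; apply Hder; try lra; apply Hseg; auto.
    - intros t Ht. apply HM; auto.
    - apply Rle_trans with (2 * (eps / (2 * R0)) * R0); [|right; field; lra].
      apply Rmult_le_compat_l; [|lra]. assert (0 < eps / (2 * R0)) by (apply Rdiv_lt_0_compat; lra). lra. }
  set (lim := fun (g : R -> C -> C) w => epsilon (inhabits (RtoC 0)) (fun y => Clim_infty (fun r => g r w) y)).
  assert (Hlim : forall g : R -> C -> C, (forall eps, 0 < eps -> exists M, forall r1 r2 w, M < r1 -> r1 <= r2 -> Cmod w < R0 -> Cmod (g r2 w - g r1 w) <= eps) ->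
     forall w, Cmod w < R0 -> Clim_infty (fun r => g r w) (lim g w)).
  { intros g Hg w Hw. unfold lim. apply (epsilon_spec (inhabits (RtoC 0)) (fun y => Clim_infty (fun r => g r w) y)).
    apply Clim_cauchy. intros eps He. destruct (Hg (eps/2)) as [M HM]; [lra|]. exists M. intros r1 r2 H1 H2.
    specialize (HM r1 r2 w H1 H2 Hw). lra. }
  assert (HL := Hlim Lam HCL). assert (Hl := Hlim lam HC).
  assert (Hunif : forall g : R -> C -> C, (forall eps, 0 < eps -> exists M, forall r1 r2 w, M < r1 -> r1 <= r2 -> Cmod w < R0 -> Cmod (g r2 w - g r1 w) <= eps) ->
     forall eps, 0 < eps -> exists M, forall r w, M < r -> Cmod w < R0 -> Cmod (g r w - lim g w) <= eps).
  { intros g Hg eps He. destruct (Hg eps He) as [M HM]. exists M. intros r w Hr Hw. rewrite Cmod_sub_sym.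
    apply (Cmod_lim_le (fun r => g r w) (lim g w) (g r w) eps r (Hlim g Hg w Hw)). intros r' Hr'. apply HM; auto; lra. }
  exists (lim Lam). split; [|apply Hunif, HCL].
  intros w Hw. exists (lim lam w). intros eps He.
  destruct (HC (eps/8)) as [M HM]; [lra|]. destruct (Hunif lam HC (eps/8)) as [M' HM']; [lra|].
  set (r := Rmax (Rmax M M') M0 + 1).
  assert (Hr : M < r /\ M' < r /\ M0 < r).
  { unfold r. pose proof (Rmax_l (Rmax M M') M0). pose proof (Rmax_r (Rmax M M') M0).
    pose proof (Rmax_l M M'). pose proof (Rmax_r M M'). lra. }
  clearbody r. destruct Hr as [Hr1 [Hr2 Hr3]].
  destruct (Hder r w Hr3 Hw (eps/4)) as [d [D1 D2]]; [lra|].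
  exists (Rmin d (R0 - Cmod w)). split; [apply Rmin_pos; lra|]. intros h Hh.
  assert (A1 := Rlt_le_trans _ _ _ Hh (Rmin_l _ _)). assert (A2 := Rlt_le_trans _ _ _ Hh (Rmin_r _ _)).
  specialize (D2 h A1). assert (Hwh : Cmod (w + h) < R0) by (pose proof (Cmod_triangle w h); lra).
  assert (Hd : Cmod ((lim Lam (w + h)%C - lim Lam w) - (Lam r (w + h)%C - Lam r w)) <= eps / 4 * Cmod h).
  { apply (Cmod_lim_le (fun r' => Lam r' (w + h)%C - Lam r' w)%C _ _ _ r).
    - apply (Clim_ext (fun r' => Lam r' (w + h)%C + (-1) * Lam r' w)%C _ _ 0); [intros; ring|].
      replace (lim Lam (w + h)%C - lim Lam w)%C with (lim Lam (w + h)%C + (-1) * lim Lam w)%C by ring.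
      apply Clim_plus; [|apply Clim_scal]; apply HL; auto.
    - intros r' Hr'.
      assert (Q := Cder_mvt (fun w => Lam r' w - Lam r w)%C (fun w => lam r' w - lam r w)%C w h (eps/8)).
      cbv beta in Q.
      replace (Lam r' (w + h)%C - Lam r' w - (Lam r (w + h)%C - Lam r w))%C
        with (Lam r' (w + h)%C - Lam r (w + h)%C - (Lam r' w - Lam r w))%C by ring.
      replace (eps / 4) with (2 * (eps / 8)) by field.
      assert (Hs : forall t, 0 <= t <= 1 -> Cmod (w + RtoC t * h) < R0).
      { intros t Ht. eapply Rle_lt_trans; [apply Cmod_triangle|]. rewrite Cmod_mult, Cmod_R, Rabs_pos_eq by lra.
        pose proof (Cmod_ge_0 h). nra. }
      apply Q.
      + intros t Ht. apply Cder_minus; apply Hder; auto; lra.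
      + intros t Ht. apply HM; auto. lra. }
  specialize (HM' r w Hr2 Hw).
  replace (lim Lam (w + h)%C - lim Lam w - lim lam w * h)%C
    with ((lim Lam (w + h)%C - lim Lam w - (Lam r (w + h)%C - Lam r w)) + (Lam r (w + h)%C - Lam r w - lam r w * h) + (lam r w - lim lam w) * h)%C by ring.
  eapply Rle_trans; [apply Cmod_triangle|]. eapply Rle_trans; [apply Rplus_le_compat_r, Cmod_triangle|].
  rewrite Cmod_mult. assert (0 <= Cmod h) by apply Cmod_ge_0.
  assert (Cmod (lam r w - lim lam w) * Cmod h <= eps / 8 * Cmod h) by (apply Rmult_le_compat_r; auto).
  assert (0 <= eps * Cmod h) by (apply Rmult_le_pos; lra). lra.
Qed.

Lemma Cder_csum (l : list C) (F : C -> C -> C) (dF : C -> C) (w : C) : (forall a, In a l -> Cder (F a) w (dF a)) ->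
  Cder (fun w => csum l (fun a => F a w)) w (csum l dF).
Proof.
  intros H. induction l as [|b l IH]; [apply (Cder_const (RtoC 0))|].
  apply (Cder_plus (F b) (fun w => csum l (fun a => F a w))); [apply H; left; auto|apply IH; intros; apply H; right; auto].
Qed.

(** [e2] is the primary factor of genus one and [e1] its logarithm for [|w| < |a|], where
    [1 - w / a] lies in the right half-plane. *)
Definition e1 (a w : C) : C := (Clog (1 - w / a) + w / a)%C.
Definition e2 (a w : C) : C := ((1 - w / a) * cexp (w / a))%C.

Lemma Re_one_minus (a w : C) : Cmod w < Cmod a -> 0 < fst (1 - w / a)%C.
Proof.
  intros H. assert (Ha : a <> 0) by (apply Cmod_gt_0; pose proof (Cmod_ge_0 w); lra).
  assert (Hq : Cmod (w / a) < 1).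
  { rewrite Cmod_div by auto. apply Rmult_lt_reg_r with (Cmod a); [pose proof (Cmod_ge_0 w); lra|].
    unfold Rdiv. rewrite Rmult_assoc, Rinv_l; pose proof (Cmod_ge_0 w); lra. }
  assert (F := fst_le_Cmod (w / a)). assert (F2 : Rabs (fst (w / a)%C) < 1) by lra. apply Rabs_def2 in F2.
  change (0 < 1 + - fst (w / a)%C). lra.
Qed.

Lemma cexp_e1 (a w : C) : Cmod w < Cmod a -> cexp (e1 a w) = e2 a w.
Proof. intros H. unfold e1, e2. rewrite cexp_plus, cexp_Clog by (apply Re_one_minus, H). reflexivity. Qed.

Lemma Cder_e1 (a w : C) : Cmod w < Cmod a -> Cder (e1 a) w (- / (a - w) + / a).
Proof.
  intros H. assert (Ha : a <> 0) by (apply Cmod_gt_0; pose proof (Cmod_ge_0 w); lra).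
  assert (Haw : (a - w <> 0)%C) by (apply Cmod_gt_0; pose proof (Cmod_tri_inv a w); lra).
  unfold e1. assert (Q : Cder (fun w => w / a)%C w (/ a)).
  { eapply Cder_eq; [apply (Cder_mult (fun w => w) (fun _ => / a)%C); [apply Cder_id|apply Cder_const]|]. cbv beta. ring. }
  apply Cder_plus; auto.
  eapply Cder_eq; [apply (Cder_comp Clog (fun w => 1 - w / a)%C w); [apply (Cder_minus (fun _ => RtoC 1)); [apply Cder_const|exact Q]|apply Cder_Clog, Re_one_minus, H]|].
  field. repeat split; auto.
Qed.

Section Product.
Variables (D : C -> Z) (K : R).
Hypotheses (HD : divisor D) (HC : count_bound D 1 K) (H0 : D 0 = 0%Z).
Hypothesis Hsq : exists L, Clim_infty (fun rho => csum (fil (fun a => 1 <= Cmod a) (lst D rho)) (fterm D)) L.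

Definition tl (r0 r : R) : list C := fil (fun a => ~ Cmod a < r0) (lst D r).
Definition Lam (r0 r : R) (w : C) : C := csum (tl r0 r) (fun a => RtoC (IZR (D a)) * e1 a w)%C.
Definition lam (r0 r : R) (w : C) : C := csum (tl r0 r) (fun a => RtoC (IZR (D a)) * (- / (a - w) + / a))%C.

Lemma tl_In r0 r a : In a (tl r0 r) <-> D a <> 0%Z /\ r0 <= Cmod a < r.
Proof. unfold tl. rewrite fil_In, lst_In by auto. intuition lra. Qed.

Lemma tl_diff r0 r1 r2 F : r0 <= r1 -> r1 <= r2 -> (csum (tl r0 r2) F - csum (tl r0 r1) F)%C = csum (tl r1 r2) F.
Proof.
  intros H1 H2. rewrite (csum_perm (tl r0 r2) (tl r0 r1 ++ tl r1 r2)); [rewrite csum_app; ring|].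
  assert (ND : forall x y, NoDup (tl x y)) by (intros; apply fil_NoDup, lst_supp, HD).
  apply NoDup_same_perm; auto.
  - apply NoDup_app; auto. intros a A B. apply tl_In in A, B. lra.
  - intros a. rewrite in_app_iff, !tl_In. split; [|intuition lra].
    intros [A B]. destruct (Rlt_le_dec (Cmod a) r1); [left|right]; split; auto; lra.
Qed.

(** [-1/(a-w) + 1/a = -w/a^2 - w^2/(a^2 (a-w))]: the first part converges by (f), the second by
    [tail_cube], both uniformly for [|w| < r0/2]. *)
Lemma lam_cauchy r0 : 1 <= r0 -> forall eps, 0 < eps -> exists M, forall r1 r2 w, M < r1 -> r1 <= r2 -> Cmod w < r0 / 2 ->
  Cmod (lam r0 r2 w - lam r0 r1 w) <= eps.
Proof.
  intros Hr0 eps He. destruct Hsq as [Ls HLs]. assert (HK := proj1 HC).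
  destruct (HLs (eps / (4 * r0))) as [M1 HM1]; [apply Rdiv_lt_0_compat; lra|].
  exists (Rmax (Rmax M1 r0) (r0 * r0 * 1200 * K / eps)). intros r1 r2 w H1 H2 Hw.
  assert (A1 : Rmax M1 r0 < r1) by (eapply Rle_lt_trans; [apply Rmax_l|exact H1]).
  assert (A2 : r0 * r0 * 1200 * K / eps < r1) by (eapply Rle_lt_trans; [apply Rmax_r|exact H1]).
  assert (A3 : M1 < r1) by (eapply Rle_lt_trans; [apply Rmax_l|exact A1]).
  assert (A4 : r0 < r1) by (eapply Rle_lt_trans; [apply Rmax_r|exact A1]).
  unfold lam. rewrite tl_diff by lra.
  rewrite (csum_ext _ _ (fun a => - w * fterm D a + - (w * w) * (RtoC (IZR (D a)) * / (a * a * (a - w))))%C).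
  2:{ intros a Ha. apply tl_In in Ha. assert (Ha0 : a <> 0) by (apply Cmod_gt_0; lra).
      assert (Haw : (a - w <> 0)%C) by (apply Cmod_gt_0; pose proof (Cmod_tri_inv a w); lra).
      unfold fterm. field. auto. }
  rewrite csum_plus, !csum_scal.
  assert (B1 : Cmod (csum (tl r1 r2) (fterm D)) <= 2 * (eps / (4 * r0))).
  { set (sg := fun rho => csum (fil (fun a => 1 <= Cmod a) (lst D rho)) (fterm D)) in *.
    assert (E : csum (tl r1 r2) (fterm D) = (sg r2 - sg r1)%C).
    { assert (Es : forall r, csum (tl 1 r) (fterm D) = sg r).
      { intros r. unfold sg, tl. apply csum_perm, NoDup_same_perm; try (apply fil_NoDup, lst_supp, HD).
        intros a. rewrite !fil_In. intuition lra. }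
      rewrite <- (tl_diff 1 r1 r2), !Es by lra. reflexivity. }
    rewrite E. replace (sg r2 - sg r1)%C with ((sg r2 - Ls) - (sg r1 - Ls))%C by ring.
    eapply Rle_trans; [apply Cmod_tri_sub|].
    assert (C1 := HM1 r1 A3). assert (C2 := HM1 r2 ltac:(lra)).
    change (Cmod (sg r1 - Ls) < eps / (4 * r0)) in C1. change (Cmod (sg r2 - Ls) < eps / (4 * r0)) in C2. lra. }
  assert (B2 : Cmod (csum (tl r1 r2) (fun a => RtoC (IZR (D a)) * / (a * a * (a - w)))%C) <= 2 * (600 * K / r1)).
  { eapply Rle_trans; [apply csum_Cmod|].
    apply Rle_trans with (rsum (tl r1 r2) (fun a => 2 * (absD D a * / (Cmod a)^3))).
    - apply rsum_le. intros a Ha. apply tl_In in Ha. assert (Ha0 : a <> 0) by (apply Cmod_gt_0; lra).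
      assert (T := Cmod_tri_inv a w). assert (Haw : (a - w <> 0)%C) by (apply Cmod_gt_0; lra).
      rewrite Cmod_mult, Cmod_R, Cmod_inv by (repeat apply Cmult_neq_0; auto). rewrite !Cmod_mult. fold (absD D a).
      replace (2 * (absD D a * / Cmod a ^ 3)) with (absD D a * (2 * / Cmod a ^ 3)) by ring.
      apply Rmult_le_compat_l; [apply absD_pos|].
      replace (2 * / Cmod a ^ 3) with (/ (Cmod a * Cmod a * (Cmod a / 2))) by (field; lra).
      apply Rinv_le_contravar; [repeat apply Rmult_lt_0_compat; lra|].
      apply Rmult_le_compat_l; [apply Rmult_le_pos; lra|lra].
    - rewrite rsum_scal. apply Rmult_le_compat_l; [lra|]. apply tail_cube; auto; [lra|apply fil_NoDup, lst_supp, HD|].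
      intros a Ha. apply tl_In in Ha. lra. }
  eapply Rle_trans; [apply Cmod_triangle|]. rewrite !Cmod_mult, !Cmod_opp, Cmod_mult.
  assert (W := Cmod_ge_0 w).
  assert (C1 : Cmod w * Cmod (csum (tl r1 r2) (fterm D)) <= r0 * (2 * (eps / (4 * r0)))) by (apply Rmult_le_compat; try apply Cmod_ge_0; lra).
  replace (r0 * (2 * (eps / (4 * r0)))) with (eps / 2) in C1 by (field; lra).
  assert (C2 : Cmod w * Cmod w * Cmod (csum (tl r1 r2) (fun a => RtoC (IZR (D a)) * / (a * a * (a - w)))%C) <= (r0 * r0 / 4) * (2 * (600 * K / r1))).
  { apply Rmult_le_compat; auto; [nra|apply Cmod_ge_0|nra]. }
  replace ((r0 * r0 / 4) * (2 * (600 * K / r1))) with (r0 * r0 * 1200 * K / 4 / r1) in C2 by (field; lra).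
  apply Rmult_lt_compat_r with (r := eps) in A2; auto. unfold Rdiv in A2. rewrite Rmult_assoc, Rinv_l in A2 by lra.
  assert (C3 : r0 * r0 * 1200 * K / 4 / r1 <= eps / 4).
  { apply Rmult_le_reg_r with r1; [lra|]. unfold Rdiv at 1. rewrite Rmult_assoc, Rinv_l by lra. lra. }
  lra.
Qed.

Lemma Lam_lim r0 : 1 <= r0 -> exists L : C -> C, (forall w, Cmod w < r0 / 2 -> Cdiff L w) /\
  (forall eps, 0 < eps -> exists M, forall r w, M < r -> Cmod w < r0 / 2 -> Cmod (Lam r0 r w - L w) <= eps).
Proof.
  intros Hr0. apply (limit_of_derivatives (r0 / 2) 0 (Lam r0) (lam r0)); [lra| | |apply lam_cauchy, Hr0].
  - intros r w _ Hw. apply Cder_csum. intros a Ha. apply tl_In in Ha. apply Cder_scal, Cder_e1. lra.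
  - intros r _. unfold Lam. apply injective_projections; [rewrite csum_fst|rewrite csum_snd]; apply rsum_0; intros a Ha;
      apply tl_In in Ha; assert (Ha0 : a <> 0) by (apply Cmod_gt_0; lra);
      replace (e1 a 0) with (RtoC 0); try (simpl; ring);
      unfold e1; replace (0 / a)%C with (RtoC 0) by (unfold Cdiv; ring); replace (1 - 0 + 0)%C with (RtoC 1) by ring;
      replace (1 - 0)%C with (RtoC 1) by ring; unfold Clog; rewrite Cmod_1, ln_1; simpl; unfold Rdiv; rewrite Rmult_0_l, atan_0;
      apply injective_projections; simpl; ring.
Qed.

Definition PZ (r : R) (w : C) : C := prod_zeros D (fun z => Cmod z < r) (fun a => e2 a w).
Definition PP (r : R) (w : C) : C := prod_poles D (fun z => Cmod z < r) (fun a => e2 a w).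
Definition zl (r : R) : list C := supp_list D (fun z => (D z > 0)%Z /\ Cmod z < r).
Definition pl (r : R) : list C := supp_list D (fun z => (D z < 0)%Z /\ Cmod z < r).

Lemma zl_supp r : supp D (fun z => (D z > 0)%Z /\ Cmod z < r) (zl r).
Proof. apply supp_list_spec; auto. apply (bounded_sub (fun z => Cmod z < r)); [tauto|apply bounded_lst]. Qed.
Lemma pl_supp r : supp D (fun z => (D z < 0)%Z /\ Cmod z < r) (pl r).
Proof. apply supp_list_spec; auto. apply (bounded_sub (fun z => Cmod z < r)); [tauto|apply bounded_lst]. Qed.

Lemma PZ_eq r w : PZ r w = cprod (zl r) (fun a => cpw (e2 a w) (Z.to_nat (D a))).
Proof. reflexivity. Qed.
Lemma PP_eq r w : PP r w = cprod (pl r) (fun a => cpw (e2 a w) (Z.to_nat (- D a))).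
Proof. reflexivity. Qed.

Lemma cprod_cexp (l : list C) (n : C -> nat) (w : C) : (forall a, In a l -> Cmod w < Cmod a) ->
  cprod l (fun a => cpw (e2 a w) (n a)) = cexp (csum l (fun a => RtoC (INR (n a)) * e1 a w)%C).
Proof.
  intros H. induction l as [|b l IH]; [unfold cprod, csum; simpl; rewrite cexp_0; reflexivity|].
  rewrite cprod_cons, csum_cons, cexp_plus, IH by (intros; apply H; right; auto).
  rewrite <- (cexp_e1 b w) by (apply H; left; auto). rewrite cpw_cexp. reflexivity.
Qed.

(** For [|w| < r0] the factors with [|a| >= r0] are exponentials of [e1], so that zeros and poles
    come only from the finite products over [|a| < r0]. *)
Lemma tail_factor r0 r w : r0 <= r -> Cmod w < r0 -> exists E1 E2 : C,
  PZ r w = (PZ r0 w * cexp E1)%C /\ PP r w = (PP r0 w * cexp E2)%C /\ (E1 - E2)%C = Lam r0 r w.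
Proof.
  intros Hr Hw. set (tz := fil (fun a => (D a > 0)%Z) (tl r0 r)). set (tp := fil (fun a => (D a < 0)%Z) (tl r0 r)).
  assert (ND : NoDup (tl r0 r)) by (apply fil_NoDup, lst_supp, HD).
  exists (csum tz (fun a => RtoC (INR (Z.to_nat (D a))) * e1 a w)%C), (csum tp (fun a => RtoC (INR (Z.to_nat (- D a))) * e1 a w)%C).
  split; [|split].
  - rewrite !PZ_eq. rewrite (cprod_perm (zl r) (zl r0 ++ tz)).
    + rewrite cprod_app. f_equal. apply (cprod_cexp tz (fun a => Z.to_nat (D a))).
      intros a Ha. apply fil_In in Ha. destruct Ha as [Ha _]. apply tl_In in Ha. lra.
    + assert (A := zl_supp r). assert (B := zl_supp r0). apply NoDup_same_perm; [apply A| |].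
      * apply NoDup_app; [apply B|apply fil_NoDup, ND|]. intros a X Y. apply B in X. apply fil_In in Y. destruct Y as [Y _]. apply tl_In in Y. lra.
      * intros a. rewrite in_app_iff. unfold tz. rewrite fil_In, tl_In. rewrite (proj2 A a), (proj2 B a).
        split; [|intuition lra]. intros [X [Y Z]]. destruct (Rlt_le_dec (Cmod a) r0); [left|right]; repeat split; auto; lra.
  - rewrite !PP_eq. rewrite (cprod_perm (pl r) (pl r0 ++ tp)).
    + rewrite cprod_app. f_equal. apply (cprod_cexp tp (fun a => Z.to_nat (- D a))).
      intros a Ha. apply fil_In in Ha. destruct Ha as [Ha _]. apply tl_In in Ha. lra.
    + assert (A := pl_supp r). assert (B := pl_supp r0). apply NoDup_same_perm; [apply A| |].
      * apply NoDup_app; [apply B|apply fil_NoDup, ND|]. intros a X Y. apply B in X. apply fil_In in Y. destruct Y as [Y _]. apply tl_In in Y. lra.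
      * intros a. rewrite in_app_iff. unfold tp. rewrite fil_In, tl_In. rewrite (proj2 A a), (proj2 B a).
        split; [|intuition lra]. intros [X [Y Z]]. destruct (Rlt_le_dec (Cmod a) r0); [left|right]; repeat split; auto; lra.
  - unfold Lam. rewrite (csum_perm (tl r0 r) (tz ++ tp)).
    + rewrite csum_app.
      rewrite (csum_ext tz (fun a => RtoC (INR (Z.to_nat (D a))) * e1 a w)%C (fun a => RtoC (IZR (D a)) * e1 a w)%C).
      2:{ intros a Ha. apply fil_In in Ha. rewrite INR_IZR_INZ, Z2Nat.id by lia. reflexivity. }
      rewrite (csum_ext tp (fun a => RtoC (INR (Z.to_nat (- D a))) * e1 a w)%C (fun a => (-1) * (RtoC (IZR (D a)) * e1 a w))%C).
      2:{ intros a Ha. apply fil_In in Ha. rewrite INR_IZR_INZ, Z2Nat.id, opp_IZR, RtoC_opp by lia. ring. }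
      rewrite csum_scal. ring.
    + apply NoDup_same_perm; auto.
      * apply NoDup_app; try (apply fil_NoDup, ND). intros a X Y. apply fil_In in X, Y. lia.
      * intros a. rewrite in_app_iff. unfold tz, tp. rewrite !fil_In, !tl_In. split; [|intuition].
        intros [X Y]. destruct (Z_lt_le_dec (D a) 0); [right|left]; repeat split; auto; try lra; lia.
Qed.

Definition Pr (r : R) (w : C) : sphere := sdiv (PZ r w) (PP r w).
Definition Floc (r0 : R) (L : C -> C) (w : C) : sphere := sdiv (PZ r0 w * cexp (L w))%C (PP r0 w).

Lemma Pr_local r0 r w : r0 <= r -> Cmod w < r0 -> Pr r w = Floc r0 (Lam r0 r) w.
Proof.
  intros Hr Hw. destruct (tail_factor r0 r w Hr Hw) as [E1 [E2 [A [B E]]]].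
  unfold Pr, Floc. rewrite !sdiv_eq, A, B, <- E.
  assert (X2 := cexp_neq_0 E2).
  destruct (Ceq_dec (PP r0 w * cexp E2) 0) as [Z1|Z1], (Ceq_dec (PP r0 w) 0) as [Z2|Z2]; auto.
  - exfalso. exact (Cmult_neq_0 _ _ Z2 X2 Z1).
  - exfalso. apply Z1. rewrite Z2. ring.
  - apply f_equal with (f := @Some C). unfold Cminus. rewrite cexp_plus, cexp_opp. field. auto.
Qed.

Lemma cexp_near0 (eps : R) : 0 < eps -> exists d, 0 < d /\ forall z, Cmod z <= d -> 2 * Cmod (cexp z - 1) < eps.
Proof.
  intros He. destruct (Ccont_cexp 0 (eps/2)) as [d [D1 D2]]; [lra|]. exists (d/2). split; [lra|]. intros z Hz.
  specialize (D2 z). replace (z - 0)%C with z in D2 by ring. rewrite cexp_0 in D2. specialize (D2 ltac:(lra)). lra.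
Qed.

(** Off the poles [Pr r] and its limit are the same quotient [y] times [cexp (Lam r0 r w)] and
    [cexp (L w)]; [rho_scaled] gives a bound free of [y], hence uniform up to the poles. *)
Lemma Pr_unif r0 L : (forall eps, 0 < eps -> exists M, forall r w, M < r -> Cmod w < r0 / 2 -> Cmod (Lam r0 r w - L w) <= eps) -> 1 <= r0 ->
  forall eps, 0 < eps -> exists M, forall r w, M < r -> Cmod w < r0 / 2 -> rhoS (Pr r w) (Floc r0 L w) < eps.
Proof.
  intros HL Hr0 eps He. destruct (cexp_near0 eps He) as [d [D1 D2]]. destruct (HL d D1) as [M HM].
  exists (Rmax M r0). intros r w Hr Hw.
  assert (A1 : M < r) by (eapply Rle_lt_trans; [apply Rmax_l|exact Hr]).
  assert (A2 : r0 < r) by (eapply Rle_lt_trans; [apply Rmax_r|exact Hr]).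
  rewrite (Pr_local r0 r w) by lra. unfold Floc. rewrite !sdiv_eq.
  destruct (Ceq_dec (PP r0 w) 0); [rewrite rho_refl; exact He|].
  set (y := (PZ r0 w / PP r0 w)%C).
  replace (PZ r0 w * cexp (Lam r0 r w) / PP r0 w)%C with (y * cexp (Lam r0 r w))%C by (unfold y; field; auto).
  replace (PZ r0 w * cexp (L w) / PP r0 w)%C with (y * cexp (L w))%C by (unfold y; field; auto).
  eapply Rle_lt_trans; [apply rho_scaled, cexp_neq_0|].
  specialize (D2 _ (HM r w A1 Hw)). unfold Cminus at 2 in D2. rewrite cexp_plus, cexp_opp in D2.
  assert (X := cexp_neq_0 (L w)). rewrite <- Rmult_div_assoc, <- Cmod_div by auto.
  replace ((cexp (Lam r0 r w) - cexp (L w)) / cexp (L w))%C with (cexp (Lam r0 r w) * / cexp (L w) - 1)%C by (field; auto).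
  exact D2.
Qed.

(** The pointwise limit; [Flim_loc] identifies it with [Floc r0 L] on each disc, so it does not
    depend on the auxiliary radius [r0]. *)
Definition Flim (w : C) : sphere := epsilon (inhabits None) (fun u => forall eps, 0 < eps -> exists M, forall r, M < r -> rhoS (Pr r w) u < eps).

Lemma Flim_loc r0 L w : (forall eps, 0 < eps -> exists M, forall r w, M < r -> Cmod w < r0 / 2 -> Cmod (Lam r0 r w - L w) <= eps) -> 1 <= r0 ->
  Cmod w < r0 / 2 -> Flim w = Floc r0 L w.
Proof.
  intros HL Hr0 Hw. assert (HU := Pr_unif r0 L HL Hr0).
  assert (HF : forall eps, 0 < eps -> exists M, forall r, M < r -> rhoS (Pr r w) (Flim w) < eps).
  { unfold Flim. apply (epsilon_spec (inhabits None) (fun u => forall eps, 0 < eps -> exists M, forall r, M < r -> rhoS (Pr r w) u < eps)).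
    exists (Floc r0 L w). intros eps He. destruct (HU eps He) as [M HM]. exists M. auto. }
  apply rho_eq0. apply Rle_antisym; [|apply rho_pos]. apply le_epsilon. intros eps He.
  destruct (HU (eps/2)) as [M1 HM1]; [lra|]. destruct (HF (eps/2)) as [M2 HM2]; [lra|].
  set (r := Rmax M1 M2 + 1). assert (A := Rmax_l M1 M2). assert (A' := Rmax_r M1 M2).
  specialize (HM1 r w ltac:(unfold r; lra) Hw). specialize (HM2 r ltac:(unfold r; lra)).
  pose proof (rho_tri (Flim w) (Pr r w) (Floc r0 L w)). rewrite (rho_sym (Flim w) (Pr r w)) in H. lra.
Qed.

Lemma Flim_unif (Rad eps : R) : 0 < eps -> exists M, forall r, r > M -> forall w, Cmod w <= Rad -> rhoS (Pr r w) (Flim w) < eps.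
Proof.
  intros He. set (r0 := 2 * (Rmax Rad 0 + 1)). assert (A := Rmax_l Rad 0). assert (A' := Rmax_r Rad 0).
  assert (Hr0 : 1 <= r0) by (unfold r0; lra).
  destruct (Lam_lim r0 Hr0) as [L [_ HL]]. destruct (Pr_unif r0 L HL Hr0 eps He) as [M HM].
  exists M. intros r Hr w Hw. assert (Hw2 : Cmod w < r0 / 2) by (unfold r0; lra).
  rewrite (Flim_loc r0 L w HL Hr0 Hw2). auto.
Qed.

Lemma e2_factor (a w : C) : a <> 0 -> e2 a w = ((w - a) * (- / a * cexp (w / a)))%C.
Proof. intros Ha. unfold e2. field. auto. Qed.

Lemma e2_neq0 (a w : C) : a <> 0 -> w <> a -> e2 a w <> 0.
Proof.
  intros Ha Hw. rewrite e2_factor by auto. apply Cmult_neq_0; [intros E; apply Hw, Csub_0_eq, E|].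
  apply Cmult_neq_0; [|apply cexp_neq_0]. intros E. apply (f_equal (fun u => u * a)%C) in E.
  replace (- / a * a)%C with (RtoC (-1)) in E by (field; auto). replace (0 * a)%C with (RtoC 0) in E by ring. apply RtoC_inj in E. lra.
Qed.

Lemma In_neq0 r a : In a (lst D r) -> a <> 0.
Proof. intros Ha E. apply lst_In in Ha; auto. subst. tauto. Qed.

Lemma PP_neq0 r w : ~ (D w < 0)%Z -> PP r w <> 0.
Proof.
  intros Hw. rewrite PP_eq. apply cprod_neq0. intros a Ha. apply (pl_supp r) in Ha. apply cpw_neq0, e2_neq0.
  - intros E. rewrite E, H0 in Ha. lia.
  - intros E. subst. tauto.
Qed.

Lemma quot_eq r w : D w = 0%Z -> (PZ r w / PP r w)%C = cprod (lst D r) (fun a => czp (e2 a w) (D a)).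
Proof.
  intros Hw.
  assert (Hperm : Permutation (lst D r) (zl r ++ pl r)) by (apply supp_zp_perm; auto; [apply bounded_lst|apply lst_supp, HD]).
  rewrite (cprod_perm _ _ _ Hperm), cprod_app. rewrite PZ_eq, PP_eq. unfold Cdiv. f_equal.
  - apply cprod_ext. intros a Ha. apply (zl_supp r) in Ha. rewrite czp_pos by lia. reflexivity.
  - assert (Hne : forall a, In a (pl r) -> cpw (e2 a w) (Z.to_nat (- D a)) <> RtoC 0).
    { intros a Ha. apply (pl_supp r) in Ha. apply cpw_neq0, e2_neq0.
      - intros E. rewrite E, H0 in Ha. lia.
      - intros E. subst. lia. }
    assert (G : forall l, (forall a, In a l -> In a (pl r)) -> (/ cprod l (fun a => cpw (e2 a w) (Z.to_nat (- D a))))%C = cprod l (fun a => czp (e2 a w) (D a))).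
    { induction l as [|b l IH]; intros Hin; [unfold cprod; simpl; field|].
      rewrite !cprod_cons. rewrite <- IH by (intros; apply Hin; right; auto).
      assert (Hb := Hin b (or_introl eq_refl)). assert (Hb2 := proj1 (proj2 (pl_supp r) b) Hb).
      rewrite czp_neg by tauto. field. split; [|apply Hne, Hb]. apply cprod_neq0. intros a Ha. apply Hne, Hin. right. auto. }
    apply G. auto.
Qed.

Lemma ln_quot r w : D w = 0%Z ->
  ln (Cmod (PZ r w / PP r w)) = rsum (lst D r) (fun a => IZR (D a) * (ln (Cmod (w - a)) - ln (Cmod a) + fst (w / a)%C)).
Proof.
  intros Hw. rewrite quot_eq by auto.
  assert (Hne : forall a, In a (lst D r) -> a <> 0 /\ w <> a).
  { intros a Ha. split; [apply (In_neq0 r), Ha|]. intros E. apply lst_In in Ha; auto. subst. tauto. }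
  rewrite ln_cprod.
  - apply rsum_ext. intros a Ha. destruct (Hne a Ha) as [A B]. rewrite ln_czp by (apply e2_neq0; auto). f_equal.
    rewrite e2_factor by auto. rewrite !Cmod_mult, Cmod_opp, Cmod_inv, Cmod_cexp by auto.
    assert (Hp := proj1 (Cmod_gt_0 a) A). assert (Hq := Cmod_sub_pos w a B).
    rewrite !ln_mult, ln_Rinv, ln_exp; auto; try apply exp_pos; try (apply Rinv_0_lt_compat; auto); [ring|].
    apply Rmult_lt_0_compat; [apply Rinv_0_lt_compat; auto|apply exp_pos].
  - intros a Ha. destruct (Hne a Ha) as [A B]. apply czp_neq0, e2_neq0; auto.
Qed.

Lemma smul_sdiv (k x y : C) : smul k (sdiv x y) = sdiv (k * x)%C y.
Proof.
  rewrite !sdiv_eq. destruct (Ceq_dec y 0); auto. unfold smul. apply f_equal with (f := @Some C).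
  change (k * (x / y) = k * x / y)%C. field. auto.
Qed.

Lemma Flim_LF (alpha : C) (R0 : R) : 1 <= R0 -> exists h, LF D (fun w => smul (cexp (alpha * w)%C) (Flim w)) 0 R0 (lst D R0) h.
Proof.
  (* [Lam_lim] gives the limit only for [|w| < r0 / 2], hence the doubled radius. *)
  intros HR0. set (r0 := 2 * R0). assert (Hr0 : 1 <= r0) by (unfold r0; lra).
  destruct (Lam_lim r0 Hr0) as [L [HLd HL]].
  assert (Hhalf : r0 / 2 = R0) by (unfold r0; field).
  set (q := fun a w : C => (- / a * cexp (w / a))%C).
  (* The points with [R0 <= |a| < r0] occur in the product but lie outside the disc, so their linear
     factors join the zero-free part [h]. *)
  set (ann := fil (fun a => ~ Cmod a < R0) (lst D r0)).
  set (h := fun w => (cexp (alpha * w + L w) * cprod (lst D r0) (fun a => czp (q a w) (D a)) * rprod D ann w)%C).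
  assert (Hq0 : forall a w, In a (lst D r0) -> q a w <> 0).
  { intros a w Ha. apply In_neq0 in Ha. apply Cmult_neq_0; [|apply cexp_neq_0]. intros E. apply (f_equal (fun u => u * a)%C) in E.
    replace (- / a * a)%C with (RtoC (-1)) in E by (field; auto). replace (0 * a)%C with (RtoC 0) in E by ring. apply RtoC_inj in E. lra. }
  assert (Hann : forall w, Cmod w < R0 -> ~ In w ann).
  { intros w Hw Hin. apply fil_In in Hin. lra. }
  assert (E0 : forall w : C, (w - 0)%C = w) by (intros; ring).
  exists h. split; [|split].
  - assert (A := lst_supp D R0 HD). split; [apply A|]. intros z. rewrite E0. apply A.
  - intros w Hw. rewrite E0 in Hw. split.
    + unfold h. apply (Cdiff_mult (fun w => cexp (alpha * w + L w) * cprod (lst D r0) (fun a => czp (q a w) (D a)))%C (rprod D ann)).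
      * apply Cdiff_mult.
        -- apply (Cdiff_comp cexp (fun w => alpha * w + L w)%C); [|eexists; apply Cder_cexp].
           apply Cdiff_plus; [apply (Cdiff_mult (fun _ => alpha) (fun w => w)); [apply Cdiff_const|apply Cdiff_id]|apply HLd; lra].
        -- apply (Cdiff_cprod (lst D r0) (fun a w => czp (q a w) (D a))). intros a Ha. apply Cdiff_czp; [|right; apply Hq0, Ha].
           unfold q. apply Cdiff_mult; [apply Cdiff_const|].
           apply (Cdiff_comp cexp (fun w => w / a)%C); [|eexists; apply Cder_cexp].
           apply (Cdiff_mult (fun w => w) (fun _ => / a)%C); [apply Cdiff_id|apply Cdiff_const].
      * apply rprod_diff, Hann, Hw.
    + unfold h. repeat apply Cmult_neq_0; [apply cexp_neq_0| |apply rprod_neq0, Hann, Hw].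
      apply cprod_neq0. intros a Ha. apply czp_neq0, Hq0, Ha.
  - intros w Hw. rewrite E0 in Hw. rewrite (Flim_loc r0 L w HL Hr0) by lra. unfold Floc. rewrite smul_sdiv, sdiv_eq.
    split; [|split].
    + intros Hd. destruct (Ceq_dec (PP r0 w) 0) as [E|E]; [exfalso; revert E; apply PP_neq0; lia|].
      apply f_equal with (f := @Some C).
      replace (cexp (alpha * w) * (PZ r0 w * cexp (L w)) / PP r0 w)%C with (cexp (alpha * w) * cexp (L w) * (PZ r0 w / PP r0 w))%C by (field; auto).
      rewrite quot_eq by auto. unfold h. rewrite cexp_plus.
      rewrite (cprod_ext _ (fun a => czp (e2 a w) (D a)) (fun a => czp (w - a) (D a) * czp (q a w) (D a))%C).
      * rewrite cprod_mult. fold (rprod D (lst D r0) w).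
        replace (rprod D (lst D r0) w) with (rprod D (lst D R0) w * rprod D ann w)%C.
        -- ring.
        -- unfold rprod. rewrite <- cprod_app. apply cprod_perm. symmetry.
           eapply Permutation_trans; [apply (fil_perm (fun a => Cmod a < R0))|]. apply Permutation_app_tail. symmetry. apply lst_fil_perm; auto. unfold r0. lra.
      * intros a Ha. assert (Ha0 := In_neq0 r0 a Ha). rewrite e2_factor by auto. fold (q a w).
        assert (Hwa : (w - a)%C <> 0). { intros E'. apply Csub_0_eq in E'. rewrite <- E' in Ha. apply lst_In in Ha; auto. tauto. }
        assert (Hqa := Hq0 a w Ha).
        destruct (Z_lt_le_dec (D a) 0).
        -- rewrite !czp_neg by auto. rewrite cpw_mult. field. split; apply cpw_neq0; auto.
        -- rewrite !czp_pos by auto. apply cpw_mult.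
    + intros Hd. destruct (Ceq_dec (PP r0 w) 0) as [E|E]; [exfalso; revert E; apply PP_neq0; lia|].
      apply f_equal with (f := @Some C). replace (PZ r0 w) with (RtoC 0); [unfold Cdiv; ring|].
      rewrite PZ_eq. symmetry. apply (cprod_zero _ _ w).
      * apply (zl_supp r0). repeat split; auto; [lia|unfold r0; lra].
      * replace (e2 w w) with (RtoC 0).
        -- destruct (Z.to_nat (D w)) eqn:En; [lia|]. rewrite cpw_S. ring.
        -- rewrite e2_factor; [ring|]. intros E'. rewrite E', H0 in Hd. lia.
    + intros Hd. destruct (Ceq_dec (PP r0 w) 0) as [E|E]; auto. exfalso. apply E.
      rewrite PP_eq. apply (cprod_zero _ _ w).
      * apply (pl_supp r0). repeat split; auto; [lia|unfold r0; lra].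
      * replace (e2 w w) with (RtoC 0).
        -- destruct (Z.to_nat (- D w)) eqn:En; [lia|]. rewrite cpw_S. ring.
        -- rewrite e2_factor; [ring|]. intros E'. rewrite E', H0 in Hd. lia.
Qed.

Lemma Flim_log (w : C) : D w = 0%Z -> exists y, Flim w = Some y /\ y <> RtoC 0 /\
  forall eps, 0 < eps -> exists M, forall r, M < r ->
    Rabs (ln (Cmod y) - rsum (lst D r) (fun a => IZR (D a) * (ln (Cmod (w - a)) - ln (Cmod a) + fst (w / a)%C))) <= eps.
Proof.
  intros Hw. set (r0 := 2 * (Cmod w + 1)). assert (Hc := Cmod_ge_0 w). assert (Hr0 : 1 <= r0) by (unfold r0; lra).
  destruct (Lam_lim r0 Hr0) as [L [_ HL]]. assert (Hw2 : Cmod w < r0 / 2) by (unfold r0; lra).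
  assert (HP : forall r, PP r w <> 0) by (intros; apply PP_neq0; lia).
  assert (Hq : forall r, (PZ r w / PP r w)%C <> RtoC 0).
  { intros r. rewrite quot_eq by auto. apply cprod_neq0. intros a Ha. apply czp_neq0, e2_neq0; [apply (In_neq0 r), Ha|].
    intros E. apply lst_In in Ha; auto. subst. tauto. }
  exists (PZ r0 w / PP r0 w * cexp (L w))%C. split; [|split].
  - rewrite (Flim_loc r0 L w HL Hr0 Hw2). unfold Floc. rewrite sdiv_eq. destruct (Ceq_dec (PP r0 w) 0); [exfalso; eapply HP; eauto|].
    apply f_equal with (f := @Some C). field. auto.
  - apply Cmult_neq_0; [apply Hq|apply cexp_neq_0].
  - intros eps He. destruct (HL eps He) as [M HM]. exists (Rmax M r0). intros r Hr.
    assert (A1 : M < r) by (eapply Rle_lt_trans; [apply Rmax_l|exact Hr]).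
    assert (A2 : r0 < r) by (eapply Rle_lt_trans; [apply Rmax_r|exact Hr]).
    rewrite <- ln_quot by auto.
    destruct (tail_factor r0 r w) as [E1 [E2 [A [B E]]]]; try lra.
    replace (PZ r w / PP r w)%C with (PZ r0 w / PP r0 w * cexp (Lam r0 r w))%C.
    2:{ rewrite A, B, <- E. unfold Cminus. rewrite cexp_plus, cexp_opp. field. split; [apply cexp_neq_0|apply HP]. }
    rewrite !Cmod_mult, !Cmod_cexp, !ln_mult, !ln_exp by (try apply exp_pos; apply Cmod_gt_0, Hq).
    replace (ln (Cmod (PZ r0 w / PP r0 w)) + fst (L w) - (ln (Cmod (PZ r0 w / PP r0 w)) + fst (Lam r0 r w))) with (- fst (Lam r0 r w - L w)%C) by (simpl; ring).
    rewrite Rabs_Ropp. eapply Rle_trans; [apply fst_le_Cmod|]. apply HM; auto.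
Qed.
End Product.

(** * Size of the canonical product *)

(* lg s = ln (min(1,s)) for s > 0. *)
Definition lg (s : R) : R := ln s - ln (m1 s).

Lemma lg_0 s : 1 <= s -> lg s = 0.
Proof. intros H. unfold lg, m1. rewrite Rmax_right by auto. ring. Qed.
Lemma lg_le s : 0 < s -> lg s <= 0.
Proof. intros H. unfold lg. assert (ln s <= ln (m1 s)); [apply Rcomplements.ln_le; auto; apply m1_ge|lra]. Qed.
Lemma lg_mono s t : 0 < s -> s <= t -> lg s <= lg t.
Proof.
  intros H1 H2. unfold lg, m1. destruct (Rle_lt_dec 1 s).
  - rewrite !Rmax_right by lra. lra.
  - rewrite (Rmax_left 1 s), ln_1 by lra. destruct (Rle_lt_dec 1 t).
    + rewrite Rmax_right by lra. assert (ln s < ln 1) by (apply ln_increasing; lra). rewrite ln_1 in H. lra.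
    + rewrite Rmax_left, ln_1 by lra. assert (ln s <= ln t) by (apply Rcomplements.ln_le; lra). lra.
Qed.

(* The size of f is, up to a bounded factor, that of the quotient of its nearby zero and pole factors. *)
Definition kbound (D : C -> Z) (f : C -> sphere) (B : R) : Prop :=
  forall z, D z = 0%Z -> exists y, f z = Some y /\ y <> RtoC 0 /\
    forall l, covers D (fun a => Cmod (a - z) < 1) l ->
      Rabs (ln (Cmod y) - rsum l (fun a => IZR (D a) * lg (Cmod (z - a)))) <= B.

(** [kk r s - ln (m1 s)] equals [kap r s] for [s >= 1] and differs from it by at most 1 below, where
    the counting bound limits the number of points. *)
Lemma kk_kap (D : C -> Z) (K K1 : R) (c : C) (r : R) (l : list C) : count_bound D 1 K -> dsum_bound D K1 ->
  1 <= r -> covers D (fun z => Cmod (z - c) < r) l ->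
  Rabs (rsum l (fun a => IZR (D a) * (kk r (Cmod (a - c)) - ln (m1 (Cmod (a - c)))))) <= K1 + K.
Proof.
  intros HC Hd Hr Hcov. assert (A := kap_bound D K1 Hd c r l Hr Hcov).
  set (P := fun a => Cmod (a - c) <= 1).
  assert (E : Rabs (rsum l (fun a => IZR (D a) * (kk r (Cmod (a - c)) - ln (m1 (Cmod (a - c)))))
     - rsum l (fun a => IZR (D a) * kap r (Cmod (a - c)))) <= rsum (fil P l) (absD D)).
  { rewrite <- rsum_minus, rsum_fil. eapply Rle_trans; [apply rsum_Rabs|]. apply rsum_le. intros a _.
    set (s := Cmod (a - c)). assert (Hs : 0 <= s) by apply Cmod_ge_0.
    rewrite <- Rmult_minus_distr_l, Rabs_mult. fold (absD D a).
    assert (HM : r <= Rmax r s) by apply Rmax_l.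
    assert (Ek : kk r s - ln (m1 s) - kap r s = (s^2 - (m1 s)^2) / (2 * (Rmax r s)^2)).
    { unfold kk, kap. rewrite Rmax_sq by lra. rewrite Rmax_m1 by lra. rewrite ln_pow by lra. simpl INR. field. lra. }
    rewrite Ek. destruct (Rle_lt_dec s 1) as [H|H].
    - rewrite (indic_true (P a)) by exact H. unfold m1. rewrite Rmax_left by auto.
      rewrite Rmult_comm. apply Rmult_le_compat_r; [apply absD_pos|].
      assert (1 <= (Rmax r s)^2) by nra. rewrite Rabs_left1.
      + apply Rmult_le_reg_r with (2 * (Rmax r s)^2); [lra|]. unfold Rdiv.
        replace (- ((s ^ 2 - 1 ^ 2) * / (2 * Rmax r s ^ 2)) * (2 * Rmax r s ^ 2)) with (1 - s^2) by (field; lra). nra.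
      + unfold Rdiv. assert (0 < / (2 * Rmax r s ^ 2)) by (apply Rinv_0_lt_compat; lra).
        assert (X : s ^ 2 - 1 ^ 2 <= 0) by nra. set (x := s ^ 2 - 1 ^ 2) in *. nra.
    - unfold m1. rewrite Rmax_right by lra. replace ((s^2 - s^2) / (2 * (Rmax r s)^2)) with 0 by (unfold Rdiv; ring).
      rewrite Rabs_R0, Rmult_0_r. apply Rmult_le_pos; [unfold indic; destruct (excluded_middle_informative _); lra|apply absD_pos]. }
  assert (F : rsum (fil P l) (absD D) <= K).
  { apply (proj2 HC c); [apply fil_NoDup, Hcov|]. intros a Ha. apply fil_In in Ha. apply Ha. }
  apply Rcomplements.Rabs_le_between in A. apply Rcomplements.Rabs_le_between in E. apply Rabs_le. lra.
Qed.

(** Write [ln|z-a| = lg|z-a| + ln(m1|z-a|)]. By (d), through [kk_kap], the sums of the second terms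
    at [z] and at 0 may be replaced by disc averages, which [area_bound] compares. The factor with
    [alpha] turns the linear terms [z / a] of the product into the terms [z conj a / rho^2] of
    [area_bound]. *)
Lemma kbound_product (D : C -> Z) (K K1 K2 : R) (alpha : C) : divisor D -> count_bound D 1 K -> dsum_bound D K1 -> esum_bound D K2 ->
  D 0 = 0%Z -> Clim_infty (fun rho => csum (lst D rho) (aterm D rho)) (- alpha)%C ->
  (exists L, Clim_infty (fun rho => csum (fil (fun a => 1 <= Cmod a) (lst D rho)) (fterm D)) L) ->
  exists B, kbound D (fun w => smul (cexp (alpha * w)%C) (Flim D w)) B.
Proof.
  intros HD HC Hd He H0 Hal Hsq.
  set (C4 := Rabs (rsum (lst D 1) (fun a => IZR (D a) * lg (Cmod (0 - a))))).
  exists (2 + (16 * K2 + 1) + 2 * (K1 + K) + C4).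
  intros z Hz. destruct (Flim_log D K HD HC H0 Hsq z Hz) as [y [Y1 [Y2 Y3]]].
  exists (cexp (alpha * z) * y)%C. split; [rewrite Y1; reflexivity|]. split; [apply Cmult_neq_0; auto; apply cexp_neq_0|].
  (* The averaging radius [r = |z| + 1] bounds the cost [|z| * 16 K2 / r] of moving from 0 to [z]
     independently of [z]. *)
  intros l0 Hcov0. set (B := Cmod z). assert (HB : 0 <= B) by apply Cmod_ge_0. set (r := B + 1).
  assert (HK2 := proj1 He).
  destruct (area_bound D K K1 K2 HD HC Hd He B HB) as [G [HG1 HG]].
  destruct (Y3 1 Rlt_0_1) as [M1 HM1].
  destruct (Hal (/ (B + 1))) as [M2 HM2]; [apply Rinv_0_lt_compat; lra|].
  (* Large enough for the product and [alpha] to be near their limits and for [G * B / rho <= 1];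
     the absolute value keeps the other summands as lower bounds when the maximum is negative. *)
  set (rho := Rmax M1 M2 + (r + 2 * B + 1) + (G * B + 1) + Rabs (Rmax M1 M2)).
  assert (A1 := Rmax_l M1 M2). assert (A2 := Rmax_r M1 M2). assert (A3 := Rle_abs (- Rmax M1 M2)). rewrite Rabs_Ropp in A3.
  assert (A3' := Rabs_pos (Rmax M1 M2)).
  assert (HGB : 0 <= G * B) by (apply Rmult_le_pos; auto).
  assert (R1 : M1 < rho) by (unfold rho, r; lra). assert (R2 : rho > M2) by (unfold rho, r; lra).
  assert (R3 : r + 2 * B + 1 <= rho) by (unfold rho; lra). assert (R4 : G * B <= rho) by (unfold rho, r; lra).
  clearbody rho. set (l := lst D rho). assert (Hrho0 : 0 < rho) by (unfold r in *; lra).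
  specialize (HM1 rho R1). specialize (HM2 rho R2). fold l in HM1, HM2.
  change (Cmod (csum l (aterm D rho) - - alpha) < / (B + 1)) in HM2.
  assert (Hcovz : forall c t, Cmod c <= B -> t <= r -> covers D (fun w => Cmod (w - c) < t) l).
  { intros c t Hc Ht. apply lst_covers_disc; auto. lra. }
  assert (El : rsum l0 (fun a => IZR (D a) * lg (Cmod (z - a))) = rsum l (fun a => IZR (D a) * lg (Cmod (z - a)))).
  { apply (covers_rsum D (fun a => Cmod (a - z) < 1)); auto.
    - apply Hcovz; unfold B, r; lra.
    - intros a [Ha|Ha]; [rewrite Ha; ring|]. rewrite lg_0 by (rewrite Cmod_sub_sym; lra). ring. }
  rewrite El.
  assert (E4 : rsum (lst D 1) (fun a => IZR (D a) * lg (Cmod (0 - a))) = rsum l (fun a => IZR (D a) * lg (Cmod (0 - a)))).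
  { apply (covers_rsum D (fun a => Cmod (a - 0) < 1)).
    - apply lst_covers_disc; auto. rewrite Cmod_0. lra.
    - apply Hcovz; [rewrite Cmod_0; auto|unfold r; lra].
    - intros a [Ha|Ha]; [rewrite Ha; ring|]. rewrite lg_0 by (rewrite Cmod_sub_sym; lra). ring. }
  assert (T1 := HG z r rho (Rle_refl _) ltac:(unfold r; lra) R3). fold l in T1.
  assert (T2 := kk_kap D K K1 z r l HC Hd ltac:(unfold r; lra) (Hcovz z r (Rle_refl _) (Rle_refl _))).
  assert (T3 := kk_kap D K K1 0 r l HC Hd ltac:(unfold r; lra) (Hcovz 0 r ltac:(rewrite Cmod_0; auto) (Rle_refl _))).
  assert (T4 : Rabs (fst (alpha * z)%C + fst (z * csum l (aterm D rho))%C) <= 1).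
  { replace (fst (alpha * z)%C + fst (z * csum l (aterm D rho))%C) with (fst (z * (csum l (aterm D rho) - - alpha))%C) by (simpl; ring).
    eapply Rle_trans; [apply fst_le_Cmod|]. rewrite Cmod_mult. fold B.
    apply Rle_trans with (B * / (B + 1)); [apply Rmult_le_compat_l; lra|].
    apply Rmult_le_reg_r with (B + 1); [lra|]. rewrite Rmult_assoc, Rinv_l; lra. }
  assert (T5 : B * (16 * K2 / r + G / rho) <= 16 * K2 + 1).
  { assert (B * (16 * K2 / r) <= 16 * K2).
    { apply Rmult_le_reg_r with r; [unfold r; lra|]. replace (B * (16 * K2 / r) * r) with (16 * K2 * B) by (field; unfold r; lra).
      apply Rmult_le_compat_l; [lra|unfold r; lra]. }
    assert (B * (G / rho) <= 1).
    { apply Rmult_le_reg_r with rho; [unfold r in *; lra|]. replace (B * (G / rho) * rho) with (G * B) by (field; unfold r in *; lra). lra. }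
    lra. }
  fold B in T1.
  assert (Ez : fst (z * csum l (aterm D rho))%C = rsum l (fun a => IZR (D a) * (fst (z / a)%C - fst (z * Cconj a)%C / rho^2))).
  { rewrite <- csum_scal, csum_fst. apply rsum_ext. intros a _. unfold aterm, Cdiv. generalize (/ a)%C. intros ia. simpl. field. lra. }
  rewrite Ez in T4.
  rewrite Cmod_mult, ln_mult, Cmod_cexp, ln_exp; [|apply Cmod_gt_0, cexp_neq_0|apply Cmod_gt_0, Y2].
  set (S1 := rsum l (fun a => IZR (D a) * (ln (Cmod (z - a)) - ln (Cmod a) + fst (z / a)%C))) in *.
  set (S2 := rsum l (fun a => IZR (D a) * (fst (z / a)%C - fst (z * Cconj a)%C / rho^2))) in *.
  set (S3 := rsum l (fun a => IZR (D a) * lg (Cmod (z - a)))) in *.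
  set (S4 := rsum l (fun a => IZR (D a) * (kk r (Cmod (a - z)) - kk r (Cmod a) + fst (z * Cconj a)%C / rho^2))) in *.
  set (S5 := rsum l (fun a => IZR (D a) * (kk r (Cmod (a - z)) - ln (m1 (Cmod (a - z)))))) in *.
  set (S6 := rsum l (fun a => IZR (D a) * (kk r (Cmod (a - 0)) - ln (m1 (Cmod (a - 0)))))) in *.
  set (S7 := rsum l (fun a => IZR (D a) * lg (Cmod (0 - a)))) in *.
  (* Term by term: the [ln m1] in [S5] and [S6] and the [lg] in [S3] and [S7] reassemble [ln|z-a|]
     and [ln|a|]. *)
  assert (ES : S1 - S2 - S3 = S4 - S5 + S6 - S7).
  { unfold S1, S2, S3, S4, S5, S6, S7. rewrite <- !rsum_minus, <- rsum_plus, <- rsum_minus. apply rsum_ext. intros a _.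
    unfold lg. rewrite (Cmod_sub_sym z a), (Cmod_sub_sym 0 a). replace (a - 0)%C with a by ring. ring. }
  unfold C4. rewrite E4. assert (T7 := Rle_abs S7). assert (T7' := Rle_abs (- S7)). rewrite Rabs_Ropp in T7'.
  apply Rcomplements.Rabs_le_between in HM1, T1, T2, T3, T4. apply Rabs_le. lra.
Qed.

(** Total boundedness as a colouring: finitely many colours, and indices of equal colour are related
    by [P]. This form is closed under conjunction ([fincl_and]) and feeds the pigeonhole principle
    directly. *)
Definition fincl (P : nat -> nat -> Prop) : Prop :=
  exists (N : nat) (c : nat -> nat), (forall n, (c n < N)%nat) /\ forall n m, c n = c m -> P n m.

Lemma fincl_and P Q : fincl P -> fincl Q -> fincl (fun n m => P n m /\ Q n m).
Proof.
  intros [N [c [H1 H2]]] [N' [c' [H1' H2']]]. exists (N * N')%nat, (fun n => c n * N' + c' n)%nat. split.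
  - intros n. specialize (H1 n). specialize (H1' n). nia.
  - intros n m E. assert (A := H1' n). assert (B := H1' m).
    assert (c n = c m) by (apply (f_equal (fun x => x / N')%nat) in E;
      rewrite !Nat.div_add_l, !Nat.div_small, !Nat.add_0_r in E by lia; exact E).
    split; [apply H2; auto|apply H2'; lia].
Qed.

Lemma fincl_list (ps : list C) (P : C -> nat -> nat -> Prop) : (forall p, In p ps -> fincl (P p)) ->
  fincl (fun n m => forall p, In p ps -> P p n m).
Proof.
  induction ps as [|b ps IH]; intros H.
  - exists 1%nat, (fun _ => 0%nat). split; [intros; lia|]. intros n m _ p [].
  - destruct (fincl_and _ _ (H b (or_introl eq_refl)) (IH (fun p Hp => H p (or_intror Hp)))) as [N [c [A B]]].
    exists N, c. split; auto. intros n m E p [Hp|Hp]; [subst; exact (proj1 (B n m E))|exact (proj2 (B n m E) p Hp)].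
Qed.

(** The unit disc and its image under inversion cover the sphere, and inversion is isometric; so a
    Euclidean grid in the disc and its inverse form a net. *)
Lemma sphere_net (eps : R) : 0 < eps -> exists net : list sphere, forall u, exists s, In s net /\ rhoS u s < eps.
Proof.
  intros He. destruct (grid_cover 1 (eps / 3)) as [ps Hps]; try lra.
  exists (map (fun p => Some p) ps ++ map (fun p => sinv (Some p)) ps).
  assert (K : forall y : C, Cmod y <= 1 -> exists p, In p ps /\ rhoS (Some y) (Some p) < eps).
  { intros y Hy. destruct (Hps y Hy) as [p [P1 P2]]. exists p. split; auto.
    eapply Rle_lt_trans; [apply rho_le_dist|]. lra. }
  intros u. destruct (classic (small 1 u)) as [Hs|Hs].
  - destruct u as [y|]; [|destruct Hs]. destruct (K y Hs) as [p [P1 P2]]. exists (Some p). split; auto.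
    apply in_app_iff. left. apply in_map_iff. exists p. auto.
  - assert (Hs' : exists y, sinv u = Some y /\ Cmod y <= 1).
    { destruct u as [y|]; [|exists (RtoC 0); split; [reflexivity|rewrite Cmod_0; lra]].
      simpl in Hs. assert (Hy : 1 < Cmod y) by (apply Rnot_le_lt; exact Hs).
      assert (Hy0 : (y : C) <> 0) by (apply Cmod_gt_0; lra).
      exists (/ y)%C. split; [unfold sinv; destruct (Ceq_dec y 0); [contradiction|reflexivity]|].
      rewrite Cmod_inv by auto. rewrite <- Rinv_1. apply Rinv_le_contravar; lra. }
    destruct Hs' as [y [Y1 Y2]]. destruct (K y Y2) as [p [P1 P2]]. exists (sinv (Some p)). split.
    + apply in_app_iff. right. apply in_map_iff. exists p. auto.
    + rewrite <- rho_sinv, sinv_invol, Y1. exact P2.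
Qed.

Lemma sphere_fincl (u : nat -> sphere) (eps : R) : 0 < eps -> fincl (fun n m => rhoS (u n) (u m) < eps).
Proof.
  intros He. destruct (sphere_net (eps/2)) as [net Hnet]; [lra|].
  assert (H : forall n, exists i, (i < length net)%nat /\ rhoS (u n) (nth i net None) < eps / 2).
  { intros n. destruct (Hnet (u n)) as [s [S1 S2]]. destruct (In_nth net s None S1) as [i [I1 I2]]. exists i. rewrite I2. auto. }
  set (c := fun n => epsilon (inhabits 0%nat) (fun i => (i < length net)%nat /\ rhoS (u n) (nth i net None) < eps / 2)).
  assert (Hc : forall n, (c n < length net)%nat /\ rhoS (u n) (nth (c n) net None) < eps / 2)
    by (intros n; apply (epsilon_spec (inhabits 0%nat) _ (H n))).
  exists (length net), c. split; [intros; apply Hc|]. intros n m E.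
  destruct (Hc n) as [_ A]. destruct (Hc m) as [_ B]. rewrite <- E in B.
  pose proof (rho_tri (u n) (nth (c n) net None) (u m)). rewrite (rho_sym (nth (c n) net None) (u m)) in H0. lra.
Qed.

Definition infset (S : nat -> Prop) : Prop := forall N, exists n, (N <= n)%nat /\ S n.

Lemma pigeon (S : nat -> Prop) (c : nat -> nat) (N : nat) : infset S -> (forall n, S n -> (c n < N)%nat) ->
  exists i, infset (fun n => S n /\ c n = i).
Proof.
  revert S. induction N; intros S HS Hc.
  - destruct (HS 0%nat) as [n [_ Hn]]. specialize (Hc n Hn). lia.
  - destruct (classic (infset (fun n => S n /\ c n = N))) as [Hy|Hn]; [exists N; auto|].
    apply not_all_ex_not in Hn. destruct Hn as [M HM].
    destruct (IHN (fun n => S n /\ (M <= n)%nat)) as [i Hi].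
    + intros K. destruct (HS (Nat.max K M)) as [n [A B]]. exists n. split; [lia|]. split; auto. lia.
    + intros n [A B]. specialize (Hc n A). assert (c n <> N) by (intros E; apply HM; exists n; auto). lia.
    + exists i. intros K. destruct (Hi K) as [n [A [[B _] E]]]. exists n. auto.
Qed.

(** [T k] is an infinite set of indices on which the first [k] colourings are constant; [phi n] is
    chosen in [T (S n)], so that from position [k] on all chosen indices agree in colouring [k]. *)
Lemma diagonal (P : nat -> nat -> nat -> Prop) : (forall k, fincl (P k)) ->
  exists phi : nat -> nat, (forall n, (phi n < phi (S n))%nat) /\ forall k n m, (k <= n)%nat -> (k <= m)%nat -> P k (phi n) (phi m).
Proof.
  intros H.
  set (cl := fun k => epsilon (inhabits (0%nat, fun _ : nat => 0%nat)) (fun q => (forall n, (snd q n < fst q)%nat) /\ forall n m, snd q n = snd q m -> P k n m)).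
  assert (Hcl : forall k, (forall n, (snd (cl k) n < fst (cl k))%nat) /\ forall n m, snd (cl k) n = snd (cl k) m -> P k n m).
  { intros k. apply (epsilon_spec (inhabits (0%nat, fun _ : nat => 0%nat)) (fun q => (forall n, (snd q n < fst q)%nat) /\ forall n m, snd q n = snd q m -> P k n m)).
    destruct (H k) as [N [c Hc]]. exists (N, c). exact Hc. }
  set (T := fix T k : nat -> Prop := match k with
     | O => fun _ => True
     | S k => fun n => T k n /\ snd (cl k) n = epsilon (inhabits 0%nat) (fun i => infset (fun n => T k n /\ snd (cl k) n = i))
     end).
  assert (HT : forall k, infset (T k)).
  { induction k; [intros N; exists N; simpl; auto|].
    simpl. apply (epsilon_spec (inhabits 0%nat) (fun i => infset (fun n => T k n /\ snd (cl k) n = i))).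
    apply (pigeon (T k) (snd (cl k)) (fst (cl k))); auto. intros n _. apply Hcl. }
  assert (Hsub : forall j k n, T (j + k)%nat n -> T k n).
  { induction j; intros k n Hn; auto. apply IHj. apply Hn. }
  set (phi := fix phi n := match n with
     | O => epsilon (inhabits 0%nat) (fun x => (0 <= x)%nat /\ T 1%nat x)
     | S n => epsilon (inhabits 0%nat) (fun x => (S (phi n) <= x)%nat /\ T (S (S n)) x)
     end).
  assert (Hphi : forall n, T (S n) (phi n)).
  { destruct n.
    - apply (epsilon_spec (inhabits 0%nat) (fun x => (0 <= x)%nat /\ T 1%nat x) (HT 1%nat 0%nat)).
    - apply (epsilon_spec (inhabits 0%nat) (fun x => (S (phi n) <= x)%nat /\ T (S (S n)) x) (HT (S (S n)) (S (phi n)))). }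
  exists phi. split.
  - intros n. apply (epsilon_spec (inhabits 0%nat) (fun x => (S (phi n) <= x)%nat /\ T (S (S n)) x) (HT (S (S n)) (S (phi n)))).
  - intros k n m Hn Hm. apply Hcl.
    assert (A : forall n, (k <= n)%nat -> T (S k) (phi n)).
    { intros x Hx. apply (Hsub (x - k)%nat). replace (x - k + S k)%nat with (S x) by lia. apply Hphi. }
    destruct (A n Hn) as [_ E1]. destruct (A m Hm) as [_ E2]. congruence.
Qed.

(** Arzela-Ascoli: the Lipschitz bound reduces closeness on the disc of radius [k] to closeness at
    finitely many grid points, where the sphere is totally bounded. One relation per [k], with
    tolerance [1/(k+1)] on that disc, enters the diagonal argument. *)
Lemma normal_of_lip (f : C -> sphere) (Lc dl : R) : meromorphic f -> 0 < dl -> 0 <= Lc ->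
  (forall z w, Cmod (w - z) < dl -> rhoS (f w) (f z) <= Lc * Cmod (w - z)) -> normal f.
Proof.
  intros Hm Hdl HLc Hlip. split; auto. intros h.
  destruct (diagonal (fun k n m => forall z, Cmod z <= INR k -> rhoS (f (z + h n)%C) (f (z + h m)%C) < / (INR k + 1))) as [phi [P1 P2]].
  - intros k. assert (Hk := pos_INR k). set (eps := / (INR k + 1)). assert (He : 0 < eps) by (apply Rinv_0_lt_compat; lra).
    set (s := Rmin (dl / 2) (eps / (4 * (Lc + 1)))).
    assert (Hs : 0 < s) by (apply Rmin_pos; [lra|apply Rdiv_lt_0_compat; lra]).
    assert (S1 : s <= dl / 2) by apply Rmin_l. assert (S2 : s <= eps / (4 * (Lc + 1))) by apply Rmin_r.
    assert (S3 : Lc * s <= eps / 4).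
    { apply Rle_trans with ((Lc + 1) * (eps / (4 * (Lc + 1)))); [apply Rmult_le_compat; lra|right; field; lra]. }
    destruct (grid_cover (INR k) s Hs Hk) as [ps Hps].
    destruct (fincl_list ps (fun p n m => rhoS (f (p + h n)%C) (f (p + h m)%C) < eps / 4)) as [N [c [C1 C2]]].
    { intros p _. apply (sphere_fincl (fun n => f (p + h n)%C)). lra. }
    exists N, c. split; auto. intros n m E z Hz. destruct (Hps z Hz) as [p [Q1 Q2]].
    specialize (C2 n m E p Q1).
    assert (L : forall j, rhoS (f (z + h j)%C) (f (p + h j)%C) <= eps / 4).
    { intros j. assert (X : Cmod (z + h j - (p + h j)) = Cmod (z - p)) by (f_equal; ring).
      eapply Rle_trans; [apply Hlip; rewrite X; lra|]. rewrite X.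
      eapply Rle_trans; [apply Rmult_le_compat_l; [exact HLc|exact Q2]|exact S3]. }
    assert (Ln := L n). assert (Lm := L m).
    pose proof (rho_tri (f (z + h n)%C) (f (p + h n)%C) (f (z + h m)%C)).
    pose proof (rho_tri (f (p + h n)%C) (f (p + h m)%C) (f (z + h m)%C)).
    rewrite (rho_sym (f (p + h m)%C) (f (z + h m)%C)) in H0. lra.
  - exists phi. split; auto. intros Rad eps He. 
    destruct (INR_unbounded (Rmax Rad (/ eps))) as [k Hk]. exists k. intros n m Hn Hm' z Hz.
    assert (A1 := Rmax_l Rad (/ eps)). assert (A2 := Rmax_r Rad (/ eps)).
    assert (Z : Cmod z <= INR k) by (change (Cmod z <= Rad) in Hz; lra).
    eapply Rlt_trans; [apply (P2 k n m Hn Hm' z Z)|].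
    assert (He' : 0 < / eps) by (apply Rinv_0_lt_compat, He).
    rewrite <- (Rinv_inv eps). apply Rinv_lt_contravar; [apply Rmult_lt_0_compat; lra|lra].
Qed.

(** * Normality and uniqueness *)

Lemma exp_le_mono x y : x <= y -> exp x <= exp y.
Proof. intros [H|H]; [left; apply exp_increasing; auto|subst; lra]. Qed.

Definition vals (D : C -> Z) (f : C -> sphere) : Prop := forall z,
  ((D z > 0)%Z -> f z = Some (RtoC 0)) /\ ((D z < 0)%Z -> f z = None) /\ (D z = 0%Z -> exists y, y <> RtoC 0 /\ f z = Some y).

Lemma mero_vals (D : C -> Z) (f : C -> sphere) : meromorphic f -> divisor_of D f -> vals D f.
Proof. intros Hm Hd z. apply order_limit; auto. Qed.

Definition negD (D : C -> Z) (a : C) : Z := (- D a)%Z.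

Lemma absD_neg D a : absD (negD D) a = absD D a.
Proof. unfold absD, negD. rewrite opp_IZR. apply Rabs_Ropp. Qed.

Lemma count_bound_neg D s K : count_bound D s K -> count_bound (negD D) s K.
Proof.
  intros [A B]. split; auto. intros c l Hl Ha. rewrite (rsum_ext l _ (absD D)) by (intros; apply absD_neg). apply (B c); auto.
Qed.

Lemma vals_neg D f : vals D f -> vals (negD D) (fun z => sinv (f z)).
Proof.
  intros H z. destruct (H z) as [A [B E]]. unfold negD. split; [|split]; intros Hz.
  - rewrite B by lia. reflexivity.
  - rewrite A by lia. unfold sinv. destruct (Ceq_dec 0 0); congruence.
  - destruct E as [y [Y1 Y2]]; [lia|]. exists (/ y)%C. rewrite Y2. unfold sinv. destruct (Ceq_dec y 0); [contradiction|].
    split; auto. intros E. apply (f_equal (fun u => u * y)%C) in E. rewrite Cinv_l in E by auto.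
    replace (0 * y)%C with (RtoC 0) in E by ring. apply RtoC_inj in E. lra.
Qed.

Lemma covers_neg D P l : covers (negD D) P l <-> covers D P l.
Proof. unfold covers, negD. split; intros [A B]; split; auto; intros z Hz; apply B; lia. Qed.

Lemma kbound_neg D f B : kbound D f B -> kbound (negD D) (fun z => sinv (f z)) B.
Proof.
  intros H z Hz. destruct (H z) as [y [Y1 [Y2 Y3]]]; [unfold negD in Hz; lia|].
  exists (/ y)%C. rewrite Y1. unfold sinv. destruct (Ceq_dec y 0); [contradiction|]. split; auto. split.
  - intros E. apply (f_equal (fun u => u * y)%C) in E. rewrite Cinv_l in E by auto.
    replace (0 * y)%C with (RtoC 0) in E by ring. apply RtoC_inj in E. lra.
  - intros l Hl. apply (proj1 (covers_neg D _ l)) in Hl. specialize (Y3 l Hl).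
    rewrite Cmod_inv by auto. rewrite ln_Rinv by (apply Cmod_gt_0; auto). rewrite <- Rabs_Ropp.
    eapply Rle_trans; [|exact Y3]. right. f_equal.
    rewrite (rsum_ext l (fun a => IZR (negD D a) * lg (Cmod (z - a))) (fun a => (-1) * (IZR (D a) * lg (Cmod (z - a))))).
    + rewrite rsum_scal. ring.
    + intros a _. unfold negD. rewrite opp_IZR. ring.
Qed.

(** Points of the disc keep distance at least [d] from all poles, so each nearby pole, with
    multiplicity, adds at most [- lg d] to the estimate of [kbound], while nearby zeros only make
    [f] smaller. *)
Lemma local_bound (D : C -> Z) (f : C -> sphere) (B K d : R) (z : C) : divisor D -> vals D f -> kbound D f B -> count_bound D 1 K -> 0 < d ->
  (forall a, (D a < 0)%Z -> 2 * d <= Cmod (a - z)) ->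
  forall w, Cmod (w - z) < d -> exists y, f w = Some y /\ Cmod y <= exp (B + K * - lg d).
Proof.
  intros HD Hv Hk HC Hd Hp w Hw. destruct (Z.lt_trichotomy (D w) 0) as [H|[H|H]].
  - specialize (Hp w H). lra.
  - destruct (Hk w H) as [y [Y1 [Y2 Y3]]]. exists y. split; auto.
    set (l := supp_list D (fun a => Cmod (a - w) < 1)).
    assert (Hl : supp D (fun a => Cmod (a - w) < 1) l) by (apply supp_list_spec; auto; apply bounded_disc).
    specialize (Y3 l (supp_covers _ _ _ Hl)).
    assert (Hlg : 0 <= - lg d) by (pose proof (lg_le d Hd); lra).
    assert (S1 : rsum l (fun a => IZR (D a) * lg (Cmod (w - a))) <= (- lg d) * rsum l (absD D)).
    { rewrite <- rsum_scal. apply rsum_le. intros a Ha. apply Hl in Ha. destruct Ha as [Ha1 Ha2].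
      assert (Hwa : 0 < Cmod (w - a)) by (apply Cmod_sub_pos; intros E; subst; lia).
      assert (L := lg_le _ Hwa). unfold absD. destruct (Z_lt_le_dec (D a) 0) as [N|N].
      - assert (d <= Cmod (w - a)).
        { specialize (Hp a N). pose proof (Cmod_tri a w z). rewrite (Cmod_sub_sym a w) in H0. lra. }
        assert (L2 := lg_mono d _ Hd H0). assert (Q : IZR (D a) <= 0) by (apply IZR_le; lia).
        rewrite Rabs_left1 by auto. nra.
      - assert (Q : 0 <= IZR (D a)) by (apply IZR_le; lia). rewrite Rabs_pos_eq by auto. nra. }
    assert (S2 : rsum l (absD D) <= K) by (apply (proj2 HC w); [apply Hl|]; intros a Ha; apply Hl in Ha; lra).
    assert (S3 : (- lg d) * rsum l (absD D) <= (- lg d) * K) by (apply Rmult_le_compat_l; auto).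
    apply Rcomplements.Rabs_le_between in Y3.
    rewrite <- (exp_ln (Cmod y)) by (apply Cmod_gt_0; auto). apply exp_le_mono. lra.
  - exists (RtoC 0). split; [apply Hv; lia|]. rewrite Cmod_0. left. apply exp_pos.
Qed.

Lemma local_lip (f : C -> sphere) (z : C) (d M : R) : meromorphic f -> 0 < d ->
  (forall w, Cmod (w - z) < d -> exists y, f w = Some y /\ Cmod y <= M) ->
  forall w, Cmod (w - z) < d -> rhoS (f w) (f z) <= 4 * M / d * Cmod (w - z).
Proof.
  intros Hm Hd Hb w Hw.
  assert (Hz : Cmod (z - z) < d) by (rewrite Cmod_sub_self; auto).
  assert (A := schwarz_lip (fun z => fin (f z)) z d M Hd).
  assert (E : forall u, Cmod (u - z) < d -> f u = Some (fin (f u))).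
  { intros u Hu. destruct (Hb u Hu) as [y [Y1 _]]. rewrite Y1. reflexivity. }
  rewrite (E w Hw), (E z Hz). eapply Rle_trans; [apply rho_le_dist|].
  replace (4 * M / d * Cmod (w - z)) with (2 * (2 * M / d * Cmod (w - z))) by (field; lra).
  apply Rmult_le_compat_l; [lra|]. apply A; auto.
  - intros u Hu. apply mero_fin_diff; auto. rewrite (E u Hu). discriminate.
  - intros u Hu. destruct (Hb u Hu) as [y [Y1 Y2]]. rewrite Y1. exact Y2.
Qed.

Lemma N1_of_kbound (D : C -> Z) (f : C -> sphere) (B K dl Rad : R) : divisor D -> meromorphic f -> vals D f -> kbound D f B -> count_bound D 1 K ->
  0 < dl -> (forall a b, (D a > 0)%Z -> (D b < 0)%Z -> dl <= Cmod (a - b)) ->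
  (forall c, (exists a, (D a > 0)%Z /\ Cmod (a - c) < Rad) /\ (exists b, (D b < 0)%Z /\ Cmod (b - c) < Rad)) -> N1 f.
Proof.
  intros HD Hm Hv Hk HC Hdl Hsep Hdense. split.
  (* By (a) a disc of radius [2 d = dl / 2] cannot meet both zeros and poles; so [f] or [1/f] is
     bounded near [z], and [local_lip] applies to that one. *)
  - set (d := dl / 4). set (M := exp (B + K * - lg d)). assert (HM : 0 < M) by apply exp_pos.
    assert (Hd : 0 < d) by (unfold d; lra).
    apply (normal_of_lip f (4 * M / d) d); auto; [apply Rdiv_le_0_compat; lra|].
    intros z w Hw.
    destruct (classic (forall a, (D a < 0)%Z -> 2 * d <= Cmod (a - z))) as [Hp|Hp].
    + apply local_lip; auto. apply (local_bound D f B K d z); auto.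
    + apply not_all_ex_not in Hp. destruct Hp as [b Hb]. apply imply_to_and in Hb. destruct Hb as [Hb1 Hb2].
      rewrite <- rho_sinv. apply (local_lip (fun z => sinv (f z))); auto.
      * apply mero_sinv; auto. exists b. rewrite (proj1 (proj2 (Hv b))) by lia. discriminate.
      * apply (local_bound (negD D) (fun z => sinv (f z)) B K d z); auto; [|apply vals_neg; auto|apply kbound_neg; auto|apply count_bound_neg; auto|].
        -- intros c r. destruct (HD c r) as [l Hl]. exists l. intros u Hu. apply Hl. unfold negD in Hu. lia.
        -- intros a Ha. unfold negD in Ha. specialize (Hsep a b ltac:(lia) Hb1). pose proof (Cmod_tri a z b).
           rewrite (Cmod_sub_sym z b) in H. unfold d in *. lra.
  (* A constant limit would be within 1/2 of both 0 and infinity, whose chordal distance is 2. *)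
  - intros h g Hu [w Hw]. destruct (Hu Rad (1/2)) as [n Hn]; [lra|]. specialize (Hn n (le_n _)).
    destruct (Hdense (h n)) as [[a [A1 A2]] [b [B1 B2]]].
    assert (Pa := Hn (a - h n)%C (Rlt_le _ _ A2)). assert (Pb := Hn (b - h n)%C (Rlt_le _ _ B2)).
    rewrite Hw in Pa, Pb.
    change (rhoS (f (a - h n + h n)%C) w < 1/2) in Pa. change (rhoS (f (b - h n + h n)%C) w < 1/2) in Pb.
    replace (a - h n + h n)%C with (a : C) in Pa by ring. replace (b - h n + h n)%C with (b : C) in Pb by ring.
    rewrite (proj1 (Hv a)) in Pa by auto. rewrite (proj1 (proj2 (Hv b))) in Pb by auto.
    assert (T := rho_tri (Some (RtoC 0)) w None). rewrite (rho_sym w), rho_0N in T. lra.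
Qed.

Lemma kbound_quotient (D : C -> Z) (f g : C -> sphere) (B B' : R) (z : C) : divisor D -> kbound D f B -> kbound D g B' -> D z = 0%Z ->
  exists yf yg, f z = Some yf /\ g z = Some yg /\ yf <> RtoC 0 /\ yg <> RtoC 0 /\ Cmod (yg / yf) <= exp (B + B').
Proof.
  intros HD Hf Hg Hz. destruct (Hf z Hz) as [yf [F1 [F2 F3]]]. destruct (Hg z Hz) as [yg [G1 [G2 G3]]].
  exists yf, yg. repeat split; auto.
  set (l := supp_list D (fun a => Cmod (a - z) < 1)).
  assert (Hl : supp D (fun a => Cmod (a - z) < 1) l) by (apply supp_list_spec; auto; apply bounded_disc).
  specialize (F3 l (supp_covers _ _ _ Hl)). specialize (G3 l (supp_covers _ _ _ Hl)).
  apply Rcomplements.Rabs_le_between in F3, G3.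
  assert (Pf := proj1 (Cmod_gt_0 yf) F2). assert (Pg := proj1 (Cmod_gt_0 yg) G2).
  rewrite Cmod_div by auto. rewrite <- (exp_ln (Cmod yg / Cmod yf)) by (apply Rdiv_lt_0_compat; auto).
  rewrite ln_div by auto. apply exp_le_mono. lra.
Qed.

Lemma Ccont_bound_punctured (g : C -> C) (z : C) (r M : R) : 0 < r -> Ccont g z ->
  (forall w, 0 < Cmod (w - z) < r -> Cmod (g w) <= M) -> Cmod (g z) <= M.
Proof.
  intros Hr Hc Hb. apply le_epsilon. intros eps He. destruct (Hc eps He) as [d [D1 D2]].
  assert (Hm0 : 0 < Rmin d r) by (apply Rmin_pos; auto). assert (L1 := Rmin_l d r). assert (L2 := Rmin_r d r).
  set (t := Rmin d r / 2) in *.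
  assert (Hw : Cmod (z + RtoC t - z) = t) by (rewrite Cmod_sub_c, Cmod_R, Rabs_pos_eq; unfold t; lra).
  specialize (D2 (z + RtoC t)%C). specialize (Hb (z + RtoC t)%C). rewrite Hw in D2, Hb.
  specialize (D2 ltac:(unfold t; lra)). specialize (Hb ltac:(unfold t; lra)).
  rewrite Cmod_sub_sym in D2. pose proof (Cmod_tri_inv (g z) (g (z + RtoC t)%C)). lra.
Qed.

Lemma kbound_unique (D : C -> Z) (f g : C -> sphere) (B B' : R) : divisor D -> D 0 = 0%Z -> vals D f -> vals D g -> kbound D f B -> kbound D g B' ->
  (forall R0, 1 <= R0 -> (exists l h, LF D f 0 R0 l h) /\ (exists l h, LF D g 0 R0 l h)) ->
  exists c, c <> RtoC 0 /\ forall w, g w = smul c (f w).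
Proof.
  intros HD H0 Vf Vg Kf Kg HLF. set (M := exp (B + B')). assert (HM : 0 < M) by apply exp_pos.
  set (q := fun z => (fin (g z) / fin (f z))%C).
  assert (E0 : forall w : C, (w - 0)%C = w) by (intros; ring).
  assert (K : forall z, D z = 0%Z -> q z = q 0).
  { intros z Hz. destruct (Ceq_dec (q z) (q 0)) as [E|E]; auto. exfalso.
    assert (Hp := Cmod_sub_pos _ _ E). set (e := Cmod (q z - q 0)) in *. assert (Hz0 := Cmod_ge_0 z).
    (* Liouville's theorem in quantitative form: the quotient is bounded by [M] on every disc, and
       on a disc of this radius Schwarz's lemma forces [|q z - q 0| < e]. *)
    set (R0 := Rmax 1 (Cmod z + 1 + 4 * M * Cmod z / e)).
    assert (HR1 : 1 <= R0) by apply Rmax_l. assert (HR2 : Cmod z + 1 + 4 * M * Cmod z / e <= R0) by apply Rmax_r.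
    assert (Hx : 0 <= 4 * M * Cmod z / e) by (apply Rdiv_le_0_compat; auto; apply Rmult_le_pos; lra).
    destruct (HLF R0 HR1) as [[lf [hf [Sf [Hf1 Hf2]]]] [lg' [hg [Sg [Hg1 Hg2]]]]].
    (* The rational factors of [f] and [g] cancel, so [Q] extends [q] holomorphically over zeros and
       poles; there its bound follows from a punctured neighbourhood by continuity. *)
    set (Q := fun w => (hg w / hf w)%C).
    assert (HQd : forall w, Cmod (w - 0) < R0 -> Cdiff Q w).
    { intros w Hw. apply (Cdiff_div hg hf); [apply Hf1|apply Hg1|apply Hf1]; auto. }
    assert (HQq : forall w, Cmod (w - 0) < R0 -> D w = 0%Z -> Q w = q w).
    { intros w Hw Hd. destruct (Hf2 w Hw) as [A _]. destruct (Hg2 w Hw) as [A' _]. unfold q, Q. rewrite A, A' by auto. simpl.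
      replace (rprod D lg' w) with (rprod D lf w) by (apply cprod_perm, (supp_perm D _ _ _ Sf Sg)).
      assert (rprod D lf w <> 0) by (apply rprod_neq0; intros Hin; apply Sf in Hin; tauto).
      field. split; auto. apply Hf1, Hw. }
    assert (HQb : forall w, Cmod (w - 0) < R0 -> Cmod (Q w) <= M).
    { intros w Hw. destruct (list_sep lf w) as [r [Hr Hs]].
      apply (Ccont_bound_punctured Q w (Rmin r (R0 - Cmod (w - 0)))).
      - apply Rmin_pos; lra.
      - apply Cdiff_Ccont, HQd, Hw.
      - intros u [U1 U2]. assert (A1 := Rlt_le_trans _ _ _ U2 (Rmin_l _ _)). assert (A2 := Rlt_le_trans _ _ _ U2 (Rmin_r _ _)).
        assert (Hu : Cmod (u - 0) < R0) by (pose proof (Cmod_tri u w 0); lra).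
        assert (Hd : D u = 0%Z).
        { destruct (Z.eq_dec (D u) 0); auto. exfalso. assert (Hin : In u lf) by (apply Sf; auto).
          assert (u <> w) by (intros E'; subst; rewrite Cmod_sub_self in U1; lra). specialize (Hs u Hin H). lra. }
        rewrite HQq by auto. destruct (kbound_quotient D f g B B' u HD Kf Kg Hd) as [yf [yg [F1 [F2 [_ [_ F3]]]]]].
        unfold q. rewrite F1, F2. exact F3. }
    assert (A := schwarz_lip Q 0 R0 M ltac:(lra) HQd HQb z). rewrite !E0 in A. specialize (A ltac:(lra)).
    rewrite !HQq in A; auto; try (rewrite E0; lra). 2:{ rewrite E0, Cmod_0. lra. }
    fold e in A.
    assert (2 * M / R0 * Cmod z < e); [|lra].
    apply Rmult_lt_reg_r with (R0 / e); [apply Rdiv_lt_0_compat; lra|].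
    replace (2 * M / R0 * Cmod z * (R0 / e)) with (4 * M * Cmod z / e / 2) by (field; lra).
    replace (e * (R0 / e)) with R0 by (field; lra). lra. }
  exists (q 0). destruct (kbound_quotient D f g B B' 0 HD Kf Kg H0) as [yf [yg [F1 [F2 [F3 [F4 _]]]]]].
  assert (Hq0 : q 0 <> RtoC 0).
  { unfold q. rewrite F1, F2. simpl. intros E. apply F4. replace yg with (yg / yf * yf)%C by (field; auto).
    change ((yg / yf)%C = RtoC 0) in E. rewrite E. change (@eq C (0 * yf)%C 0). ring. }
  split; auto. intros w. destruct (Z.lt_trichotomy (D w) 0) as [H|[H|H]].
  - rewrite (proj1 (proj2 (Vf w))), (proj1 (proj2 (Vg w))) by auto. reflexivity.
  - destruct (kbound_quotient D f g B B' w HD Kf Kg H) as [zf [zg [G1 [G2 [G3 [G4 _]]]]]].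
    rewrite <- (K w H). unfold q. rewrite G1, G2. simpl. apply f_equal with (f := @Some C).
    assert (X : forall a b : C, b <> 0 -> a = (a / b * b)%C) by (intros; field; auto). apply X; auto.
  - rewrite (proj1 (Vf w)), (proj1 (Vg w)) by lia. simpl. apply f_equal with (f := @Some C).
    change (@eq C 0 (q 0%C * 0)%C). ring.
Qed.

(** * Uniform behaviour of N1-functions *)

Lemma not_small_sinv e u : 0 < e -> ~ small e u -> small (/ e) (sinv u).
Proof.
  intros He H. destruct u as [y|]; simpl.
  - destruct (Ceq_dec y 0) as [E|E].
    + exfalso. apply H. simpl. rewrite E, Cmod_0. lra.
    + simpl in *. rewrite Cmod_inv by auto. apply Rinv_le_contravar; lra.
  - rewrite Cmod_0. left. apply Rinv_0_lt_compat, He.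
Qed.

Lemma small_mono e e' u : e <= e' -> small e u -> small e' u.
Proof. destruct u; simpl; [lra|auto]. Qed.

Lemma small_Some e u : small e u -> u = Some (fin u) /\ Cmod (fin u) <= e.
Proof. destruct u; simpl; [auto|contradiction]. Qed.

(** * Normality and non-constant limits in quantitative form *)

Definition s_cauchy (u : nat -> sphere) : Prop :=
  forall eps, 0 < eps -> exists N, forall n m, (n >= N)%nat -> (m >= N)%nat -> rhoS (u n) (u m) < eps.
Definition s_conv (u : nat -> sphere) (w : sphere) : Prop :=
  forall eps, 0 < eps -> exists N, forall n, (n >= N)%nat -> rhoS (u n) w < eps.

Lemma dist_le_rho (e : R) (z w : C) : 0 <= e -> Cmod z <= e -> Cmod w <= e -> Cmod (z - w) <= (1 + e ^ 2) * rhoS (Some z) (Some w).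
Proof.
  intros He Hz Hw. rewrite rho_SS.
  assert (S : forall y : C, Cmod y <= e -> 0 < sN y /\ sN y * sN y <= 1 + e ^ 2).
  { intros y Hy. unfold sN. assert (Q := Cmod_ge_0 y). change (Cnorm y) with (Cmod y). split; [apply sqrt_lt_R0; nra|]. rewrite sqrt_sqrt by nra. nra. }
  destruct (S z Hz) as [A1 A2]. destruct (S w Hw) as [B1 B2].
  assert (P : 0 < sN z * sN w) by (apply Rmult_lt_0_compat; auto).
  assert (Q : sN z * sN w <= 1 + e ^ 2) by nra. assert (X := Cmod_ge_0 (z - w)%C).
  replace ((1 + e ^ 2) * (2 * Cmod (z - w) / (sN z * sN w))) with (Cmod (z - w) * (2 * ((1 + e ^ 2) / (sN z * sN w)))) by (field; lra).
  assert (1 <= (1 + e ^ 2) / (sN z * sN w)) by (apply Rcomplements.Rle_div_r; lra). nra.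
Qed.

Lemma sphere_complete_bounded (u : nat -> sphere) (e : R) : 0 <= e -> (exists N, forall n, (n >= N)%nat -> small e (u n)) -> s_cauchy u -> exists w, s_conv u w.
Proof.
  intros He [N0 HN0] HC.
  assert (HC2 : forall eps, 0 < eps -> exists N, (N >= N0)%nat /\ forall n m, (n >= N)%nat -> (m >= N)%nat -> Cmod (fin (u n) - fin (u m)) < eps).
  { intros eps Hp. assert (He2 : 0 < 1 + e ^ 2) by nra. destruct (HC (eps / (1 + e ^ 2))) as [N HN]; [apply Rdiv_lt_0_compat; auto|].
    exists (max N N0). split; [lia|]. intros n m Hn Hm. destruct (small_Some _ _ (HN0 n ltac:(lia))) as [A1 A2].
    destruct (small_Some _ _ (HN0 m ltac:(lia))) as [B1 B2]. specialize (HN n m ltac:(lia) ltac:(lia)). rewrite A1, B1 in HN.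
    eapply Rle_lt_trans; [apply (dist_le_rho e); auto|]. apply Rmult_lt_compat_l with (r := 1 + e ^ 2) in HN; auto.
    replace ((1 + e ^ 2) * (eps / (1 + e ^ 2))) with eps in HN by (field; lra). exact HN. }
  destruct (Rcomplete.R_complete (fun n => fst (fin (u n)))) as [x Hx].
  { intros eps Hp. destruct (HC2 eps Hp) as [N [_ HN]]. exists N. intros n m Hn Hm. unfold Rdist.
    eapply Rle_lt_trans; [|apply (HN n m Hn Hm)]. apply (fst_le_Cmod (fin (u n) - fin (u m))). }
  destruct (Rcomplete.R_complete (fun n => snd (fin (u n)))) as [y Hy].
  { intros eps Hp. destruct (HC2 eps Hp) as [N [_ HN]]. exists N. intros n m Hn Hm. unfold Rdist.
    eapply Rle_lt_trans; [|apply (HN n m Hn Hm)]. apply (snd_le_Cmod (fin (u n) - fin (u m))). }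
  exists (Some (x, y)). intros eps Hp. destruct (Hx (eps / 4)) as [Nx HNx]; [lra|]. destruct (Hy (eps / 4)) as [Ny HNy]; [lra|].
  exists (max N0 (max Nx Ny)). intros n Hn. destruct (small_Some _ _ (HN0 n ltac:(lia))) as [A1 _]. rewrite A1.
  eapply Rle_lt_trans; [apply rho_le_dist|]. specialize (HNx n ltac:(lia)). specialize (HNy n ltac:(lia)). unfold Rdist in *.
  pose proof (Cmod_le_sum (fin (u n) - (x, y))%C). 
  change (fst (fin (u n) - (x, y))%C) with (fst (fin (u n)) - x) in H. change (snd (fin (u n) - (x, y))%C) with (snd (fin (u n)) - y) in H. lra.
Qed.

Lemma sphere_complete (u : nat -> sphere) : s_cauchy u -> exists w, s_conv u w.
Proof.
  intros HC. destruct (classic (exists N, forall n, (n >= N)%nat -> small 4 (u n))) as [H|H].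
  - apply (sphere_complete_bounded u 4); auto; lra.
  (* A value outside [small 4] has a reciprocal within chordal distance 1/2 of 0; the Cauchy
     tolerance 1/4 keeps all later reciprocals within distance 1, that is in [small 1]. *)
  - destruct (HC (1/4)) as [N HN]; [lra|].
    assert (exists n, (n >= N)%nat /\ ~ small 4 (u n)) as [n0 [Hn0 Hs]].
    { apply NNPP. intros Q. apply H. exists N. intros n Hn. apply NNPP. intros Q2. apply Q. exists n. auto. }
    apply not_small_sinv in Hs; [|lra]. apply rho_small in Hs; [|lra].
    destruct (sphere_complete_bounded (fun n => sinv (u n)) 1) as [w Hw].
    + lra.
    + exists N. intros n Hn. apply small_rho. eapply Rle_trans; [apply (rho_tri _ (sinv (u n0)))|]. rewrite rho_sinv.
      specialize (HN n n0 Hn Hn0). lra.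
    + intros eps Hp. destruct (HC eps Hp) as [M HM]. exists M. intros. rewrite rho_sinv. apply HM; auto.
    + exists (sinv w). intros eps Hp. destruct (Hw eps Hp) as [M HM]. exists M. intros n Hn. rewrite <- rho_sinv, sinv_invol. apply HM, Hn.
Qed.

Definition uc (f : C -> sphere) : Prop :=
  forall eps, 0 < eps -> exists d, 0 < d /\ forall z z', Cmod (z' - z) < d -> rhoS (f z') (f z) < eps.
(* A quantitative form of the absence of constant limits, visibly invariant under f -> 1/f. *)
Definition osc (f : C -> sphere) : Prop :=
  exists Rad eps, 0 < Rad /\ 0 < eps /\ forall c, exists z z', Cmod (z - c) <= Rad /\ Cmod (z' - c) <= Rad /\ eps <= rhoS (f z) (f z').

Lemma Cadd_sub (a b : C) : (a + b - b)%C = a.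
Proof. ring. Qed.

Lemma phi_ge (phi : nat -> nat) : (forall n, (phi n < phi (S n))%nat) -> forall n, (n <= phi n)%nat.
Proof. intros H. induction n as [|n IH]; [lia|specialize (H n); lia]. Qed.

Lemma inv_S_lt (eps : R) : 0 < eps -> exists N, forall n, (n >= N)%nat -> / (INR n + 1) < eps.
Proof.
  intros He. destruct (archimed_cor1 eps He) as [N [H1 H2]]. exists N. intros n Hn. eapply Rle_lt_trans; [|exact H1].
  apply Rinv_le_contravar; [apply lt_0_INR; lia|]. assert (INR N <= INR n) by (apply le_INR; lia). lra.
Qed.

Lemma inv_S_pos n : 0 < / (INR n + 1).
Proof. apply Rinv_0_lt_compat. pose proof (pos_INR n). lra. Qed.

(** Otherwise pairs of points with distance tending to 0 keep values [eps] apart. Translates by a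
    subsequence of their first points are uniformly close to one fixed translate, which is
    continuous at the origin: a contradiction. *)
Lemma normal_uc f : normal f -> uc f.
Proof.
  intros [Hm Hn]. apply NNPP. intros H. apply not_all_ex_not in H. destruct H as [eps H]. apply imply_to_and in H. destruct H as [He H].
  assert (Hz : forall n : nat, exists p : C * C, Cmod (snd p - fst p) < / (INR n + 1) /\ eps <= rhoS (f (snd p)) (f (fst p))).
  { intros n. apply NNPP. intros Q. apply H. exists (/ (INR n + 1)). split; [apply inv_S_pos|]. intros z z' Hd.
    apply Rnot_le_lt. intros Q2. apply Q. exists (z, z'). auto. }
  destruct (choice _ Hz) as [p Hp]. destruct (Hn (fun n => fst (p n))) as [phi [Hphi HN]].
  destruct (HN 1 (eps / 3)) as [N HN']; [lra|]. 
  destruct (mero_rcont f (fst (p (phi N))) Hm (eps / 3)) as [d [Hd1 Hd2]]; [lra|].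
  destruct (inv_S_lt (Rmin d 1)) as [M HM]; [apply Rmin_pos; lra|].
  set (n := max N M). assert (Pn := phi_ge phi Hphi n). specialize (HM (phi n) ltac:(unfold n in *; lia)).
  destruct (Hp (phi n)) as [A1 A2]. set (w := (snd (p (phi n)) - fst (p (phi n)))%C) in *.
  assert (L1 := Rmin_l d 1). assert (L2 := Rmin_r d 1).
  assert (B1 := HN' n N ltac:(unfold n; lia) (le_n _) w ltac:(change (Cmod w <= 1); lra)).
  assert (B2 := HN' N n (le_n _) ltac:(unfold n; lia) (RtoC 0) ltac:(change (Cmod 0 <= 1); rewrite Cmod_0; lra)).
  change (rhoS (f (w + fst (p (phi n)))%C) (f (w + fst (p (phi N)))%C) < eps / 3) in B1.
  change (rhoS (f (0 + fst (p (phi N)))%C) (f (0 + fst (p (phi n)))%C) < eps / 3) in B2.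
  replace (w + fst (p (phi n)))%C with (snd (p (phi n)) : C) in B1 by (unfold w; ring).
  rewrite !Cplus_0_l in B2. specialize (Hd2 (w + fst (p (phi N)))%C).
  replace (w + fst (p (phi N)) - fst (p (phi N)))%C with w in Hd2 by ring. specialize (Hd2 ltac:(lra)).
  assert (T1 := rho_tri (f (snd (p (phi n)))) (f (w + fst (p (phi N)))%C) (f (fst (p (phi n))))).
  assert (T2 := rho_tri (f (w + fst (p (phi N)))%C) (f (fst (p (phi N)))) (f (fst (p (phi n))))). lra.
Qed.

(** If it failed, [f] would vary by less than [1/(n+1)] on a disc of radius [n + 1] about some
    [c n]. Along a subsequence given by normality the values at the centres converge, since the
    sphere is complete, and the translates tend to that constant. *)
Lemma N1_osc f : N1 f -> osc f.
Proof.
  intros [[Hm Hn] Hc]. apply NNPP. intros H.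
  assert (Hz : forall n : nat, exists c : C, forall z z', Cmod (z - c) <= INR n + 1 -> Cmod (z' - c) <= INR n + 1 -> rhoS (f z) (f z') < / (INR n + 1)).
  { intros n. apply NNPP. intros Q. apply H. exists (INR n + 1), (/ (INR n + 1)). split; [pose proof (pos_INR n); lra|]. split; [apply inv_S_pos|].
    intros c. apply NNPP. intros Q2. apply Q. exists c. intros z z' H1 H2. apply Rnot_le_lt. intros Q3. apply Q2. exists z, z'. auto. }
  destruct (choice _ Hz) as [c Hcc]. destruct (Hn c) as [phi [Hphi HN]].
  destruct (sphere_complete (fun n => f (c (phi n)))) as [w Hw].
  { intros eps He. destruct (HN 0 eps He) as [N HN']. exists N. intros n m H1 H2. specialize (HN' n m H1 H2 (RtoC 0)).
    change (Cmod 0 <= 0 -> rhoS (f (0 + c (phi n))%C) (f (0 + c (phi m))%C) < eps) in HN'. rewrite !Cplus_0_l, Cmod_0 in HN'. apply HN'. lra. }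
  apply (Hc (fun n => c (phi n)) (fun _ => w)); [|exists w; auto].
  intros Rad eps He. destruct (Hw (eps / 2)) as [N1 HN1]; [lra|]. destruct (inv_S_lt (eps / 2)) as [N2 HN2]; [lra|].
  destruct (floor_exists (Rabs Rad) (Rabs_pos _)) as [N3 [HN3 HN4]].
  exists (max N1 (max N2 N3)). intros n Hn' z Hz'. assert (Pn := phi_ge phi Hphi n).
  specialize (HN1 n ltac:(lia)). specialize (HN2 (phi n) ltac:(lia)).
  assert (INR N3 <= INR (phi n)) by (apply le_INR; lia). pose proof (Rle_abs Rad).
  assert (A := Hcc (phi n) (z + c (phi n))%C (c (phi n))). rewrite Cmod_sub_self in A.
    rewrite Cadd_sub in A. change (Cmod z <= Rad) in Hz'.
  assert (P0 := pos_INR (phi n)). specialize (A ltac:(lra) ltac:(lra)). change (rhoS (f (z + c (phi n))%C) w < eps).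
  pose proof (rho_tri (f (z + c (phi n))%C) (f (c (phi n))) w). lra.
Qed.

(** What necessity and uniqueness use of an N1-function, in a form that passes to [1/f] with divisor
    [negD D] ([tame_neg]). *)
Definition tame (D : C -> Z) (f : C -> sphere) : Prop :=
  divisor D /\ meromorphic f /\ vals D f /\ uc f /\ osc f /\ (forall c R0, exists l h, LF D f c R0 l h).

Lemma tame_N1 D f : divisor D -> N1 f -> divisor_of D f -> tame D f.
Proof.
  intros HD HN Hf. assert (Hm : meromorphic f) by apply HN. repeat split; auto; try apply HD.
  - apply Hm.
  - apply Hm.
  - apply (mero_vals D f Hm Hf).
  - apply (mero_vals D f Hm Hf).
  - apply (mero_vals D f Hm Hf).
  - apply normal_uc, HN.
  - apply N1_osc, HN.
  - intros. apply LF_exists; auto.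
Qed.

Lemma rprod_neg D l z : ~ In z l -> rprod (negD D) l z = (/ rprod D l z)%C.
Proof.
  intros Hz. induction l as [|a l IH].
  - unfold rprod, cprod. simpl. apply injective_projections; simpl; field.
  - assert (Ha : (z - a)%C <> 0). { intros E. apply Csub_0_eq in E. apply Hz. left. congruence. }
    assert (Hl : ~ In z l) by (intros E; apply Hz; right; auto).
    change (rprod (negD D) (a :: l) z) with (czp (z - a) (- D a) * rprod (negD D) l z)%C.
    change (rprod D (a :: l) z) with (czp (z - a) (D a) * rprod D l z)%C. rewrite IH by auto.
    assert (czp (z - a) (D a) <> 0) by (apply czp_neq0; auto). assert (rprod D l z <> 0) by (apply rprod_neq0; auto).
    replace (czp (z - a) (- D a)) with (/ czp (z - a) (D a))%C by (symmetry; apply czp_opp; auto). field. auto.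
Qed.

Lemma LF_neg D f c R0 l h : LF D f c R0 l h -> LF (negD D) (fun z => sinv (f z)) c R0 l (fun z => / h z)%C.
Proof.
  intros [[Hl0 Hl] [Hh Hf]]. split; [|split].
  - split; auto. intros z. rewrite Hl. unfold negD. split; intros [A B]; split; auto; lia.
  - intros z Hz. destruct (Hh z Hz) as [A B]. split; [apply Cdiff_inv; auto|]. intros E.
    apply (f_equal (fun u => u * h z)%C) in E. rewrite Cinv_l in E by auto. replace (0 * h z)%C with (RtoC 0) in E by ring.
    apply RtoC_inj in E. lra.
  - intros z Hz. destruct (Hf z Hz) as [A [B E]]. destruct (Hh z Hz) as [H1 H2]. unfold negD. split; [|split]; intros HD.
    + assert (Hn : ~ In z l) by (rewrite Hl; intros [Q _]; lia). rewrite A by lia. assert (P := rprod_neq0 D l z Hn).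
      unfold sinv. destruct (Ceq_dec (h z * rprod D l z)%C 0) as [Q|Q].
      * exfalso. apply (Cmult_neq_0 _ _ H2 P Q).
      * change (fun a => (- D a)%Z) with (negD D). rewrite rprod_neg by auto. apply f_equal with (f := @Some C). field. auto.
    + rewrite E by lia. reflexivity.
    + rewrite B by lia. unfold sinv. destruct (Ceq_dec 0 0); congruence.
Qed.

Lemma osc_sinv f : osc f -> osc (fun z => sinv (f z)).
Proof.
  intros [Rad [eps [A [B H]]]]. exists Rad, eps. repeat split; auto. intros c. destruct (H c) as [z [z' [H1 [H2 H3]]]].
  exists z, z'. rewrite rho_sinv. auto.
Qed.

Lemma tame_neg D f : tame D f -> tame (negD D) (fun z => sinv (f z)).
Proof.
  intros [HD [Hm [Hv [Hu [Ho HL]]]]]. assert (Hm' : meromorphic (fun z => sinv (f z))).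
  { apply mero_sinv; auto. destruct Ho as [Rad [eps [A [B H]]]]. destruct (H 0) as [z [z' [_ [_ H3]]]].
    destruct (classic (f z = Some (RtoC 0))) as [E|E]; [|exists z; auto]. exists z'. intros E'. rewrite E, E', rho_refl in H3. lra. }
  split; [|split; [|split; [|split; [|split]]]]; auto.
  - intros c r. destruct (HD c r) as [l Hl]. exists l. intros u Hu2. apply Hl. unfold negD in Hu2. lia.
  - apply vals_neg, Hv.
  - intros eps He. destruct (Hu eps He) as [d [H1 H2]]. exists d. split; auto. intros. rewrite rho_sinv. auto.
  - apply osc_sinv, Ho.
  - intros c R0. destruct (HL c R0) as [l [h H]]. exists l, (fun z => / h z)%C. apply LF_neg, H.
Qed.

(** The values at a zero and at a pole have chordal distance 2, which uniform continuity forbids for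
    close points. *)
Lemma tame_sep D f : tame D f -> exists dl, 0 < dl /\ forall a b, (D a > 0)%Z -> (D b < 0)%Z -> dl <= Cmod (a - b).
Proof.
  intros [HD [Hm [Hv [Hu _]]]]. destruct (Hu 1) as [d [H1 H2]]; [lra|]. exists d. split; auto.
  intros a b Ha Hb. apply Rnot_lt_le. intros H. specialize (H2 b a H).
  rewrite (proj1 (Hv a)), (proj1 (proj2 (Hv b))), rho_0N in H2 by auto. lra.
Qed.

Lemma Cdiv_mul_cancel (a b : C) : b <> 0 -> (a / b * b)%C = a.
Proof. intros H. field. auto. Qed.

(** * Propagation of smallness, and bounds for ln|f| and the counting function *)

Definition near_small (f : C -> sphere) (d : R) : Prop :=
  forall z z', Cmod (z' - z) < d -> small (1/4) (f z) -> small 1 (f z').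

Lemma uc_near f : uc f -> exists d, 0 < d /\ near_small f d.
Proof.
  intros H. destruct (H (1/2)) as [d [H1 H2]]; [lra|]. exists d. split; auto. intros z z' Hd Hs. apply small_rho.
  apply rho_small in Hs; [|lra]. specialize (H2 z z' Hd). pose proof (rho_tri (f z') (f z) (Some (RtoC 0))). lra.
Qed.

Lemma near_small_le f d d' : d' <= d -> near_small f d -> near_small f d'.
Proof. intros H H1 z z' Hd. apply H1. lra. Qed.

Definition cball_small (f : C -> sphere) (p : C) (s e : R) : Prop := forall z, Cmod (z - p) < s -> small e (f z).

(* Three circles around a point near the boundary: on the inner one f is tiny, on the outer one it is
   bounded by 1, and the pole of order k at the centre weighs the inner bound against the outer one. *)
Lemma propagate1 f d eps : meromorphic f -> 0 < d -> near_small f d -> 0 < eps ->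
  exists eps', 0 < eps' /\ forall p s, d / 16 <= s -> cball_small f p s eps' -> cball_small f p (s + d / 8) eps.
Proof.
  intros Hm Hd Hn He.
  (* The circles about [z2] have radii [d/32] and [d/2], and [z] lies within [3d/16] of [z2]: the
     ratio is at most 6 to the inner radius and 3/8 to the outer one. So [k] makes the outer
     contribution [(3/8)^k] small, and [e1 <= eps / 6^k] the inner one. *)
  destruct (pow_lt_1_zero (3/8)) with (y := eps) as [k Hk]; [rewrite Rabs_pos_eq; lra|auto|].
  specialize (Hk k (le_n _)). rewrite Rabs_pos_eq in Hk by (apply pow_le; lra).
  assert (P6 : 0 < 6 ^ k) by (apply pow_lt; lra).
  set (e1 := Rmin (Rmin eps (1/4)) (eps / 6 ^ k)).
  assert (E0 : 0 < e1) by (unfold e1; repeat apply Rmin_pos; try lra; apply Rdiv_lt_0_compat; auto).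
  assert (E1 : e1 <= eps) by (unfold e1; eapply Rle_trans; [apply Rmin_l|apply Rmin_l]).
  assert (E2 : e1 <= 1/4) by (unfold e1; eapply Rle_trans; [apply Rmin_l|apply Rmin_r]).
  assert (E3 : e1 * 6 ^ k <= eps).
  { assert (e1 <= eps / 6 ^ k) by apply Rmin_r. apply Rmult_le_compat_r with (r := 6 ^ k) in H; [|lra].
    replace (eps / 6 ^ k * 6 ^ k) with eps in H by (field; lra). exact H. }
  clearbody e1. exists e1. split; auto. intros p s Hs Hb z Hz.
  destruct (Rlt_le_dec (Cmod (z - p)) s) as [Hzs|Hzs]; [apply (small_mono e1); auto|].
  set (m := Cmod (z - p)) in *. assert (Hm0 : 0 < m) by lra.
  set (t := (s - d / 16) / m). assert (Ht : t * m = s - d / 16) by (unfold t; field; lra).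
  assert (Ht0 : 0 <= t) by (unfold t; apply Rdiv_le_0_compat; lra).
  (* The point on the segment from [p] to [z] at depth [d/16] inside the ball where [f] is already
     tiny. *)
  set (z2 := (p + RtoC t * (z - p))%C).
  assert (A1 : Cmod (z2 - p) = s - d / 16).
  { unfold z2. rewrite Cmod_sub_c, Cmod_mult, Cmod_R, Rabs_pos_eq; auto. }
  assert (A2 : Cmod (z - z2) = m - s + d / 16).
  { replace (z - z2)%C with (RtoC (1 - t) * (z - p))%C by (unfold z2; rewrite RtoC_minus; ring).
    rewrite Cmod_mult, Cmod_R, Rabs_pos_eq; [fold m; nra|]. assert (t * m <= 1 * m) by lra. apply Rmult_le_reg_r in H; lra. }
  clearbody z2 t.
  assert (Hin : forall w, Cmod (w - z2) < d / 16 -> small e1 (f w)).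
  { intros w Hw. apply Hb. pose proof (Cmod_tri w z2 p). lra. }
  assert (Hout : forall w, Cmod (w - z2) < d -> small 1 (f w)).
  { intros w Hw. apply (Hn z2); auto. apply (small_mono e1); auto. apply Hin. rewrite Cmod_sub_self. lra. }
  set (psi := fun w => (fin (f w) / cpw (w - z2) k)%C).
  set (M := Rmax (e1 * (32 / d) ^ k) ((2 / d) ^ k)).
  assert (HM0 : 0 <= M) by (eapply Rle_trans; [|apply Rmax_r]; apply pow_le; left; apply Rdiv_lt_0_compat; lra).
  assert (Hdf : forall w, 0 < Cmod (w - z2) < d -> Cdiff psi w).
  { intros w [W1 W2]. unfold psi. apply (Cdiff_div (fun w => fin (f w)) (fun w => cpw (w - z2) k)).
    - apply cpw_neq0. intros E. rewrite E, Cmod_0 in W1. lra.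
    - apply mero_fin_diff; auto. intros E. specialize (Hout w W2). rewrite E in Hout. exact Hout.
    - apply (Cdiff_cpw (fun w => w - z2)%C). apply (Cdiff_minus (fun w => w) (fun _ => z2)); [apply Cdiff_id|apply Cdiff_const].
    }
  assert (Hval : forall w e r, 0 < r -> Cmod (w - z2) = r -> small e (f w) -> Cmod (psi w) <= e * (/ r) ^ k).
  { intros w e r Hr Hw Hsm. unfold psi. rewrite Cmod_div, Cmod_cpw, Hw, pow_inv.
    - apply Rmult_le_compat_r; [left; apply Rinv_0_lt_compat, pow_lt, Hr|]. apply (small_Some e (f w) Hsm).
    - apply cpw_neq0. intros E. rewrite E, Cmod_0 in Hw. lra. }
  assert (MP := max_principle psi z2 (d / 32) (d / 2) M ltac:(lra) ltac:(lra) HM0).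
  assert (B : Cmod (psi z) <= M).
  { apply MP; [| | |lra].
    - intros w Hw. apply Cdiff_Ccont, Hdf. lra.
    - intros w Hw. exists (d / 32). split; [lra|]. intros u Hu. apply Hdf.
      pose proof (Cmod_tri u w z2). pose proof (Cmod_tri w u z2). rewrite (Cmod_sub_sym w u) in H0. lra.
    - intros w [Hw|Hw].
      + eapply Rle_trans; [|apply Rmax_l]. replace (32 / d) with (/ (d / 32)) by (field; lra). apply Hval; auto; [lra|]. apply Hin. lra.
      + eapply Rle_trans; [|apply Rmax_r]. replace (2 / d) with (/ (d / 2)) by (field; lra). rewrite <- (Rmult_1_l ((/ (d / 2)) ^ k)). apply Hval; auto; [lra|]. apply Hout. lra. }
  assert (Hz1 := Hout z ltac:(lra)). apply small_Some in Hz1. destruct Hz1 as [Z1 _]. rewrite Z1. simpl.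
  assert (N0 : cpw (z - z2) k <> 0) by (apply cpw_neq0; intros E; rewrite E, Cmod_0 in A2; lra).
  assert (Hfz : Cmod (fin (f z)) = Cmod (psi z) * Cmod (z - z2) ^ k).
  { rewrite <- Cmod_cpw, <- Cmod_mult. f_equal. unfold psi. symmetry. apply Cdiv_mul_cancel, N0. }
  rewrite Hfz. assert (0 <= Cmod (z - z2) <= 3 * d / 16) by lra.
  assert (Pw : Cmod (z - z2) ^ k <= (3 * d / 16) ^ k) by (apply pow_incr; lra).
  assert (Pw0 : 0 <= Cmod (z - z2) ^ k) by (apply pow_le; lra).
  apply Rle_trans with (M * (3 * d / 16) ^ k).
  { apply Rmult_le_compat; auto. apply Cmod_ge_0. }
  unfold M. apply Rmax_case.
  - rewrite Rmult_assoc, <- Rpow_mult_distr. replace (32 / d * (3 * d / 16)) with 6 by (field; lra). exact E3.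
  - rewrite <- Rpow_mult_distr. replace (2 / d * (3 * d / 16)) with (3 / 8) by (field; lra). lra.
Qed.

Lemma propagate f d n : meromorphic f -> 0 < d -> near_small f d -> forall eps, 0 < eps ->
  exists eps', 0 < eps' /\ forall p s, d / 16 <= s -> cball_small f p s eps' -> cball_small f p (s + INR n * (d / 8)) eps.
Proof.
  intros Hm Hd Hn. induction n as [|n IH]; intros eps He.
  - exists eps. split; auto. intros p s _ H. simpl. rewrite Rmult_0_l, Rplus_0_r. exact H.
  - destruct (propagate1 f d eps Hm Hd Hn He) as [e1 [H1 H2]]. destruct (IH e1 H1) as [e2 [H3 H4]].
    exists e2. split; auto. intros p s Hs H. rewrite S_INR. replace (s + (INR n + 1) * (d / 8)) with (s + INR n * (d / 8) + d / 8) by ring.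
    apply H2; [pose proof (pos_INR n); nra|]. apply H4; auto.
Qed.

(** Smallness on one disc propagates in a fixed number of steps to the radius [Rad] of [osc], where
    it would contradict the oscillation. *)
Lemma nondegenerate D f s : tame D f -> 0 < s -> exists eps, 0 < eps /\ forall p, ~ cball_small f p s eps.
Proof.
  intros [HD [Hm [Hv [Hu [Ho HL]]]]] Hs. destruct (uc_near f Hu) as [d0 [Hd0 Hn0]]. destruct Ho as [Rad [e0 [HR [He0 Hosc]]]].
  set (d := Rmin d0 s). assert (Hd : 0 < d) by (apply Rmin_pos; auto). assert (L1 := Rmin_l d0 s). assert (L2 := Rmin_r d0 s). fold d in L1, L2.
  assert (Hn := near_small_le f d0 d L1 Hn0). destruct (INR_unbounded (Rad * 8 / d)) as [n Hnn].
  destruct (propagate f d n Hm Hd Hn (e0 / 8)) as [eps [E1 E2]]; [lra|]. exists eps. split; auto. intros p Hp.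
  specialize (E2 p s ltac:(lra) Hp). destruct (Hosc p) as [z [z' [Z1 [Z2 Z3]]]].
  assert (HRn : Rad < s + INR n * (d / 8)).
  { apply Rmult_lt_compat_r with (r := d / 8) in Hnn; [|lra]. replace (Rad * 8 / d * (d / 8)) with Rad in Hnn by (field; lra). lra. }
  assert (S1 := E2 z ltac:(lra)). assert (S2 := E2 z' ltac:(lra)). apply rho_small in S1, S2; try lra.
  pose proof (rho_tri (f z) (Some (RtoC 0)) (f z')). rewrite (rho_sym (Some (RtoC 0)) (f z')) in H. lra.
Qed.

(* The Cayley transform of the left half-plane centred at L z, combined with Schwarz's lemma. *)
Lemma half_plane_harnack (L : C -> C) (z : C) (r : R) : 0 < r -> (forall w, Cmod (w - z) < r -> Cdiff L w /\ fst (L w) <= 0) -> fst (L z) < 0 ->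
  forall w, Cmod (w - z) <= r / 4 -> fst (L w) <= fst (L z) / 3.
Proof.
  intros Hr HL Hz w Hw. set (x0 := L z) in *.
  set (phi := fun u => ((L u - x0) / (L u + Cconj x0))%C).
  assert (Hden : forall u, Cmod (u - z) < r -> (L u + Cconj x0)%C <> 0).
  { intros u Hu E. apply (f_equal fst) in E. simpl in E. pose proof (proj2 (HL u Hu)). lra. }
  assert (Hle : forall u, Cmod (u - z) < r -> Cmod (L u - x0) <= Cmod (L u + Cconj x0)).
  { intros u Hu. assert (A := proj2 (HL u Hu)). unfold Cmod. apply sqrt_le_1_alt. simpl. nra. }
  assert (Hs : Cmod (phi w) <= 1 / r * Cmod (w - z)).
  { apply (schwarz phi z r 1); [auto|lra| | | |].
    - intros u Hu. unfold phi. apply (Cdiff_div (fun u => L u - x0)%C (fun u => L u + Cconj x0)%C); [apply Hden, Hu| |].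
      + apply (Cdiff_minus L (fun _ => x0)); [apply HL, Hu|apply Cdiff_const].
      + apply (Cdiff_plus L (fun _ => Cconj x0)); [apply HL, Hu|apply Cdiff_const].
    - intros u Hu. unfold phi. rewrite Cmod_div by (apply Hden, Hu). apply Rcomplements.Rle_div_l; [apply Cmod_gt_0, Hden, Hu|]. rewrite Rmult_1_l. apply Hle, Hu.
    - unfold phi, x0. replace (L z - L z)%C with (RtoC 0) by ring. unfold Cdiv. ring.
    - lra. }
  assert (Hs2 : Cmod (phi w) <= 1/4).
  { eapply Rle_trans; [exact Hs|]. apply Rle_trans with (1 / r * (r / 4)); [|right; field; lra].
    apply Rmult_le_compat_l; [left; apply Rdiv_lt_0_compat; lra|auto]. }
  assert (Hwr : Cmod (w - z) < r) by lra.
  unfold phi in Hs2. rewrite Cmod_div in Hs2 by (apply Hden, Hwr). apply (proj1 (Rcomplements.Rle_div_l _ _ _ (proj1 (Cmod_gt_0 _) (Hden w Hwr)))) in Hs2.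
  assert (T : Cmod (L w + Cconj x0) <= Cmod (L w - x0) + 2 * - fst x0).
  { replace (L w + Cconj x0)%C with ((L w - x0) + RtoC (2 * fst x0))%C by (apply injective_projections; simpl; ring).
    eapply Rle_trans; [apply Cmod_triangle|]. rewrite Cmod_R, Rabs_left by lra. lra. }
  pose proof (fst_le_Cmod (L w - x0)%C). simpl in H. apply Rcomplements.Rabs_le_between in H. lra.
Qed.

Lemma lower_bound D f eta : tame D f -> 0 < eta -> exists kap, 0 < kap /\
  forall z, (forall a, D a <> 0%Z -> eta <= Cmod (a - z)) -> kap <= Cmod (fin (f z)).
Proof.
  intros HT He. assert (HT' := HT). destruct HT' as [HD [Hm [Hv [Hu [Ho HL]]]]]. destruct (uc_near f Hu) as [d [Hd Hn]].
  set (r := Rmin eta d). assert (Hr : 0 < r) by (apply Rmin_pos; auto). assert (L1 := Rmin_l eta d). assert (L2 := Rmin_r eta d). fold r in L1, L2. clearbody r.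
  destruct (nondegenerate D f (r / 8) HT) as [e [E1 E2]]; [lra|].
  (* This is the cube of [e]: if [|f z| < e^3], the Harnack bound [fst (L w) <= fst (L z) / 3] makes
     [|f| < e] on a disc of radius [r/8], against [nondegenerate]. The bound 1/4 is what
     [near_small] starts from. *)
  exists (Rmin (1/4) (exp (3 * ln e))). split; [apply Rmin_pos; [lra|apply exp_pos]|].
  intros z Hsep. apply Rnot_lt_le. intros Hlt. assert (S1 := Rlt_le_trans _ _ _ Hlt (Rmin_l _ _)). assert (S2 := Rlt_le_trans _ _ _ Hlt (Rmin_r _ _)).
  assert (Hv0 : forall w, Cmod (w - z) < r -> exists y, y <> RtoC 0 /\ f w = Some y).
  { intros w Hw. apply Hv. destruct (Z.eq_dec (D w) 0); auto. specialize (Hsep w n). lra. }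
  assert (Hz0 : Cmod (z - z) = 0) by apply Cmod_sub_self.
  assert (Hsm : forall w, Cmod (w - z) < r -> small 1 (f w)).
  { intros w Hw. apply (Hn z); [lra|]. destruct (Hv0 z) as [y [_ Hy]]; [lra|]. rewrite Hy in *. simpl in *. lra. }
  destruct (holo_log (fun w => fin (f w)) z (r / 2)) as [L HLg]; [lra| |].
  { intros w Hw. destruct (Hv0 w) as [y [Y1 Y2]]; [lra|]. split; [apply mero_fin_diff; auto; rewrite Y2; discriminate|rewrite Y2; exact Y1]. }
  assert (HM : forall w, Cmod (w - z) < r / 2 -> Cmod (fin (f w)) = exp (fst (L w))).
  { intros w Hw. destruct (HLg w Hw) as [_ E]. rewrite <- E. apply Cmod_cexp. }
  assert (Hneg : forall w, Cmod (w - z) < r / 2 -> fst (L w) <= 0).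
  { intros w Hw. apply Rnot_lt_le. intros Q. specialize (Hsm w ltac:(lra)). apply small_Some in Hsm. destruct Hsm as [_ Hsm]. rewrite (HM w Hw) in Hsm.
    apply exp_increasing in Q. rewrite exp_0 in Q. lra. }
  assert (Hz : fst (L z) < 0).
  { destruct (Hneg z) as [Q|Q]; [lra|auto|]. rewrite (HM z), Q, exp_0 in S1 by lra. lra. }
  assert (HH := half_plane_harnack L z (r / 2) ltac:(lra) (fun w Hw => conj (proj1 (HLg w Hw)) (Hneg w Hw)) Hz).
  apply (E2 z). intros w Hw. specialize (HH w ltac:(lra)). destruct (Hv0 w) as [y [Y1 Y2]]; [lra|].
  assert (HMw := HM w ltac:(lra)). rewrite Y2 in *. simpl in *. rewrite HMw. rewrite (HM z) in S2 by lra. apply exp_lt_inv in S2.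
  rewrite <- (exp_ln e) by auto. apply exp_le_mono. lra.
Qed.

Lemma two_sided D f eta : tame D f -> 0 < eta -> exists B, 0 <= B /\
  forall z, (forall a, D a <> 0%Z -> eta <= Cmod (a - z)) -> exists y, f z = Some y /\ y <> RtoC 0 /\ Rabs (ln (Cmod y)) <= B.
Proof.
  intros HT He. destruct (lower_bound D f eta HT He) as [k1 [K1 H1]]. destruct (lower_bound _ _ eta (tame_neg D f HT) He) as [k2 [K2 H2]].
  exists (Rmax 0 (Rmax (- ln k1) (- ln k2))). split; [apply Rmax_l|]. intros z Hz.
  assert (Dz : D z = 0%Z). { destruct (Z.eq_dec (D z) 0); auto. specialize (Hz z n). rewrite Cmod_sub_self in Hz. lra. }
  destruct HT as [_ [_ [Hv _]]]. destruct (proj2 (proj2 (Hv z)) Dz) as [y [Y1 Y2]]. exists y. split; auto. split; auto.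
  specialize (H1 z Hz). specialize (H2 z). rewrite Y2 in H1, H2. simpl in H1, H2. destruct (Ceq_dec y 0); [contradiction|]. simpl in H2.
  rewrite Cmod_inv in H2 by auto.
  assert (P := proj1 (Cmod_gt_0 y) Y1). assert (H3 : k2 <= / Cmod y) by (apply H2; intros a Ha; apply Hz; unfold negD in Ha; lia).
  assert (A := Rcomplements.ln_le _ _ K1 H1). assert (B := Rcomplements.ln_le _ _ K2 H3). rewrite ln_Rinv in B by auto.
  eapply Rle_trans; [|apply Rmax_r]. apply Rcomplements.Rabs_le_between. 
  assert (M1 := Rmax_l (- ln k1) (- ln k2)). assert (M2 := Rmax_r (- ln k1) (- ln k2)). lra.
Qed.

Lemma rprod_diff_nonneg (D : C -> Z) l (z : C) : (forall a, In a l -> (0 <= D a)%Z \/ a <> z) -> Cdiff (rprod D l) z.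
Proof.
  intros H. apply (Cdiff_cprod l (fun a w => czp (w - a) (D a))). intros a Ha. apply (Cdiff_czp (fun w => w - a)%C); [apply Cdiff_sub_const|].
  destruct (H a Ha) as [Q|Q]; auto. right. intros E. apply Q. symmetry. apply Csub_0_eq, E.
Qed.

Lemma rprod_zero (D : C -> Z) l (z : C) : In z l -> (D z > 0)%Z -> rprod D l z = RtoC 0.
Proof. intros H Hz. apply (cprod_zero _ _ z H). replace (z - z)%C with (RtoC 0) by ring. apply czp_zero. lia. Qed.

Lemma rprod_split (D : C -> Z) (P : C -> Prop) l (z : C) : rprod D l z = (rprod D (fil P l) z * rprod D (fil (fun a => ~ P a) l) z)%C.
Proof. unfold rprod. rewrite <- cprod_app. apply cprod_perm, fil_perm. Qed.

Lemma rprod_lower (D : C -> Z) l (z : C) t : 0 < t -> (forall a, In a l -> (0 <= D a)%Z /\ t <= Cmod (z - a)) ->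
  exp (rsum l (absD D) * ln t) <= Cmod (rprod D l z).
Proof.
  intros Ht H. assert (Hz : ~ In z l) by (intros E; apply H in E; rewrite Cmod_sub_self in E; lra).
  rewrite <- (exp_ln (Cmod (rprod D l z))) by (apply Cmod_gt_0, rprod_neq0, Hz). apply exp_le_mono. rewrite ln_rprod by auto.
  rewrite Rmult_comm, <- rsum_scal. apply rsum_le. intros a Ha. destruct (H a Ha) as [A B]. unfold absD. apply IZR_le in A.
  rewrite Rabs_pos_eq by auto. rewrite Rmult_comm. apply Rmult_le_compat_l; auto. apply Rcomplements.ln_le; auto.
Qed.

Lemma rprod_upper (D : C -> Z) l (z : C) t : ~ In z l -> (forall a, In a l -> (0 <= D a)%Z /\ Cmod (z - a) <= t) ->
  Cmod (rprod D l z) <= exp (rsum l (absD D) * ln t).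
Proof.
  intros Hz H. rewrite <- (exp_ln (Cmod (rprod D l z))) by (apply Cmod_gt_0, rprod_neq0, Hz). apply exp_le_mono. rewrite ln_rprod by auto.
  rewrite Rmult_comm, <- rsum_scal. apply rsum_le. intros a Ha. destruct (H a Ha) as [A B]. unfold absD. apply IZR_le in A.
  rewrite Rabs_pos_eq by auto. rewrite (Rmult_comm (ln t)). apply Rmult_le_compat_l; auto. apply Rcomplements.ln_le; auto.
  apply Cmod_sub_pos. intros E. apply Hz. subst. auto.
Qed.

(* Many zeros near a point a force f to be tiny around a: divide them out and use the maximum principle. *)
Lemma zeros_bound D f : tame D f -> exists s N, 0 < s /\ 0 <= N /\
  forall a l, NoDup l -> (forall x, In x l -> (D x > 0)%Z /\ Cmod (x - a) < s) -> (D a > 0)%Z -> rsum l (absD D) <= N.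
Proof.
  intros HT. assert (HT' := HT). destruct HT' as [HD [Hm [Hv [Hu [Ho HL]]]]]. destruct (uc_near f Hu) as [d [Hd Hn]].
  destruct (nondegenerate D f (d / 16) HT) as [e [E1 E2]]; [lra|].
  (* With [n] zeros within [d/16] of [a] divided out, passing from the circle of radius [d/2] to the
     disc of radius [d/16] gains a factor of at least [(d/4)/(d/8) = 2] per zero; [2^(-n) < e] then
     contradicts [nondegenerate]. *)
  exists (d / 16), (Rmax 0 (- ln e / ln 2)). split; [lra|]. split; [apply Rmax_l|]. intros a l Hl Hla Da.
  assert (Hln2 : 0 < ln 2) by (rewrite <- ln_1; apply ln_increasing; lra).
  apply Rnot_lt_le. intros Hbig. assert (Hbig2 := Rle_lt_trans _ _ _ (Rmax_r _ _) Hbig).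
  set (n := rsum l (absD D)) in *. assert (Hne : - ln e < n * ln 2) by (apply Rcomplements.Rlt_div_l in Hbig2; auto).
  assert (Hsm : forall w, Cmod (w - a) < d -> small 1 (f w)).
  { intros w Hw. apply (Hn a); auto. rewrite (proj1 (Hv a)) by auto. simpl. rewrite Cmod_0. lra. }
  assert (Hpos : forall w, Cmod (w - a) < d -> (0 <= D w)%Z).
  { intros w Hw. destruct (Z_lt_le_dec (D w) 0); auto. specialize (Hsm w Hw). rewrite (proj1 (proj2 (Hv w))) in Hsm by auto. destruct Hsm. }
  destruct (HL a d) as [l0 [h [Sl [Hh Hf]]]].
  set (l1 := fil (fun x => In x l) l0). set (l2 := fil (fun x => ~ In x l) l0).
  assert (Hl1 : Permutation l l1).
  { apply NoDup_same_perm; auto; [apply fil_NoDup, Sl|]. intros x. unfold l1. rewrite fil_In. split; [|tauto].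
    intros Hx. split; auto. apply Sl. destruct (Hla x Hx). split; [lia|lra]. }
  assert (Hn1 : rsum l1 (absD D) = n) by (unfold n; symmetry; apply rsum_perm, Hl1).
  assert (Hl1p : forall x, In x l1 -> (D x > 0)%Z /\ Cmod (x - a) < d / 16) by (intros x Hx; apply Hla, (Permutation_in x (Permutation_sym Hl1) Hx)).
  set (h2 := fun w => (h w * rprod D l2 w)%C).
  assert (Hfw : forall w, Cmod (w - a) < d -> D w = 0%Z -> f w = Some (h2 w * rprod D l1 w)%C).
  { intros w Hw Dw. rewrite (proj1 (Hf w Hw) Dw). rewrite (rprod_split D (fun x => In x l) l0). fold l1 l2. unfold h2. apply f_equal with (f := @Some C). ring. }
  assert (Hd2 : forall w, Cmod (w - a) < d -> Cdiff h2 w).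
  { intros w Hw. apply (Cdiff_mult h (rprod D l2)); [apply Hh, Hw|]. apply rprod_diff_nonneg. intros x Hx. left. apply Hpos.
    unfold l2 in Hx. rewrite fil_In in Hx. apply Sl, Hx. }
  assert (Hb : forall w, Cmod (w - a) = d / 2 -> Cmod (h2 w) <= exp (- (n * ln (d / 4)))).
  { intros w Hw. destruct (Z.eq_dec (D w) 0) as [Dw|Dw].
    - specialize (Hsm w ltac:(lra)). rewrite Hfw in Hsm by (auto; lra). simpl in Hsm. rewrite Cmod_mult in Hsm.
      assert (LB := rprod_lower D l1 w (d / 4) ltac:(lra)). rewrite Hn1 in LB.
      assert (exp (n * ln (d / 4)) <= Cmod (rprod D l1 w)).
      { apply LB. intros x Hx. destruct (Hl1p x Hx) as [X1 X2]. split; [lia|]. pose proof (Cmod_tri w x a). lra. }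
      rewrite exp_Ropp. assert (P := exp_pos (n * ln (d / 4))). rewrite <- (Rmult_1_l (/ _)). apply Rcomplements.Rle_div_r; auto.
      pose proof (Cmod_ge_0 (h2 w)). nra.
    - assert (In w l2).
      { unfold l2. rewrite fil_In. split; [apply Sl; split; auto; lra|]. intros Q. destruct (Hla w Q). lra. }
      unfold h2. rewrite rprod_zero; auto; [|specialize (Hpos w ltac:(lra)); lia]. rewrite Cmult_0_r, Cmod_0. left. apply exp_pos. }
  assert (MP : forall w, Cmod (w - a) <= d / 2 -> Cmod (h2 w) <= exp (- (n * ln (d / 4)))).
  { intros w Hw. apply (max_principle h2 a (-1) (d / 2)); try lra.
    - left. apply exp_pos.
    - intros u Hu'. apply Cdiff_Ccont, Hd2. lra.
    - intros u Hu'. exists (d / 2). split; [lra|]. intros v Hv'. apply Hd2. pose proof (Cmod_tri v u a). lra.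
    - intros u [Hu'|Hu']; [pose proof (Cmod_ge_0 (u - a)); lra|]. auto.
    - pose proof (Cmod_ge_0 (w - a)). lra. }
  apply (E2 a). intros w Hw. destruct (Z.eq_dec (D w) 0) as [Dw|Dw].
  - rewrite Hfw by (auto; lra). simpl. rewrite Cmod_mult.
    assert (UB := rprod_upper D l1 w (d / 8)). rewrite Hn1 in UB.
    assert (Cmod (rprod D l1 w) <= exp (n * ln (d / 8))).
    { apply UB. - intros Hin. apply Hl1p in Hin. lia. - intros x Hx. destruct (Hl1p x Hx) as [X1 X2]. split; [lia|].
      pose proof (Cmod_tri w a x). rewrite (Cmod_sub_sym a x) in H. lra. }
    apply Rle_trans with (exp (- (n * ln (d / 4))) * exp (n * ln (d / 8))).
    { apply Rmult_le_compat; auto using Cmod_ge_0. apply MP. lra. }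
    rewrite <- exp_plus, <- (exp_ln e) by auto. apply exp_le_mono.
    replace (d / 4) with (d / 8 * 2) by field. rewrite ln_mult by lra. nra.
  - rewrite (proj1 (Hv w)); [simpl; rewrite Cmod_0; lra|]. specialize (Hpos w ltac:(lra)). lia.
Qed.

(** In a disc of radius [s/4] all points are within [s] of any one of them, so [zeros_bound] at one
    zero counts all zeros and, for [1/f], at one pole all poles; [count_bound_scale] then changes
    the radius. *)
Lemma tame_count D f : tame D f -> forall R0, 0 <= R0 -> exists K, count_bound D R0 K.
Proof.
  intros HT R0 HR. destruct (zeros_bound D f HT) as [s1 [N1 [S1 [P1 H1]]]]. destruct (zeros_bound _ _ (tame_neg D f HT)) as [s2 [N2 [S2 [P2 H2]]]].
  set (s := Rmin s1 s2). assert (Hs : 0 < s) by (apply Rmin_pos; auto). assert (L1 := Rmin_l s1 s2). assert (L2 := Rmin_r s1 s2). fold s in L1, L2. clearbody s.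
  apply (count_bound_scale D (s / 4) (N1 + N2) R0); auto; [lra|]. split; [lra|]. intros c l Hl Hc.
  rewrite (rsum_split (fun x => (D x > 0)%Z)). apply Rplus_le_compat.
  - destruct (fil (fun x => (D x > 0)%Z) l) as [|a l'] eqn:El; [exact P1|]. rewrite <- El.
    assert (Ha : In a (fil (fun x => (D x > 0)%Z) l)) by (rewrite El; left; auto). rewrite fil_In in Ha. destruct Ha as [A1 A2].
    apply (H1 a); auto; [apply fil_NoDup, Hl|]. intros x Hx. rewrite fil_In in Hx. destruct Hx as [X1 X2]. split; auto.
    pose proof (Cmod_tri x c a). rewrite (Cmod_sub_sym c a) in H. specialize (Hc x X1) as Q1. specialize (Hc a A1). lra.
  - rewrite (rsum_split (fun x => (D x < 0)%Z)). set (l' := fil (fun x => ~ (D x > 0)%Z) l).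
    rewrite (rsum_0 (fil (fun a => ~ (D a < 0)%Z) l')).
    2:{ intros x Hx. rewrite fil_In in Hx. unfold l' in Hx. rewrite fil_In in Hx. unfold absD. replace (D x) with 0%Z by lia. apply Rabs_R0. }
    rewrite Rplus_0_r. assert (Hl' : NoDup l') by (apply fil_NoDup, Hl).
    assert (Hc' : forall x, In x l' -> Cmod (x - c) <= s / 4) by (intros x Hx; apply Hc; unfold l' in Hx; rewrite fil_In in Hx; tauto). clearbody l'.
    destruct (fil (fun x => (D x < 0)%Z) l') as [|a l''] eqn:El; [exact P2|]. rewrite <- El.
    assert (Ha : In a (fil (fun x => (D x < 0)%Z) l')) by (rewrite El; left; auto). rewrite fil_In in Ha. destruct Ha as [A1 A2].
    rewrite (rsum_ext _ (absD D) (absD (negD D))) by (intros; symmetry; apply absD_neg).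
    apply (H2 a); [apply fil_NoDup, Hl'| |unfold negD; lia]. intros x Hx. rewrite fil_In in Hx. destruct Hx as [X1 X2]. split; [unfold negD; lia|].
    pose proof (Cmod_tri x c a). rewrite (Cmod_sub_sym c a) in H. specialize (Hc' x X1) as Q1. specialize (Hc' a A1). lra.
Qed.

(** Each point to avoid costs a factor 3: the outer third of the interval on the side away from [x]
    has distance at least a sixth of the length from [x]. *)
Lemma avoid_list (l : list R) (al be : R) : al < be -> exists rho, al <= rho <= be /\ forall x, In x l -> (be - al) / (6 * 3 ^ length l) <= Rabs (x - rho).
Proof.
  revert al be. induction l as [|x l IH]; intros al be H.
  - exists al. split; [lra|]. intros x [].
  - assert (P : 1 <= 3 ^ length l) by (apply pow_R1_Rle; lra). simpl length. simpl pow.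
    assert (Q : forall t, 0 <= t -> t / (6 * (3 * 3 ^ length l)) = t / 3 / (6 * 3 ^ length l)) by (intros; field; lra).
    rewrite Q by lra. assert (B : (be - al) / 3 / (6 * 3 ^ length l) <= (be - al) / 6).
    { apply Rcomplements.Rle_div_l; [lra|]. nra. }
    destruct (Rle_lt_dec x ((al + be) / 2)).
    + destruct (IH (be - (be - al) / 3) be) as [rho [R1 R2]]; [lra|]. exists rho. split; [lra|].
      intros y [E|Hy]; [subst; rewrite Rabs_left1; lra|]. replace ((be - al) / 3) with (be - (be - (be - al) / 3)) by ring. apply R2, Hy.
    + destruct (IH al (al + (be - al) / 3)) as [rho [R1 R2]]; [lra|]. exists rho. split; [lra|].
      intros y [E|Hy]; [subst; rewrite Rabs_pos_eq; lra|]. replace ((be - al) / 3) with (al + (be - al) / 3 - al) by ring. apply R2, Hy.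
Qed.

Lemma length_count D l : (forall a, In a l -> D a <> 0%Z) -> INR (length l) <= rsum l (absD D).
Proof.
  induction l as [|a l IH]; intros H; [simpl; unfold rsum; simpl; lra|].
  rewrite rsum_cons. simpl length. rewrite S_INR. assert (1 <= absD D a) by (apply absD_ge1, H; left; auto).
  assert (INR (length l) <= rsum l (absD D)) by (apply IH; intros; apply H; right; auto). lra.
Qed.

Lemma rsum_ln_bound (D : C -> Z) (l : list C) (F : C -> R) (B : R) : 0 <= B -> (forall a, In a l -> Rabs (F a) <= B) ->
  Rabs (rsum l (fun a => IZR (D a) * F a)) <= rsum l (absD D) * B.
Proof.
  intros HB H. eapply Rle_trans; [apply rsum_Rabs|]. rewrite Rmult_comm, <- rsum_scal. apply rsum_le. intros a Ha.
  rewrite Rabs_mult. unfold absD. rewrite Rmult_comm. apply Rmult_le_compat_r; [apply Rabs_pos|auto].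
Qed.

Lemma disc_max (g : C -> C) (c : C) (r r' M : R) : 0 < r < r' -> 0 <= M -> (forall w, Cmod (w - c) < r' -> Cdiff g w) ->
  (forall w, Cmod (w - c) = r -> Cmod (g w) <= M) -> Cmod (g c) <= M.
Proof.
  intros Hr HM Hd Hb. apply (max_principle g c (-1) r); try lra.
  - intros u Hu. apply Cdiff_Ccont, Hd. lra.
  - intros u Hu. exists (r' - r). split; [lra|]. intros v Hv. apply Hd. pose proof (Cmod_tri v u c). lra.
  - intros u [Hu|Hu]; [pose proof (Cmod_ge_0 (u - c)); lra|auto].
  - rewrite Cmod_sub_self. lra.
Qed.

(** Around [z] there is a circle of radius between 1 and 2 that stays at distance [eta] from the
    divisor, where [two_sided] bounds [ln|f|]. Dividing out the points inside leaves a zero-free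
    [h2]; the maximum principle for [h2] and its reciprocal carries the bound to the centre. *)
Lemma tame_kbound D f : tame D f -> exists B, 0 <= B /\ kbound D f B.
Proof.
  intros HT. assert (HT' := HT). destruct HT' as [HD [Hm [Hv [Hu [Ho HL]]]]].
  destruct (tame_count D f HT 3) as [K HK]; [lra|]. assert (HK0 := proj1 HK).
  destruct (floor_exists K HK0) as [N [HN1 HN2]].
  (* At most [S N] distinct points of the divisor lie within 3 of any [z], so [avoid_list] yields
     this distance uniformly in [z]. *)
  set (eta := 1 / (6 * 3 ^ S N)). assert (P3 : 1 <= 3 ^ S N) by (apply pow_R1_Rle; lra).
  assert (Het : 0 < eta) by (unfold eta; apply Rdiv_lt_0_compat; lra).
  assert (Het1 : eta <= 1 / 6) by (unfold eta; apply Rmult_le_compat_l; [lra|]; apply Rinv_le_contravar; lra).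
  destruct (two_sided D f eta HT Het) as [B0 [HB0 HB]].
  assert (Hln2 : 0 < ln 2) by (rewrite <- ln_1; apply ln_increasing; lra).
  assert (Hlneta : 0 < - ln eta) by (assert (ln eta < ln 1) by (apply ln_increasing; lra); rewrite ln_1 in H; lra).
  exists (B0 + K * - ln eta + K * ln 2). split; [nra|]. intros z Dz. destruct (proj2 (proj2 (Hv z)) Dz) as [y [Y1 Y2]]. exists y. split; auto. split; auto.
  intros l Hl. destruct (HL z 3) as [l0 [h [Sl [Hh Hf]]]].
  assert (C0 : rsum l0 (absD D) <= K) by (apply (proj2 HK z); [apply Sl|]; intros a Ha; apply Sl in Ha; lra).
  assert (Hlen : (length l0 <= S N)%nat).
  { apply INR_le. rewrite S_INR. pose proof (length_count D l0 (fun a Ha => proj1 (proj1 (proj2 Sl a) Ha))). lra. }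
  destruct (avoid_list (map (fun a => Cmod (a - z)) l0) 1 2) as [rho [R1 R2]]; [lra|]. rewrite length_map in R2.
  assert (Hav : forall a, In a l0 -> eta <= Rabs (Cmod (a - z) - rho)).
  { intros a Ha. eapply Rle_trans; [|apply R2, (in_map (fun a => Cmod (a - z))), Ha]. unfold eta. replace (2 - 1) with 1 by ring.
    apply Rmult_le_compat_l; [lra|]. apply Rinv_le_contravar.
    - assert (0 < 3 ^ length l0) by (apply pow_lt; lra). lra.
    - apply Rmult_le_compat_l; [lra|]. apply Rle_pow; [lra|auto]. }
  clear R2. set (l1 := fil (fun a => Cmod (a - z) < rho) l0). set (l2 := fil (fun a => ~ Cmod (a - z) < rho) l0).
  assert (C1 : rsum l1 (absD D) <= K).
  { apply (proj2 HK z); [apply fil_NoDup, Sl|]. intros a Ha. unfold l1 in Ha. rewrite fil_In in Ha. lra. }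
  assert (Hl2 : forall w, Cmod (w - z) < rho + eta -> ~ In w l2).
  { intros w Hw Hi. unfold l2 in Hi. rewrite fil_In in Hi. destruct Hi as [I1 I2]. specialize (Hav w I1). rewrite Rabs_pos_eq in Hav by lra. lra. }
  set (h2 := fun w => (h w * rprod D l2 w)%C).
  assert (Hd2 : forall w, Cmod (w - z) < rho + eta -> Cdiff h2 w /\ h2 w <> 0).
  { intros w Hw. split.
    - apply (Cdiff_mult h (rprod D l2)); [apply Hh; lra|]. apply rprod_diff, Hl2, Hw.
    - apply Cmult_neq_0; [apply Hh; lra|apply rprod_neq0, Hl2, Hw]. }
  assert (Hfw : forall w, Cmod (w - z) < rho + eta -> D w = 0%Z -> f w = Some (h2 w * rprod D l1 w)%C).
  { intros w Hw Dw. rewrite (proj1 (Hf w ltac:(lra)) Dw). rewrite (rprod_split D (fun a => Cmod (a - z) < rho) l0). fold l1 l2. unfold h2. apply f_equal with (f := @Some C). ring. }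
  assert (Hlnf : forall w, Cmod (w - z) < rho + eta -> D w = 0%Z -> forall v, f w = Some v -> ln (Cmod v) = ln (Cmod (h2 w)) + rsum l1 (fun a => IZR (D a) * ln (Cmod (w - a)))).
  { intros w Hw Dw v Hfv. rewrite (Hfw w Hw Dw) in Hfv. injection Hfv as Hfv. rewrite <- Hfv.
    assert (~ In w l1) by (unfold l1; rewrite fil_In; intros [Q _]; apply Sl in Q; tauto).
    rewrite Cmod_mult, ln_mult; [rewrite ln_rprod; auto| |]; apply Cmod_gt_0; [apply Hd2, Hw|apply rprod_neq0; auto]. }
  set (B1 := B0 + K * - ln eta).
  assert (Hcirc : forall w, Cmod (w - z) = rho -> Rabs (ln (Cmod (h2 w))) <= B1).
  { intros w Hw. assert (Hsep : forall a, D a <> 0%Z -> eta <= Cmod (a - w)).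
    { intros a Ha. pose proof (Cmod_tri a w z). pose proof (Cmod_tri w a z). rewrite (Cmod_sub_sym w a) in H0.
      destruct (Rlt_le_dec (Cmod (a - z)) 3).
      - assert (Hi : In a l0) by (apply Sl; auto). specialize (Hav a Hi). unfold Rabs in Hav. destruct (Rcase_abs _); lra.
      - lra. }
    assert (Dw : D w = 0%Z). { destruct (Z.eq_dec (D w) 0); auto. specialize (Hsep w n). rewrite Cmod_sub_self in Hsep. lra. }
    destruct (HB w Hsep) as [v [V1 [V2 V3]]]. assert (E := Hlnf w ltac:(lra) Dw v V1).
    assert (S : Rabs (rsum l1 (fun a => IZR (D a) * ln (Cmod (w - a)))) <= rsum l1 (absD D) * - ln eta).
    { apply rsum_ln_bound; [lra|]. intros a Ha. unfold l1 in Ha. rewrite fil_In in Ha. destruct Ha as [A1 A2]. apply Sl in A1.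
      specialize (Hsep a (proj1 A1)). rewrite Cmod_sub_sym in Hsep. assert (Cmod (w - a) <= / eta).
      { apply Rle_trans with 4; [pose proof (Cmod_tri w z a); rewrite (Cmod_sub_sym z a) in H; lra|].
        rewrite <- (Rinv_inv 4). apply Rinv_le_contravar; lra. }
      apply Rcomplements.Rabs_le_between. split.
      - rewrite Ropp_involutive. apply Rcomplements.ln_le; auto.
      - rewrite <- ln_Rinv by auto. apply Rcomplements.ln_le; lra. }
    assert (rsum l1 (absD D) * - ln eta <= K * - ln eta) by (apply Rmult_le_compat_r; lra).
    apply Rcomplements.Rabs_le_between in S, V3. unfold B1. apply Rcomplements.Rabs_le_between. lra. }
  assert (Hz : Cmod (z - z) < rho + eta) by (rewrite Cmod_sub_self; lra).
  assert (Hcen : Rabs (ln (Cmod (h2 z))) <= B1).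
  { apply Rcomplements.Rabs_le_between. assert (P := proj1 (Cmod_gt_0 _) (proj2 (Hd2 z Hz))). split.
    - assert (M := disc_max (fun w => / h2 w)%C z rho (rho + eta) (exp B1) ltac:(lra) (Rlt_le _ _ (exp_pos _))).
      assert (Cmod (/ h2 z) <= exp B1).
      { apply M.
        - intros w Hw. apply Cdiff_inv; apply Hd2, Hw.
        - intros w Hw. assert (Hw2 := Hd2 w ltac:(lra)). rewrite Cmod_inv by apply Hw2. assert (Pw := proj1 (Cmod_gt_0 _) (proj2 Hw2)).
          rewrite <- (exp_ln (/ Cmod (h2 w))) by (apply Rinv_0_lt_compat; auto). rewrite ln_Rinv by auto. apply exp_le_mono.
          specialize (Hcirc w Hw). apply Rcomplements.Rabs_le_between in Hcirc. lra. }
      rewrite Cmod_inv in H by apply (Hd2 z Hz). apply Rcomplements.ln_le in H; [|apply Rinv_0_lt_compat; auto].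
      rewrite ln_Rinv, ln_exp in H by auto. lra.
    - assert (M := disc_max h2 z rho (rho + eta) (exp B1) ltac:(lra) (Rlt_le _ _ (exp_pos _)) (fun w Hw => proj1 (Hd2 w Hw))).
      assert (Cmod (h2 z) <= exp B1).
      { apply M. intros w Hw. assert (Hw2 := Hd2 w ltac:(lra)). assert (Pw := proj1 (Cmod_gt_0 _) (proj2 Hw2)).
        rewrite <- (exp_ln (Cmod (h2 w))) by auto. apply exp_le_mono.
        specialize (Hcirc w Hw). apply Rcomplements.Rabs_le_between in Hcirc. lra. }
      apply Rcomplements.ln_le in H; auto. rewrite ln_exp in H. lra. }
  rewrite (Hlnf z Hz Dz y Y2).
  assert (E : rsum l (fun a => IZR (D a) * lg (Cmod (z - a))) = rsum l1 (fun a => IZR (D a) * lg (Cmod (z - a)))).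
  { apply (covers_rsum D (fun a => Cmod (a - z) < 1)); auto.
    - split; [apply fil_NoDup, Sl|]. intros a Ha1 Ha2. unfold l1. rewrite fil_In. split; [apply Sl; split; auto; lra|lra].
    - intros a [Ha|Ha]; [rewrite Ha; ring|]. rewrite lg_0; [ring|]. rewrite Cmod_sub_sym. lra. }
  rewrite E. 
  (* Replacing [ln|z-a|] by [lg|z-a|] costs at most [ln 2] per point, with multiplicity, because
     [|z-a| < rho <= 2] on [l1]. *)
  assert (S : Rabs (rsum l1 (fun a => IZR (D a) * ln (m1 (Cmod (z - a))))) <= rsum l1 (absD D) * ln 2).
  { apply rsum_ln_bound; [lra|]. intros a Ha. unfold l1 in Ha. rewrite fil_In in Ha. assert (Q := m1_ge (Cmod (z - a))).
    assert (m1 (Cmod (z - a)) <= 2) by (unfold m1; apply Rmax_lub; [lra|]; rewrite Cmod_sub_sym; lra).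
    assert (1 <= m1 (Cmod (z - a))) by (unfold m1; apply Rmax_l).
    rewrite Rabs_pos_eq; [apply Rcomplements.ln_le; lra|]. rewrite <- ln_1. apply Rcomplements.ln_le; lra. }
  assert (E2 : rsum l1 (fun a => IZR (D a) * ln (Cmod (z - a))) - rsum l1 (fun a => IZR (D a) * lg (Cmod (z - a))) = rsum l1 (fun a => IZR (D a) * ln (m1 (Cmod (z - a))))).
  { rewrite <- rsum_minus. apply rsum_ext. intros a _. unfold lg. ring. }
  assert (rsum l1 (absD D) * ln 2 <= K * ln 2) by (apply Rmult_le_compat_r; lra).
  replace (ln (Cmod (h2 z)) + _ - _) with (ln (Cmod (h2 z)) + rsum l1 (fun a => IZR (D a) * ln (m1 (Cmod (z - a))))) by lra.
  eapply Rle_trans; [apply Rabs_triang|]. fold B1. lra.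
Qed.

Lemma poles_dense D f : tame D f -> exists Rad, forall c, exists b, (D b < 0)%Z /\ Cmod (b - c) < Rad.
Proof.
  intros HT. destruct (tame_kbound D f HT) as [B [HB Hk]]. destruct (tame_count D f HT 1) as [K HK]; [lra|].
  destruct HT as [HD [Hm [Hv [Hu [[R0 [e0 [HR [He Ho]]]] HL]]]]].
  set (M := exp (B + K * - lg (1/2))). assert (HM : 0 < M) by apply exp_pos.
  (* If no pole is within [d + 1], then [|f| <= M] on the disc of radius [d] and [local_lip] gives
     the factor [4 M / d]; this [d] keeps the deviation from [f c] over the radius [R0] of [osc]
     below [e0 / 2]. *)
  set (d := R0 + 1 + 16 * M * R0 / e0). assert (Hx : 0 < 16 * M * R0 / e0) by (apply Rdiv_lt_0_compat; auto; nra).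
  exists (d + 1). intros c. apply NNPP. intros Hno.
  assert (Hb : forall w, Cmod (w - c) < d -> exists y, f w = Some y /\ Cmod y <= M).
  { intros w Hw. apply (local_bound D f B K (1/2) w HD Hv Hk HK ltac:(lra)); [|rewrite Cmod_sub_self; lra].
    intros a Ha. apply Rnot_lt_le. intros Q. apply Hno. exists a. split; auto. pose proof (Cmod_tri a w c). lra. }
  assert (Hl := local_lip f c d M Hm ltac:(unfold d; lra) Hb). destruct (Ho c) as [z [z' [Z1 [Z2 Z3]]]].
  assert (S : forall w, Cmod (w - c) <= R0 -> rhoS (f w) (f c) < e0 / 2).
  { intros w Hw. eapply Rle_lt_trans; [apply Hl; unfold d; lra|]. apply Rle_lt_trans with (4 * M / d * R0).
    - apply Rmult_le_compat_l; auto. apply Rdiv_le_0_compat; unfold d; lra.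
    - replace (4 * M / d * R0) with (4 * M * R0 / d) by (field; unfold d; lra). apply Rcomplements.Rlt_div_l; [unfold d; lra|].
      unfold d. replace (e0 / 2 * (R0 + 1 + 16 * M * R0 / e0)) with (e0 / 2 * (R0 + 1) + 8 * M * R0) by (field; lra). nra. }
  assert (S1 := S z Z1). assert (S2 := S z' Z2). pose proof (rho_tri (f z) (f c) (f z')). rewrite (rho_sym (f c) (f z')) in H. lra.
Qed.

Lemma tame_dense D f : tame D f -> exists Rad, forall c,
  (exists a, (D a > 0)%Z /\ Cmod (a - c) < Rad) /\ (exists b, (D b < 0)%Z /\ Cmod (b - c) < Rad).
Proof.
  intros HT. destruct (poles_dense D f HT) as [R1 H1]. destruct (poles_dense _ _ (tame_neg D f HT)) as [R2 H2].
  exists (Rmax R1 R2). intros c. split.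
  - destruct (H2 c) as [a [A1 A2]]. exists a. unfold negD in A1. split; [lia|]. pose proof (Rmax_r R1 R2). lra.
  - destruct (H1 c) as [a [A1 A2]]. exists a. split; [lia|]. pose proof (Rmax_l R1 R2). lra.
Qed.

(** * Circle means of ln|f| *)

Lemma ln_succ_le M : 0 < M -> ln (M + 1) - ln M <= / M.
Proof.
  intros H. replace (M + 1) with (M * (1 + / M)) by (field; lra). assert (P := Rinv_0_lt_compat M H).
  rewrite ln_mult by lra. assert (ln (1 + / M) <= / M); [|lra].
  rewrite <- (ln_exp (/ M)) at 2. apply Rcomplements.ln_le; [lra|]. apply exp_ineq1_le.
Qed.

Lemma ln_sub_cont (c a : C) (r : R) : 0 < r -> r <> Cmod (a - c) ->
  (forall y, continuous (fun y => ln (Cmod (c + RtoC r * cis y - a))) y) /\ ex_RInt (fun y => ln (Cmod (c + RtoC r * cis y - a))) 0 (2 * PI).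
Proof.
  intros Hr Hn. apply (ex_RInt_circle (fun z => ln (Cmod (z - a)))); [lra|]. intros z Hz.
  apply (Rcont_at_ln (fun z => z - a)%C); [apply Cdiff_Ccont, Cdiff_sub_const|]. intros E. apply Csub_0_eq in E. apply Hn. congruence.
Qed.

(** [- lg t] is [ln max(1,t) - ln t]. With [M = max(r,|a-c|)] the angular means of these are at most
    [ln (M + 1)] and exactly [ln M], and [ln (M + 1) - ln M <= 1/M <= 1/r]. The factor [1/r] offsets
    the O(r) points near the circle. *)
Lemma lg_circle (c a : C) (r : R) : 1 <= r -> r <> Cmod (a - c) ->
  ex_RInt (fun y => - lg (Cmod (c + RtoC r * cis y - a))) 0 (2 * PI) /\
  RInt (fun y => - lg (Cmod (c + RtoC r * cis y - a))) 0 (2 * PI) <= 2 * PI / r * indic (Rabs (Cmod (a - c) - r) < 1).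
Proof.
  intros Hr Hn. assert (HP := PI_RGT_0).
  assert (Hz : forall y, Cmod (c + RtoC r * cis y - c) = r) by (intros y; rewrite Cmod_sub_c, Cmod_Rcis; lra).
  destruct (Rlt_le_dec (Rabs (Cmod (a - c) - r)) 1) as [H|H].
  - rewrite indic_true, Rmult_1_r by auto. assert (Ha : 0 < Cmod (a - c)) by (apply Rabs_def2 in H; lra).
    destruct (ln_max1_circle c a r ltac:(lra) Ha) as [A1 A2]. destruct (ln_circle c a r ltac:(lra) Hn) as [B1 _].
    destruct (ln_sub_cont c a r ltac:(lra) Hn) as [_ B2].
    assert (E : forall y, ln (Rmax 1 (Cmod (c + RtoC r * cis y - a))) - ln (Cmod (c + RtoC r * cis y - a)) = - lg (Cmod (c + RtoC r * cis y - a))) by (intros; unfold lg, m1; ring).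
    split.
    + eapply ex_RInt_ext; [intros y _; apply E|]. apply (ex_RInt_minus (V := R_NormedModule)); auto.
    + erewrite RInt_ext; [|intros y _; symmetry; apply E]. rewrite RInt_Rminus by auto. rewrite B1.
      assert (HM : r <= Rmax r (Cmod (a - c))) by apply Rmax_l. set (M := Rmax r (Cmod (a - c))) in *.
      assert (L := ln_succ_le M ltac:(lra)). assert (/ M <= / r) by (apply Rinv_le_contravar; lra). unfold Rdiv. nra.
  - rewrite indic_false, Rmult_0_r by lra.
    assert (E : forall y, 0 = - lg (Cmod (c + RtoC r * cis y - a))).
    { intros y. rewrite lg_0; [ring|]. specialize (Hz y). set (w := (c + RtoC r * cis y)%C) in *. pose proof (Cmod_tri a w c). pose proof (Cmod_tri w a c).
      rewrite (Cmod_sub_sym a w) in H0. unfold Rabs in H. destruct (Rcase_abs _); lra. }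
    split.
    + eapply ex_RInt_ext; [intros y _; apply E|]. apply ex_RInt_const.
    + erewrite RInt_ext; [|intros y _; symmetry; apply E]. rewrite RInt_const. unfold scal; simpl; unfold mult; simpl. lra.
Qed.

Lemma RInt_rsum (l : list C) (k : C -> R) (F : C -> R -> R) (a b : R) : (forall x, In x l -> ex_RInt (F x) a b) ->
  ex_RInt (fun y => rsum l (fun x => k x * F x y)) a b /\ RInt (fun y => rsum l (fun x => k x * F x y)) a b = rsum l (fun x => k x * RInt (F x) a b).
Proof.
  induction l as [|x l IH]; intros H.
  - unfold rsum; simpl. split; [apply ex_RInt_const|]. rewrite RInt_const. unfold scal; simpl; unfold mult; simpl. ring.
  - destruct IH as [I1 I2]; [intros; apply H; right; auto|]. assert (Hx := H x (or_introl eq_refl)).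
    assert (E : forall y, k x * F x y + rsum l (fun x => k x * F x y) = rsum (x :: l) (fun x => k x * F x y)) by (intros; rewrite rsum_cons; auto).
    split.
    + eapply ex_RInt_ext; [intros y _; apply E|]. apply ex_RInt_Rplus; auto. apply ex_RInt_Rscal, Hx.
    + erewrite RInt_ext; [|intros y _; symmetry; apply E]. assert (Hx' := ex_RInt_Rscal (k x) _ _ _ Hx). rewrite RInt_Rplus, RInt_Rscal, I2, rsum_cons by auto. reflexivity.
Qed.

Lemma CI_csum (l : list C) (k : C -> C) (F : C -> R -> C) (a b : R) : a <= b -> (forall x, In x l -> cont_on (F x) a b) ->
  cont_on (fun y => csum l (fun x => k x * F x y)%C) a b /\ CI (fun y => csum l (fun x => k x * F x y)%C) a b = csum l (fun x => k x * CI (F x) a b)%C.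
Proof.
  intros Hab. induction l as [|x l IH]; intros H.
  - split; [intros t Ht; apply (Rcont_const 0)|]. unfold csum; simpl. rewrite (CI_const (RtoC 0)). ring.
  - destruct IH as [I1 I2]; [intros; apply H; right; auto|]. assert (Hx := H x (or_introl eq_refl)).
    assert (Hx' : cont_on (fun y => k x * F x y)%C a b) by (intros t Ht; apply (Rcont_mult (fun _ => k x)); [apply Rcont_const|apply Hx, Ht]).
    split.
    + intros t Ht. apply (Rcont_plus (fun y => k x * F x y)%C (fun y => csum l (fun x => k x * F x y)%C)); [apply Hx', Ht|apply I1, Ht].
    + rewrite csum_cons, <- I2, <- CI_scal by auto. rewrite <- CI_plus by auto. reflexivity.
Qed.

Lemma RInt_dom (F G : R -> R) (a b : R) : a <= b -> ex_RInt F a b -> ex_RInt G a b -> (forall y, a <= y <= b -> Rabs (F y) <= G y) ->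
  Rabs (RInt F a b) <= RInt G a b.
Proof.
  intros Hab HF HG H. apply Rcomplements.Rabs_le_between. split.
  - assert (RInt (fun y => (-1) * G y) a b <= RInt F a b).
    { apply RInt_le; auto; [apply ex_RInt_Rscal, HG|]. intros y Hy. specialize (H y ltac:(lra)). apply Rcomplements.Rabs_le_between in H. lra. }
    rewrite RInt_Rscal in H0 by auto. lra.
  - apply RInt_le; auto. intros y Hy. specialize (H y ltac:(lra)). apply Rcomplements.Rabs_le_between in H. lra.
Qed.

Lemma CI_dom (F : R -> C) (G : R -> R) (a b : R) : a <= b -> cont_on F a b -> ex_RInt G a b -> (forall y, a <= y <= b -> Cmod (F y) <= G y) ->
  Cmod (CI F a b) <= 2 * RInt G a b.
Proof.
  intros Hab HF HG H. destruct (cont_on_ex F a b Hab HF) as [E1 E2]. eapply Rle_trans; [apply Cmod_le_sum|]. unfold CI; simpl.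
  assert (A := RInt_dom _ G a b Hab E1 HG (fun y Hy => Rle_trans _ _ _ (fst_le_Cmod (F y)) (H y Hy))).
  assert (B := RInt_dom _ G a b Hab E2 HG (fun y Hy => Rle_trans _ _ _ (snd_le_Cmod (F y)) (H y Hy))). lra.
Qed.

Lemma Rcont_conj_cis y : Rcont (fun y => Cconj (cis y)) y.
Proof.
  apply (Rcont_curve Cconj cis y); [apply Rcont_cis|]. intros eps He. exists eps. split; auto. intros w Hw.
  replace (Cconj w - Cconj (cis y))%C with (Cconj (w - cis y)) by (apply injective_projections; simpl; ring).
  unfold Cmod, Cconj in *; simpl in *. match goal with |- ?a < _ => match type of Hw with ?b < _ => replace a with b; auto end end.
  f_equal. ring.
Qed.

(** On the circle [u = ln|f|] is dominated by [g], which is [B] plus the local logarithms;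
    [lg_circle] and the number of points near the circle bound the mean of [g]. The zeroth and first
    Fourier coefficients of [u] are computed from [log_moment] for [h] and [ln_circle] for each
    linear factor. *)
Lemma circle_bounds (D : C -> Z) (f : C -> sphere) (B K : R) (c : C) (R0 r : R) (l : list C) (h : C -> C) (h1 : C) :
  kbound D f B -> 0 <= B -> count_bound D 1 K -> LF D f c R0 l h -> Cder h c h1 -> 1 <= r -> r + 1 <= R0 -> (forall a, In a l -> r <> Cmod (a - c)) ->
  Rabs (ln (Cmod (h c)) + rsum l (fun a => IZR (D a) * ln (Rmax r (Cmod (a - c))))) <= B + 420 * K /\
  Cmod (RtoC r * (h1 / h c - csum l (fun a => RtoC (IZR (D a) / Rmax r (Cmod (a - c)) ^ 2) * Cconj (a - c))))%C <= 4 * (B + 420 * K).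
Proof.
  intros Hk HB HC [Sl [Hh Hf]] Hh1 Hr HR Hn. assert (HP := PI_RGT_0). assert (HK := proj1 HC).
  assert (Hw : forall y, Cmod (c + RtoC r * cis y - c) = r) by (intros y; rewrite Cmod_sub_c, Cmod_Rcis; lra).
  assert (Hwl : forall y, ~ In (c + RtoC r * cis y)%C l) by (intros y Hi; apply (Hn _ Hi); rewrite Hw; auto).
  set (lh := fun y => ln (Cmod (h (c + RtoC r * cis y)%C))).
  set (la := fun a y => ln (Cmod (c + RtoC r * cis y - a))).
  set (nl := fun a y => - lg (Cmod (c + RtoC r * cis y - a))).
  set (u := fun y => lh y + rsum l (fun a => IZR (D a) * la a y)).
  set (g := fun y => B + rsum l (fun a => absD D a * nl a y)).
  assert (Hlh : (forall y, continuous lh y) /\ ex_RInt lh 0 (2 * PI)).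
  { apply (ex_RInt_circle (fun z => ln (Cmod (h z)))); [lra|]. intros z Hz. apply Rcont_at_ln; [apply Cdiff_Ccont, Hh; lra|apply Hh; lra]. }
  assert (Hla : forall a, In a l -> (forall y, continuous (la a) y) /\ ex_RInt (la a) 0 (2 * PI)).
  { intros a Ha. apply ln_sub_cont; [lra|apply Hn, Ha]. }
  destruct (RInt_rsum l (fun a => IZR (D a)) la 0 (2 * PI)) as [Q1 Q2]; [intros a Ha; apply Hla, Ha|].
  destruct (RInt_rsum l (absD D) nl 0 (2 * PI)) as [N1 N2]; [intros a Ha; apply lg_circle; auto|].
  assert (Hg : ex_RInt g 0 (2 * PI)) by (apply ex_RInt_Rplus; auto; apply ex_RInt_const).
  assert (Hu : ex_RInt u 0 (2 * PI)) by (apply ex_RInt_Rplus; [apply Hlh|exact Q1]).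
  assert (Hg2 : RInt g 0 (2 * PI) <= 2 * PI * (B + 420 * K)).
  { unfold g. rewrite RInt_Rplus by (auto; apply ex_RInt_const). rewrite RInt_const. unfold scal; simpl; unfold mult; simpl. rewrite N2.
    assert (S : rsum l (fun a => absD D a * RInt (nl a) 0 (2 * PI)) <= 2 * PI / r * rsum (fil (fun a => Rabs (Cmod (a - c) - r) < 1) l) (absD D)).
    { rewrite rsum_fil, <- rsum_scal. apply rsum_le. intros a Ha. assert (L := proj2 (lg_circle c a r Hr (Hn a Ha))). fold (nl a) in L.
      assert (P := absD_pos D a). apply Rmult_le_compat_l with (r := absD D a) in L; auto. fold (nl a) in *.
      replace (2 * PI / r * (indic (Rabs (Cmod (a - c) - r) < 1) * absD D a)) with (absD D a * (2 * PI / r * indic (Rabs (Cmod (a - c) - r) < 1))) by ring. exact L. }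
    (* Four annuli of width 1/2 starting at [r - 1] give [5 * 28 K (r + 2)], at most [420 K r] for
       [r >= 1]. *)
    assert (A : rsum (fil (fun a => Rabs (Cmod (a - c) - r) < 1) l) (absD D) <= (INR 4 + 1) * (28 * K * (r - 1 + INR 4 / 2 + 1))).
    { apply (count_annulus D K c (r - 1) 4); auto; [lra|apply fil_NoDup, Sl|]. intros a Ha. rewrite fil_In in Ha. destruct Ha as [_ Ha]. apply Rabs_def2 in Ha. simpl. lra. }
    replace (INR 4) with 4 in A by (simpl; ring).
    assert (T : 2 * PI / r * rsum (fil (fun a => Rabs (Cmod (a - c) - r) < 1) l) (absD D) <= 2 * PI / r * (420 * K * r)).
    { apply Rmult_le_compat_l; [left; apply Rdiv_lt_0_compat; lra|]. nra. }
    replace (2 * PI / r * (420 * K * r)) with (2 * PI * (420 * K)) in T by (field; lra). lra. }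
  assert (Hug : forall y, Rabs (u y) <= g y).
  { intros y. set (w := (c + RtoC r * cis y)%C) in *. assert (Hw0 : Cmod (w - c) = r) by apply Hw. assert (Hwl' : ~ In w l) by apply Hwl.
    assert (Dw : D w = 0%Z). { destruct (Z.eq_dec (D w) 0); auto. exfalso. apply Hwl', Sl. split; auto. lra. }
    destruct (Hk w Dw) as [v [V1 [V2 V3]]]. rewrite (proj1 (Hf w ltac:(lra)) Dw) in V1. injection V1 as V1.
    assert (E : ln (Cmod v) = u y).
    { rewrite <- V1. assert (h w <> 0) by (apply Hh; lra). rewrite Cmod_mult, ln_mult; [rewrite ln_rprod by auto; reflexivity| |]; apply Cmod_gt_0; auto. apply rprod_neq0; auto. }
    specialize (V3 l). rewrite E in V3. assert (Hcov : covers D (fun a => Cmod (a - w) < 1) l).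
    { split; [apply Sl|]. intros a A1 A2. apply Sl. split; auto. pose proof (Cmod_tri a w c). lra. }
    specialize (V3 Hcov).
    assert (S : Rabs (rsum l (fun a => IZR (D a) * lg (Cmod (w - a)))) <= rsum l (fun a => absD D a * nl a y)).
    { eapply Rle_trans; [apply rsum_Rabs|]. apply rsum_le. intros a Ha. rewrite Rabs_mult. unfold absD, nl. fold w.
      assert (0 < Cmod (w - a)) by (apply Cmod_sub_pos; intros E'; subst a; auto). pose proof (lg_le _ H). rewrite (Rabs_left1 (lg _)) by auto. lra. }
    unfold g. apply Rcomplements.Rabs_le_between in V3, S. apply Rcomplements.Rabs_le_between. lra. }
  destruct (log_moment h c R0 r h1 ltac:(lra) Hh Hh1) as [M1 M2].
  split.
  - assert (I := RInt_dom u g 0 (2 * PI) ltac:(lra) Hu Hg (fun y _ => Hug y)).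
    assert (E : RInt u 0 (2 * PI) = 2 * PI * (ln (Cmod (h c)) + rsum l (fun a => IZR (D a) * ln (Rmax r (Cmod (a - c)))))).
    { unfold u. rewrite RInt_Rplus by (auto; apply Hlh). rewrite Q2. unfold lh. rewrite M1, Rmult_plus_distr_l. f_equal. rewrite <- rsum_scal.
      apply rsum_ext. intros a Ha. unfold la. rewrite (proj1 (ln_circle c a r ltac:(lra) (Hn a Ha))). ring. }
    rewrite E, Rabs_mult, (Rabs_pos_eq (2 * PI)) in I by lra. apply Rmult_le_reg_l with (2 * PI); lra.
  - set (U := fun y => (RtoC (u y) * Cconj (cis y))%C).
    set (Uh := fun y => (RtoC (lh y) * Cconj (cis y))%C). set (Ua := fun a y => (RtoC (la a y) * Cconj (cis y))%C).
    assert (HUh : cont_on Uh 0 (2 * PI)).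
    { intros y _. apply (Rcont_mult (fun y => RtoC (lh y)) (fun y => Cconj (cis y))); [apply Rcont_RtoC, Hlh|apply Rcont_conj_cis]. }
    destruct (CI_csum l (fun a => RtoC (IZR (D a))) Ua 0 (2 * PI)) as [W1 W2]; [lra| |].
    { intros a Ha y _. apply (Rcont_mult (fun y => RtoC (la a y)) (fun y => Cconj (cis y))); [apply Rcont_RtoC, Hla, Ha|apply Rcont_conj_cis]. }
    assert (EU : forall y, U y = (Uh y + csum l (fun a => RtoC (IZR (D a)) * Ua a y))%C).
    { intros y. unfold U, Uh, u. rewrite RtoC_plus, Cmult_plus_distr_r. f_equal. clear.
      induction l as [|a l IH]; [unfold rsum, csum; simpl; ring|]. rewrite rsum_cons, csum_cons, RtoC_plus, Cmult_plus_distr_r, IH. f_equal.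
      unfold Ua. rewrite RtoC_mult. ring. }
    assert (CU : cont_on (fun y => Uh y + csum l (fun a => RtoC (IZR (D a)) * Ua a y))%C 0 (2 * PI)).
    { intros y Hy. apply (Rcont_plus Uh (fun y => csum l (fun a => RtoC (IZR (D a)) * Ua a y)%C)); auto. }
    assert (I := CI_dom _ g 0 (2 * PI) ltac:(lra) CU Hg). 
    assert (EI : CI (fun y => Uh y + csum l (fun a => RtoC (IZR (D a)) * Ua a y))%C 0 (2 * PI) =
      (RtoC PI * (RtoC r * (h1 / h c - csum l (fun a => RtoC (IZR (D a) / Rmax r (Cmod (a - c)) ^ 2) * Cconj (a - c)))))%C).
    { rewrite CI_plus by (auto; lra). rewrite W2. unfold Uh, lh. rewrite M2.
      rewrite (csum_ext l (fun a => RtoC (IZR (D a)) * CI (Ua a) 0 (2 * PI))%C (fun a => RtoC (- (PI * r)) * (RtoC (IZR (D a) / Rmax r (Cmod (a - c)) ^ 2) * Cconj (a - c)))%C).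
      - rewrite csum_scal, RtoC_opp, RtoC_mult. ring.
      - intros a Ha. unfold Ua, la. rewrite (proj2 (ln_circle c a r ltac:(lra) (Hn a Ha))). rewrite !Cmult_assoc, <- !RtoC_mult. f_equal. f_equal. field.
        assert (r <= Rmax r (Cmod (a - c))) by apply Rmax_l. lra. }
    rewrite EI, Cmod_mult, Cmod_R, (Rabs_pos_eq PI) in I by lra.
    assert (I2 : PI * Cmod (RtoC r * (h1 / h c - csum l (fun a => RtoC (IZR (D a) / Rmax r (Cmod (a - c)) ^ 2) * Cconj (a - c))))%C <= 2 * RInt g 0 (2 * PI)).
    { apply I. intros y _. rewrite <- EU. unfold U. rewrite Cmod_mult, Cmod_R. replace (Cmod (Cconj (cis y))) with 1; [rewrite Rmult_1_r; apply Hug|].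
      symmetry. rewrite <- (Cmod_cis y) at 1. unfold Cmod, Cconj; simpl. f_equal. ring. }
    apply Rmult_le_reg_l with PI; auto. lra.
Qed.

(** The circle formulas exclude the finitely many radii [|a-c|]; continuity in the radius extends
    their bounds to these. *)
Lemma avoid_bound (bad : list R) (G : R -> R) (t T M : R) : t < T -> continuous G t ->
  (forall s, t <= s < T -> ~ In s bad -> Rabs (G s) <= M) -> Rabs (G t) <= M.
Proof.
  intros Ht Hc Hb. apply le_epsilon. intros eps He. destruct (proj1 (continuous_R_iff G t) Hc eps He) as [d [D1 D2]].
  set (m := Rmin d (T - t)). assert (Hm : 0 < m) by (apply Rmin_pos; lra). assert (L1 := Rmin_l d (T - t)). assert (L2 := Rmin_r d (T - t)). fold m in L1, L2.
  destruct (avoid_list bad t (t + m / 2)) as [s [S1 S2]]; [lra|].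
  assert (Hs : ~ In s bad).
  { intros Hi. specialize (S2 s Hi). replace (s - s) with 0 in S2 by ring. rewrite Rabs_R0 in S2. assert (0 < 3 ^ length bad) by (apply pow_lt; lra).
    assert (0 < (t + m / 2 - t) / (6 * 3 ^ length bad)) by (apply Rdiv_lt_0_compat; lra). lra. }
  specialize (Hb s ltac:(lra) Hs). specialize (D2 s). rewrite Rabs_pos_eq in D2 by lra. specialize (D2 ltac:(lra)).
  pose proof (Rabs_triang (G s) (- (G s - G t))). rewrite Rabs_Ropp in H. replace (G s + - (G s - G t)) with (G t) in H by ring. lra.
Qed.

Lemma Rmax_continuous (s t : R) : continuous (fun t => Rmax t s) t.
Proof.
  apply (continuous_R_iff (fun t => Rmax t s)). intros eps He. exists eps. split; auto. intros u Hu.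
  unfold Rmax. destruct (Rle_dec u s), (Rle_dec t s); revert Hu; unfold Rabs; repeat destruct (Rcase_abs _); lra.
Qed.

Lemma rsum_continuous (l : list C) (k : C -> R) (F : C -> R -> R) (t : R) : (forall a, In a l -> continuous (F a) t) ->
  continuous (fun t => rsum l (fun a => k a * F a t)) t.
Proof.
  induction l as [|a l IH]; intros H.
  - apply continuous_const.
  - apply (continuous_ext (fun t => k a * F a t + rsum l (fun a => k a * F a t))); [intros; symmetry; apply rsum_cons|].
    apply (continuous_plus (V := R_NormedModule)); [|apply IH; intros; apply H; right; auto].
    apply (continuous_scal_r (V := R_NormedModule) (k a) (F a)), H. left; auto.
Qed.

Lemma ln_Rmax_continuous (s t : R) : 0 < t -> continuous (fun t => ln (Rmax t s)) t.
Proof.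
  intros Ht. apply (continuous_comp (fun t => Rmax t s) ln); [apply Rmax_continuous|].
  apply (ex_derive_continuous ln). assert (t <= Rmax t s) by apply Rmax_l. auto_derive. lra.
Qed.

Lemma inv_Rmax_continuous (s t : R) : 0 < t -> continuous (fun t => / Rmax t s ^ 2) t.
Proof.
  intros Ht. apply (continuous_comp (fun t => Rmax t s) (fun m => / m ^ 2)); [apply Rmax_continuous|].
  apply (ex_derive_continuous (fun m => / m ^ 2)). assert (t <= Rmax t s) by apply Rmax_l. auto_derive. apply Rgt_not_eq. nra.
Qed.

Lemma Lr_Rmax r s : 1 <= r -> Lr r s = ln (Rmax r s) - ln (Rmax 1 s).
Proof. intros H. unfold Lr, m1. rewrite Rmax_assoc, (Rmax_left r 1) by lra. reflexivity. Qed.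

(* With J(t) = j - sum D w / max(t,s)^2, the function sum D w (ln max(t,s) + t^2 / (2 max(t,s)^2)) - t^2 j / 2
   has derivative -t J(t), and t^2 J(t) accounts for its second part. *)
Lemma moment_ode (D : C -> Z) (l : list C) (s w : C -> R) (j B r : R) : 1 <= r ->
  (forall t, 1 <= t <= r -> Rabs (t * (j - rsum l (fun a => IZR (D a) * w a * / Rmax t (s a) ^ 2))) <= B) ->
  Rabs (rsum l (fun a => IZR (D a) * w a * Lr r (s a))) <= 2 * B * r.
Proof.
  intros Hr HB.
  set (Psi := fun t => rsum l (fun a => IZR (D a) * w a * (ln (Rmax t (s a)) + t ^ 2 / (2 * Rmax t (s a) ^ 2))) - t ^ 2 * j / 2).
  set (J := fun t => j - rsum l (fun a => IZR (D a) * w a * / Rmax t (s a) ^ 2)).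
  assert (HM : forall t a, t <= Rmax t (s a)) by (intros; apply Rmax_l).
  assert (A : Rabs (Psi r - Psi 1) <= B * r - B * 1).
  { apply (mvt_dom Psi (fun t => - (t * J t)) (fun t => B * t) (fun _ => B)); auto.
    - intros t Ht. unfold Psi, J.
      replace (- (t * (j - rsum l (fun a => IZR (D a) * w a * / Rmax t (s a) ^ 2)))) with (rsum l (fun a => IZR (D a) * w a * (t / Rmax t (s a) ^ 2)) - t * j).
      2:{ rewrite (rsum_ext l (fun a => IZR (D a) * w a * (t / Rmax t (s a) ^ 2)) (fun a => t * (IZR (D a) * w a * / Rmax t (s a) ^ 2))) by (intros; unfold Rdiv; ring).
          rewrite rsum_scal. ring. }
      apply (is_derive_minus (V := R_NormedModule) (fun t => rsum l (fun a => IZR (D a) * w a * (ln (Rmax t (s a)) + t ^ 2 / (2 * Rmax t (s a) ^ 2)))) (fun t => t ^ 2 * j / 2)).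
      + apply (is_derive_rsum l (fun a t => IZR (D a) * w a * (ln (Rmax t (s a)) + t ^ 2 / (2 * Rmax t (s a) ^ 2)))).
        intros a Ha. apply (is_derive_scal (fun t => ln (Rmax t (s a)) + t ^ 2 / (2 * Rmax t (s a) ^ 2)) t (IZR (D a) * w a)).
        apply (glue_derive (fun t m => ln m + t ^ 2 / (2 * m ^ 2))).
        * intros Hm. rewrite Rmax_right by auto. auto_derive; [nra|]. field. nra.
        * intros Hm. rewrite Rmax_left by auto. auto_derive; [split; [lra|split; [nra|auto]]|]. field. nra.
      + auto_derive; auto. field.
    - intros t Ht. auto_derive; auto. ring.
    - intros t Ht. rewrite Rabs_Ropp. apply HB, Ht. }
  assert (E : rsum l (fun a => IZR (D a) * w a * Lr r (s a)) = (Psi r - Psi 1) + r * (r * J r) / 2 - 1 * J 1 / 2).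
  { unfold Psi, J. rewrite (rsum_ext l _ (fun a => IZR (D a) * w a * (ln (Rmax r (s a)) + r ^ 2 / (2 * Rmax r (s a) ^ 2)) - r ^ 2 / 2 * (IZR (D a) * w a * / Rmax r (s a) ^ 2)
      - (IZR (D a) * w a * (ln (Rmax 1 (s a)) + 1 ^ 2 / (2 * Rmax 1 (s a) ^ 2)) - 1 / 2 * (IZR (D a) * w a * / Rmax 1 (s a) ^ 2)))).
    - rewrite !rsum_minus, !rsum_scal. field.
    - intros a _. rewrite Lr_Rmax by auto. specialize (HM r a) as H1. specialize (HM 1 a) as H2. field. split; lra. }
  rewrite E. assert (B1 := HB r ltac:(lra)). assert (B2 := HB 1 ltac:(lra)). fold (J r) in B1. fold (J 1) in B2.
  assert (B3 : Rabs (r * (r * J r)) <= r * B) by (rewrite Rabs_mult, (Rabs_pos_eq r) by lra; apply Rmult_le_compat_l; lra).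
  assert (B0 : 0 <= B) by (pose proof (Rabs_pos (1 * J 1)); lra).
  apply Rcomplements.Rabs_le_between in A, B2, B3. apply Rcomplements.Rabs_le_between. nra.
Qed.

Section Moments.
Variables (D : C -> Z) (f : C -> sphere) (B K : R).
Hypothesis (HT : tame D f) (Hk : kbound D f B) (HB : 0 <= B) (HC : count_bound D 1 K).

(** One list and one [h] serve all radii up to [r], so that the unknown constants [ln|h c|] and
    [h1 / h c] can be eliminated by comparing radii: by subtraction in [tame_dsum], through
    [moment_ode] in [tame_esum]. *)
Lemma circle_data (c : C) (r : R) : 1 <= r -> exists l h h1, supp D (fun z => Cmod (z - c) < r + 2) l /\
  (forall t, 1 <= t <= r -> Rabs (ln (Cmod (h c)) + rsum l (fun a => IZR (D a) * ln (Rmax t (Cmod (a - c))))) <= B + 420 * K) /\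
  (forall t (p : C -> R), 1 <= t <= r -> p = fst \/ p = snd ->
     Rabs (t * (p (h1 / h c)%C - rsum l (fun a => IZR (D a) * p (Cconj (a - c)) * / Rmax t (Cmod (a - c)) ^ 2))) <= 4 * (B + 420 * K)).
Proof.
  intros Hr. destruct (proj2 (proj2 (proj2 (proj2 (proj2 HT)))) c (r + 2)) as [l [h HL]].
  destruct (proj1 (proj2 HL) c) as [[h1 Hh1] _]; [rewrite Cmod_sub_self; lra|].
  exists l, h, h1. split; [apply HL|].
  assert (Q : forall s, 1 <= s -> s < r + 1 -> ~ In s (map (fun a => Cmod (a - c)) l) ->  forall a, In a l -> s <> Cmod (a - c)).
  { intros s _ _ Hs a Ha E. apply Hs. rewrite E. apply (in_map (fun a => Cmod (a - c))), Ha. }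
  split.
  - intros t Ht. apply (avoid_bound (map (fun a => Cmod (a - c)) l) (fun t => ln (Cmod (h c)) + rsum l (fun a => IZR (D a) * ln (Rmax t (Cmod (a - c))))) t (r + 1)); [lra| |].
    + apply (continuous_plus (V := R_NormedModule)); [apply continuous_const|]. apply (rsum_continuous l (fun a => IZR (D a)) (fun a t => ln (Rmax t (Cmod (a - c))))).
      intros a _. apply ln_Rmax_continuous. lra.
    + intros s Hs Hbad. apply (circle_bounds D f B K c (r + 2) s l h h1); auto; try lra. apply Q; auto; lra.
  - intros t p Ht Hp.
    apply (avoid_bound (map (fun a => Cmod (a - c)) l) (fun t => t * (p (h1 / h c)%C - rsum l (fun a => IZR (D a) * p (Cconj (a - c)) * / Rmax t (Cmod (a - c)) ^ 2))) t (r + 1)); [lra| |].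
    + apply (continuous_mult (K := R_AbsRing) (fun t => t)); [apply continuous_id|]. apply (continuous_minus (V := R_NormedModule)); [apply continuous_const|].
      apply (rsum_continuous l (fun a => IZR (D a) * p (Cconj (a - c))) (fun a t => / Rmax t (Cmod (a - c)) ^ 2)). intros a _. apply inv_Rmax_continuous. lra.
    + intros s Hs Hbad. destruct (circle_bounds D f B K c (r + 2) s l h h1) as [_ A]; auto; try lra; [apply Q; auto; lra|].
      eapply Rle_trans; [|exact A].
      set (X := (RtoC s * (h1 / h c - csum l (fun a => RtoC (IZR (D a) / Rmax s (Cmod (a - c)) ^ 2) * Cconj (a - c))))%C).
      assert (E : s * (p (h1 / h c)%C - rsum l (fun a => IZR (D a) * p (Cconj (a - c)) * / Rmax s (Cmod (a - c)) ^ 2)) = p X).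
      { unfold X. set (q := (h1 / h c)%C). clearbody q. destruct Hp as [E|E]; rewrite E.
        - transitivity (s * (fst q - fst (csum l (fun a => RtoC (IZR (D a) / Rmax s (Cmod (a - c)) ^ 2) * Cconj (a - c))%C))); [|simpl; ring].
          rewrite csum_fst. f_equal. f_equal. apply rsum_ext. intros a _. simpl. unfold Rdiv. ring.
        - transitivity (s * (snd q - snd (csum l (fun a => RtoC (IZR (D a) / Rmax s (Cmod (a - c)) ^ 2) * Cconj (a - c))%C))); [|simpl; ring].
          rewrite csum_snd. f_equal. f_equal. apply rsum_ext. intros a _. simpl. unfold Rdiv. ring. }
      rewrite E. destruct Hp as [Ep|Ep]; rewrite Ep; [apply fst_le_Cmod|apply snd_le_Cmod].
Qed.

Lemma tame_dsum : dsum_bound D (2 * (B + 420 * K)).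
Proof.
  assert (HK := proj1 HC). split; [lra|]. intros c r l Hr Hl. destruct (circle_data c r Hr) as [l0 [h [h1 [S0 [A _]]]]].
  rewrite (covers_rsum D (fun z => Cmod (z - c) < r) l l0); auto.
  - rewrite (rsum_ext l0 _ (fun a => IZR (D a) * ln (Rmax r (Cmod (a - c))) - IZR (D a) * ln (Rmax 1 (Cmod (a - c))))) by (intros; rewrite Lr_Rmax by auto; ring).
    rewrite rsum_minus. assert (A1 := A r ltac:(lra)). assert (A2 := A 1 ltac:(lra)). apply Rcomplements.Rabs_le_between in A1, A2. apply Rcomplements.Rabs_le_between. lra.
  - apply (covers_sub D (fun z => Cmod (z - c) < r + 2)); [intros; lra|]. apply supp_covers, S0.
  - intros a [Ha|Ha]; [rewrite Ha; ring|]. rewrite Lr_0; [ring|auto|lra].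
Qed.

Lemma tame_esum : esum_bound D (16 * (B + 420 * K)).
Proof.
  assert (HK := proj1 HC). split; [lra|]. intros c r l Hr Hl. destruct (circle_data c r Hr) as [l0 [h [h1 [S0 [_ A]]]]].
  rewrite (covers_csum D (fun z => Cmod (z - c) < r) l l0); auto.
  - eapply Rle_trans; [apply Cmod_le_sum|]. rewrite csum_fst, csum_snd.
    (* [moment_ode] doubles the bound [4 (B + 420 K)], and the two coordinates add up, whence the
       constant 16. *)
    assert (A1 := moment_ode D l0 (fun a => Cmod (a - c)) (fun a => fst (Cconj (a - c))) _ _ r Hr (fun t Ht => A t fst Ht (or_introl eq_refl))).
    assert (A2 := moment_ode D l0 (fun a => Cmod (a - c)) (fun a => snd (Cconj (a - c))) _ _ r Hr (fun t Ht => A t snd Ht (or_intror eq_refl))).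
    rewrite (rsum_ext l0 (fun a => fst (RtoC (IZR (D a) * Lr r (Cmod (a - c))) * (a - c))%C) (fun a => IZR (D a) * fst (Cconj (a - c)) * Lr r (Cmod (a - c)))) by (intros; simpl; ring).
    (* [circle_data] concerns the conjugate of [a - c], whence the sign in the second coordinate. *)
    rewrite (rsum_ext l0 (fun a => snd (RtoC (IZR (D a) * Lr r (Cmod (a - c))) * (a - c))%C) (fun a => (-1) * (IZR (D a) * snd (Cconj (a - c)) * Lr r (Cmod (a - c))))) by (intros; simpl; ring).
    rewrite rsum_scal, Rabs_mult. replace (Rabs (-1)) with 1 by (rewrite Rabs_left; lra). lra.
  - apply (covers_sub D (fun z => Cmod (z - c) < r + 2)); [intros; lra|]. apply supp_covers, S0.
  - intros a [Ha|Ha]; [rewrite Ha|rewrite Lr_0; [|auto|lra]]; apply injective_projections; simpl; ring.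
Qed.
End Moments.

(** * The conditions of the theorem *)

Lemma Rint_is_RInt (g : R -> R) (a b v : R) : Rint g a b v <-> is_RInt g a b v.
Proof.
  split.
  - intros [pr E]. rewrite <- E, <- RInt_Reals. apply (RInt_correct (V := R_CompleteNormedModule)), ex_RInt_Reals_1, pr.
  - intros H. assert (E : ex_RInt g a b) by (exists v; auto). exists (ex_RInt_Reals_0 g a b E). rewrite <- RInt_Reals. apply is_RInt_unique, H.
Qed.

Lemma is_RInt_zero (a b : R) : is_RInt (fun _ => 0) a b 0.
Proof.
  assert (H := is_RInt_const (V := R_NormedModule) a b 0). change (is_RInt (fun _ => 0) a b ((b - a) * 0)) in H.
  rewrite Rmult_0_r in H. exact H.
Qed.

Lemma is_RInt_indic (r s : R) : 1 < r -> is_RInt (fun t => indic (s < t) / t) 1 r (Lr r s).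
Proof.
  intros Hr. destruct (Rlt_le_dec s r) as [H|H].
  - rewrite Lr_Rmax by lra. rewrite Rmax_left by lra. set (m := Rmax 1 s). assert (M1 : 1 <= m) by apply Rmax_l. assert (M2 : s <= m) by apply Rmax_r.
    assert (M3 : m < r) by (unfold m; apply Rmax_lub_lt; auto).
    replace (ln r - ln m) with (0 + (ln r - ln m)) by ring.
    apply (is_RInt_Chasles (V := R_NormedModule) _ 1 m r 0 (ln r - ln m)).
    + destruct (Rle_lt_dec s 1) as [Hs|Hs].
      * unfold m. rewrite Rmax_left by auto. apply (is_RInt_point (V := R_NormedModule)).
      * apply (is_RInt_ext (fun _ => 0)).
        -- intros t Ht. unfold m in Ht. rewrite (Rmax_right 1 s), Rmin_left, Rmax_right in Ht by lra. rewrite indic_false by lra. symmetry. apply Rmult_0_l.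
        -- apply is_RInt_zero.
    + apply (is_RInt_ext (fun t => / t)).
      * intros t Ht. rewrite Rmin_left, Rmax_right in Ht by lra. rewrite indic_true by lra. symmetry. apply Rmult_1_l.
      * apply (is_RInt_derive (V := R_CompleteNormedModule) ln (fun t => / t)).
        -- intros t Ht. rewrite Rmin_left, Rmax_right in Ht by lra. auto_derive; [lra|]. field. lra.
        -- intros t Ht. rewrite Rmin_left, Rmax_right in Ht by lra. apply (ex_derive_continuous (fun t => / t)). auto_derive. lra.
  - rewrite Lr_0 by lra. apply (is_RInt_ext (fun _ => 0)).
    + intros t Ht. rewrite Rmin_left, Rmax_right in Ht by lra. rewrite indic_false by lra. symmetry. apply Rmult_0_l.
    + apply is_RInt_zero.
Qed.

Lemma is_RInt_rsum (l : list C) (w s : C -> R) (r : R) : 1 < r ->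
  is_RInt (fun t => rsum l (fun a => w a * (indic (s a < t) / t))) 1 r (rsum l (fun a => w a * Lr r (s a))).
Proof.
  intros Hr. induction l as [|a l IH].
  - unfold rsum; simpl. apply is_RInt_zero.
  - rewrite rsum_cons. apply (is_RInt_ext (fun t => w a * (indic (s a < t) / t) + rsum l (fun a => w a * (indic (s a < t) / t)))).
    + intros t _. rewrite rsum_cons. reflexivity.
    + apply (is_RInt_plus (V := R_NormedModule)); auto. apply (is_RInt_scal (V := R_NormedModule) _ 1 r (w a)), is_RInt_indic, Hr.
Qed.

Lemma supp_inner D (c : C) (r t : R) l : t <= r -> supp D (fun z => Cmod (z - c) < r) l ->
  supp D (fun z => Cmod (z - c) < t) (fil (fun z => Cmod (z - c) < t) l).
Proof. intros Ht H. apply (supp_fil D (fun z => Cmod (z - c) < r)); auto. intros z Hz. lra. Qed.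

Lemma card_integral D (c : C) (r : R) l : divisor D -> 1 < r -> supp D (fun z => Cmod (z - c) < r) l ->
  is_RInt (fun t => (card_zeros D (fun z => Cnorm (Csub z c) < t) - card_poles D (fun z => Cnorm (Csub z c) < t)) / t) 1 r
    (rsum l (fun a => IZR (D a) * Lr r (Cmod (a - c)))).
Proof.
  intros HD Hr Hl. eapply is_RInt_ext; [|apply (is_RInt_rsum l (fun a => IZR (D a)) (fun a => Cmod (a - c)) r Hr)].
  intros t Ht. rewrite Rmin_left, Rmax_right in Ht by lra.
  change (rsum l (fun a => IZR (D a) * (indic (Cmod (a - c) < t) / t)) = (card_zeros D (fun z : C => Cmod (z - c) < t) - card_poles D (fun z : C => Cmod (z - c) < t)) / t).
  rewrite (card_zp_minus D _ (fil (fun z => Cmod (z - c) < t) l) HD (bounded_disc c t)); [|apply (supp_inner D c r); auto; lra].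
  rewrite rsum_fil. unfold Rdiv. rewrite Rmult_comm, <- rsum_scal. apply rsum_ext. intros; ring.
Qed.

Lemma sum_integral D (c : C) (r : R) l : divisor D -> 1 < r -> supp D (fun z => Cmod (z - c) < r) l ->
  Cint (fun t => Cmul (Defs.RtoC (/ t))
                 (Csub (sum_zeros D (fun z => Cnorm (Csub z c) < t) (fun z => Csub z c))
                       (sum_poles D (fun z => Cnorm (Csub z c) < t) (fun z => Csub z c)))) 1 r
    (csum l (fun a => RtoC (IZR (D a) * Lr r (Cmod (a - c))) * (a - c))%C).
Proof.
  intros HD Hr Hl.
  assert (E : forall t, 1 < t < r -> Cmul (Defs.RtoC (/ t)) (Csub (sum_zeros D (fun z => Cnorm (Csub z c) < t) (fun z => Csub z c)) (sum_poles D (fun z => Cnorm (Csub z c) < t) (fun z => Csub z c)))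
     = csum l (fun a => RtoC (IZR (D a) * (indic (Cmod (a - c) < t) / t)) * (a - c))%C).
  { intros t Ht.
    change ((RtoC (/ t) * (sum_zeros D (fun z : C => Cmod (z - c) < t) (fun z : C => z - c) - sum_poles D (fun z : C => Cmod (z - c) < t) (fun z : C => z - c)))%C
      = csum l (fun a => RtoC (IZR (D a) * (indic (Cmod (a - c) < t) / t)) * (a - c))%C).
    rewrite (sum_zp D _ (fil (fun z => Cmod (z - c) < t) l) (fun z => z - c)%C HD (bounded_disc c t)); [|apply (supp_inner D c r); auto; lra].
    rewrite csum_fil, <- csum_scal. apply csum_ext. intros a _. unfold Rdiv. rewrite !RtoC_mult. ring. }
  split; apply Rint_is_RInt.
  - rewrite csum_fst. rewrite (rsum_ext l _ (fun a => IZR (D a) * fst (a - c)%C * Lr r (Cmod (a - c)))) by (intros; simpl; ring).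
    eapply is_RInt_ext; [|apply (is_RInt_rsum l (fun a => IZR (D a) * fst (a - c)%C) (fun a => Cmod (a - c)) r Hr)].
    intros t Ht. rewrite Rmin_left, Rmax_right in Ht by lra. cbv beta. rewrite E by auto. rewrite csum_fst. apply rsum_ext. intros; simpl; ring.
  - rewrite csum_snd. rewrite (rsum_ext l _ (fun a => IZR (D a) * snd (a - c)%C * Lr r (Cmod (a - c)))) by (intros; simpl; ring).
    eapply is_RInt_ext; [|apply (is_RInt_rsum l (fun a => IZR (D a) * snd (a - c)%C) (fun a => Cmod (a - c)) r Hr)].
    intros t Ht. rewrite Rmin_left, Rmax_right in Ht by lra. cbv beta. rewrite E by auto. rewrite csum_snd. apply rsum_ext. intros; simpl; ring.
Qed.

Lemma Rint_unique g a b v v' : Rint g a b v -> Rint g a b v' -> v = v'.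
Proof. intros H1 H2. apply Rint_is_RInt in H1, H2. rewrite <- (is_RInt_unique _ _ _ _ H1). apply is_RInt_unique, H2. Qed.

Lemma Lr_1 s : Lr 1 s = 0.
Proof. unfold Lr, m1. rewrite Rmax_assoc, (Rmax_left 1 1) by lra. ring. Qed.

(** The integrand in (d) is a finite sum of step functions divided by [t], so the integral exists
    and equals the sum with [Lr]; at [r = 1], which (d) leaves out, this sum vanishes. *)
Lemma dsum_iff D : divisor D -> (exists K, dsum_bound D K) <->
  (exists K, forall c r, r > 1 -> exists v,
    Rint (fun t => (card_zeros D (fun z => Cnorm (Csub z c) < t) - card_poles D (fun z => Cnorm (Csub z c) < t)) / t) 1 r v /\ Rabs v < K).
Proof.
  intros HD. split.
  - intros [K [HK H]]. exists (K + 1). intros c r Hr. assert (Hl := supp_list_spec D _ HD (bounded_disc c r)). eexists.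
    split; [apply Rint_is_RInt, (card_integral D c r _ HD Hr Hl)|]. specialize (H c r _ (Rlt_le _ _ Hr) (supp_covers _ _ _ Hl)). lra.
  - intros [K H]. exists K. assert (HK : 0 <= K).
    { destruct (H (RtoC 0) 2) as [v [_ Hv]]; [lra|]. pose proof (Rabs_pos v). lra. }
    split; auto. intros c r l [Hr|Hr] Hl.
    + assert (Hl' := supp_list_spec D _ HD (bounded_disc c r)). destruct (H c r Hr) as [v [Hv1 Hv2]].
      rewrite (Rint_unique _ _ _ _ _ Hv1 (proj2 (Rint_is_RInt _ _ _ _) (card_integral D c r _ HD Hr Hl'))) in Hv2.
      rewrite (covers_rsum D _ l _ _ Hl (supp_covers _ _ _ Hl')); [lra|]. intros a [Ha|Ha]; [rewrite Ha; ring|]. rewrite Lr_0; lra.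
    + subst r. rewrite rsum_0, Rabs_R0; auto. intros. rewrite Lr_1. ring.
Qed.

Lemma esum_iff D : divisor D -> (exists K, esum_bound D K) <->
  (exists K, forall c r, r > 1 -> exists v,
    Cint (fun t => Cmul (Defs.RtoC (/ t))
                 (Csub (sum_zeros D (fun z => Cnorm (Csub z c) < t) (fun z => Csub z c))
                       (sum_poles D (fun z => Cnorm (Csub z c) < t) (fun z => Csub z c)))) 1 r v
    /\ Cnorm (Cmul (Defs.RtoC (/ r)) v) < K).
Proof.
  intros HD. assert (N : forall r v, 0 < r -> Cnorm (Cmul (Defs.RtoC (/ r)) v) = Cmod v / r).
  { intros r v Hr. change (Cmod (RtoC (/ r) * v) = Cmod v / r). rewrite Cmod_mult, Cmod_R, Rabs_pos_eq; [unfold Rdiv; ring|]. left. apply Rinv_0_lt_compat, Hr. }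
  split.
  - intros [K [HK H]]. exists (K + 1). intros c r Hr. assert (Hl := supp_list_spec D _ HD (bounded_disc c r)). eexists.
    split; [apply (sum_integral D c r _ HD Hr Hl)|]. specialize (H c r _ (Rlt_le _ _ Hr) (supp_covers _ _ _ Hl)). rewrite N by lra.
    apply Rle_lt_trans with K; [|lra]. apply Rcomplements.Rle_div_l; lra.
  - intros [K H]. exists K. assert (HK : 0 <= K).
    { destruct (H (RtoC 0) 2) as [v [_ Hv]]; [lra|]. rewrite N in Hv by lra. assert (0 <= Cmod v / 2) by (apply Rdiv_le_0_compat; [apply Cmod_ge_0|lra]). lra. }
    split; auto. intros c r l [Hr|Hr] Hl.
    + assert (Hl' := supp_list_spec D _ HD (bounded_disc c r)). destruct (H c r Hr) as [v [[Hv1 Hv2] Hv]].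
      destruct (sum_integral D c r _ HD Hr Hl') as [I1 I2]. assert (E : v = csum (supp_list D (fun z => Cmod (z - c) < r)) (fun a => RtoC (IZR (D a) * Lr r (Cmod (a - c))) * (a - c))%C).
      { apply injective_projections; [apply (Rint_unique _ _ _ _ _ Hv1 I1)|apply (Rint_unique _ _ _ _ _ Hv2 I2)]. }
      rewrite N in Hv by lra. apply (proj1 (Rcomplements.Rlt_div_l _ _ _ (Rlt_trans _ _ _ Rlt_0_1 Hr))) in Hv.
      rewrite (covers_csum D _ l _ _ Hl (supp_covers _ _ _ Hl')). { match goal with |- Cmod ?x <= _ => replace x with v by exact E end. lra. } intros a [Ha|Ha]; [rewrite Ha|rewrite Lr_0 by lra]; apply injective_projections; simpl; ring.
    + subst r. rewrite (csum_ext l _ (fun a => 0 * 0)%C). { rewrite csum_scal, Cmult_0_l, Cmod_0. lra. } intros. rewrite Lr_1. apply injective_projections; simpl; ring.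
Qed.

Lemma count_iff D : divisor D -> (exists K, count_bound D 1 K) <->
  (exists K, forall c, card_zeros D (fun z => Cnorm (Csub z c) <= 1) + card_poles D (fun z => Cnorm (Csub z c) <= 1) < K).
Proof.
  intros HD. assert (E : forall c, card_zeros D (fun z => Cnorm (Csub z c) <= 1) + card_poles D (fun z => Cnorm (Csub z c) <= 1) = rsum (supp_list D (fun z => Cmod (z - c) <= 1)) (absD D)).
  { intros c. apply (card_zp_plus D (fun z => Cmod (z - c) <= 1)); auto; [apply bounded_disc_le|apply supp_list_spec; auto; apply bounded_disc_le]. }
  assert (S : forall c, supp D (fun z => Cmod (z - c) <= 1) (supp_list D (fun z => Cmod (z - c) <= 1))) by (intros c; apply supp_list_spec; auto; apply bounded_disc_le).
  split.
  - intros [K [HK H]]. exists (K + 1). intros c. rewrite E. apply Rle_lt_trans with K; [|lra]. apply (H c); [apply S|]. intros a Ha. apply S in Ha. tauto.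
  - intros [K H]. exists K. assert (P : forall c, 0 <= rsum (supp_list D (fun z => Cmod (z - c) <= 1)) (absD D)) by (intros; apply rsum_nonneg; intros; apply absD_pos).
    split; [specialize (H (RtoC 0)); rewrite E in H; specialize (P 0); lra|]. intros c l Hl Ha. specialize (H c). rewrite E in H.
    rewrite (rsum_split (fun a => D a <> 0%Z) l). rewrite (rsum_0 (fil (fun a => ~ D a <> 0%Z) l)).
    2:{ intros a Hi. rewrite fil_In in Hi. unfold absD. replace (D a) with 0%Z by lia. apply Rabs_R0. }
    rewrite Rplus_0_r. rewrite (rsum_split (fun a => In a l) (supp_list D (fun z => Cmod (z - c) <= 1))) in H.
    rewrite (rsum_perm _ (fil (fun a => In a l) (supp_list D (fun z => Cmod (z - c) <= 1)))).
    + assert (0 <= rsum (fil (fun a => ~ In a l) (supp_list D (fun z => Cmod (z - c) <= 1))) (absD D)) by (apply rsum_nonneg; intros; apply absD_pos). lra.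
    + apply NoDup_same_perm; [apply fil_NoDup, Hl|apply fil_NoDup, S|]. intros a. rewrite !fil_In. destruct (S c) as [_ Sc]. rewrite Sc. split; [|tauto]. intros [A1 A2]. auto.
Qed.

Lemma square_clause D L : divisor D -> Clim_infty (fun rho => csum (fil (fun a => 1 <= Cmod a) (lst D rho)) (fterm D)) L ->
  Clim_infty (fun r => Csub (sum_zeros D (fun z => 1 <= Cnorm z < r) (fun z => Defs.Cinv (Cmul z z)))
                       (sum_poles D (fun z => 1 <= Cnorm z < r) (fun z => Defs.Cinv (Cmul z z)))) L.
Proof.
  intros HD. apply (Clim_ext _ _ L 0). intros r _. symmetry. unfold fterm.
  apply (sum_zp D (fun z => 1 <= Cmod z < r) (fil (fun a => 1 <= Cmod a) (lst D r)) (fun z => / (z * z))%C HD).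
  - apply (bounded_sub (fun z => Cmod (z - 0) < r)); [|apply bounded_disc]. intros z Hz. replace (z - 0)%C with z by ring. lra.
  - destruct (lst_supp D r HD) as [A B]. split; [apply fil_NoDup, A|]. intros z. rewrite fil_In, B. tauto.
Qed.

Lemma alpha_clause D L : divisor D -> Clim_infty (fun rho => csum (lst D rho) (aterm D rho)) L ->
  Clim_infty (fun r => Csub
          (sum_poles D (fun z => Cnorm z < r)
             (fun b => Csub (Defs.Cinv b) (Cmul (Defs.Cconj b) (Defs.RtoC (/ (r * r))))))
          (sum_zeros D (fun z => Cnorm z < r)
             (fun a => Csub (Defs.Cinv a) (Cmul (Defs.Cconj a) (Defs.RtoC (/ (r * r))))))) (- L)%C.
Proof.
  intros HD HL. replace (- L)%C with (-(1) * L)%C by (change (@eq C (-(1) * L)%C (- L)%C); ring). apply (Clim_scal (-(1))%C) in HL.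
  revert HL. apply (Clim_ext _ _ (-(1) * L)%C 0). intros r _.
  change ((-(1) * csum (lst D r) (aterm D r))%C = (sum_poles D (fun z => Cmod z < r) (fun b => / b - Cconj b * RtoC (/ (r * r))) - sum_zeros D (fun z => Cmod z < r) (fun b => / b - Cconj b * RtoC (/ (r * r))))%C).
  assert (E := sum_zp D (fun z => Cmod z < r) (lst D r) (fun b => / b - Cconj b * RtoC (/ (r * r)))%C HD).
  rewrite (csum_ext _ (aterm D r) (fun a => RtoC (IZR (D a)) * (/ a - Cconj a * RtoC (/ (r * r))))%C).
  - rewrite <- E.
    + change (@eq C (-(1) * (sum_zeros D (fun z => Cmod z < r) (fun b => / b - Cconj b * RtoC (/ (r * r))) - sum_poles D (fun z => Cmod z < r) (fun b => / b - Cconj b * RtoC (/ (r * r)))))%C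
        (sum_poles D (fun z => Cmod z < r) (fun b => / b - Cconj b * RtoC (/ (r * r))) - sum_zeros D (fun z => Cmod z < r) (fun b => / b - Cconj b * RtoC (/ (r * r))))%C).
      generalize (sum_zeros D (fun z => Cmod z < r) (fun b => / b - Cconj b * RtoC (/ (r * r)))%C), (sum_poles D (fun z => Cmod z < r) (fun b => / b - Cconj b * RtoC (/ (r * r)))%C).
      intros x y. apply injective_projections; simpl; ring.
    + apply (bounded_sub (fun z => Cmod (z - 0) < r)); [|apply bounded_disc]. intros z Hz. replace (z - 0)%C with z by ring. lra.
    + apply lst_supp, HD.
  - intros a _. unfold aterm. replace (r ^ 2) with (r * r) by ring. ring.
Qed.

(** Conditions (a) to (e) with their constants exposed and with (d) and (e) in evaluated form;
    necessity ends and sufficiency starts here. *)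
Definition conditions (D : C -> Z) (dl K K1 K2 Rad : R) : Prop :=
  0 < dl /\ (forall a b, (D a > 0)%Z -> (D b < 0)%Z -> dl <= Cmod (a - b)) /\ count_bound D 1 K /\
  (forall c, (exists a, (D a > 0)%Z /\ Cmod (a - c) < Rad) /\ (exists b, (D b < 0)%Z /\ Cmod (b - c) < Rad)) /\ dsum_bound D K1 /\ esum_bound D K2.

Lemma N1_conditions D f : divisor D -> N1 f -> divisor_of D f -> exists dl K K1 K2 Rad, conditions D dl K K1 K2 Rad.
Proof.
  intros HD HN Hf. assert (HT := tame_N1 D f HD HN Hf). destruct (tame_sep D f HT) as [dl [A1 A2]].
  destruct (tame_count D f HT 1) as [K HK]; [lra|]. destruct (tame_kbound D f HT) as [B [HB Hk]]. destruct (tame_dense D f HT) as [Rad HR].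
  exists dl, K, (2 * (B + 420 * K)), (16 * (B + 420 * K)), Rad. split; auto. split; auto. split; auto. split; auto.
  split; [apply (tame_dsum D f)|apply (tame_esum D f)]; auto.
Qed.

(** Every N1-function with divisor [D] obeys, by [tame_kbound], the same kind of two-sided estimate
    as the product; this is why [kbound_unique] gives uniqueness. *)
Lemma conditions_product D dl K K1 K2 Rad : divisor D -> D (RtoC 0) = 0%Z -> conditions D dl K K1 K2 Rad ->
  exists L, Clim_infty (fun rho => csum (lst D rho) (aterm D rho)) L /\
  let f0 := fun w => smul (cexp (- L * w)) (Flim D w) in
  N1 f0 /\ divisor_of D f0 /\ (forall g, N1 g -> divisor_of D g -> exists c, c <> RtoC 0 /\ forall w, g w = smul c (f0 w)).
Proof.
  intros HD H0 [Hdl [Hsep [HK [HR [Hd He]]]]]. destruct (alpha_lim D K K1 K2 HD HK Hd He H0) as [L HL]. exists L. split; auto.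
  assert (Hsq := square_lim D K K1 K2 HD HK Hd He). intros f0.
  destruct (kbound_product D K K1 K2 (- L)%C HD HK Hd He H0) as [B HB]; auto.
  { assert (X : forall x : C, (- - x)%C = x) by (intros; ring). rewrite X. exact HL. }
  fold f0 in HB.
  assert (HLF : forall R0, 1 <= R0 -> exists h, LF D f0 0 R0 (lst D R0) h) by (intros R0 H; apply (Flim_LF D K HD HK H0 Hsq (- L)%C R0 H)).
  destruct (LF_mero D f0) as [Hm Hdiv].
  { intros z0. destruct (HLF (Cmod z0 + 1)) as [h Hh]; [pose proof (Cmod_ge_0 z0); lra|]. exists 0, (Cmod z0 + 1), (lst D (Cmod z0 + 1)), h.
    split; auto. replace (z0 - 0)%C with z0 by ring. lra. }
  assert (Hv := mero_vals D f0 Hm Hdiv). split; [|split; auto].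
  - apply (N1_of_kbound D f0 B K dl Rad); auto.
  - intros g Hg Hgd. assert (HT := tame_N1 D g HD Hg Hgd). destruct (tame_kbound D g HT) as [B' [_ HB']].
    apply (kbound_unique D f0 g B B'); auto; [apply HT|]. intros R0 HR0. split.
    + destruct (HLF R0 HR0) as [h Hh]. exists (lst D R0), h. exact Hh.
    + apply HT.
Qed.

Import Pilot.Defs.

Theorem mainTheorem1 (D : Cc -> Z) (HD : divisor D) (H0 : D Czero = 0%Z) :
  ((exists f, N1 f /\ divisor_of D f) <->
   ( (* (a) *)
     (exists delta, delta > 0 /\ forall a b, (D a > 0)%Z -> (D b < 0)%Z ->
        Cnorm (Csub a b) >= delta) /\
     (* (b) *)
     (exists K, forall c,
        card_zeros D (fun z => Cnorm (Csub z c) <= 1)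
        + card_poles D (fun z => Cnorm (Csub z c) <= 1) < K) /\
     (* (c) *)
     (exists Rad, forall c,
        (exists a, (D a > 0)%Z /\ Cnorm (Csub a c) < Rad) /\
        (exists b, (D b < 0)%Z /\ Cnorm (Csub b c) < Rad)) /\
     (* (d) *)
     (exists K, forall c r, r > 1 -> exists v,
        Rint (fun t => (card_zeros D (fun z => Cnorm (Csub z c) < t)
                        - card_poles D (fun z => Cnorm (Csub z c) < t)) / t) 1 r v
        /\ Rabs v < K) /\
     (* (e) *)
     (exists K, forall c r, r > 1 -> exists v,
        Cint (fun t => Cmul (RtoC (/ t))
                 (Csub (sum_zeros D (fun z => Cnorm (Csub z c) < t) (fun z => Csub z c))
                       (sum_poles D (fun z => Cnorm (Csub z c) < t) (fun z => Csub z c)))) 1 r v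
        /\ Cnorm (Cmul (RtoC (/ r)) v) < K) /\
     (* (f) *)
     (exists L, Clim_infty
        (fun r => Csub (sum_zeros D (fun z => 1 <= Cnorm z < r) (fun z => Cinv (Cmul z z)))
                       (sum_poles D (fun z => 1 <= Cnorm z < r) (fun z => Cinv (Cmul z z)))) L)))
  /\
  ((exists f, N1 f /\ divisor_of D f) ->
   exists alpha : Cc,
     Clim_infty
       (fun r => Csub
          (sum_poles D (fun z => Cnorm z < r)
             (fun b => Csub (Cinv b) (Cmul (Cconj b) (RtoC (/ (r * r))))))
          (sum_zeros D (fun z => Cnorm z < r)
             (fun a => Csub (Cinv a) (Cmul (Cconj a) (RtoC (/ (r * r))))))) alpha /\
     exists F : Cc -> sphere,
       (forall Rad eps, eps > 0 -> exists M, forall r, r > M ->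
          forall w, Cnorm w <= Rad ->
            rhoS (sdiv
                    (prod_zeros D (fun z => Cnorm z < r)
                       (fun a => Cmul (Csub Cone (Cdiv w a)) (Cexp (Cdiv w a))))
                    (prod_poles D (fun z => Cnorm z < r)
                       (fun b => Cmul (Csub Cone (Cdiv w b)) (Cexp (Cdiv w b)))))
                 (F w) < eps) /\
       forall g, N1 g -> divisor_of D g ->
         exists c : Cc, c <> Czero /\
           forall w, g w = smul c (smul (Cexp (Cmul alpha w)) (F w))).
Proof.
  split; [split|].
  - intros [f [HN Hf]]. destruct (N1_conditions D f HD HN Hf) as [dl [K [K1 [K2 [Rad [A1 [A2 [A3 [A4 [A5 A6]]]]]]]]]].
    split; [exists dl; split; [lra|intros a b Ha Hb; apply Rle_ge, A2; auto]|].
    split; [apply (count_iff D HD); exists K; exact A3|]. split; [exists Rad; exact A4|].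
    split; [apply (dsum_iff D HD); exists K1; exact A5|]. split; [apply (esum_iff D HD); exists K2; exact A6|].
    destruct (square_lim D K K1 K2 HD A3 A5 A6) as [L HL]. exists L. apply (square_clause D L HD HL).
  - intros [[dl [A1 A2]] [Hb [[Rad Hc] [Hd [He _]]]]].
    apply (count_iff D HD) in Hb. apply (dsum_iff D HD) in Hd. apply (esum_iff D HD) in He.
    destruct Hb as [K HK], Hd as [K1 HK1], He as [K2 HK2].
    destruct (conditions_product D dl K K1 K2 Rad HD H0) as [L [_ [P1 [P2 _]]]].
    + split; [exact A1|]. split; [intros a b Ha Hb; apply Rge_le, A2; auto|]. auto.
    + eexists. split; [exact P1|exact P2].
  - intros [f [HN Hf]]. destruct (N1_conditions D f HD HN Hf) as [dl [K [K1 [K2 [Rad HC]]]]].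
    destruct (conditions_product D dl K K1 K2 Rad HD H0 HC) as [L [HL [_ [_ P3]]]].
    destruct HC as [_ [_ [A3 [_ [A5 A6]]]]].
    (* [L] is the limit of the sums with zeros counted positively, so [alpha = - L]; [Flim D] is the
       limit of the bare product, without the exponential factor. *)
    exists (Copp L). split; [apply (alpha_clause D L HD HL)|]. exists (Flim D). split; [|exact P3].
    apply (Flim_unif D K HD A3 (square_lim D K K1 K2 HD A3 A5 A6)).
Qed.
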